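(* There exists a constant $c>0$ with the following property. Let $\lambda>0$ and let $p_0,p_1\in \Lambda_0$ satisfy $0<\lambda|p_0-p_1|^2< c$. Then there exists a smooth solution $\gamma:\bar{I}\times[0,\infty)\to\mathbf{R}^2$ (each $\gamma(\cdot,t)$ an immersed curve) to the $\lambda$-elastic flow \[ \partial_t\gamma = -2\nabla_s^2\kappa-|\kappa|^2\kappa+\lambda\kappa \] under the natural boundary condition \[ \gamma(0,t)=p_0,\quad \gamma(1,t)=p_1,\quad \kappa(0,t)=\kappa(1,t)=0 \quad \text{for all } t\geq0, \] such that $\gamma(I\times[0,t_0])\subset H_+^\circ$ and $\gamma(I\times[t_1,\infty))\subset H_-^\circ$ for some $0<t_0<t_1<\infty$.
   Context: $I:=(0,1)$, $\bar I:=[0,1]$. For a family of immersed planar curves $\gamma(\cdot,t)$, $s$ denotes the arclength parameter, $\partial_s:=|\partial_x\gamma|^{-1}\partial_x$, $\kappa:=\partial_s^2\gamma$ is the curvature vector, and for a vector field $\psi$ along $\gamma$, $\nabla_s\psi:=\partial_s\psi-\langle \partial_s\psi,\partial_s\gamma\rangle\partial_s\gamma$ is the normal derivative ($\langle\cdot,\cdot\rangle$ the Euclidean inner product). With $e_2=(0,1)$, $H_\pm:=\{x\in\mathbf{R}^2 : \pm\langle x,e_2\rangle\geq0\}$ are the closed upper/lower half-planes, $\Lambda_0:=\partial H_\pm$ is the horizontal axis, and $H_\pm^\circ:=H_\pm\setminus\Lambda_0$ the open half-planes. *)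

(* Defs.v *)
From Stdlib Require Import Reals List.
From Coquelicot Require Import Coquelicot.
Open Scope R_scope.

Definition vec := (R * R)%type.
Definition vadd (a b : vec) : vec := (fst a + fst b, snd a + snd b).
Definition vsub (a b : vec) : vec := (fst a - fst b, snd a - snd b).
Definition vscal (k : R) (a : vec) : vec := (k * fst a, k * snd a).
Definition vdot (a b : vec) : R := fst a * fst b + snd a * snd b.
Definition vnorm (a : vec) : R := sqrt (vdot a a).
Definition vzero : vec := (0, 0).

(* A (time-dependent) vector field along a family of curves:
   u in R is the curve parameter, t in R is time. *)
Definition field := R -> R -> vec.

Fixpoint iter_pd (l : list bool) (f : R -> R -> R) : R -> R -> R :=
  match l with
  | nil => f
  | b :: l' =>
      let h := iter_pd l' f in
      if b then (fun u t => Derive (fun v => h v t) u)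
      else (fun u t => Derive (fun s => h u s) t)
  end.

Definition smooth2 (f : R -> R -> R) : Prop :=
  forall (l : list bool) (u t : R),
    ex_derive (fun v => iter_pd l f v t) u /\
    ex_derive (fun s => iter_pd l f u s) t /\
    continuous (fun p : R * R => iter_pd l f (fst p) (snd p)) (u, t).

Definition smooth_field (g : field) : Prop :=
  smooth2 (fun u t => fst (g u t)) /\ smooth2 (fun u t => snd (g u t)).

Definition du (f : field) : field :=
  fun u t => (Derive (fun v => fst (f v t)) u, Derive (fun v => snd (f v t)) u).
Definition dt (f : field) : field :=
  fun u t => (Derive (fun s => fst (f u s)) t, Derive (fun s => snd (f u s)) t).

Definition ds (g : field) (f : field) : field :=
  fun u t => vscal (/ vnorm (du g u t)) (du f u t).

Definition curv (g : field) : field := ds g (ds g g).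

Definition nabla_s (g : field) (psi : field) : field :=
  fun u t =>
    let a := ds g psi u t in
    let T := ds g g u t in
    vsub a (vscal (vdot a T) T).

Definition elastic_rhs (lambda : R) (g : field) : field :=
  fun u t =>
    let k := curv g u t in
    vadd (vscal (-2) (nabla_s g (nabla_s g (curv g)) u t))
         (vadd (vscal (- vdot k k) k) (vscal lambda k)).

(* g (a smooth map on R x R, restricted to [0,1] x [0,oo)) is a smooth
   solution of the lambda-elastic flow with the natural boundary condition. *)
Definition elastic_flow_nbc (lambda : R) (p0 p1 : vec) (g : field) : Prop :=
  smooth_field g /\
  (forall u t, 0 <= u <= 1 -> 0 <= t -> 0 < vnorm (du g u t)) /\
  (forall u t, 0 <= u <= 1 -> 0 <= t -> dt g u t = elastic_rhs lambda g u t) /\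
  (forall t, 0 <= t ->
     g 0 t = p0 /\ g 1 t = p1 /\ curv g 0 t = vzero /\ curv g 1 t = vzero).

(* Main.v *)
(** The unknown is the tangent angle [Aj 0 x t] as a function of [x] in [[0, PI]], coupled with a scalar [L t]: up to
    a tangential reparametrization and a change of time, the elastic flow becomes a fourth order parabolic equation
    for the angle with vanishing odd derivatives at both ends, hence an infinite system of ordinary differential
    equations for cosine coefficients.  After truncation it is solved by a fixed point argument, and as long as the
    truncation is inactive the decay of the coefficients makes the solution smooth for positive times.

    When [lambda * |p0 - p1|^2] is small the rescaled endpoints are at a small distance [eps], and the curve stays
    close to a rotated copy of the teardrop, the critical loop of the length-penalized bending energy whose endpoints
    coincide.  The second variation at the teardrop is coercive modulo rotations, so the energy excess
    [- 2 W2 eps cos b + O(eps^2)] traps the curve near the rotated teardrops and leaves the rotation angle [b] as the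
    only free parameter.  A moment of the normal velocity bounds the dissipation below by a multiple of
    [(eps sin b)^2].  Starting with [b] close to [PI], where the curve lies above the axis, the decrease of the energy
    therefore drives [cos b] up to nearly [1], where the curve lies below the axis. *)

(* At distance zero the rotated teardrops form a circle of critical points of equal energy, so only
   terms of order [eps] tell the two sides of the axis apart. The direction is read off
   [- 2 W2 eps cos b]; the other errors must be of second order or absorbed by coercivity. The
   variables absorb dilations: arclength is [ell x] with [L = lambda ell^2], physical time runs
   [ell^4] times as fast, and the energy enters through the scale-invariant [(B + PI L)^2 / L],
   where [B] integrates [th_x^2]. Fixed endpoints become conservation of [sqrt L] times the end
   vector of the unscaled curve. The truncation clamps the coefficients at a level that decays
   exponentially in [n], at a rate growing with time. High modes stay below it by parabolic
   smoothing, the finitely many low ones because the energy keeps the angle near a teardrop.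
   Inactivity of the truncation and trapping thus come from one continuation argument. The final
   curve starts at a positive time of this flow, where it is already smooth; a smooth clamp of the
   clock supplies values for negative times. *)
Require Import Defs.
From Stdlib Require Import Reals Lra Lia Psatz ZArith List FunctionalExtensionality ClassicalEpsilon.
From Coquelicot Require Import Coquelicot.
Open Scope R_scope.

(** * Series, fixed points and mean value estimates *)

(** Integrals are typed in the carrier of a normed module, which hides the real operations;
    generalising them to real variables lets [ring] work. *)
Ltac Rring :=
  repeat match goal with |- context [@RInt ?V ?f ?a ?b] =>
    let r := fresh "r" in pose (r := @RInt V f a b : R); change (@RInt V f a b) with r; clearbody r end;
  match goal with |- @eq _ ?a ?b => change (@eq R a b) end; ring.

Tactic Notation "ballR" ident(H) :=
  unfold ball in H; simpl in H; unfold AbsRing_ball, abs, minus, plus, opp in H; simpl in H.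
Ltac pos := intros; repeat first
  [ assumption | lra
  | match goal with
    | |- 0 < _ * _ => apply Rmult_lt_0_compat
    | |- 0 <= _ * _ => apply Rmult_le_pos
    | |- 0 < _ / _ => apply Rdiv_lt_0_compat
    | |- 0 <= _ / _ => apply Rle_mult_inv_pos
    | |- 0 < _ + _ => apply Rplus_lt_le_0_compat
    | |- 0 <= _ + _ => apply Rplus_le_le_0_compat
    | |- 0 <= Rabs _ => apply Rabs_pos
    | |- 0 <= sqrt _ => apply sqrt_pos
    | |- 0 < sqrt _ => apply sqrt_lt_R0
    | |- 0 < exp _ => apply exp_pos
    | |- 0 <= exp _ => apply Rlt_le, exp_pos
    | |- 0 <= _ ^ 2 => apply pow2_ge_0
    | |- 0 <= _ ^ _ => apply pow_le
    | |- 0 < _ ^ _ => apply pow_lt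
    | |- 0 < / _ => apply Rinv_0_lt_compat
    | |- 0 <= / _ => apply Rlt_le, Rinv_0_lt_compat
    end ].
Tactic Notation "le_via" uconstr(t) := eapply Rle_trans; [apply t|].
Ltac Rfield := match goal with |- @eq _ ?a ?b => change (@eq R a b) end; field.

Lemma exp_mono (x y : R) : x <= y -> exp x <= exp y.
Proof. intros [H|H]; [left; now apply exp_increasing|right; now subst]. Qed.

Lemma ex_series_nonneg_bounded (a : nat -> R) (M : R) :
  (forall n, 0 <= a n) -> (forall N, sum_n a N <= M) ->
  ex_series a /\ Series a <= M.
Proof.
  intros Ha HM.
  assert (E : ex_finite_lim_seq (sum_n a)).
  { apply ex_finite_lim_seq_incr with M; [|exact HM].
    intros n. rewrite sum_Sn. unfold plus; simpl. specialize (Ha (S n)). lra. }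
  assert (Ex : ex_series a) by auto.
  split; [exact Ex|].
  apply (is_lim_seq_le (sum_n a) (fun _ => M) (Series a) M HM).
  - exact (Series_correct a Ex).
  - apply is_lim_seq_const.
Qed.

Lemma Series_nonneg (a : nat -> R) : (forall n, 0 <= a n) -> ex_series a -> 0 <= Series a.
Proof.
  intros Ha Hs. replace 0 with (Series (fun _ : nat => 0)).
  - apply Series_le; [intros n; split; [lra|apply Ha]|exact Hs].
  - apply is_series_unique. apply is_series_Reals. intros e He. exists 0%nat. intros n _.
    rewrite sum_eq_R0; [unfold Rdist; rewrite Rminus_0_r, Rabs_R0; exact He|auto].
Qed.

Lemma Series_split (a : nat -> R) (N : nat) : ex_series a ->
  Series a = sum_n a N + Series (fun k => a (S N + k)%nat).
Proof.
  intros H. rewrite (Series_incr_n a (S N)); [|lia|exact H].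
  now rewrite sum_n_Reals.
Qed.

Lemma sum_n_le_Series (a : nat -> R) (N : nat) :
  (forall n, 0 <= a n) -> ex_series a -> sum_n a N <= Series a.
Proof.
  intros Ha Hs. rewrite (Series_split a N Hs).
  enough (0 <= Series (fun k => a (S N + k)%nat)) by lra.
  apply Series_nonneg; auto.
  now apply (ex_series_incr_n a (S N)).
Qed.

Lemma ex_series_dom (a M : nat -> R) :
  ex_series M -> (forall n, Rabs (a n) <= M n) -> ex_series (fun n => Rabs (a n)).
Proof.
  intros HM H. apply (@ex_series_le R_AbsRing R_CompleteNormedModule) with M; [|exact HM].
  intros n. now rewrite Rabs_Rabsolu.
Qed.

Lemma Series_dom (a M : nat -> R) :
  ex_series M -> (forall n, Rabs (a n) <= M n) -> Rabs (Series a) <= Series M.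
Proof.
  intros HM H. apply Rle_trans with (Series (fun n => Rabs (a n))).
  - apply Series_Rabs. now apply ex_series_dom with M.
  - apply Series_le; [intros n; split; [apply Rabs_pos|apply H]|exact HM].
Qed.

(** The index is chosen from the tail of the majorant alone. This uniformity over all dominated
    sequences is what Tannery's theorem uses. *)
Lemma Series_tail_dom (M : nat -> R) (eps : R) : ex_series M -> 0 < eps ->
  exists N, forall a, (forall n, Rabs (a n) <= M n) -> Rabs (Series a - sum_n a N) <= eps.
Proof.
  intros HM He.
  pose proof (Series_correct M HM) as L.
  assert (L' : is_lim_seq (sum_n M) (Series M)) by auto.
  apply is_lim_seq_spec in L'. destruct (L' (mkposreal eps He)) as [N HN].
  exists N. intros a Ha.
  assert (Ea : ex_series a) by (apply ex_series_Rabs; now apply ex_series_dom with M).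
  rewrite (Series_split a N Ea).
  replace (_ - _) with (Series (fun k => a (S N + k)%nat)) by ring.
  apply Rle_trans with (Series (fun k => M (S N + k)%nat)).
  - apply Series_dom; [now apply (ex_series_incr_n M (S N))|auto].
  - specialize (HN N (Nat.le_refl _)). simpl in HN.
    rewrite (Series_split M N HM) in HN.
    apply Rabs_def2 in HN. lra.
Qed.

Lemma filterlim_sum_n {T : Type} (F : (T -> Prop) -> Prop) {FF : Filter F}
  (f : nat -> T -> R) (l : nat -> R) (N : nat) :
  (forall n, filterlim (f n) F (locally (l n))) ->
  filterlim (fun x => sum_n (fun n => f n x) N) F (locally (sum_n l N)).
Proof.
  intros H. induction N as [|N IH].
  - rewrite sum_O. eapply filterlim_ext; auto. intros x. now rewrite sum_O.
  - rewrite sum_Sn. eapply filterlim_ext; [intros x; symmetry; apply sum_Sn|].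
    eapply filterlim_comp_2; [exact IH|apply H|].
    apply (filterlim_plus (V := R_NormedModule)).
Qed.

Lemma filterlim_Rabs_le {T : Type} (F : (T -> Prop) -> Prop) {FF : ProperFilter F}
  (f : T -> R) (l M : R) :
  filterlim f F (locally l) -> F (fun x => Rabs (f x) <= M) -> Rabs l <= M.
Proof.
  intros H HM. apply Rnot_lt_le. intros Hlt.
  assert (He : 0 < Rabs l - M) by lra.
  pose proof (proj1 (filterlim_locally f l) H (mkposreal _ He)) as H1.
  destruct (filter_ex _ (filter_and _ _ HM H1)) as [x [Hx1 Hx2]].
  ballR Hx2.
  pose proof (Rabs_triang (f x) (l - f x)). replace (f x + (l - f x)) with l in H0 by ring.
  rewrite (Rabs_minus_sym l) in H0. unfold Rminus in H0. lra.
Qed.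

(* Tannery's theorem. *)
Lemma filterlim_Series {T : Type} (F : (T -> Prop) -> Prop) {FF : ProperFilter F}
  (f : nat -> T -> R) (l M : nat -> R) :
  ex_series M -> F (fun x => forall n, Rabs (f n x) <= M n) ->
  (forall n, filterlim (f n) F (locally (l n))) ->
  filterlim (fun x => Series (fun n => f n x)) F (locally (Series l)).
Proof.
  intros HM Hd Hl. apply filterlim_locally. intros eps.
  assert (Hl' : forall n, Rabs (l n) <= M n).
  { intros n. apply (filterlim_Rabs_le F (f n)); [auto|].
    eapply filter_imp; [|exact Hd]. auto. }
  assert (He : 0 < eps / 3) by (destruct eps; simpl; lra).
  destruct (Series_tail_dom M (eps / 3) HM He) as [N HN].
  pose proof (filterlim_sum_n F f l N Hl) as HS.
  pose proof (proj1 (filterlim_locally _ _) HS (mkposreal _ He)) as H1.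
  eapply filter_imp; [|apply (filter_and _ _ Hd H1)].
  intros x [Hx1 Hx2].
  unfold ball in *; simpl in *; unfold AbsRing_ball, abs, minus, plus, opp in *; simpl in *.
  pose proof (HN _ Hx1). pose proof (HN _ Hl').
  apply Rabs_le_between in H. apply Rabs_le_between in H0.
  apply Rabs_lt_between in Hx2. apply Rabs_lt_between. lra.
Qed.

Lemma ex_series_sum_n (F : nat -> nat -> R) (K : nat) :
  (forall k, ex_series (fun n => F n k)) ->
  ex_series (fun n => sum_n (F n) K) /\
  Series (fun n => sum_n (F n) K) = sum_n (fun k => Series (fun n => F n k)) K.
Proof.
  intros H. induction K as [|K [IH1 IH2]].
  - assert (E : forall n, sum_n (F n) 0 = F n 0%nat) by (intros; apply sum_O).
    rewrite sum_O. split.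
    + eapply ex_series_ext; auto. auto.
    + apply Series_ext, E.
  - assert (E : forall n, sum_n (F n) (S K) = sum_n (F n) K + F n (S K)).
    { intros. now rewrite sum_Sn. }
    rewrite sum_Sn. split.
    + eapply ex_series_ext; [intros n; symmetry; apply E|].
      apply (ex_series_plus (V := R_NormedModule)); auto.
    + rewrite (Series_ext _ _ E), Series_plus; auto. now rewrite IH2.
Qed.

(** Finite sums of rows commute with the sum over columns by linearity. Tannery's theorem, with the
    column sums of absolute values as majorant, passes to the limit. *)
Lemma Series_Fubini (F : nat -> nat -> R) :
  (forall n, ex_series (fun k => Rabs (F n k))) ->
  ex_series (fun n => Series (fun k => Rabs (F n k))) ->
  (forall k, ex_series (fun n => Rabs (F n k))) /\
  ex_series (fun k => Series (fun n => Rabs (F n k))) /\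
  Series (fun n => Series (F n)) = Series (fun k => Series (fun n => F n k)).
Proof.
  intros H1 H2.
  assert (C : forall k, ex_series (fun n => Rabs (F n k))).
  { intros k. apply ex_series_dom with (M := fun n => Series (fun k => Rabs (F n k))); [exact H2|].
    intros n. apply Rle_trans with (sum_n (fun k => Rabs (F n k)) k).
    - destruct k; [rewrite sum_O; lra|]. rewrite sum_Sn. unfold plus; simpl.
      enough (0 <= sum_n (fun k => Rabs (F n k)) k) by lra.
      rewrite sum_n_Reals. apply cond_pos_sum. pos.
    - apply sum_n_le_Series; [pos|apply H1]. }
  split; [exact C|].
  assert (C2 : ex_series (fun k => Series (fun n => Rabs (F n k))) ).
  { apply (ex_series_nonneg_bounded _ (Series (fun n => Series (fun k => Rabs (F n k))))).
    - intros k. apply Series_nonneg; [pos|apply C].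
    - intros K. destruct (ex_series_sum_n (fun n k => Rabs (F n k)) K C) as [E1 E2].
      rewrite <- E2. apply Series_le; [|exact H2].
      split.
      + rewrite sum_n_Reals. apply cond_pos_sum. pos.
      + apply sum_n_le_Series; [pos|apply H1]. }
  split; [exact C2|].
  assert (L : filterlim (fun N => Series (fun k => sum_n (fun n => F n k) N)) eventually
     (locally (Series (fun k => Series (fun n => F n k))))).
  { apply (filterlim_Series eventually (fun k N => sum_n (fun n => F n k) N) _ _ C2).
    - exists 0%nat. intros N _ k.
      apply Rle_trans with (sum_n (fun n => Rabs (F n k)) N).
      + rewrite !sum_n_Reals. apply Rsum_abs.
      + apply sum_n_le_Series; [pos|apply C].
    - intros k. apply Series_correct. apply ex_series_Rabs, C. }
  assert (L2 : filterlim (fun N => Series (fun k => sum_n (fun n => F n k) N)) eventually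
     (locally (Series (fun n => Series (F n))))).
  { eapply filterlim_ext.
    - symmetry.
      apply ex_series_sum_n. intros n. apply ex_series_Rabs, H1.
    - apply Series_correct. apply ex_series_Rabs.
      apply ex_series_dom with (M := fun n => Series (fun k => Rabs (F n k))); [exact H2|].
      intros n. apply Series_Rabs, H1. }
  exact (filterlim_locally_unique (V := R_NormedModule) _ _ _ L2 L).
Qed.

Lemma is_series_single (m : nat) (v : R) :
  is_series (fun n => if Nat.eqb n m then v else 0) v.
Proof.
  assert (E : forall N, sum_n (fun n => if Nat.eqb n m then v else 0) N = if Nat.leb m N then v else 0).
  { induction N as [|N IH].
    - rewrite sum_O. now destruct m.
    - rewrite sum_Sn, IH.
      destruct (Nat.leb_spec m N); destruct (Nat.leb_spec m (S N));
      destruct (Nat.eqb_spec (S N) m); try lia;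
      rewrite ?Rplus_0_r, ?Rplus_0_l; auto. }
  change (is_lim_seq (sum_n (fun n => if Nat.eqb n m then v else 0)) v).
  apply (is_lim_seq_ext_loc (fun _ => v)); [|apply is_lim_seq_const].
  exists m. intros N HN. rewrite E. destruct (Nat.leb_spec m N); auto; lia.
Qed.

(** The permutation becomes a double array with one nonzero entry in each row and each column;
    Fubini then sums it both ways. *)
Lemma Series_rearrange (f : nat -> R) (s s' : nat -> nat) :
  (forall n, s' (s n) = n) -> (forall n, s (s' n) = n) ->
  ex_series (fun n => Rabs (f n)) ->
  ex_series (fun n => Rabs (f (s n))) /\ Series (fun n => f (s n)) = Series f.
Proof.
  intros E1 E2 Hf.
  set (F := fun k n => if Nat.eqb n (s' k) then f k else 0).
  assert (A : forall k n, Rabs (F k n) = if Nat.eqb n (s' k) then Rabs (f k) else 0).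
  { intros. unfold F. destruct Nat.eqb; [lra|apply Rabs_R0]. }
  assert (R1 : forall k, is_series (fun n => Rabs (F k n)) (Rabs (f k))).
  { intros k. eapply is_series_ext; [|apply (is_series_single (s' k))]. auto. }
  destruct (Series_Fubini F) as [C1 [C2 C3]].
  - eexists; apply R1.
  - eapply ex_series_ext; [|exact Hf]. symmetry. apply is_series_unique, R1.
  - assert (B : forall k n, F k n = if Nat.eqb k (s n) then f (s n) else 0).
    { intros. unfold F. destruct (Nat.eqb_spec n (s' k)); destruct (Nat.eqb_spec k (s n)); subst; auto;
      [now rewrite E2 in n0|now rewrite E1 in n0]. }
    split.
    + eapply ex_series_ext; [|exact C2]. intros n. apply is_series_unique.
      eapply is_series_ext; [|apply (is_series_single (s n))].
      intros k. rewrite B. destruct Nat.eqb; [lra|now rewrite Rabs_R0].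
    + transitivity (Series (fun n => Series (fun k => F k n))).
      * apply Series_ext. symmetry. apply is_series_unique.
        eapply is_series_ext; [|apply (is_series_single (s n))].
        auto.
      * rewrite <- C3. apply Series_ext. intros k. apply is_series_unique, is_series_single.
Qed.

Lemma Rle_of_geometric (x C : R) : (forall k : nat, x <= C * (1/2)^k) -> x <= 0.
Proof.
  intros H. apply (is_lim_seq_le (fun _ => x) (fun k => C * (1/2)^k) x 0 H).
  - apply is_lim_seq_const.
  - replace (Finite 0) with (Rbar_mult C 0) by (simpl; f_equal; ring).
    apply is_lim_seq_scal_l, is_lim_seq_geom. rewrite Rabs_pos_eq; lra.
Qed.

(** Banach's theorem with contraction factor one half in a weighted sup norm. No complete space is
    built: the limit is the pointwise telescoping series, and membership of the limit in [P] is
    asked only for sequences converging at the geometric rate. *)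
Lemma weighted_fixpoint {I : Type} (w : I -> R) (P : (I -> R) -> Prop)
  (Phi : (I -> R) -> I -> R) (f0 : I -> R) (M : R) :
  (forall i, 0 <= w i) -> P f0 -> (forall f, P f -> P (Phi f)) ->
  (forall i, Rabs (Phi f0 i - f0 i) <= M * w i) ->
  (forall f g d, 0 <= d -> P f -> P g -> (forall i, Rabs (f i - g i) <= d * w i) ->
     forall i, Rabs (Phi f i - Phi g i) <= d / 2 * w i) ->
  (forall (F : nat -> I -> R) f, (forall k, P (F k)) ->
     (forall k i, Rabs (F k i - f i) <= 2 * M * (1/2)^k * w i) -> P f) ->
  0 <= M ->
  exists f, P f /\ (forall i, Phi f i = f i).
Proof.
  intros Hw P0 PP H0 HC Hcl HM.
  set (F := fix F k := match k with O => f0 | S k => Phi (F k) end).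
  assert (PF : forall k, P (F k)) by (induction k; simpl; auto).
  assert (D : forall k i, Rabs (F (S k) i - F k i) <= M * (1/2)^k * w i).
  { induction k as [|k IH]; intros i.
    - rewrite Rmult_1_r. apply H0.
    -
      replace (M * (1/2)^(S k) * w i) with (M * (1/2)^k / 2 * w i) by (simpl; field).
      apply HC; auto. pos. }
  set (f := fun i => f0 i + Series (fun k => F (S k) i - F k i)).
  assert (G : forall c, is_series (fun k => c * (1/2)^k) (c * 2)).
  { intros c. replace (c * 2) with (scal c (/ (1 - 1/2))) by (unfold scal; simpl; unfold mult; simpl; field).
    apply (is_series_scal (K := R_AbsRing) (V := R_NormedModule) c (fun k => (1/2)^k)).
    apply is_series_geom. rewrite Rabs_pos_eq; lra. }
  assert (T : forall k i, Rabs (F k i - f i) <= 2 * M * (1/2)^k * w i).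
  { intros k i.
    assert (Ex : ex_series (fun k => F (S k) i - F k i)).
    { apply ex_series_Rabs. apply ex_series_dom with (M := fun k => M * w i * (1/2)^k).
      - eexists; apply G.
      - intros n. specialize (D n i). lra. }
    assert (Tel : forall K, F K i + Series (fun j => F (S (K + j)) i - F (K + j)%nat i) = f i).
    { induction K as [|K IH].
      - reflexivity.
      - rewrite <- IH. rewrite (Series_incr_1 (fun j => F (S (K + j)) i - F (K + j)%nat i)).
        + rewrite Nat.add_0_r.
          replace (Series (fun k0 : nat => F (S (K + S k0)) i - F (K + S k0)%nat i))
            with (Series (fun j : nat => F (S (S K + j)) i - F (S K + j)%nat i)); [ring|].
          apply Series_ext. intros j. now rewrite Nat.add_succ_r.
        + now apply (ex_series_incr_n (fun k => F (S k) i - F k i) K). }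
    rewrite <- (Tel k).
    replace (F k i - _) with (- Series (fun j => F (S (k + j)) i - F (k + j)%nat i)) by ring.
    rewrite Rabs_Ropp.
    replace (2 * M * (1/2)^k * w i) with (Series (fun j => M * (1/2)^k * w i * (1/2)^j)).
    - apply Series_dom; [eexists; apply G|].
      intros j. specialize (D (k + j)%nat i). rewrite pow_add in D. lra.
    - rewrite (is_series_unique _ _ (G _)). ring. }
  exists f. assert (Pf : P f) by (apply (Hcl F f PF T)).
  split; [exact Pf|].
  intros i. apply Rminus_diag_uniq.
  enough (Rabs (Phi f i - f i) <= 0) as Z.
  { pose proof (Rabs_pos (Phi f i - f i)). apply Rabs_eq_0. lra. }
  apply (Rle_of_geometric _ (3 * M * w i)). intros k.
  assert (A : Rabs (Phi (F k) i - Phi f i) <= 2 * M * (1/2)^k / 2 * w i).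
  { apply HC; auto. pos. }
  pose proof (T (S k) i) as B. change (F (S k)) with (Phi (F k)) in B. simpl pow in B.
  apply Rabs_le_between in A. apply Rabs_le_between in B. apply Rabs_le_between.
  lra.
Qed.

Lemma MVT_interior (f df : R -> R) (a b : R) : a < b ->
  (forall x, a <= x <= b -> continuous f x) ->
  (forall x, a < x < b -> is_derive f x (df x)) ->
  exists c, a < c < b /\ f b - f a = df c * (b - a).
Proof.
  intros Hab Hc Hd.
  assert (p1 : forall c, a < c < b -> derivable_pt f c).
  { intros c H. exists (df c). apply is_derive_Reals, Hd, H. }
  destruct (MVT f id a b p1 (fun c _ => derivable_pt_id c) Hab) as [c [P E]].
  - intros c H. apply continuity_pt_filterlim, Hc, H.
  - intros c H. apply derivable_continuous, derivable_id.
  - exists c.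
    rewrite (derive_pt_eq_0 _ _ _ (derivable_pt_id c) (derivable_pt_lim_id c)) in E.
    rewrite (derive_pt_eq_0 f c (df c) (p1 c P)) in E; [unfold id in E; lra|].
    apply is_derive_Reals, Hd, P.
Qed.

Lemma nonincreasing_of_derive (f df : R -> R) (a b : R) : a <= b ->
  (forall x, a <= x <= b -> continuous f x) ->
  (forall x, a < x < b -> is_derive f x (df x) /\ df x <= 0) -> f b <= f a.
Proof.
  intros Hab Hc Hd.
  destruct (Rle_lt_or_eq_dec a b Hab) as [Hlt|E]; [|subst; lra].
  destruct (MVT_interior f df a b Hlt Hc) as [c [Hc1 Hc2]].
  - now apply Hd.
  - destruct (Hd c Hc1). nra.
Qed.

Lemma constant_of_derive (f : R -> R) (a b : R) : a <= b ->
  (forall x, a <= x <= b -> continuous f x) ->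
  (forall x, a < x < b -> is_derive f x 0) -> f b = f a.
Proof.
  intros Hab Hc Hd.
  destruct (Rle_lt_or_eq_dec a b Hab) as [Hlt|E]; [|subst; lra].
  destruct (MVT_interior f (fun _ => 0) a b Hlt Hc Hd) as [c [Hc1 Hc2]]. lra.
Qed.

Lemma IVT_value (f : R -> R) (a b v : R) : a <= b ->
  (forall x, a <= x <= b -> continuous f x) -> f a <= v <= f b ->
  exists c, a <= c <= b /\ f c = v.
Proof.
  intros Hab Hc Hv.
  destruct (Req_dec (f a) v) as [E|N1]; [exists a; split; [lra|auto]|].
  destruct (Req_dec (f b) v) as [E|N2]; [exists b; split; [lra|auto]|].
  assert (a < b) by (destruct Hab; [auto|subst; lra]).
  destruct (Ranalysis5.IVT_interv (fun x => f x - v) a b) as [c [C1 C2]]; try lra.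
  - intros x Hx. apply continuity_pt_minus; [|apply continuity_pt_const; intro; reflexivity].
    apply continuity_pt_filterlim, Hc, Hx.
  - exists c. lra.
Qed.

(** Continuation argument: the gained factor two makes the set of times up to which [f <= r] open to
    the right, and continuity makes it closed. *)
Lemma continuous_barrier (f : R -> R) (r : R) (T : R) : 0 < r -> 0 <= T ->
  (forall t, 0 <= t <= T -> continuous f t) -> f 0 <= r / 2 ->
  (forall t, 0 <= t <= T -> (forall s, 0 <= s <= t -> f s <= r) -> f t <= r / 2) ->
  forall t, 0 <= t <= T -> f t <= r.
Proof.
  intros Hr HT Hc H0 H t Ht. apply Rnot_lt_le. intros Hlt.
  (* the supremum of the times up to which [f <= r] *)
  set (E := fun s => 0 <= s <= t /\ forall s', 0 <= s' <= s -> f s' <= r).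
  assert (E0 : E 0). { split; [lra|]. intros s' Hs'. replace s' with 0 by lra. lra. }
  destruct (completeness E) as [m [M1 M2]].
  - exists t. intros s [Hs _]. lra.
  - exists 0. exact E0.
  - assert (m0 : 0 <= m) by auto.
    assert (mt : m <= t) by (apply M2; intros s [Hs _]; lra).
    assert (B : forall s, 0 <= s < m -> f s <= r).
    { intros s Hs. apply Rnot_lt_le. intros Hf.
      assert (m <= s); [|lra]. apply M2. intros s1 [Hs1 Hs2].
      specialize (Hs2 s). lra. }
    assert (Cm : continuous f m) by (apply Hc; lra).
    assert (Bm : f m <= r).
    { apply Rnot_lt_le. intros Hf.
      pose proof (proj1 (filterlim_locally f (f m)) Cm (mkposreal (f m - r) ltac:(lra))) as [d Hd].
      destruct (Req_dec m 0) as [Z|Z]; [subst; lra|].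
      set (s := Rmax 0 (m - d / 2)).
      assert (0 <= s < m). { unfold s. destruct d as [d dp]; simpl. unfold Rmax. destruct Rle_dec; lra. }
      ballR Hd.
      assert (Rabs (f s + - f m) < f m - r).
      { apply Hd. unfold s. destruct d as [d dp]; simpl. unfold Rmax, Rabs.
        destruct Rle_dec; destruct Rcase_abs; lra. }
      apply Rabs_lt_between in H2. specialize (B s H1). lra. }
    assert (Fm : f m <= r / 2).
    { apply H; [lra|]. intros s Hs. destruct (Req_dec s m); [subst; auto|apply B; lra]. }
    pose proof (proj1 (filterlim_locally f (f m)) Cm (mkposreal (r / 2) ltac:(lra))) as [d Hd].
    destruct d as [d dp].
    assert (m <> t) by (intros ->; lra).
    set (s := Rmin t (m + d / 2)).
    assert (m < s <= t). { unfold s, Rmin. destruct Rle_dec; lra. }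
    assert (s <= m); [|lra].
    apply M1. split; [lra|]. intros s' Hs'.
    destruct (Rle_dec s' m) as [L|L].
    + destruct (Req_dec s' m); [subst; auto|apply B; lra].
    + ballR Hd.
      assert (Rabs (f s' + - f m) < r / 2).
      { apply Hd. unfold s in *. unfold Rmin in *. destruct Rle_dec; unfold Rabs; destruct Rcase_abs; lra. }
      apply Rabs_lt_between in H3. lra.
Qed.

(** * Calculus in two variables *)

Definition cont2 (f : R -> R -> R) (x t : R) : Prop :=
  continuous (fun p : R * R => f (fst p) (snd p)) (x, t).

Lemma cont2_const (c x t : R) : cont2 (fun _ _ => c) x t.
Proof. apply continuous_const. Qed.
Lemma cont2_fst (x t : R) : cont2 (fun x _ => x) x t.
Proof. apply continuous_fst. Qed.
Lemma cont2_snd (x t : R) : cont2 (fun _ t => t) x t.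
Proof. apply continuous_snd. Qed.
Lemma cont2_plus (f g : R -> R -> R) (x t : R) :
  cont2 f x t -> cont2 g x t -> cont2 (fun x t => f x t + g x t) x t.
Proof. intros Hf Hg. exact (continuous_plus (V := R_NormedModule) _ _ _ Hf Hg). Qed.
Lemma cont2_mult (f g : R -> R -> R) (x t : R) :
  cont2 f x t -> cont2 g x t -> cont2 (fun x t => f x t * g x t) x t.
Proof. intros Hf Hg. exact (continuous_mult (K := R_AbsRing) _ _ _ Hf Hg). Qed.
Lemma cont2_comp2 (f g h : R -> R -> R) (x t : R) :
  cont2 g x t -> cont2 h x t -> cont2 f (g x t) (h x t) -> cont2 (fun x t => f (g x t) (h x t)) x t.
Proof. intros Hg Hh Hf. exact (continuous_comp_2 _ _ f _ Hg Hh Hf). Qed.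
Lemma cont2_comp1 (f : R -> R) (g : R -> R -> R) (x t : R) :
  cont2 g x t -> continuous f (g x t) -> cont2 (fun x t => f (g x t)) x t.
Proof. intros Hg Hf. exact (continuous_comp (fun p : R * R => g (fst p) (snd p)) f (x, t) Hg Hf). Qed.
Lemma cont2_slice1 (f : R -> R -> R) (x t : R) : cont2 f x t -> continuous (fun y => f y t) x.
Proof.
  intros H. apply continuous_comp_2.
  - apply continuous_id. - apply continuous_const. - exact H.
Qed.
Lemma cont2_slice2 (f : R -> R -> R) (x t : R) : cont2 f x t -> continuous (fun s => f x s) t.
Proof.
  intros H. apply continuous_comp_2.
  - apply continuous_const. - apply continuous_id. - exact H.
Qed.
Lemma cont2_ext (P : R -> Prop) (f g : R -> R -> R) (x t : R) : locally t P ->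
  (forall y s, P s -> f y s = g y s) -> cont2 f x t -> cont2 g x t.
Proof.
  intros HP E H.
  apply (continuous_ext_loc _ (fun p => f (fst p) (snd p))); [|exact H].
  destruct HP as [d Hd]. exists d. intros [y s] [_ B]. auto.
Qed.

Lemma ex_RInt_cont (f : R -> R) (a b : R) : (forall x, continuous f x) -> ex_RInt f a b.
Proof. intros H. apply (ex_RInt_continuous (V := R_CompleteNormedModule)). auto. Qed.

Lemma is_derive_RInt_var (f : R -> R) (a x : R) : (forall x, continuous f x) ->
  is_derive (fun x => RInt f a x) x (f x).
Proof.
  intros H. apply (is_derive_RInt (V := R_NormedModule) f (RInt f a) a x); [|apply H].
  exists (mkposreal 1 Rlt_0_1). intros y _. apply (RInt_correct (V := R_CompleteNormedModule)).
  now apply ex_RInt_cont.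
Qed.

Lemma Rabs_RInt_le (f : R -> R) (a b M : R) : (forall x, continuous f x) ->
  (forall x, Rmin a b <= x <= Rmax a b -> Rabs (f x) <= M) ->
  Rabs (RInt f a b) <= Rabs (b - a) * M.
Proof.
  intros Hc H. apply (norm_RInt_le_const_abs (V := R_NormedModule) f a b (RInt f a b) M H).
  apply (RInt_correct (V := R_CompleteNormedModule)). now apply ex_RInt_cont.
Qed.

(** The change of the parameter is handled by uniform continuity on a compact slab, with a margin of
    one around [x]; the change of the upper limit by continuity of the primitive. Each gets half of
    the tolerance. *)
Lemma cont2_RInt (P : R -> Prop) (f : R -> R -> R) (x t : R) : locally t P ->
  (forall y s, P s -> cont2 f y s) -> cont2 (fun x t => RInt (fun y => f y t) 0 x) x t.
Proof.
  intros HP Hc.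
  assert (Pt : P t) by (apply (locally_singleton _ _ HP)).
  assert (Hs : forall s, P s -> forall y, continuous (fun y => f y s) y)
    by (intros; apply cont2_slice1; auto).
  apply filterlim_locally. intros [e He].
  set (A := Rabs x + 1). assert (A1 : 1 <= A) by (unfold A; pose proof (Rabs_pos x); lra).
  assert (He' : 0 < e / 2 / (A + 1)) by pos.
  destruct (uniform_continuity_2d_1d f (- A) A t) with (eps := mkposreal _ He') as [d Hd].
  { intros y _. apply continuity_2d_pt_filterlim. apply (Hc y t Pt). }
  assert (Cx : continuous (fun x => RInt (fun y => f y t) 0 x) x).
  { apply (ex_derive_continuous (V := R_NormedModule)). eexists.
    apply is_derive_RInt_var. auto. }
  pose proof (proj1 (filterlim_locally _ _) Cx (mkposreal (e/2) ltac:(lra))) as [d2 Hd2].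
  destruct HP as [d3 Hd3].
  assert (Hm : 0 < Rmin (Rmin d d2) (Rmin d3 1)).
  { destruct d, d2, d3; simpl. repeat apply Rmin_pos; lra. }
  exists (mkposreal _ Hm). intros [x' t'] [B1 B2].
  assert (M1 : Rabs (x' + - x) < d2) by (eapply Rlt_le_trans; [exact B1|]; eapply Rle_trans; [apply Rmin_l|apply Rmin_r]).
  assert (M2 : Rabs (x' + - x) < 1) by (eapply Rlt_le_trans; [exact B1|]; eapply Rle_trans; [apply Rmin_r|apply Rmin_r]).
  assert (M3 : Rabs (t' + - t) < d) by (eapply Rlt_le_trans; [exact B2|]; eapply Rle_trans; [apply Rmin_l|apply Rmin_l]).
  assert (M4 : Rabs (t' + - t) < d3) by (eapply Rlt_le_trans; [exact B2|]; eapply Rle_trans; [apply Rmin_r|apply Rmin_l]).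
  specialize (Hd2 x' M1). ballR Hd2.
  unfold ball; simpl; unfold AbsRing_ball, abs, minus, plus, opp; simpl.
  assert (X' : Rabs x' <= A).
  { unfold A. apply Rabs_lt_between in M2. unfold Rabs. repeat destruct Rcase_abs; lra. }
  assert (Q : Rabs (RInt (fun y => f y t' - f y t) 0 x') <= Rabs (x' - 0) * (e / 2 / (A + 1))).
  { apply Rabs_RInt_le.
    - intros y. apply (continuous_minus (V := R_NormedModule)); auto.
    - intros y Hy. apply Rlt_le.
      assert (- A <= y <= A).
      { apply Rabs_le_between in X'. unfold Rmin, Rmax in Hy. destruct Rle_dec; lra. }
      apply Rabs_lt_between in M3.
      apply Hd; try lra. rewrite Rminus_diag, Rabs_R0; lra. }
  rewrite (RInt_minus (V := R_CompleteNormedModule) (fun y => f y t') (fun y => f y t)) in Q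
    by (apply ex_RInt_cont, Hs; auto).
  unfold minus, plus, opp in Q; simpl in Q. rewrite Rminus_0_r in Q.
  assert (Rabs x' * (e / 2 / (A + 1)) <= e / 2).
  { apply Rle_trans with ((A + 1) * (e / 2 / (A + 1))).
    - apply Rmult_le_compat_r; lra.
    - right. field. lra. }
  apply Rabs_lt_between in Hd2. assert (Q' := Rle_trans _ _ _ Q H).
  apply Rabs_le_between in Q'. apply Rabs_lt_between. lra.
Qed.

Lemma is_derive_const_plus (c : R) (g : R -> R) (x l : R) :
  is_derive g x l -> is_derive (fun x => c + g x) x l.
Proof.
  intros H. apply is_derive_Reals. apply is_derive_Reals in H.
  replace l with (0 + l) by ring.
  exact (derivable_pt_lim_plus (fun _ => c) g x 0 l (derivable_pt_lim_const c x) H).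
Qed.

Lemma is_derive_Rplus (f g : R -> R) (x f' g' : R) : is_derive f x f' -> is_derive g x g' ->
  is_derive (fun x => f x + g x) x (f' + g').
Proof. intros Hf Hg. exact (is_derive_plus (V := R_NormedModule) f g x f' g' Hf Hg). Qed.

Lemma is_derive_Rminus (f g : R -> R) (x f' g' : R) : is_derive f x f' -> is_derive g x g' ->
  is_derive (fun x => f x - g x) x (f' - g').
Proof. intros Hf Hg. exact (is_derive_minus (V := R_NormedModule) f g x f' g' Hf Hg). Qed.

Lemma is_derive_Rmult (f g : R -> R) (x f' g' : R) : is_derive f x f' -> is_derive g x g' ->
  is_derive (fun x => f x * g x) x (f' * g x + f x * g').
Proof.
  intros Hf Hg. apply is_derive_Reals. apply derivable_pt_lim_mult; now apply is_derive_Reals.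
Qed.

Lemma is_derive_sqr (f : R -> R) (x l : R) : is_derive f x l -> is_derive (fun x => f x ^ 2) x (2 * f x * l).
Proof.
  intros H. apply (is_derive_ext (fun x => f x * f x)); pos.
  replace (2 * f x * l) with (l * f x + f x * l) by ring. now apply is_derive_Rmult.
Qed.

Lemma is_derive_inj (f : R -> R) (x l l' : R) : is_derive f x l -> is_derive f x l' -> l = l'.
Proof. intros H H'. now rewrite <- (is_derive_unique _ _ _ H), <- (is_derive_unique _ _ _ H'). Qed.

Lemma RInt_exact (F f : R -> R) (a b : R) : (forall x, is_derive F x (f x)) -> (forall x, continuous f x) ->
  RInt f a b = F b - F a.
Proof.
  intros H C. apply is_RInt_unique.
  apply (is_RInt_derive (V := R_CompleteNormedModule) F f); auto.
Qed.

Lemma RInt_Rminus (f g : R -> R) (a b : R) : (forall x, continuous f x) -> (forall x, continuous g x) ->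
  RInt (fun x => f x - g x) a b = RInt f a b - RInt g a b.
Proof. intros Hf Hg. apply (RInt_minus (V := R_CompleteNormedModule)); now apply ex_RInt_cont. Qed.

Lemma RInt_Rplus (f g : R -> R) (a b : R) : (forall x, continuous f x) -> (forall x, continuous g x) ->
  RInt (fun x => f x + g x) a b = RInt f a b + RInt g a b.
Proof. intros Hf Hg. apply (RInt_plus (V := R_CompleteNormedModule)); now apply ex_RInt_cont. Qed.

Lemma RInt_Rscal (c : R) (f : R -> R) (a b : R) : (forall x, continuous f x) ->
  RInt (fun x => c * f x) a b = c * RInt f a b.
Proof. intros Hf. apply (RInt_scal (V := R_CompleteNormedModule)); now apply ex_RInt_cont. Qed.

Lemma is_derive_sin_comp (f : R -> R) (x l : R) : is_derive f x l -> is_derive (fun x => sin (f x)) x (l * cos (f x)).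
Proof. intros H. exact (is_derive_comp (V := R_NormedModule) sin f x _ _ (is_derive_sin (f x)) H). Qed.

Lemma is_derive_cos_comp (f : R -> R) (x l : R) : is_derive f x l -> is_derive (fun x => cos (f x)) x (l * - sin (f x)).
Proof. intros H. exact (is_derive_comp (V := R_NormedModule) cos f x _ _ (is_derive_cos (f x)) H). Qed.

Lemma is_derive_Ropp (f : R -> R) (x l : R) : is_derive f x l -> is_derive (fun x => - f x) x (- l).
Proof. intros H. exact (is_derive_opp (V := R_NormedModule) f x l H). Qed.

Lemma continuous_Rmult_c (f g : R -> R) (x : R) : continuous f x -> continuous g x -> continuous (fun x => f x * g x) x.
Proof. exact (continuous_mult (K := R_AbsRing) f g x). Qed.
Lemma continuous_Rplus_c (f g : R -> R) (x : R) : continuous f x -> continuous g x -> continuous (fun x => f x + g x) x.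
Proof. exact (continuous_plus (V := R_NormedModule) f g x). Qed.
Lemma continuous_Rminus_c (f g : R -> R) (x : R) : continuous f x -> continuous g x -> continuous (fun x => f x - g x) x.
Proof. exact (continuous_minus (V := R_NormedModule) f g x). Qed.
Lemma continuous_Ropp_c (f : R -> R) (x : R) : continuous f x -> continuous (fun x => - f x) x.
Proof. exact (continuous_opp (V := R_NormedModule) f x). Qed.
Lemma continuous_pow_c (f : R -> R) (n : nat) (x : R) : continuous f x -> continuous (fun x => f x ^ n) x.
Proof.
  intros H. induction n as [|n IH]; [apply continuous_const|]. exact (continuous_Rmult_c f (fun x => f x ^ n) x H IH).
Qed.
Lemma continuous_Rsqr_c (f : R -> R) (x : R) : continuous f x -> continuous (fun x => f x ^ 2) x.
Proof. exact (continuous_pow_c f 2 x). Qed.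
Lemma continuous_abs_comp (f : R -> R) (x : R) : continuous f x -> continuous (fun x => Rabs (f x)) x.
Proof. intros H. apply continuous_comp; [exact H|apply continuous_Rabs]. Qed.
Lemma continuous_cos_comp (f : R -> R) (x : R) : continuous f x -> continuous (fun x => cos (f x)) x.
Proof. intros H. apply continuous_comp; [exact H|apply continuity_pt_filterlim, continuity_cos]. Qed.
Lemma continuous_sin_comp (f : R -> R) (x : R) : continuous f x -> continuous (fun x => sin (f x)) x.
Proof. intros H. apply continuous_comp; [exact H|apply continuity_pt_filterlim, continuity_sin]. Qed.
Lemma continuous_of_derive (f : R -> R) (x l : R) : is_derive f x l -> continuous f x.
Proof. intros H. apply (ex_derive_continuous (V := R_NormedModule)). eexists; exact H. Qed.
Lemma continuous_reflect (f : R -> R) (c x : R) : continuous f (c - x) -> continuous (fun x => f (c - x)) x.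
Proof.
  intros H. apply continuous_comp; [|exact H].
  apply continuous_Rminus_c; [apply continuous_const|apply continuous_id].
Qed.

Create HintDb cont.
Create HintDb deriv.
#[global] Hint Constants Opaque : cont deriv.

Ltac cnt := intros; repeat first
  [ assumption
  | match goal with
    | |- continuous (fun _ => ?c) _ => apply continuous_const
    | |- continuous (fun x => x) _ => apply continuous_id
    | |- continuous (fun x => @?f x + @?g x) _ => apply (continuous_Rplus_c f g)
    | |- continuous (fun x => @?f x - @?g x) _ => apply (continuous_Rminus_c f g)
    | |- continuous (fun x => @?f x * @?g x) _ => apply (continuous_Rmult_c f g)
    | |- continuous (fun x => @?f x / ?c) _ => apply (continuous_Rmult_c f (fun _ => / c))
    | |- continuous (fun x => - @?f x) _ => apply (continuous_Ropp_c f)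
    | |- continuous (fun x => @?f x ^ ?n) _ => apply (continuous_pow_c f n)
    | |- continuous (fun x => cos (@?f x)) _ => apply (continuous_cos_comp f)
    | |- continuous (fun x => sin (@?f x)) _ => apply (continuous_sin_comp f)
    | |- continuous cos _ => apply (continuous_cos_comp (fun x => x))
    | |- continuous sin _ => apply (continuous_sin_comp (fun x => x))
    | |- continuous (fun x => Rabs (@?f x)) _ => apply (continuous_abs_comp f)
    | H : forall _, continuous ?f _ |- continuous ?f _ => apply H
    | H : forall _, continuous (fun x => @?f x) _ |- continuous ?g _ => exact (H _)
    | H : forall _, is_derive ?f _ _ |- continuous ?f _ => exact (continuous_of_derive _ _ _ (H _))
    | H : forall _, is_derive (fun x => @?f x) _ _ |- continuous ?g _ => exact (continuous_of_derive _ _ _ (H _))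
    | |- continuous (fun x => ?f (?c - x)) _ => apply continuous_reflect
    end
  | solve [eauto with cont] ].

Lemma is_derive_eq (f : R -> R) (x l l' : R) : is_derive f x l -> l = l' -> is_derive f x l'.
Proof. now intros H <-. Qed.
Lemma is_derive_cst (c x : R) : is_derive (fun _ : R => c) x 0.
Proof. exact (is_derive_const (V := R_NormedModule) c x). Qed.
Lemma is_derive_var (x : R) : is_derive (fun y : R => y) x 1.
Proof. exact (is_derive_id (K := R_AbsRing) x). Qed.
Lemma is_derive_exp_comp (f : R -> R) (x l : R) : is_derive f x l -> is_derive (fun x => exp (f x)) x (l * exp (f x)).
Proof. intros H. exact (is_derive_comp (V := R_NormedModule) exp f x _ _ (is_derive_exp (f x)) H). Qed.

Ltac der1 := match goal with
  | |- is_derive (fun _ => ?c) _ _ => eapply (is_derive_cst c)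
  | |- is_derive (fun x => x) _ _ => eapply is_derive_var
  | |- is_derive (fun x => @?f x + @?g x) _ _ => eapply (is_derive_Rplus f g)
  | |- is_derive (fun x => @?f x - @?g x) _ _ => eapply (is_derive_Rminus f g)
  | |- is_derive (fun x => @?f x * @?g x) _ _ => eapply (is_derive_Rmult f g)
  | |- is_derive (fun x => @?f x / ?c) _ _ => eapply (is_derive_Rmult f (fun _ => / c))
  | |- is_derive (fun x => - @?f x) _ _ => eapply (is_derive_Ropp f)
  | |- is_derive (fun x => @?f x ^ 2) _ _ => eapply (is_derive_sqr f)
  | |- is_derive (fun x => cos (@?f x)) _ _ => eapply (is_derive_cos_comp f)
  | |- is_derive (fun x => sin (@?f x)) _ _ => eapply (is_derive_sin_comp f)
  | |- is_derive cos _ _ => eapply (is_derive_cos_comp (fun x => x))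
  | |- is_derive sin _ _ => eapply (is_derive_sin_comp (fun x => x))
  | |- is_derive (fun x => exp (@?f x)) _ _ => eapply (is_derive_exp_comp f)
  | H : forall _, is_derive ?f _ _ |- is_derive ?f _ _ => eapply H
  | H : is_derive ?f ?x _ |- is_derive ?f ?x _ => eapply H
  | H : forall _, is_derive (fun x => @?f x) _ _ |- is_derive ?g _ _ => exact (H _)
  end.
(* reduces [is_derive f x l] to an identity between [l] and the derivative computed by the usual rules *)
Ltac der := intros; eapply is_derive_eq; [solve [repeat first [der1 | solve [eauto with deriv]]]|try solve [ring | Rring]].

Lemma RInt_cst (a b c : R) : RInt (fun _ => c) a b = (b - a) * c.
Proof. exact (RInt_const (V := R_CompleteNormedModule) a b c). Qed.

Ltac rlin1 := match goal with
  | |- context [RInt (fun x => @?f x + @?g x) ?a ?b] => rewrite (RInt_Rplus f g a b) by cnt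
  | |- context [RInt (fun x => @?f x - @?g x) ?a ?b] => rewrite (RInt_Rminus f g a b) by cnt
  | |- context [RInt (fun x => ?c * @?f x) ?a ?b] => rewrite (RInt_Rscal c f a b) by cnt
  | |- context [RInt (fun _ => ?c) ?a ?b] => rewrite (RInt_cst a b c)
  end.
(* distributes the integrals of the goal over sums, differences and constant factors *)
Ltac rlin := repeat rlin1; cbv beta.
Ltac rlin_as F := rewrite (RInt_ext _ F) by (intros; first [Rring | Rfield]); rlin.

Definition opn (P : R -> Prop) : Prop := forall t, P t -> locally t P.

Lemma is_derive_RInt_time (P : R -> Prop) (f ft : R -> R -> R) (a b t : R) : opn P -> P t ->
  (forall y s, P s -> is_derive (fun s => f y s) s (ft y s)) ->
  (forall y s, P s -> cont2 f y s) -> (forall y s, P s -> cont2 ft y s) ->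
  is_derive (fun s => RInt (fun y => f y s) a b) t (RInt (fun y => ft y t) a b).
Proof.
  intros HP Pt Hd Hc Hct.
  replace (RInt (fun y => ft y t) a b) with (RInt (fun y => Derive (fun s => f y s) t) a b).
  2: { apply RInt_ext. intros y _. apply is_derive_unique, Hd, Pt. }
  apply is_derive_RInt_param.
  - apply (filter_imp P); [|auto]. eexists. auto.
  - intros y _. apply continuity_2d_pt_filterlim.
    change (continuous (fun p : R * R => Derive (fun z => f (snd p) z) (fst p)) (t, y)).
    apply (continuous_ext_loc _ (fun p : R * R => ft (snd p) (fst p))).
    + destruct (HP t Pt) as [d Hdd]. exists d. intros [s y'] [B _].
      symmetry. apply is_derive_unique, Hd, Hdd, B.
    + apply continuous_comp_2.
      * apply continuous_snd.
      * apply continuous_fst.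
      * apply (Hct y t Pt).
  - apply (filter_imp P); [|auto]. intros s Ps. apply ex_RInt_cont.
    intros y. apply cont2_slice1; auto.
Qed.

Lemma is_derive_comp2 (P : R -> Prop) (f fx ft : R -> R -> R) (g h : R -> R) (s g' h' : R) :
  opn P -> P (h s) ->
  (forall x t, P t -> is_derive (fun y => f y t) x (fx x t)) ->
  (forall x t, P t -> is_derive (fun r => f x r) t (ft x t)) ->
  (forall x t, P t -> cont2 fx x t) ->
  is_derive g s g' -> is_derive h s h' ->
  is_derive (fun s => f (g s) (h s)) s (fx (g s) (h s) * g' + ft (g s) (h s) * h').
Proof.
  intros HP Ps Hx Ht Hc Hg Hh. apply is_derive_Reals.
  apply (derivable_pt_lim_comp_2d f g h s); try (apply is_derive_Reals; assumption).
  apply filterdiff_differentiable_pt_lim.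
  eapply filterdiff_ext_lin; [apply (is_derive_filterdiff f (g s) (h s) fx (ft (g s) (h s)))|].
  - destruct (HP _ Ps) as [d Hd]. exists d. intros [y r] [_ B]. der.
  - auto.
  - now apply Hc.
  - auto.
Qed.

(** Derivatives are existential witnesses rather than values of [Derive], so closure under each
    operation is an induction on [k] that exhibits the derivative. The time set [P] allows functions
    regular only at admissible times, while [x] always runs over the whole line. *)
Fixpoint CK (P : R -> Prop) (k : nat) (f : R -> R -> R) : Prop :=
  (forall x t, P t -> cont2 f x t) /\
  match k with
  | O => True
  | S k' => exists fx ft : R -> R -> R,
      (forall x t, P t -> is_derive (fun y => f y t) x (fx x t) /\ is_derive (fun s => f x s) t (ft x t)) /\
      CK P k' fx /\ CK P k' ft
  end.

Lemma CK_cont P k f : CK P k f -> forall x t, P t -> cont2 f x t.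
Proof. destruct k; intros H; apply H. Qed.

Lemma CK_pred P k : forall f, CK P (S k) f -> CK P k f.
Proof.
  induction k as [|k IH]; intros f [H1 [fx [ft [H2 [H3 H4]]]]].
  - split; auto.
  - split; [exact H1|]. exists fx, ft. auto.
Qed.

Lemma CK_ext P k : opn P -> forall f g, (forall x t, P t -> f x t = g x t) -> CK P k f -> CK P k g.
Proof.
  intros HP. destruct k as [|k]; intros f g E [H1 H2];
  (split; [intros x t Pt; apply (cont2_ext P f); [now apply HP|exact E|now apply H1]|]).
  - exact I.
  - destruct H2 as [fx [ft [H2 H3]]]. exists fx, ft. split; [|exact H3].
    intros x t Pt. destruct (H2 x t Pt) as [A B]. split.
    + eapply is_derive_ext; [|exact A]. intros y. now apply E.
    + eapply is_derive_ext_loc; [|exact B]. eapply filter_imp; auto.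
      auto.
Qed.

Lemma CK_const P k c : CK P k (fun _ _ => c).
Proof.
  revert c. induction k as [|k IH]; (split; [intros; apply cont2_const|]); [exact I|].
  exists (fun _ _ => 0), (fun _ _ => 0). split; auto.
  split; der.
Qed.

Lemma CK_fst P k : CK P k (fun x _ => x).
Proof.
  destruct k; (split; [intros; apply cont2_fst|]); [exact I|].
  exists (fun _ _ => 1), (fun _ _ => 0). split; [|split; apply CK_const].
  split; der.
Qed.

Lemma CK_snd P k : CK P k (fun _ t => t).
Proof.
  destruct k; (split; [intros; apply cont2_snd|]); [exact I|].
  exists (fun _ _ => 0), (fun _ _ => 1). split; [|split; apply CK_const].
  split; der.
Qed.

Lemma CK_plus P k : forall f g, CK P k f -> CK P k g -> CK P k (fun x t => f x t + g x t).
Proof.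
  induction k as [|k IH]; intros f g [F1 F2] [G1 G2];
  (split; [intros; apply cont2_plus; auto|]); [exact I|].
  destruct F2 as [fx [ft [F2 [F3 F4]]]], G2 as [gx [gt [G2 [G3 G4]]]].
  exists (fun x t => fx x t + gx x t), (fun x t => ft x t + gt x t).
  split; auto.
  intros x t Pt. destruct (F2 x t Pt), (G2 x t Pt).
  split; der.
Qed.

Lemma CK_mult P k : forall f g, CK P k f -> CK P k g -> CK P k (fun x t => f x t * g x t).
Proof.
  induction k as [|k IH]; intros f g Hf Hg; pose proof Hf as [F1 F2]; pose proof Hg as [G1 G2];
  (split; [intros; apply cont2_mult; auto|]); [exact I|].
  destruct F2 as [fx [ft [F2 [F3 F4]]]], G2 as [gx [gt [G2 [G3 G4]]]].
  apply CK_pred in Hf. apply CK_pred in Hg.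
  exists (fun x t => fx x t * g x t + f x t * gx x t), (fun x t => ft x t * g x t + f x t * gt x t).
  split; [|split; apply CK_plus; apply IH; assumption].
  intros x t Pt. destruct (F2 x t Pt), (G2 x t Pt).
  split.
  - apply (is_derive_Rmult (fun y => f y t) (fun y => g y t)); assumption.
  - apply is_derive_Rmult; assumption.
Qed.

Lemma CK_opp P k f : CK P k f -> CK P k (fun x t => - f x t).
Proof.
  intros H. replace (fun x t => - f x t) with (fun x t => (-1) * f x t).
  - apply CK_mult; [apply CK_const|exact H].
  - apply functional_extensionality; intro; apply functional_extensionality; intro; ring.
Qed.

Lemma CK_minus P k f g : CK P k f -> CK P k g -> CK P k (fun x t => f x t - g x t).
Proof. intros. apply CK_plus; [auto|now apply CK_opp]. Qed.

Lemma CK_comp2 (P Q : R -> Prop) k : opn P -> opn Q ->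
  forall f g h, CK P k f -> CK Q k g -> CK Q k h -> (forall x t, Q t -> P (h x t)) ->
  CK Q k (fun x t => f (g x t) (h x t)).
Proof.
  intros OP OQ. induction k as [|k IH]; intros f g h Hf Hg Hh HP;
  pose proof Hf as [F1 F2]; pose proof Hg as [G1 G2]; pose proof Hh as [H1 H2];
  (split; [intros x t Qt; apply cont2_comp2; [auto|auto|apply F1; auto]|]); [exact I|].
  destruct F2 as [fx [ft [F2 [F3 F4]]]], G2 as [gx [gt [G2 [G3 G4]]]], H2 as [hx [ht [H2 [H3 H4]]]].
  apply CK_pred in Hg. apply CK_pred in Hh.
  exists (fun x t => fx (g x t) (h x t) * gx x t + ft (g x t) (h x t) * hx x t),
         (fun x t => fx (g x t) (h x t) * gt x t + ft (g x t) (h x t) * ht x t).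
  split; [|split; apply CK_plus; apply CK_mult; try assumption; apply IH; assumption].
  intros x t Qt. destruct (G2 x t Qt), (H2 x t Qt).
  split.
  - apply (is_derive_comp2 P f fx ft (fun x => g x t) (fun x => h x t)); auto.
    + intros; now apply F2. + intros; now apply F2. + apply (CK_cont P k fx F3).
  - apply (is_derive_comp2 P f fx ft (fun t => g x t) (fun t => h x t)); auto.
    + intros; now apply F2. + intros; now apply F2. + apply (CK_cont P k fx F3).
Qed.

Lemma CK_sincos P k : forall f, CK P k f -> CK P k (fun x t => sin (f x t)) /\ CK P k (fun x t => cos (f x t)).
Proof.
  induction k as [|k IH]; intros f Hf; pose proof Hf as [F1 F2];
  (split; (split; [intros x t Pt; apply cont2_comp1; [auto|cnt]|]));
  try exact I; destruct F2 as [fx [ft [F2 [F3 F4]]]]; apply CK_pred in Hf; destruct (IH f Hf) as [S C].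
  - exists (fun x t => fx x t * cos (f x t)), (fun x t => ft x t * cos (f x t)).
    split; [|split; apply CK_mult; assumption].
    intros x t Pt. destruct (F2 x t Pt).
    split; der.
  - exists (fun x t => fx x t * - sin (f x t)), (fun x t => ft x t * - sin (f x t)).
    split; [|split; apply CK_mult; try assumption; now apply CK_opp].
    intros x t Pt. destruct (F2 x t Pt).
    split; der.
Qed.

Lemma CK_exp P k : forall f, CK P k f -> CK P k (fun x t => exp (f x t)).
Proof.
  induction k as [|k IH]; intros f Hf; pose proof Hf as [F1 F2];
  (split; [intros x t Pt; apply cont2_comp1; [now apply F1|apply continuous_exp]|]); [exact I|].
  destruct F2 as [fx [ft [F2 [F3 F4]]]]; apply CK_pred in Hf.
  exists (fun x t => fx x t * exp (f x t)), (fun x t => ft x t * exp (f x t)).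
  split; [|split; apply CK_mult; auto].
  intros x t Pt. destruct (F2 x t Pt).
  split; der.
Qed.

Lemma CK_inv P k : forall f, (forall x t, P t -> f x t <> 0) -> CK P k f -> CK P k (fun x t => / f x t).
Proof.
  induction k as [|k IH]; intros f H0 Hf; pose proof Hf as [F1 F2];
  (split; [intros x t Pt; apply cont2_comp1; [now apply F1|apply continuous_Rinv; auto]|]); [exact I|].
  destruct F2 as [fx [ft [F2 [F3 F4]]]]; apply CK_pred in Hf.
  exists (fun x t => - fx x t * (/ f x t * / f x t)), (fun x t => - ft x t * (/ f x t * / f x t)).
  split; [|split; apply CK_mult; try (now apply CK_opp); apply CK_mult; apply IH; auto].
  intros x t Pt. destruct (F2 x t Pt).
  split.
  - replace (- fx x t * (/ f x t * / f x t)) with (- fx x t / f x t ^ 2) by (field; auto).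
    apply (is_derive_inv (fun y => f y t)); auto.
  - replace (- ft x t * (/ f x t * / f x t)) with (- ft x t / f x t ^ 2) by (field; auto).
    apply is_derive_inv; auto.
Qed.

Lemma CK_sqrt P k : forall f, (forall x t, P t -> 0 < f x t) -> CK P k f -> CK P k (fun x t => sqrt (f x t)).
Proof.
  induction k as [|k IH]; intros f H0 Hf; pose proof Hf as [F1 F2];
  (split; [intros x t Pt; apply cont2_comp1; [now apply F1|apply continuous_sqrt]|]); [exact I|].
  destruct F2 as [fx [ft [F2 [F3 F4]]]]; apply CK_pred in Hf.
  assert (Hs : forall x t, P t -> 2 * sqrt (f x t) <> 0).
  { intros x t Pt. pose proof (sqrt_lt_R0 _ (H0 x t Pt)). lra. }
  assert (CK P k (fun x t => / (2 * sqrt (f x t)))).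
  { apply CK_inv; [exact Hs|]. apply CK_mult; [apply CK_const|auto]. }
  exists (fun x t => fx x t * / (2 * sqrt (f x t))), (fun x t => ft x t * / (2 * sqrt (f x t))).
  split; [|split; apply CK_mult; auto].
  intros x t Pt. destruct (F2 x t Pt).
  split; [apply (is_derive_sqrt (fun y => f y t)) | apply (is_derive_sqrt (fun y => f x y))]; auto.
Qed.

Lemma CK_RInt P k : opn P -> forall f, CK P k f -> CK P k (fun x t => RInt (fun y => f y t) 0 x).
Proof.
  intros OP. induction k as [|k IH]; intros f Hf; pose proof Hf as [F1 F2];
  (split; [intros x t Pt; apply (cont2_RInt P); [now apply OP|exact F1]|]); [exact I|].
  destruct F2 as [fx [ft [F2 [F3 F4]]]]; apply CK_pred in Hf.
  exists f, (fun x t => RInt (fun y => ft y t) 0 x).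
  split; [|auto].
  split.
  - apply (is_derive_RInt_var (fun y => f y t)). intros y. apply cont2_slice1; auto.
  - apply (is_derive_RInt_time P f ft); auto.
    + intros; now apply F2. + apply (CK_cont P k ft F4).
Qed.

Lemma cont2_swap f x t : cont2 f t x -> cont2 (fun x t => f t x) x t.
Proof. intros H. exact (cont2_comp2 f (fun _ t => t) (fun x _ => x) x t (cont2_snd x t) (cont2_fst x t) H). Qed.

Lemma CK_swap k : forall f, CK (fun _ => True) k f -> CK (fun _ => True) k (fun x t => f t x).
Proof.
  induction k as [|k IH]; intros f [F1 F2]; (split; [intros; apply cont2_swap; auto|]); [exact I|].
  destruct F2 as [fx [ft [F2 [F3 F4]]]].
  exists (fun x t => ft t x), (fun x t => fx t x). split; [|auto].
  intros x t _. destruct (F2 t x I). auto.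
Qed.

(** Uniqueness of derivatives identifies the witnesses inside [CK] with the iterated [Derive] in
    every order of differentiation. *)
Lemma CK_smooth2 f : (forall k, CK (fun _ => True) k f) -> smooth2 f.
Proof.
  intros H.
  assert (G : forall l k, CK (fun _ => True) k (iter_pd l f)).
  { induction l as [|b l IH]; [exact H|]. intros k.
    destruct (IH (S k)) as [_ [fx [ft [D [Hx Ht]]]]]. simpl.
    destruct b.
    - replace (fun u t => Derive (fun v => iter_pd l f v t) u) with fx; [exact Hx|].
      apply functional_extensionality; intro x; apply functional_extensionality.
      symmetry. apply is_derive_unique. now apply D.
    - replace (fun u t => Derive (fun s => iter_pd l f u s) t) with ft; [exact Ht|].
      apply functional_extensionality; intro x; apply functional_extensionality.
      symmetry. apply is_derive_unique. now apply D. }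
  intros l u t. destruct (G l 1%nat) as [C [fx [ft [D _]]]]. destruct (D u t I) as [D1 D2].
  split; [eexists; exact D1|]. split; [eexists; exact D2|]. exact (C u t I).
Qed.

(** * Flows of time-dependent fields *)

Lemma CK_dx (P : R -> Prop) (f fx : R -> R -> R) : opn P -> (forall k, CK P k f) ->
  (forall x t, P t -> is_derive (fun y => f y t) x (fx x t)) -> forall k, CK P k fx.
Proof.
  intros OP H D k. destruct (H (S k)) as [_ [gx [gt [G1 [G2 _]]]]].
  apply (CK_ext P k OP gx); [|exact G2].
  intros x t Pt. rewrite <- (is_derive_unique _ _ _ (D x t Pt)).
  symmetry. apply is_derive_unique. now apply G1.
Qed.

Lemma opn_True : opn (fun _ => True).
Proof. intros t _. now apply filter_forall. Qed.

Lemma continuous_of_approx {U : UniformSpace} (F : nat -> U -> R) (f : U -> R) (x : U) (C : R) :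
  locally x (fun y => forall k, Rabs (F k y - f y) <= C * (1/2)^k) ->
  (forall k, continuous (F k) x) -> continuous f x.
Proof.
  intros HL HF. apply filterlim_locally. intros eps.
  assert (exists k : nat, Rabs (C * (1/2)^k) < eps / 3) as [k Hk].
  { assert (L : is_lim_seq (fun k => C * (1/2)^k) 0).
    { replace (Finite 0) with (Rbar_mult C 0) by (simpl; f_equal; ring).
      apply is_lim_seq_scal_l, is_lim_seq_geom. rewrite Rabs_pos_eq; lra. }
    apply is_lim_seq_spec in L. destruct eps as [e He].
    destruct (L (mkposreal (e/3) ltac:(lra))) as [N HN].
    exists N. specialize (HN N (Nat.le_refl N)). now rewrite Rminus_0_r in HN. }
  destruct eps as [e He].
  pose proof (proj1 (filterlim_locally (F k) (F k x)) (HF k) (mkposreal (e/3) ltac:(lra))) as HE.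
  pose proof (locally_singleton _ _ HL k) as H0.
  eapply filter_imp; [|apply (filter_and _ _ HL HE)].
  intros y [A B]. specialize (A k).
  unfold ball in *; simpl in *; unfold AbsRing_ball, abs, minus, plus, opp in *; simpl in *.
  apply Rabs_lt_between in B. apply Rabs_le_between in A. apply Rabs_le_between in H0.
  apply Rabs_lt_between in Hk. apply Rabs_lt_between. lra.
Qed.

Lemma is_derive_of_quadratic (f : R -> R) (x l C : R) :
  (forall h, Rabs h <= 1 -> Rabs (f (x + h) - f x - h * l) <= C * h^2) -> is_derive f x l.
Proof.
  intros H. apply is_derive_Reals. intros eps He.
  assert (0 <= C). { specialize (H 1). rewrite Rabs_pos_eq in H by lra.
    pose proof (Rabs_pos (f (x + 1) - f x - 1 * l)). lra. }
  assert (Hd : 0 < Rmin 1 (eps / (C + 1))).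
  { apply Rmin_pos; [lra|]. pos. }
  exists (mkposreal _ Hd). intros h Hh Hlt. simpl in Hlt.
  assert (L1 : Rabs h <= 1) by (pose proof (Rmin_l 1 (eps / (C + 1))); lra).
  assert (L2 : Rabs h < eps / (C + 1)) by (pose proof (Rmin_r 1 (eps / (C + 1))); lra).
  specialize (H h L1).
  replace ((f (x + h) - f x) / h - l) with ((f (x + h) - f x - h * l) / h) by (field; auto).
  unfold Rdiv. rewrite Rabs_mult, Rabs_inv.
  assert (Hp : 0 < Rabs h) by now apply Rabs_pos_lt.
  apply Rle_lt_trans with (C * Rabs h).
  - apply Rmult_le_reg_r with (Rabs h); [exact Hp|].
    rewrite Rmult_assoc, Rinv_l by lra. rewrite <- pow2_abs in H. lra.
  - apply Rle_lt_trans with ((C + 1) * Rabs h); [nra|].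
    apply Rmult_lt_compat_l with (r := C + 1) in L2; [|lra].
    replace ((C + 1) * (eps / (C + 1))) with eps in L2 by (field; lra). exact L2.
Qed.

Lemma Gronwall_fwd (G g : R -> R) (a b T : R) : 0 < a ->
  (forall t, 0 <= t <= T -> is_derive G t (g t)) ->
  (forall t, 0 <= t <= T -> g t <= a * G t + b) ->
  forall t, 0 <= t <= T -> G t <= (G 0 + b / a) * exp (a * t) - b / a.
Proof.
  intros Ha HG Hg t Ht.
  assert (M : (G t + b / a) * exp (- (a * t)) <= (G 0 + b / a) * exp (- (a * 0))).
  { apply (nonincreasing_of_derive (fun t => (G t + b / a) * exp (- (a * t)))
       (fun t => g t * exp (- (a * t)) + (G t + b / a) * (- a * exp (- (a * t)))) 0 t); [lra| |].
    - intros x Hx. apply (ex_derive_continuous (V := R_NormedModule)).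
      assert (ex_derive G x) by (eexists; apply HG; lra). auto_derive. auto.
    - intros x Hx. assert (D := HG x ltac:(lra)). split.
      +
        der.
      + specialize (Hg x ltac:(lra)). pose proof (exp_pos (- (a * x))).
        replace (_ + _) with ((g x - (a * G x + b)) * exp (- (a * x))) by (field; lra). nra. }
  rewrite Rmult_0_r, Ropp_0, exp_0, exp_Ropp in M.
  pose proof (exp_pos (a * t)).
  apply Rmult_le_compat_r with (r := exp (a * t)) in M; [|lra].
  rewrite Rmult_assoc, Rinv_l, Rmult_1_r in M by lra. lra.
Qed.

Lemma Gronwall (G g : R -> R) (a b T : R) : 0 < a -> 0 <= b ->
  (forall t, Rabs t <= T -> is_derive G t (g t)) ->
  (forall t, Rabs t <= T -> Rabs (g t) <= a * G t + b) ->
  forall t, Rabs t <= T -> G t <= (G 0 + b / a) * exp (a * Rabs t).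
Proof.
  intros Ha Hb HG Hg t Ht.
  assert (0 <= b / a) by pos.
  destruct (Rle_dec 0 t) as [L|L].
  - rewrite (Rabs_pos_eq t) in * by lra.
    enough (G t <= (G 0 + b / a) * exp (a * t) - b / a) by lra.
    apply (Gronwall_fwd G g a b T Ha); pos.
    + apply HG. rewrite Rabs_pos_eq; lra.
    + le_via Rle_abs. apply Hg. rewrite Rabs_pos_eq; lra.
  - rewrite (Rabs_left t) in * by lra.
    assert (B := fun H1 H2 => Gronwall_fwd (fun t => G (- t)) (fun t => - g (- t)) a b T Ha H1 H2 (- t)).
    cbv beta in B. rewrite Ropp_involutive, Ropp_0 in B.
    enough (G t <= (G 0 + b / a) * exp (a * - t) - b / a) by lra.
    apply B; [| |lra]; intros s Hs.
    + assert (D : is_derive G (- s) (g (- s))) by (apply HG; rewrite Rabs_Ropp, Rabs_pos_eq; lra).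
      replace (- g (- s)) with ((-1) * g (- s)) by Rring.
      apply (is_derive_comp (V := R_NormedModule) G Ropp s (g (- s)) (-1)); [exact D|].
      auto_derive; [auto|ring].
    + specialize (Hg (- s)). rewrite Rabs_Ropp, (Rabs_pos_eq s) in Hg by lra.
      pose proof (Rle_abs (- g (- s))). rewrite Rabs_Ropp in H0. lra.
Qed.

Lemma RInt_reflect (g : R -> R) (t : R) : (forall s, continuous g s) ->
  RInt g 0 t = - RInt (fun s => g (- s)) 0 (- t).
Proof.
  intros Hg.
  pose proof (RInt_comp (V := R_CompleteNormedModule) g Ropp (fun _ => -1) 0 (- t)) as H.
  rewrite Ropp_0, Ropp_involutive in H. rewrite <- H.
  - rewrite <- (RInt_opp (V := R_CompleteNormedModule)).
    + apply RInt_ext. intros s _. unfold scal, opp; simpl. unfold mult; simpl. ring.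
    + apply ex_RInt_cont. intros s. apply continuous_comp; [|apply Hg].
      apply (continuous_opp (V := R_NormedModule) (fun s => s)), continuous_id.
  - auto.
  - split; [auto_derive; [auto|ring]|cnt].
Qed.

Lemma Rabs_RInt_exp_pos (g : R -> R) (c K t : R) : 0 < K -> 0 <= c -> 0 <= t ->
  (forall s, continuous g s) -> (forall s, 0 <= s <= t -> Rabs (g s) <= c * exp (K * s)) ->
  Rabs (RInt g 0 t) <= c / K * exp (K * t).
Proof.
  intros HK Hc Ht Hg Hb.
  apply Rle_trans with (RInt (fun s => c * exp (K * s)) 0 t).
  - eapply Rle_trans; [apply abs_RInt_le; [exact Ht|now apply ex_RInt_cont]|].
    apply RInt_le; [exact Ht| | |].
    + apply ex_RInt_cont. cnt.
    + apply ex_RInt_cont. intros s. apply (ex_derive_continuous (V := R_NormedModule)). auto_derive. auto.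
    + intros s Hs. apply Hb. lra.
  - assert (E : is_RInt (fun s => c * exp (K * s)) 0 t (minus (c / K * exp (K * t)) (c / K * exp (K * 0)))).
    { apply (is_RInt_derive (fun s => c / K * exp (K * s))).
      - intros s _. auto_derive; [auto|]. field. lra.
      - intros s _. apply (ex_derive_continuous (V := R_NormedModule)). auto_derive. auto. }
    rewrite (is_RInt_unique _ _ _ _ E). unfold minus, plus, opp; simpl.
    assert (0 <= c / K) by pos.
    rewrite Rmult_0_r, exp_0. lra.
Qed.

Lemma Rabs_RInt_exp (g : R -> R) (c K t : R) : 0 < K -> 0 <= c ->
  (forall s, continuous g s) -> (forall s, Rabs (g s) <= c * exp (K * Rabs s)) ->
  Rabs (RInt g 0 t) <= c / K * exp (K * Rabs t).
Proof.
  intros HK Hc Hg Hb. destruct (Rle_dec 0 t) as [L|L].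
  - rewrite (Rabs_pos_eq t) by lra. apply Rabs_RInt_exp_pos; auto.
    intros s Hs. rewrite <- (Rabs_pos_eq s) at 2 by lra. apply Hb.
  - rewrite (Rabs_left t) by lra.
    rewrite RInt_reflect by auto. rewrite Rabs_Ropp.
    apply Rabs_RInt_exp_pos; auto; [lra| |].
    + intros s. apply continuous_comp; [|apply Hg].
      apply (continuous_opp (V := R_NormedModule) (fun s => s)), continuous_id.
    + intros s Hs. specialize (Hb (- s)). rewrite Rabs_Ropp, (Rabs_pos_eq s) in Hb by lra. exact Hb.
Qed.

Section Flow.

Variables (f fy : R -> R -> R) (B K L : R).
Hypothesis f_smooth : forall k, CK (fun _ => True) k f.
Hypothesis f_dy : forall y t, is_derive (fun y => f y t) y (fy y t).
Hypothesis f_bd : forall y t, Rabs (f y t) <= B.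
Hypothesis fy_bd : forall y t, Rabs (fy y t) <= K.
Hypothesis fy_lip : forall y y' t, Rabs (fy y' t - fy y t) <= L * Rabs (y' - y).
Hypothesis K_ge : 1 <= K.
Hypothesis L_ge : 0 <= L.

Lemma flow_mvt (y y' t : R) : exists z, f y' t - f y t = fy z t * (y' - y) /\ Rabs (z - y) <= Rabs (y' - y).
Proof.
  apply (MVT_cor4 (fun y => f y t) (fun y => fy y t) y (Rabs (y' - y))); [|lra].
  der.
Qed.

Lemma flow_lip (y y' t : R) : Rabs (f y' t - f y t) <= K * Rabs (y' - y).
Proof.
  destruct (flow_mvt y y' t) as [z [E _]]. rewrite E, Rabs_mult.
  apply Rmult_le_compat_r; [pos|auto].
Qed.

Lemma flow_quad (y y' t : R) : Rabs (f y' t - f y t - fy y t * (y' - y)) <= L * (y' - y)^2.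
Proof.
  destruct (flow_mvt y y' t) as [z [E Hz]]. rewrite E.
  replace (_ - _) with ((fy z t - fy y t) * (y' - y)) by Rring.
  rewrite Rabs_mult, <- pow2_abs.
  replace (L * Rabs (y' - y)^2) with (L * Rabs (y' - y) * Rabs (y' - y)) by Rring.
  apply Rmult_le_compat_r; pos.
  eapply Rle_trans; [auto|]. now apply Rmult_le_compat_l.
Qed.

Lemma flow_cont_along (Y : R -> R) : (forall s, continuous Y s) -> forall s, continuous (fun s => f (Y s) s) s.
Proof.
  intros HY s. apply continuous_comp_2; cnt.
  apply (CK_cont _ 0 f (f_smooth 0%nat) (Y s) s I).
Qed.

(** Picard iteration in the weight [exp (2 K |t|)]: integrating it gains [1 / (2 K)], which beats
    the Lipschitz constant [K] by a factor two. The solution is therefore global at once, without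
    gluing local ones. *)
Lemma flow_exists : exists Y : R -> R -> R, (forall u, Y u 0 = u) /\
  forall u t, is_derive (Y u) t (f (Y u t) t).
Proof.
  destruct (weighted_fixpoint (fun i : R * R => exp (2 * K * Rabs (snd i)))
    (fun Y => forall u t, continuous (fun s => Y (u, s)) t)
    (fun Y i => fst i + RInt (fun s => f (Y (fst i, s)) s) 0 (snd i))
    (fun i => fst i) B) as [Y [PY FY]].
  - pos.
  - apply continuous_const.
  - intros Y HY u t. apply (continuous_plus (V := R_NormedModule)); [apply continuous_const|].
    apply ex_derive_continuous. eexists.
    apply (is_derive_RInt_var (fun s => f (Y (u, s)) s)). now apply flow_cont_along.
  - intros [u t]; simpl. replace (u + _ - u) with (RInt (fun s => f u s) 0 t) by Rring.
    eapply Rle_trans; [apply Rabs_RInt_le with (M := B)|].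
    + apply flow_cont_along. cnt.
    + auto.
    + rewrite Rminus_0_r, Rmult_comm. apply Rmult_le_compat_l; [eapply Rle_trans; [apply Rabs_pos|apply (f_bd 0 0)]|].
      pose proof (exp_ineq1_le (2 * K * Rabs t)). pose proof (Rabs_pos t). nra.
  - intros Y Z d Hd HY HZ H [u t]; simpl.
    replace (u + RInt (fun s => f (Y (u, s)) s) 0 t - (u + RInt (fun s => f (Z (u, s)) s) 0 t)) with (minus (RInt (fun s => f (Y (u, s)) s) 0 t) (RInt (fun s => f (Z (u, s)) s) 0 t)) by (unfold minus, plus, opp; simpl; Rring).
    replace (d / 2) with (K * d / (2 * K)) by (field; lra).
    rewrite <- (RInt_minus (V := R_CompleteNormedModule) (fun s => f (Y (u, s)) s) (fun s => f (Z (u, s)) s))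
      by (apply ex_RInt_cont; now apply flow_cont_along).
    apply Rabs_RInt_exp; [lra|pos| |].
    + intros s. apply (continuous_minus (V := R_NormedModule)); now apply flow_cont_along.
    + intros s.
      le_via flow_lip. rewrite Rmult_assoc. apply Rmult_le_compat_l; [lra|].
      auto.
  - intros F Y HF HFY u t.
    apply (continuous_of_approx (fun k s => F k (u, s)) _ t (2 * B * exp (2 * K * (Rabs t + 1)))); auto.
    exists (mkposreal 1 Rlt_0_1). intros s Bs k. eapply Rle_trans; auto. simpl.
    ballR Bs.
    replace (2 * B * exp (2 * K * (Rabs t + 1)) * (1 / 2) ^ k) with (2 * B * (1 / 2) ^ k * exp (2 * K * (Rabs t + 1))) by Rring.
    apply Rmult_le_compat_l.
    + apply Rmult_le_pos; pos. pose proof (Rabs_pos (f 0 0)). pose proof (f_bd 0 0). lra.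
    + apply exp_mono. apply Rmult_le_compat_l; [lra|].
      apply Rabs_lt_between in Bs. unfold Rabs. repeat destruct Rcase_abs; lra.
  - eapply Rle_trans; [apply Rabs_pos|apply (f_bd 0 0)].
  - exists (fun u t => Y (u, t)). split.
    + intros u. rewrite <- FY. rewrite RInt_point. unfold zero; simpl. ring.
    + intros u t.
      apply (is_derive_ext (fun t => u + RInt (fun s => f (Y (u, s)) s) 0 t)).
      { intros s. apply (FY (u, s)). }
      apply is_derive_const_plus.
      apply (is_derive_RInt_var (fun s => f (Y (u, s)) s)). now apply flow_cont_along.
Qed.

Variable Y : R -> R -> R.
Hypothesis Y_0 : forall u, Y u 0 = u.
Hypothesis Y_t : forall u t, is_derive (Y u) t (f (Y u t) t).

Lemma flow_gap (u v t : R) : (Y v t - Y u t)^2 <= (v - u)^2 * exp (2 * K * Rabs t).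
Proof.
  pose proof (Gronwall (fun t => (Y v t - Y u t)^2)
    (fun t => 2 * (Y v t - Y u t) * (f (Y v t) t - f (Y u t) t)) (2 * K) 0 (Rabs t)) as G.
  cbv beta in G. rewrite !Y_0 in G.
  replace ((v - u)^2) with ((v - u)^2 + 0 / (2 * K)) by lra.
  apply G; try lra.
  -
    der.
  - intros s _. rewrite !Rabs_mult, (Rabs_pos_eq 2) by lra.
    pose proof (flow_lip (Y u s) (Y v s) s). rewrite <- (pow2_abs (Y v s - Y u s)).
    pose proof (Rabs_pos (Y v s - Y u s)). nra.
Qed.

Lemma flow_gap_abs (u v t : R) : Rabs (Y v t - Y u t) <= Rabs (v - u) * exp (K * Rabs t).
Proof.
  pose proof (exp_pos (K * Rabs t)).
  rewrite <- (Rabs_pos_eq (exp (K * Rabs t))), <- Rabs_mult by lra.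
  apply Rsqr_le_abs_0. unfold Rsqr. pose proof (flow_gap u v t) as G.
  replace (exp (2 * K * Rabs t)) with (exp (K * Rabs t) * exp (K * Rabs t)) in G
    by (rewrite <- exp_plus; f_equal; ring).
  nra.
Qed.

Lemma flow_cont2 u t : cont2 Y u t.
Proof.
  apply filterlim_locally. intros [e He].
  set (E := exp (K * (Rabs t + 1))). pose proof (exp_pos (K * (Rabs t + 1))) as EP. fold E in EP.
  assert (Ct : continuous (Y u) t) by (apply (ex_derive_continuous (V := R_NormedModule)); eexists; apply Y_t).
  pose proof (proj1 (filterlim_locally _ _) Ct (mkposreal (e/2) ltac:(lra))) as [d Hd].
  assert (H1 : 0 < e / 2 / E) by pos.
  assert (H2 : 0 < Rmin (e / 2 / E) (Rmin d 1)).
  { destruct d; simpl. repeat apply Rmin_pos; lra. }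
  exists (mkposreal _ H2). intros [v s] [B1 B2].
  unfold ball in *; simpl in *. unfold AbsRing_ball, abs, minus, plus, opp in *; simpl in *.
  assert (A1 : Rabs (v + - u) < e / 2 / E) by (eapply Rlt_le_trans; [exact B1|apply Rmin_l]).
  assert (A2 : Rabs (s + - t) < d) by (eapply Rlt_le_trans; [exact B2|eapply Rle_trans; [apply Rmin_r|apply Rmin_l]]).
  assert (A3 : Rabs (s + - t) < 1) by (eapply Rlt_le_trans; [exact B2|eapply Rle_trans; [apply Rmin_r|apply Rmin_r]]).
  specialize (Hd s A2).
  assert (G : Rabs (Y v s - Y u s) <= e / 2).
  { le_via flow_gap_abs.
    apply Rle_trans with (e / 2 / E * E).
    - apply Rmult_le_compat; try apply Rabs_pos; [pos|unfold Rminus; lra|].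
      apply exp_mono. apply Rmult_le_compat_l; [lra|].
      apply Rabs_lt_between in A3. unfold Rabs. repeat destruct Rcase_abs; lra.
    - right. field. lra. }
  apply Rabs_le_between in G. apply Rabs_lt_between in Hd. apply Rabs_lt_between. lra.
Qed.

Lemma flow_fy_smooth : forall k, CK (fun _ => True) k fy.
Proof. apply (CK_dx _ f); [exact opn_True|auto|]. der. Qed.

(** The solution of the linearised equation with initial value one, explicit because the equation is
    scalar. Its positivity later makes the reparametrised curve immersed. *)
Definition flow_u (u t : R) : R := exp (RInt (fun s => fy (Y u s) s) 0 t).

Lemma flow_du u t : is_derive (fun v => Y v t) u (flow_u u t).
Proof.
  set (C := L * exp (2 * K * Rabs t)).
  assert (C0 : 0 <= C) by (apply Rmult_le_pos; [lra|pos]).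
  assert (Ey : forall s, is_derive (fun s => flow_u u s) s (fy (Y u s) s * flow_u u s)).
  { intros s.
    apply (is_derive_comp (V := R_NormedModule) exp); [apply is_derive_exp|].
    apply (is_derive_RInt_var (fun s => fy (Y u s) s)). intros r.
    apply continuous_comp_2.
    - apply (ex_derive_continuous (V := R_NormedModule)). eexists; apply Y_t.
    - apply continuous_id.
    - apply (CK_cont _ 0 fy (flow_fy_smooth 0%nat) _ r I). }
  assert (E0 : flow_u u 0 = 1).
  { unfold flow_u. rewrite RInt_point. apply exp_0. }
  apply (is_derive_of_quadratic _ _ _ (C * exp ((2 * K + 1) * Rabs t))).
  intros h _.
  set (Z := fun s => Y (u + h) s - Y u s - h * flow_u u s).
  set (z := fun s => f (Y (u + h) s) s - f (Y u s) s - h * (fy (Y u s) s * flow_u u s)).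
  assert (Bz : forall s, Rabs s <= Rabs t -> Rabs (z s) <= K * Rabs (Z s) + C * h^2).
  { intros s Hs. unfold z.
    replace (_ - _ - _) with ((f (Y (u + h) s) s - f (Y u s) s - fy (Y u s) s * (Y (u + h) s - Y u s))
       + fy (Y u s) s * Z s) by (unfold Z; ring).
    le_via Rabs_triang. rewrite Rplus_comm. apply Rplus_le_compat.
    - rewrite Rabs_mult. apply Rmult_le_compat_r; [pos|auto].
    - le_via flow_quad. unfold C. rewrite Rmult_assoc.
      apply Rmult_le_compat_l; [lra|].
      le_via flow_gap. replace (u + h - u) with h by ring.
      rewrite Rmult_comm. apply Rmult_le_compat_r; [nra|].
      apply exp_mono. apply Rmult_le_compat_l; lra. }
  (* The squared remainder is differentiable where the modulus may not be. The rate [2 K + 1] comes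
     from [2 |Z| (K |Z| + b) <= (2 K + 1) Z^2 + b^2]. *)
  assert (G : Z t ^ 2 <= (Z 0 ^2 + (C * h^2)^2 / (2 * K + 1)) * exp ((2 * K + 1) * Rabs t)).
  { apply (Gronwall (fun s => Z s ^ 2) (fun s => 2 * Z s * z s) (2 * K + 1) ((C * h^2)^2) (Rabs t)); try lra.
    - apply pow2_ge_0.
    - unfold Z, z.
      der.
    - intros s Hs. specialize (Bz s Hs). rewrite !Rabs_mult, (Rabs_pos_eq 2) by lra.
      rewrite <- (pow2_abs (Z s)). pose proof (Rabs_pos (Z s)).
      set (b := C * h^2) in *. pose proof (Rle_0_sqr (Rabs (Z s) - b)). unfold Rsqr in *. nra. }
  replace (Z 0) with 0 in G by (unfold Z; rewrite !Y_0, E0; ring).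
  fold (Z t).
  assert (P : 0 <= C * exp ((2 * K + 1) * Rabs t) * h ^ 2) by pos.
  rewrite <- (Rabs_pos_eq _ P). apply Rsqr_le_abs_0. unfold Rsqr.
  assert (e1 : 1 <= exp ((2 * K + 1) * Rabs t)).
  { pose proof (exp_ineq1_le ((2 * K + 1) * Rabs t)). pose proof (Rabs_pos t). nra. }
  set (e := exp ((2 * K + 1) * Rabs t)) in *.
  assert (Z t ^ 2 <= (C * h^2)^2 * e).
  { eapply Rle_trans; [exact G|]. apply Rmult_le_compat_r; [lra|].
    replace (0^2 + (C * h^2)^2 / (2 * K + 1)) with ((C * h^2)^2 * / (2 * K + 1)) by lra.
    rewrite <- (Rmult_1_r ((C * h^2)^2)) at 2. apply Rmult_le_compat_l; pos.
    rewrite <- Rinv_1. apply Rinv_le_contravar; lra. }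
  nra.
Qed.

Lemma flow_smooth : forall k, CK (fun _ => True) k Y.
Proof.
  induction k as [|k IH]; (split; [intros; apply flow_cont2|]); [exact I|].
  exists flow_u, (fun u t => f (Y u t) t). split; [|split].
  - split; [apply flow_du|auto].
  - apply CK_exp.
    apply CK_swap.
    apply (CK_RInt _ k opn_True (fun s u => fy (Y u s) s)).
    apply CK_swap.
    apply (CK_comp2 _ _ k opn_True opn_True fy); auto; [apply flow_fy_smooth|apply CK_snd].
  - apply (CK_comp2 _ _ k opn_True opn_True f); auto; apply CK_snd.
Qed.

(** Gronwall for the squared distance to [y0]. It pins the ends [0] and [PI] of the parameter
    interval under the tangential reparametrization. *)
Lemma flow_fixed y0 : (forall t, f y0 t = 0) -> forall t, Y y0 t = y0.
Proof.
  intros H t.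
  pose proof (Gronwall (fun t => (Y y0 t - y0)^2)
    (fun t => 2 * (Y y0 t - y0) * (f (Y y0 t) t - 0)) (2 * K) 0 (Rabs t)) as G.
  cbv beta in G. rewrite Y_0 in G.
  assert (G' : (Y y0 t - y0)^2 <= ((y0 - y0)^2 + 0 / (2 * K)) * exp (2 * K * Rabs t)).
  { apply G; try lra.
    - der.
    - intros s _. rewrite <- (H s) at 1. rewrite !Rabs_mult, (Rabs_pos_eq 2) by lra.
      pose proof (flow_lip y0 (Y y0 s) s). rewrite <- (pow2_abs (Y y0 s - y0)).
      pose proof (Rabs_pos (Y y0 s - y0)). nra. }
  pose proof (pow2_ge_0 (Y y0 t - y0)).
  assert (Y y0 t - y0 = 0); [|lra]. apply Rsqr_0_uniq. unfold Rsqr. lra.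
Qed.

End Flow.

(** * Absolutely convergent trigonometric series *)

(** The enumeration 0, -1, 1, -2, 2, ... of the integers, with inverse [nz]. It reduces sums over
    the integers to absolutely convergent ordinary series. *)
Definition zn (n : nat) : Z :=
  if Z.even (Z.of_nat n) then (Z.of_nat n / 2)%Z else (- ((Z.of_nat n + 1) / 2))%Z.
Definition nz (z : Z) : nat := if (0 <=? z)%Z then Z.to_nat (2 * z) else Z.to_nat (- 2 * z - 1).

Lemma zn_nz z : zn (nz z) = z.
Proof.
  unfold zn, nz. destruct (Z.leb_spec 0 z); rewrite Z2Nat.id by lia.
  - assert (E : Z.even (2 * z) = true) by (rewrite Z.even_mul; reflexivity).
    rewrite E, Z.mul_comm. apply Z.div_mul. lia.
  - replace (- 2 * z - 1)%Z with (1 + 2 * (- z - 1))%Z by ring.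
    rewrite Z.even_add_mul_2. simpl Z.even.
    replace (1 + 2 * (- z - 1) + 1)%Z with ((- z) * 2)%Z by ring. rewrite Z.div_mul; lia.
Qed.

Lemma nz_zn n : nz (zn n) = n.
Proof.
  unfold zn, nz.
  destruct (Z.even (Z.of_nat n)) eqn:E.
  - apply Z.even_spec in E. destruct E as [m E]. rewrite E, Z.mul_comm, Z.div_mul by lia.
    destruct (Z.leb_spec 0 m); lia.
  - assert (O : Z.odd (Z.of_nat n) = true) by (rewrite <- Z.negb_even, E; reflexivity).
    apply Z.odd_spec in O. destruct O as [m O]. rewrite O.
    replace (2 * m + 1 + 1)%Z with ((m + 1) * 2)%Z by ring. rewrite Z.div_mul by lia.
    destruct (Z.leb_spec 0 (- (m + 1))); lia.
Qed.

Definition summ (f : Z -> R) : Prop := ex_series (fun n => Rabs (f (zn n))).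
Definition sumZ (f : Z -> R) : R := Series (fun n => f (zn n)).

Lemma summ_ex f : summ f -> ex_series (fun n => f (zn n)).
Proof. apply ex_series_Rabs. Qed.

Lemma summ_dom f M : summ M -> (forall n, Rabs (f n) <= M n) -> summ f.
Proof. intros H D. apply (ex_series_dom _ (fun n => M (zn n))); [now apply summ_ex|auto]. Qed.

Lemma sumZ_dom f M : summ M -> (forall n, Rabs (f n) <= M n) -> Rabs (sumZ f) <= sumZ M.
Proof. intros H D. apply Series_dom; [now apply summ_ex|auto]. Qed.

Lemma sumZ_ext f g : (forall n, f n = g n) -> sumZ f = sumZ g.
Proof. intros H. apply Series_ext. auto. Qed.

Lemma summ_scal c f : summ f -> summ (fun n => c * f n).
Proof.
  intros H. eapply ex_series_ext; [|apply (ex_series_scal_l (Rabs c)), H].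
  symmetry. apply Rabs_mult.
Qed.

Lemma summ_plus f g : summ f -> summ g -> summ (fun n => f n + g n).
Proof.
  intros Hf Hg. apply (ex_series_dom _ (fun n => Rabs (f (zn n)) + Rabs (g (zn n)))).
  - apply (ex_series_plus (V := R_NormedModule)); assumption.
  - intros n. apply Rabs_triang.
Qed.

Lemma sumZ_scal c f : sumZ (fun n => c * f n) = c * sumZ f.
Proof. apply Series_scal_l. Qed.

Lemma sumZ_plus f g : summ f -> summ g -> sumZ (fun n => f n + g n) = sumZ f + sumZ g.
Proof. intros. apply Series_plus; now apply summ_ex. Qed.

Lemma sumZ_minus f g : summ f -> summ g -> sumZ (fun n => f n - g n) = sumZ f - sumZ g.
Proof. intros. apply Series_minus; now apply summ_ex. Qed.

Lemma sumZ_refl f m : summ f -> summ (fun k => f (m - k)%Z) /\ sumZ (fun k => f (m - k)%Z) = sumZ f.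
Proof.
  intros H.
  destruct (Series_rearrange (fun n => f (zn n)) (fun n => nz (m - zn n)) (fun n => nz (m - zn n))) as [A B].
  - intros n. rewrite zn_nz. replace (m - (m - zn n))%Z with (zn n) by ring. apply nz_zn.
  - intros n. rewrite zn_nz. replace (m - (m - zn n))%Z with (zn n) by ring. apply nz_zn.
  - exact H.
  - split.
    + eapply ex_series_ext; [|exact A]. intros n. simpl. now rewrite zn_nz.
    + unfold sumZ. rewrite <- B. apply Series_ext. intros n. now rewrite zn_nz.
Qed.

Lemma sumZ_opp f : summ f -> summ (fun k => f (- k)%Z) /\ sumZ (fun k => f (- k)%Z) = sumZ f.
Proof. exact (sumZ_refl f 0). Qed.

Lemma sumZ_shift f m : summ f -> summ (fun k => f (k - m)%Z) /\ sumZ (fun k => f (k - m)%Z) = sumZ f.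
Proof.
  intros H. destruct (sumZ_opp f H) as [A B].
  destruct (sumZ_refl _ m A) as [C D]. rewrite B in D.
  assert (E : (fun k => f (k - m)%Z) = (fun k => f (- (m - k))%Z)).
  { apply functional_extensionality. intros k. f_equal. ring. }
  rewrite E. auto.
Qed.

Lemma sumZ_Fubini (F : Z -> Z -> R) :
  (forall n, summ (F n)) -> summ (fun n => sumZ (fun k => Rabs (F n k))) ->
  sumZ (fun n => sumZ (F n)) = sumZ (fun k => sumZ (fun n => F n k)).
Proof.
  intros H1 H2.
  apply Series_Fubini.
  - intros n. apply H1.
  - apply summ_ex in H2. exact H2.
Qed.

Lemma sumZ_lim {T : Type} (F : (T -> Prop) -> Prop) {FF : ProperFilter F}
  (f : Z -> T -> R) (l M : Z -> R) :
  summ M -> F (fun x => forall n, Rabs (f n x) <= M n) ->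
  (forall n, filterlim (f n) F (locally (l n))) ->
  filterlim (fun x => sumZ (fun n => f n x)) F (locally (sumZ l)).
Proof.
  intros HM HD HL.
  apply (filterlim_Series F (fun n => f (zn n)) (fun n => l (zn n)) (fun n => M (zn n))).
  - now apply summ_ex. - eapply filter_imp; [|exact HD]. auto. - auto.
Qed.

Lemma sumZ_derive (f f' : Z -> R -> R) (M : Z -> R) (t : R) (d : posreal) :
  summ M -> (forall s, Rabs (s - t) < d -> summ (fun n => f n s)) ->
  (forall n s, Rabs (s - t) < d -> is_derive (f n) s (f' n s) /\ Rabs (f' n s) <= M n) ->
  is_derive (fun s => sumZ (fun n => f n s)) t (sumZ (fun n => f' n t)).
Proof.
  intros HM HS HD.
  set (sl := fun n h => if Req_EM_T h 0 then f' n t else (f n (t + h) - f n t) / h).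
  assert (D0 : Rabs (t - t) < d) by (rewrite Rminus_diag, Rabs_R0; apply cond_pos).
  assert (B : forall h, Rabs h < d -> forall n, Rabs (sl n h) <= M n).
  { intros h Hh n. unfold sl. destruct (Req_EM_T h 0); [now apply HD|].
    destruct (MVT_cor4 (f n) (f' n) t (Rabs h)) with (b := t + h) as [c [E Hc]].
    - intros c Hc. apply HD. lra.
    - replace (t + h - t) with h by ring. lra.
    - rewrite E. replace (f' n c * (t + h - t) / h) with (f' n c) by (field; auto).
      apply HD. replace (t + h - t) with h in Hc by ring. lra. }
  assert (L : filterlim (fun h => sumZ (fun n => sl n h)) (locally 0) (locally (sumZ (fun n => f' n t)))).
  { apply (sumZ_lim (locally 0) sl _ M HM).
    - exists d. intros h Hh. apply B.
      ballR Hh.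
      rewrite Ropp_0, Rplus_0_r in Hh. exact Hh.
    - intros n. destruct (HD n t D0) as [Hd _]. apply is_derive_Reals in Hd.
      apply filterlim_locally. intros [e He]. destruct (Hd e He) as [d' Hd'].
      exists d'. intros h Hh.
      unfold ball in *; simpl in *; unfold AbsRing_ball, abs, minus, plus, opp in *; simpl in *.
      rewrite Ropp_0, Rplus_0_r in Hh. unfold sl.
      destruct (Req_EM_T h 0); [rewrite Rplus_opp_r, Rabs_R0; exact He|].
      now apply Hd'. }
  apply is_derive_Reals. intros e He.
  pose proof (proj1 (filterlim_locally _ _) L (mkposreal e He)) as [d' Hd'].
  assert (Hm : 0 < Rmin d d') by (apply Rmin_pos; apply cond_pos).
  exists (mkposreal _ Hm). intros h Hh Hlt.
  assert (L1 : Rabs h < d) by (eapply Rlt_le_trans; [exact Hlt|apply Rmin_l]).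
  assert (L2 : Rabs h < d') by (eapply Rlt_le_trans; [exact Hlt|apply Rmin_r]).
  specialize (Hd' h).
  unfold ball in *; simpl in *; unfold AbsRing_ball, abs, minus, plus, opp in *; simpl in *.
  rewrite Ropp_0, Rplus_0_r in Hd'.
  replace ((sumZ (fun n => f n (t + h)) - sumZ (fun n => f n t)) / h) with (sumZ (fun n => sl n h)); [auto|].
  unfold Rdiv. rewrite Rmult_comm, <- sumZ_minus.
  - rewrite <- sumZ_scal. apply sumZ_ext. intros n. unfold sl. destruct (Req_EM_T h 0); [lra|].
    lra.
  - apply HS. replace (t + h - t) with h by ring. exact L1.
  - auto.
Qed.

(** A summable weight for which sequences of size [O(w)] form a convolution algebra; two derivatives
    turn [w^2] into [w]. *)
Definition w (n : Z) : R := / (1 + IZR n ^ 2).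

Lemma w_den n : 1 <= 1 + IZR n ^ 2.
Proof. pose proof (pow2_ge_0 (IZR n)). lra. Qed.

Lemma w_pos n : 0 < w n.
Proof. apply Rinv_0_lt_compat. pos. Qed.

Lemma w_le_1 n : w n <= 1.
Proof.
  pose proof (Rinv_le_contravar 1 (1 + IZR n ^ 2) Rlt_0_1 (w_den n)) as H. now rewrite Rinv_1 in H.
Qed.

Lemma zn_lower n : INR n <= 2 * Rabs (IZR (zn n)).
Proof.
  rewrite <- abs_IZR, INR_IZR_INZ, <- mult_IZR. apply IZR_le.
  pose proof (nz_zn n) as E. unfold nz in E. destruct (Z.leb_spec 0 (zn n)); lia.
Qed.

Lemma summ_w : summ w.
Proof.
  apply (ex_series_nonneg_bounded _ 8).
  - intros; apply Rabs_pos.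
  - intros N. apply Rle_trans with (8 - 8 / (INR N + 2)).
    + assert (T : forall n, Rabs (w (zn n)) <= 8 / (INR n + 1) - 8 / (INR n + 2)).
      { intros n. pose proof (pos_INR n). rewrite Rabs_pos_eq by (left; apply w_pos).
        replace (8 / (INR n + 1) - 8 / (INR n + 2)) with (/ ((INR n + 1) * (INR n + 2) / 8)) by (field; lra).
        apply Rinv_le_contravar; [nra|].
        pose proof (zn_lower n). rewrite <- (pow2_abs (IZR (zn n))).
        pose proof (pow2_ge_0 (INR n - 2)). nra. }
      induction N as [|N IH].
      * rewrite sum_O. specialize (T 0%nat). simpl INR in *. lra.
      * rewrite sum_Sn. specialize (T (S N)). rewrite S_INR in *.
        change (sum_n (fun n => Rabs (w (zn n))) N + Rabs (w (zn (S N))) <= 8 - 8 / (INR N + 1 + 2)).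
        replace (INR N + 1 + 1) with (INR N + 2) in T by ring.
        lra.
    + pose proof (pos_INR N). assert (0 < 8 / (INR N + 2)) by pos. lra.
Qed.

Definition Sw : R := sumZ w.
Lemma Sw_ge_1 : 1 <= Sw.
Proof.
  pose proof (sum_n_le_Series (fun n => w (zn n)) 0 (fun n => Rlt_le _ _ (w_pos (zn n))) (summ_ex _ summ_w)) as H.
  rewrite sum_O in H. assert (E : w (zn 0) = 1); [|now rewrite <- E at 1].
  change (zn 0) with 0%Z. unfold w. lra.
Qed.

(** The exponential factor encodes analyticity in a strip of width [r]. Since
    [|n| <= |k| + |n - k|], it is compatible with convolution; [r = 0] gives the plain algebra. *)
Definition Wb (A r : R) (f : Z -> R) : Prop :=
  forall n, Rabs (f n) <= A * w n * exp (- (r * Rabs (IZR n))).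

Lemma exp_decay_le_1 r n : 0 <= r -> exp (- (r * Rabs (IZR n))) <= 1.
Proof.
  intros H. rewrite <- exp_0. apply exp_mono.
  assert (0 <= r * Rabs (IZR n)) by pos. lra.
Qed.

Lemma Wb_A_pos A r f : Wb A r f -> 0 <= A.
Proof.
  intros H. specialize (H 0%Z). pose proof (Rabs_pos (f 0%Z)).
  pose proof (w_pos 0). pose proof (exp_pos (- (r * Rabs 0))).
  assert (0 < w 0 * exp (- (r * Rabs 0))) by nra. nra.
Qed.

Lemma Wb_w A r f : 0 <= r -> Wb A r f -> forall n, Rabs (f n) <= A * w n.
Proof.
  intros Hr H n. le_via H. rewrite <- (Rmult_1_r (A * w n)) at 2.
  apply Rmult_le_compat_l; [|now apply exp_decay_le_1].
  apply Rmult_le_pos; [now apply (Wb_A_pos A r f)|left; apply w_pos].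
Qed.

Lemma Wb_summ A r f : 0 <= r -> Wb A r f -> summ f.
Proof. intros Hr H. apply (summ_dom f (fun n => A * w n)); [apply summ_scal, summ_w|now apply Wb_w with r]. Qed.

Lemma Wb_mono A A' r f : A <= A' -> Wb A r f -> Wb A' r f.
Proof.
  intros HA H n. le_via H.
  apply Rmult_le_compat_r; pos. apply Rmult_le_compat_r; [left; apply w_pos|exact HA].
Qed.

Definition conv (f g : Z -> R) (n : Z) : R := sumZ (fun k => f k * g (n - k)%Z).

(** Equivalent, after clearing denominators, to [1 + n^2 <= 2 (1 + k^2) + 2 (1 + (n - k)^2)]. *)
Lemma w_conv n k : w k * w (n - k) <= w n * (2 * w k + 2 * w (n - k)%Z).
Proof.
  unfold w. rewrite minus_IZR. pose proof (w_den n). pose proof (w_den k). pose proof (w_den (n - k)).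
  rewrite minus_IZR in H1. set (a := IZR n) in *. set (b := IZR k) in *.
  replace (/ (1 + a ^ 2) * (2 * / (1 + b ^ 2) + 2 * / (1 + (a - b) ^ 2)))
    with (/ (1 + b ^ 2) * / (1 + (a - b) ^ 2) * ((2 * (1 + (a - b) ^ 2) + 2 * (1 + b ^ 2)) / (1 + a ^ 2)))
    by (field; lra).
  rewrite <- (Rmult_1_r (/ (1 + b ^ 2) * / (1 + (a - b) ^ 2))) at 1.
  apply Rmult_le_compat_l.
  - apply Rmult_le_pos; pos.
  - apply Rmult_le_reg_r with (1 + a ^ 2); [lra|].
    replace ((2 * (1 + (a - b) ^ 2) + 2 * (1 + b ^ 2)) / (1 + a ^ 2) * (1 + a ^ 2))
      with (2 * (1 + (a - b) ^ 2) + 2 * (1 + b ^ 2)) by (field; lra).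
    pose proof (pow2_ge_0 (a - 2 * b)). nra.
Qed.

Lemma conv_term A B r f g n k : 0 <= r -> Wb A r f -> Wb B r g ->
  Rabs (f k * g (n - k)%Z) <= A * B * w n * exp (- (r * Rabs (IZR n))) * (2 * w k + 2 * w (n - k)%Z).
Proof.
  intros Hr Hf Hg. rewrite Rabs_mult.
  pose proof (Wb_A_pos _ _ _ Hf). pose proof (Wb_A_pos _ _ _ Hg).
  eapply Rle_trans; [apply Rmult_le_compat; [apply Rabs_pos|apply Rabs_pos|apply Hf|apply Hg]|].
  replace (A * w k * exp (- (r * Rabs (IZR k))) * (B * w (n - k) * exp (- (r * Rabs (IZR (n - k))))))
    with (A * B * ((w k * w (n - k)%Z) * (exp (- (r * Rabs (IZR k))) * exp (- (r * Rabs (IZR (n - k)))))))  by ring.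
  replace (A * B * w n * exp (- (r * Rabs (IZR n))) * (2 * w k + 2 * w (n - k)%Z))
    with (A * B * ((w n * (2 * w k + 2 * w (n - k)%Z)) * exp (- (r * Rabs (IZR n))))) by ring.
  apply Rmult_le_compat_l; [nra|].
  pose proof (w_pos k). pose proof (w_pos (n - k)).
  apply Rmult_le_compat; [nra|pos|apply w_conv|].
  rewrite <- exp_plus. apply exp_mono. rewrite minus_IZR.
  pose proof (Rabs_triang (IZR k) (IZR n - IZR k)). replace (IZR k + (IZR n - IZR k)) with (IZR n) in H3 by ring. nra.
Qed.

Lemma summ_ww n : summ (fun k => 2 * w k + 2 * w (n - k)%Z).
Proof. apply summ_plus; apply summ_scal; [exact summ_w|exact (proj1 (sumZ_refl w n summ_w))]. Qed.

Lemma sumZ_ww n : sumZ (fun k => 2 * w k + 2 * w (n - k)%Z) = 4 * Sw.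
Proof.
  rewrite (sumZ_plus (fun k => 2 * w k) (fun k => 2 * w (n - k)%Z)).
  - rewrite !sumZ_scal, (proj2 (sumZ_refl w n summ_w)). unfold Sw. ring.
  - apply summ_scal, summ_w.
  - apply summ_scal, (proj1 (sumZ_refl w n summ_w)).
Qed.

Lemma conv_summ A B r f g n : 0 <= r -> Wb A r f -> Wb B r g -> summ (fun k => f k * g (n - k)%Z).
Proof.
  intros Hr Hf Hg. eapply summ_dom; [|intros k; apply (conv_term A B r f g n k Hr Hf Hg)].
  apply summ_scal, summ_ww.
Qed.

Lemma conv_abs_bound A B r f g n : 0 <= r -> Wb A r f -> Wb B r g ->
  sumZ (fun k => Rabs (f k * g (n - k)%Z)) <= 4 * Sw * A * B * w n * exp (- (r * Rabs (IZR n))).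
Proof.
  intros Hr Hf Hg. le_via Rle_abs.
  le_via ((sumZ_dom _ (fun k => A * B * w n * exp (- (r * Rabs (IZR n))) * (2 * w k + 2 * w (n - k)%Z)))).
  - apply summ_scal, summ_ww.
  - intros k. rewrite Rabs_Rabsolu. now apply conv_term.
  - rewrite sumZ_scal, sumZ_ww. lra.
Qed.

Lemma conv_Wb A B r f g : 0 <= r -> Wb A r f -> Wb B r g -> Wb (4 * Sw * A * B) r (conv f g).
Proof.
  intros Hr Hf Hg n. eapply Rle_trans; [|apply (conv_abs_bound A B r f g n Hr Hf Hg)].
  apply Series_Rabs. exact (conv_summ A B r f g n Hr Hf Hg).
Qed.

Lemma conv_lip A B d e f g f' g' : Wb A 0 f' -> Wb B 0 g ->
  Wb d 0 (fun n => f n - f' n) -> Wb e 0 (fun n => g n - g' n) ->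
  Wb (4 * Sw * (d * B + A * e)) 0 (fun n => conv f g n - conv f' g' n).
Proof.
  intros Hf' Hg Hd He.
  assert (E : forall n, conv f g n - conv f' g' n = conv (fun n => f n - f' n) g n + conv f' (fun n => g n - g' n) n).
  { intros n.
    pose proof (conv_summ d B 0 _ _ n (Rle_refl 0) Hd Hg) as S1.
    pose proof (conv_summ A e 0 _ _ n (Rle_refl 0) Hf' He) as S2.
    pose proof (conv_summ A B 0 _ _ n (Rle_refl 0) Hf' Hg) as S3.
    assert (E1 : conv f g n = conv (fun n => f n - f' n) g n + conv f' g n).
    { unfold conv. rewrite <- (sumZ_plus _ _ S1 S3). apply sumZ_ext. intros k. ring. }
    assert (E2 : conv f' g' n = conv f' g n - conv f' (fun n => g n - g' n) n).
    { unfold conv. rewrite <- (sumZ_minus _ _ S3 S2). apply sumZ_ext. intros k. ring. }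
    lra. }
  intros n. rewrite E.
  pose proof (conv_Wb d B 0 _ _ (Rle_refl 0) Hd Hg n) as B1.
  pose proof (conv_Wb A e 0 _ _ (Rle_refl 0) Hf' He n) as B2.
  le_via Rabs_triang. lra.
Qed.

Lemma conv_parity f g s t : (forall n, f (- n)%Z = s * f n) -> (forall n, g (- n)%Z = t * g n) ->
  (forall n, summ (fun k => f k * g (n - k)%Z)) ->
  forall n, conv f g (- n)%Z = s * t * conv f g n.
Proof.
  intros Hf Hg Hs n. unfold conv. rewrite <- (proj2 (sumZ_opp _ (Hs (- n)%Z))).
  rewrite <- sumZ_scal. apply sumZ_ext. intros k.
  replace (- n - - k)%Z with (- (n - k))%Z by ring. rewrite Hf, Hg. ring.
Qed.

(* Trigonometric series with a phase: [ev 0] is the cosine series and [ev (- (PI / 2))] the sine series. *)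
Definition ev (p : R) (f : Z -> R) (x : R) : R := sumZ (fun n => f n * cos (IZR n * x + p)).

Lemma Rabs_cos_le_1 y : Rabs (cos y) <= 1.
Proof. apply Rabs_le_between. apply COS_bound. Qed.

Lemma Rabs_mult_cos a y : Rabs (a * cos y) <= Rabs a.
Proof.
  rewrite Rabs_mult. rewrite <- (Rmult_1_r (Rabs a)) at 2.
  apply Rmult_le_compat_l; [pos|apply Rabs_cos_le_1].
Qed.

Lemma ev_summ p f x : summ f -> summ (fun n => f n * cos (IZR n * x + p)).
Proof.
  intros H. apply (summ_dom _ (fun n => Rabs (f n))).
  - eapply ex_series_ext; [|exact H]. intros. now rewrite Rabs_Rabsolu.
  - intros n. apply Rabs_mult_cos.
Qed.

Lemma summ_abs f : summ f -> summ (fun n => Rabs (f n)).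
Proof. intros H. eapply ex_series_ext; [|exact H]. intros. now rewrite Rabs_Rabsolu. Qed.

Lemma ev_ext p f g x : (forall n, f n = g n) -> ev p f x = ev p g x.
Proof. intros H. apply sumZ_ext. intros n. now rewrite H. Qed.

Lemma ev_plus p f g x : summ f -> summ g -> ev p (fun n => f n + g n) x = ev p f x + ev p g x.
Proof.
  intros Hf Hg. unfold ev. rewrite <- sumZ_plus by now apply ev_summ.
  apply sumZ_ext. intros n. ring.
Qed.

Lemma ev_scal p c f x : ev p (fun n => c * f n) x = c * ev p f x.
Proof. unfold ev. rewrite <- sumZ_scal. apply sumZ_ext. intros n. ring. Qed.

Lemma ev_phase_PI p f x : ev (p + PI) f x = - ev p f x.
Proof.
  replace (- ev p f x) with ((-1) * ev p f x) by ring. unfold ev. rewrite <- sumZ_scal.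
  apply sumZ_ext. intros n. rewrite <- Rplus_assoc, neg_cos. ring.
Qed.

Lemma ev_dx p f x : summ f -> summ (fun n => IZR n * f n) ->
  is_derive (ev p f) x (ev (p + PI / 2) (fun n => IZR n * f n) x).
Proof.
  intros Hf Hn.
  apply (sumZ_derive (fun n x => f n * cos (IZR n * x + p))
     (fun n x => IZR n * f n * cos (IZR n * x + (p + PI / 2))) (fun n => Rabs (IZR n * f n)) x (mkposreal 1 Rlt_0_1)).
  - now apply summ_abs.
  - intros s _. now apply ev_summ.
  - split; [|apply Rabs_mult_cos].
    rewrite <- Rplus_assoc, (cos_plus _ (PI / 2)), cos_PI2, sin_PI2. der.
Qed.

Lemma ev_odd_cos f x : summ f -> (forall n, f (- n)%Z = - f n) -> ev 0 f x = 0.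
Proof.
  intros Hs H. assert (E : ev 0 f x = - ev 0 f x); [|lra].
  unfold ev at 1. rewrite <- (proj2 (sumZ_opp _ (ev_summ 0 f x Hs))).
  replace (- ev 0 f x) with ((-1) * ev 0 f x) by ring. unfold ev. rewrite <- sumZ_scal. apply sumZ_ext.
  intros n. rewrite H, opp_IZR. replace (- IZR n * x + 0) with (- (IZR n * x + 0)) by ring.
  rewrite cos_neg. ring.
Qed.

Lemma ev_even_sin f x : summ f -> (forall n, f (- n)%Z = f n) -> ev (PI / 2) f x = 0.
Proof.
  intros Hs H. assert (E : ev (PI / 2) f x = - ev (PI / 2) f x); [|lra].
  unfold ev at 1. rewrite <- (proj2 (sumZ_opp _ (ev_summ (PI / 2) f x Hs))).
  replace (- ev (PI / 2) f x) with ((-1) * ev (PI / 2) f x) by ring. unfold ev.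
  rewrite <- sumZ_scal. apply sumZ_ext.
  intros n. rewrite H, opp_IZR, !cos_plus, cos_PI2.
  replace (- IZR n * x) with (- (IZR n * x)) by ring. rewrite sin_neg. ring.
Qed.

(** After exchanging sums and shifting [n = m + k], the addition formula splits the cosine. The
    terms with quarter-turned phases are the products of sines, hence the minus sign carried by
    every product of two sine series below. *)
Lemma ev_conv A B r f g p q x : 0 <= r -> Wb A r f -> Wb B r g ->
  ev (p + q) (conv f g) x = ev p f x * ev q g x - ev (p + PI / 2) f x * ev (q + PI / 2) g x.
Proof.
  intros Hr Hf Hg.
  pose proof (Wb_summ _ _ _ Hr Hf) as Sf. pose proof (Wb_summ _ _ _ Hr Hg) as Sg.
  transitivity (sumZ (fun k => sumZ (fun n => f k * g (n - k)%Z * cos (IZR n * x + (p + q))))).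
  - rewrite <- (sumZ_Fubini (fun n k => f k * g (n - k)%Z * cos (IZR n * x + (p + q)))).
    + unfold conv. apply sumZ_ext. intros n. rewrite Rmult_comm, <- sumZ_scal. apply sumZ_ext. intros k. ring.
    + intros n. apply (summ_dom _ (fun k => Rabs (f k * g (n - k)%Z))).
      * apply summ_abs, (conv_summ A B r); assumption.
      * intros k. apply Rabs_mult_cos.
    + apply (summ_dom _ (fun n => 4 * Sw * A * B * w n)); [apply summ_scal, summ_w|].
      intros n.
      assert (S1 : summ (fun k => Rabs (f k * g (n - k)%Z))) by (apply summ_abs, (conv_summ A B r); assumption).
      le_via ((sumZ_dom _ (fun k => Rabs (f k * g (n - k)%Z)) S1)).
      * intros k. rewrite Rabs_Rabsolu. apply Rabs_mult_cos.
      * le_via (conv_abs_bound A B r f g n Hr Hf Hg).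
        rewrite <- (Rmult_1_r (4 * Sw * A * B * w n)) at 2.
        apply Rmult_le_compat_l; [|now apply exp_decay_le_1].
        pose proof Sw_ge_1. pose proof (w_pos n). pose proof (Wb_A_pos _ _ _ Hf). pose proof (Wb_A_pos _ _ _ Hg).
        pos.
  - transitivity (sumZ (fun k => ev q g x * (f k * cos (IZR k * x + p)) - ev (q + PI / 2) g x * (f k * cos (IZR k * x + (p + PI / 2))))).
    + apply sumZ_ext. intros k.
      set (h := fun m => f k * g m * cos (IZR (m + k) * x + (p + q))).
      transitivity (sumZ (fun n => h (n - k)%Z)).
      { apply sumZ_ext. intros n. unfold h. now replace (n - k + k)%Z with n by ring. }
      assert (Eh : forall m, h m = f k * cos (IZR k * x + p) * (g m * cos (IZR m * x + q))
          - f k * cos (IZR k * x + (p + PI / 2)) * (g m * cos (IZR m * x + (q + PI / 2)))).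
      { intros m. unfold h. rewrite plus_IZR.
        replace ((IZR m + IZR k) * x + (p + q)) with ((IZR k * x + p) + (IZR m * x + q)) by ring.
        rewrite <- !Rplus_assoc, !(cos_plus _ (PI / 2)), cos_PI2, sin_PI2.
        replace (IZR k * x + p + IZR m * x + q) with ((IZR k * x + p) + (IZR m * x + q)) by ring.
        rewrite (cos_plus (IZR k * x + p)). ring. }
      assert (Sh : summ h).
      { apply (summ_dom _ (fun m => Rabs (f k) * Rabs (g m))); [now apply summ_scal, summ_abs|].
        intros m. rewrite <- Rabs_mult. apply Rabs_mult_cos. }
      rewrite (proj2 (sumZ_shift h k Sh)).
      rewrite (sumZ_ext _ _ Eh), (sumZ_minus (fun m => f k * cos (IZR k * x + p) * (g m * cos (IZR m * x + q)))).
      * rewrite !sumZ_scal. unfold ev. ring.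
      * now apply summ_scal, ev_summ.
      * now apply summ_scal, ev_summ.
    + rewrite (sumZ_minus (fun k => ev q g x * (f k * cos (IZR k * x + p)))).
      * rewrite !sumZ_scal. unfold ev. ring.
      * now apply summ_scal, ev_summ.
      * now apply summ_scal, ev_summ.
Qed.

Lemma ev_cont2 p (f : Z -> R -> R) (M : Z -> R) (x t : R) : summ M ->
  locally t (fun s => forall n, Rabs (f n s) <= M n) ->
  (forall n, continuous (f n) t) -> cont2 (fun x t => ev p (fun n => f n t) x) x t.
Proof.
  intros HM HL Hc.
  apply (sumZ_lim (locally (x, t)) (fun n (y : R * R) => f n (snd y) * cos (IZR n * fst y + p)) _ M HM).
  - destruct HL as [d Hd]. exists d. intros [y s] [_ B] n.
    le_via Rabs_mult_cos. auto.
  - intros n.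
    apply (cont2_mult (fun _ s => f n s) (fun y _ => cos (IZR n * y + p)) x t).
    + apply cont2_comp1; [apply cont2_snd|apply Hc].
    + apply (cont2_comp1 (fun y => cos (IZR n * y + p)) (fun y _ => y)); [apply cont2_fst|].
      cnt.
Qed.

(** By the product formula, [ev 0 f] times [cos (m x)] is again a cosine series [h], with
    [h 0 = f m]. Its primitive is [h 0 * x] plus a sine series, which vanishes at both ends. *)
Lemma ev_coeff f m : summ (fun n => IZR n * f n) -> summ f -> (forall n, f (- n)%Z = f n) ->
  is_RInt (fun x => ev 0 f x * cos (IZR m * x)) 0 PI (PI * f m).
Proof.
  intros Hn Hf He.
  set (h := fun n => / 2 * (f (n - m)%Z + f (n - - m)%Z)).
  assert (Sh : summ h) by (apply summ_scal, summ_plus; apply sumZ_shift; exact Hf).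
  assert (Snh : summ (fun n => IZR n * h n)).
  { destruct (sumZ_shift _ m Hn) as [A1 _]. destruct (sumZ_shift _ (- m) Hn) as [A2 _].
    destruct (sumZ_shift _ m Hf) as [B1 _]. destruct (sumZ_shift _ (- m) Hf) as [B2 _].
    eapply summ_dom.
    - apply (summ_plus _ _ (summ_plus _ _ (summ_abs _ A1) (summ_abs _ A2))
        (summ_scal (Rabs (IZR m)) _ (summ_plus _ _ (summ_abs _ B1) (summ_abs _ B2)))).
    - intros n. unfold h.
      replace (IZR n * (/ 2 * (f (n - m)%Z + f (n - - m)%Z))) with
        (/ 2 * (IZR (n - m) * f (n - m)%Z + IZR (n - - m) * f (n - - m)%Z + IZR m * f (n - m)%Z - IZR m * f (n - - m)%Z))
        by (rewrite !minus_IZR, opp_IZR; ring).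
      rewrite Rabs_mult, (Rabs_pos_eq (/ 2)) by lra.
      set (a := IZR (n - m) * f (n - m)%Z). set (b := IZR (n - - m) * f (n - - m)%Z).
      replace (Rabs (IZR m) * (Rabs (f (n - m)%Z) + Rabs (f (n - - m)%Z)))
        with (Rabs (IZR m * f (n - m)%Z) + Rabs (IZR m * f (n - - m)%Z)) by (rewrite !Rabs_mult; ring).
      set (c := IZR m * f (n - m)%Z). set (e := IZR m * f (n - - m)%Z).
      pose proof (Rabs_triang (a + b + c) (- e)).
      pose proof (Rabs_triang (a + b) c). pose proof (Rabs_triang a b).
      rewrite Rabs_Ropp in H. unfold Rminus.
      pose proof (Rabs_pos (a + b + c + - e)). lra. }
  assert (E : forall x, ev 0 h x = ev 0 f x * cos (IZR m * x)).
  { intros x. unfold h. rewrite ev_scal, ev_plus by (apply sumZ_shift; exact Hf).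
    assert (Sc : forall k, ev 0 (fun n => f (n - k)%Z) x = cos (IZR k * x) * ev 0 f x - sin (IZR k * x) * ev (- (PI / 2)) f x).
    { intros k. unfold ev.
      transitivity (sumZ (fun n => (fun j => f j * cos (IZR (j + k) * x + 0)) (n - k)%Z)).
      { apply sumZ_ext. intros n. now replace (n - k + k)%Z with n by ring. }
      assert (Sj : summ (fun j => f j * cos (IZR (j + k) * x + 0))).
      { apply (summ_dom _ _ (summ_abs _ Hf)). intros j. apply Rabs_mult_cos. }
      rewrite (proj2 (sumZ_shift _ k Sj)).
      - rewrite <- !sumZ_scal, <- sumZ_minus by (apply summ_scal, ev_summ; exact Hf).
        apply sumZ_ext. intros j. rewrite plus_IZR.
        replace ((IZR j + IZR k) * x + 0) with (IZR j * x + IZR k * x) by ring.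
        rewrite Rplus_0_r, !cos_plus, sin_neg, cos_neg, cos_PI2, sin_PI2. ring. }
    rewrite !Sc, opp_IZR. replace (- IZR m * x) with (- (IZR m * x)) by ring. rewrite cos_neg, sin_neg. field. }
  assert (Hm : h 0%Z = f m).
  { unfold h. replace (0 - - m)%Z with m by ring. rewrite He. field. }
  (* Coefficients of the primitive of the series [h] without its constant term. *)
  set (g := fun n => if Z.eq_dec n 0 then 0 else h n / IZR n).
  assert (Bg : forall n, Rabs (g n) <= Rabs (h n)).
  { intros n. unfold g. destruct (Z.eq_dec n 0); [rewrite Rabs_R0; apply Rabs_pos|].
    unfold Rdiv. rewrite Rabs_mult, Rabs_inv. rewrite <- (Rmult_1_r (Rabs (h n))) at 2.
    apply Rmult_le_compat_l; pos. rewrite <- Rinv_1. apply Rinv_le_contravar; [lra|].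
    rewrite <- abs_IZR. apply IZR_le. lia. }
  assert (Sg : summ g) by (apply (summ_dom _ _ (summ_abs _ Sh)), Bg).
  assert (Sng : summ (fun n => IZR n * g n)).
  { apply (summ_dom _ _ (summ_abs _ Sh)). intros n. unfold g.
    destruct (Z.eq_dec n 0); [rewrite Rmult_0_r, Rabs_R0; apply Rabs_pos|].
    right. f_equal. field. now apply not_0_IZR. }
  set (d0 := fun n => if Z.eq_dec n 0 then h 0%Z else 0).
  assert (D : forall x, is_derive (fun x => h 0%Z * x + ev (- (PI / 2)) g x) x (ev 0 f x * cos (IZR m * x))).
  { intros x. rewrite <- E.
    replace (ev 0 h x) with (h 0%Z * 1 + ev (- (PI / 2) + PI / 2) (fun n => IZR n * g n) x).
    - apply is_derive_Rplus; [apply (is_derive_scal (fun x => x)), (is_derive_id (K := R_AbsRing))|].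
      now apply ev_dx.
    - replace (- (PI / 2) + PI / 2) with 0 by ring.
      assert (S0 : summ d0). { apply (summ_dom _ _ (summ_abs _ Sh)). intros n. unfold d0.
        destruct (Z.eq_dec n 0); [subst; lra|rewrite Rabs_R0; apply Rabs_pos]. }
      replace (ev 0 h x) with (ev 0 (fun n => d0 n + IZR n * g n) x).
      + rewrite ev_plus by auto. f_equal.
        symmetry. apply is_series_unique.
        eapply is_series_ext; [|apply (is_series_single (nz 0) (h 0%Z * 1))].
        intros n. simpl. unfold d0. destruct (Nat.eqb_spec n (nz 0)) as [->|N].
        * rewrite Rmult_0_l, Rplus_0_r, cos_0. reflexivity.
        * destruct (Z.eq_dec (zn n) 0) as [Z0|]; [|ring].
          exfalso. apply N. rewrite <- Z0. now rewrite nz_zn.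
      + apply ev_ext. intros n. unfold d0, g. destruct (Z.eq_dec n 0); [subst; ring|].
        field. now apply not_0_IZR. }
  replace (PI * f m) with (minus (h 0%Z * PI + ev (- (PI / 2)) g PI) (h 0%Z * 0 + ev (- (PI / 2)) g 0)).
  - apply (is_RInt_derive (fun x => h 0%Z * x + ev (- (PI / 2)) g x)).
    + auto.
    + intros x _. apply (continuous_ext (ev 0 h)); [exact E|].
      apply (ex_derive_continuous (V := R_NormedModule)). eexists. now apply ev_dx.
  - rewrite Hm. unfold minus, plus, opp; simpl.
    assert (S0 : forall k, ev (- (PI / 2)) g (IZR k * PI) = 0).
    {
      transitivity (sumZ (fun n => 0 * w n)); [|rewrite sumZ_scal; ring].
      apply sumZ_ext. intros n. rewrite cos_plus, cos_neg, cos_PI2.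
      replace (IZR n * (IZR k * PI)) with (IZR (n * k) * PI) by (rewrite mult_IZR; ring).
      rewrite sin_eq_0_1; [ring|]. now exists (n * k)%Z. }
    pose proof (S0 1%Z) as S1. pose proof (S0 0%Z) as S2. rewrite Rmult_1_l in S1. rewrite Rmult_0_l in S2.
    lra.
Qed.

(** * The teardrop elastica *)

(** One lobe of the figure-eight elastica, described by its tangent angle, which solves the pendulum
    equation. [td_first] is conservation of pendulum energy, and [Ls] is the value of [L] for which
    the lobe is stationary under the flow. [td_odd] gives the vertical closing condition, so only
    the horizontal one is listed. Vanishing of [Th1] at the ends is the natural boundary
    condition. *)
Record teardrop (Th Th1 : R -> R) (W2 Ls th0 : R) : Prop := {
  td_W2 : 0 < W2;
  td_Ls : 0 < Ls;
  td_d1 : forall x, is_derive Th x (Th1 x);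
  td_d2 : forall x, is_derive Th1 x (- W2 * sin (Th x));
  td_first : forall x, Th1 x ^ 2 = Ls + 2 * W2 * cos (Th x);
  td_left : Th1 0 = 0;
  td_right : Th1 PI = 0;
  td_odd : forall x, Th (PI - x) = - Th x;
  td_incr : forall x, 0 < x < PI -> 0 < Th1 x;
  td_th0 : Th PI = th0;
  td_th0_range : 0 < th0 < PI;
  td_closed : RInt (fun x => cos (Th x)) 0 PI = 0
}.
Arguments td_W2 {_ _ _ _ _} _.
Arguments td_Ls {_ _ _ _ _} _.
Arguments td_d1 {_ _ _ _ _} _.
Arguments td_d2 {_ _ _ _ _} _.
Arguments td_first {_ _ _ _ _} _.
Arguments td_left {_ _ _ _ _} _.
Arguments td_right {_ _ _ _ _} _.
Arguments td_odd {_ _ _ _ _} _.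
Arguments td_incr {_ _ _ _ _} _.
Arguments td_th0 {_ _ _ _ _} _.
Arguments td_th0_range {_ _ _ _ _} _.
Arguments td_closed {_ _ _ _ _} _.
#[global] Hint Resolve td_d1 td_d2 : deriv.

Section Elliptic.
Variable m : R.
Hypothesis m_pos : 0 < m.
Hypothesis m_lt1 : m < 1.

(** Jacobi's delta with parameter [m]; the solution of [p' = dlt p] starting at [0] is the Jacobi
    amplitude. *)
Definition dlt (y : R) : R := sqrt (1 - m * sin y ^ 2).
Lemma dlt_arg y : 1 - m <= 1 - m * sin y ^ 2 <= 1.
Proof. pose proof (SIN_bound y). assert (0 <= sin y ^ 2 <= 1) by nra. nra. Qed.
Lemma dlt_pos y : 0 < dlt y.
Proof. apply sqrt_lt_R0. pose proof (dlt_arg y). lra. Qed.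
Lemma dlt_le_1 y : dlt y <= 1.
Proof. rewrite <- sqrt_1. apply sqrt_le_1_alt. apply dlt_arg. Qed.
Lemma dlt_ge y : sqrt (1 - m) <= dlt y.
Proof. apply sqrt_le_1_alt. apply dlt_arg. Qed.

Lemma dlt_derive y : is_derive dlt y (- m * sin y * cos y / dlt y).
Proof.
  pose proof (dlt_arg y). pose proof (dlt_pos y). unfold dlt in *.
  replace (- m * sin y * cos y / sqrt (1 - m * sin y ^ 2)) with ((- m * (2 * sin y * cos y)) * / (2 * sqrt (1 - m * sin y ^ 2))) by (field; lra).
  apply (is_derive_sqrt (fun y => 1 - m * sin y ^ 2)); [|lra].
  der.
Qed.

Lemma dlt_smooth k : CK (fun _ => True) k (fun y _ => dlt y).
Proof.
  apply CK_sqrt; [intros y _ _; pose proof (dlt_arg y); lra|].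
  apply CK_minus; [apply CK_const|]. apply CK_mult; [apply CK_const|].
  assert (S : CK (fun _ => True) k (fun y _ => sin y)) by (apply (CK_sincos _ k (fun y _ => y)), CK_fst).
  apply (CK_ext _ k opn_True (fun y t => sin y * sin y)); pos. now apply CK_mult.
Qed.

Definition dK : R := 1 + / sqrt (1 - m).
Lemma dlt_d_bd y : Rabs (- m * sin y * cos y / dlt y) <= dK.
Proof.
  assert (s0 : 0 < sqrt (1 - m)) by pos.
  unfold Rdiv. rewrite Rabs_mult, Rabs_inv, (Rabs_pos_eq (dlt y)) by (left; apply dlt_pos).
  assert (B : Rabs (- m * sin y * cos y) <= 1).
  { rewrite !Rabs_mult, Rabs_Ropp, (Rabs_pos_eq m) by lra.
    assert (Rabs (sin y) <= 1) by (apply Rabs_le_between; apply SIN_bound).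
    assert (Rabs (cos y) <= 1) by (apply Rabs_le_between; apply COS_bound).
    pose proof (Rabs_pos (cos y)).
    assert (m * Rabs (sin y) <= 1) by nra. nra. }
  assert (I : / dlt y <= / sqrt (1 - m)) by (apply Rinv_le_contravar; [exact s0|apply dlt_ge]).
  assert (0 < / dlt y) by (apply Rinv_0_lt_compat, dlt_pos).
  apply Rle_trans with (1 * / dlt y); [apply Rmult_le_compat_r; lra|]. unfold dK. lra.
Qed.
Lemma dK_ge : 1 <= dK.
Proof.
  unfold dK. assert (0 < / sqrt (1 - m)); [|lra]. pos.
Qed.

(** The amplitude is a trajectory of the global flow. Its oddness follows from Gronwall for
    [(p s + p (- s))^2], because [dlt] is even and Lipschitz. *)
Lemma amplitude_exists : exists p : R -> R, p 0 = 0 /\ (forall s, is_derive p s (dlt (p s))) /\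
  (forall s, p (- s) = - p s).
Proof.
  destruct (flow_exists (fun y _ => dlt y) (fun y _ => - m * sin y * cos y / dlt y) 1 dK dlt_smooth
    (fun y _ => dlt_derive y)) as [Y [Y0 Yt]].
  - intros y _. rewrite Rabs_pos_eq by (left; apply dlt_pos). apply dlt_le_1.
  - intros y _. apply dlt_d_bd.
  - exact dK_ge.
  - exists (Y 0). split; [apply Y0|]. split; auto.
    intros s.
    pose proof (Gronwall (fun s => (Y 0 s + Y 0 (- s)) ^ 2) (fun s => 2 * (Y 0 s + Y 0 (- s)) * (dlt (Y 0 s) + - dlt (Y 0 (- s))))
       (2 * dK) 0 (Rabs s)) as G.
    assert (dK1 := dK_ge).
    assert (G' : (Y 0 s + Y 0 (- s)) ^ 2 <= ((Y 0 0 + Y 0 (- 0)) ^ 2 + 0 / (2 * dK)) * exp (2 * dK * Rabs s)).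
    { apply G; try lra.
      - intros t _. apply (is_derive_sqr (fun s => Y 0 s + Y 0 (- s))).
        apply is_derive_Rplus; [apply Yt|].
        replace (- dlt (Y 0 (- t))) with ((-1) * dlt (Y 0 (- t))) by ring.
        apply (is_derive_comp (V := R_NormedModule) (Y 0) Ropp t); [apply Yt|]. auto_derive; [auto|ring].
      - intros t _. rewrite !Rabs_mult, (Rabs_pos_eq 2) by lra.
        assert (Ev : dlt (Y 0 (- t)) = dlt (- Y 0 (- t))).
        { unfold dlt. rewrite sin_neg. f_equal. ring. }
        rewrite Ev.
        pose proof (flow_lip (fun y _ => dlt y) (fun y _ => - m * sin y * cos y / dlt y) dK (fun y _ => dlt_derive y)
          (fun y _ => dlt_d_bd y) (- Y 0 (- t)) (Y 0 t) 0) as Lp.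
        replace (Y 0 t - - Y 0 (- t)) with (Y 0 t + Y 0 (- t)) in Lp by ring.
        unfold Rminus in Lp. rewrite <- (pow2_abs (Y 0 t + Y 0 (- t))).
        pose proof (Rabs_pos (Y 0 t + Y 0 (- t))). nra. }
    rewrite Ropp_0, Y0 in G'.
    pose proof (pow2_ge_0 (Y 0 s + Y 0 (- s))).
    assert (Y 0 s + Y 0 (- s) = 0); [|lra]. apply Rsqr_0_uniq. unfold Rsqr. lra.
Qed.

Lemma mvt_all (f df : R -> R) (a b : R) : a < b -> (forall x, is_derive f x (df x)) ->
  exists c, a < c < b /\ f b - f a = df c * (b - a).
Proof.
  intros H D. apply MVT_interior; auto.
  cnt.
Qed.

(** In complete elliptic integrals this is [2 E(m) - K(m)]; its zero is the closing condition of the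
    loop. *)
Definition Ell (m : R) : R := RInt (fun y => (1 - 2 * m * sin y ^ 2) / sqrt (1 - m * sin y ^ 2)) 0 (PI / 2).

(** The angle is the oscillating pendulum solution [2 asin (k sin (am))]. The substitution
    [y = ps x] turns the integral of [cos Th] into [Ell m], once over each half of the interval. *)
Lemma teardrop_of_modulus : 1 / 2 < m -> Ell m = 0 -> exists Th Th1 W2 Ls th0, teardrop Th Th1 W2 Ls th0.
Proof.
  destruct amplitude_exists as [p [p0 [pd podd]]].
  set (k := sqrt m). assert (k0 : 0 < k) by (apply sqrt_lt_R0; lra).
  assert (k2 : k ^ 2 = m) by (apply pow2_sqrt; lra).
  assert (k1 : k < 1). { rewrite <- sqrt_1. apply sqrt_lt_1_alt. lra. }
  assert (s0 : 0 < sqrt (1 - m)) by pos.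
  assert (Incr : forall a b, a < b -> p a < p b).
  { intros a b Hab. destruct (mvt_all p (fun s => dlt (p s)) a b Hab pd) as [c [_ E]].
    pose proof (dlt_pos (p c)). nra. }
  assert (PIp := PI_RGT_0).
  assert (exists T, 0 < T /\ p T = PI / 2) as [T [T0 pT]].
  { set (b := PI / 2 / sqrt (1 - m)). assert (b0 : 0 < b) by (apply Rdiv_lt_0_compat; lra).
    destruct (IVT_value p 0 b (PI / 2)) as [T [HT E]]; [lra| | |].
    - cnt.
    - destruct (mvt_all p (fun s => dlt (p s)) 0 b b0 pd) as [c [_ E]].
      pose proof (dlt_ge (p c)).
      assert (sqrt (1 - m) * b = PI / 2) by (unfold b; field; lra). nra.
    - exists T. split; [|exact E]. destruct HT as [[H|H] _]; [exact H|]. subst T. lra. }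
  (* Frequency rescaling the quarter period [T] to [PI / 2], so that half a period fills the
     interval exactly. *)
  set (om := 2 * T / PI). assert (om0 : 0 < om) by (apply Rdiv_lt_0_compat; lra).
  set (s := fun x => om * (x - PI / 2)).
  assert (sd : forall x, is_derive s x om) by (intros x; unfold s; auto_derive; [auto|ring]).
  set (ps := fun x => p (s x)).
  assert (psd : forall x, is_derive ps x (om * dlt (ps x))).
  { intros x. apply (is_derive_comp (V := R_NormedModule) p s x); auto. }
  set (Th := fun x => 2 * asin (k * sin (ps x))).
  set (Th1 := fun x => 2 * k * om * cos (ps x)).
  assert (kb : forall y, -1 < k * sin y < 1). { intros y. pose proof (SIN_bound y). split; nra. }
  assert (sinTh : forall x, sin (Th x) = 2 * (k * sin (ps x)) * dlt (ps x)).
  { intros x. unfold Th. rewrite sin_2a, sin_asin, cos_asin by (pose proof (kb (ps x)); lra).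
    unfold dlt. f_equal. f_equal. unfold Rsqr. rewrite <- k2. ring. }
  assert (cosTh : forall x, cos (Th x) = 1 - 2 * m * sin (ps x) ^ 2).
  { intros x. unfold Th. rewrite cos_2a_sin, sin_asin by (pose proof (kb (ps x)); lra). rewrite <- k2. ring. }
  assert (spi : s PI = T) by (unfold s, om; field; lra).
  assert (s00 : s 0 = - T) by (unfold s, om; field; lra).
  (* The pendulum energy of amplitude [k] gives this [Ls]; it is positive exactly because
     [m > 1 / 2]. *)
  exists Th, Th1, (om ^ 2), (2 * om ^ 2 * (2 * m - 1)), (Th PI).
  assert (om2 : 0 < om ^ 2) by pos.
  split.
  - exact om2.
  - nra.
  - intros x. unfold Th1.
    assert (D1 : is_derive (fun x => k * sin (ps x)) x (k * (om * dlt (ps x) * cos (ps x)))) by der.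
    assert (D2 : is_derive asin (k * sin (ps x)) (/ dlt (ps x))).
    { apply is_derive_Reals. replace (dlt (ps x)) with (sqrt (1 - (k * sin (ps x))²)).
      - replace (/ sqrt (1 - (k * sin (ps x))²)) with (1 / sqrt (1 - (k * sin (ps x))²)) by lra.
        apply (derive_pt_eq_1 asin _ _ (derivable_pt_asin _ (kb (ps x)))). apply derive_pt_asin.
      - unfold dlt. f_equal. unfold Rsqr. rewrite <- k2. ring. }
    pose proof (is_derive_comp (V := R_NormedModule) asin (fun x => k * sin (ps x)) x _ _ D2 D1) as D3.
    replace (2 * k * om * cos (ps x)) with (2 * ((k * (om * dlt (ps x) * cos (ps x))) * / dlt (ps x))).
    + apply is_derive_scal. exact D3.
    + field. pose proof (dlt_pos (ps x)). lra.
  - intros x. unfold Th1. replace (- om ^ 2 * sin (Th x)) with (2 * k * om * (om * dlt (ps x) * - sin (ps x))) by (rewrite sinTh; ring).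
    der.
  - intros x. rewrite cosTh. unfold Th1.
    replace ((2 * k * om * cos (ps x)) ^ 2) with (4 * k ^ 2 * om ^ 2 * cos (ps x) ^ 2) by ring.
    rewrite k2. pose proof (sin2_cos2 (ps x)) as SC. unfold Rsqr in SC.
    replace (cos (ps x) ^ 2) with (1 - sin (ps x) ^ 2) by lra. ring.
  - unfold Th1, ps. rewrite s00, podd, pT, cos_neg, cos_PI2. ring.
  - unfold Th1, ps. rewrite spi, pT, cos_PI2. ring.
  - intros x. unfold Th, ps. replace (s (PI - x)) with (- s x) by (unfold s; field).
    rewrite podd, sin_neg. replace (k * - sin (p (s x))) with (- (k * sin (p (s x)))) by ring.
    rewrite asin_opp. ring.
  - intros x Hx. unfold Th1.
    assert (Hs : - T < s x < T).
    { rewrite <- spi at 2. rewrite <- s00. unfold s. split; nra. }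
    assert (- (PI / 2) < ps x < PI / 2).
    { rewrite <- pT, <- podd. split; apply Incr; lra. }
    assert (cp : 0 < cos (ps x)) by (apply cos_gt_0; lra).
    pos.
  - reflexivity.
  - unfold Th, ps. rewrite spi, pT, sin_PI2, Rmult_1_r.
    pose proof (asin_bound_lt k ltac:(lra)) as Bd.
    assert (0 < asin k).
    { apply Rnot_le_lt. intros Hn. pose proof (sin_asin k ltac:(lra)) as Es.
      pose proof (sin_ge_0 (- asin k) ltac:(lra) ltac:(lra)) as Sg. rewrite sin_neg in Sg. lra. }
    lra.
  - set (h := fun y => (1 - 2 * m * sin y ^ 2) / dlt y).
    assert (hc : forall y, continuous h y).
    { intros y. apply (ex_derive_continuous (V := R_NormedModule)).
      assert (ex_derive dlt y) by (eexists; apply dlt_derive). pose proof (dlt_pos y).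
      unfold h. auto_derive. split; pos. }
    assert (E1 : RInt h 0 (PI / 2) = 0) by auto.
    assert (E2 : RInt h (- (PI / 2)) 0 = 0).
    { pose proof (RInt_reflect h (- (PI / 2)) hc) as Q. rewrite Ropp_involutive in Q.
      assert (Eh : RInt (fun s => h (- s)) 0 (PI / 2) = RInt h 0 (PI / 2)).
      { apply RInt_ext. intros y _. unfold h, dlt. rewrite sin_neg. now replace ((- sin y) ^ 2) with (sin y ^ 2) by ring. }
      rewrite Eh, E1 in Q.
      pose proof (opp_RInt_swap (V := R_CompleteNormedModule) h 0 (- (PI / 2)) (ex_RInt_cont h _ _ hc)) as O.
      rewrite <- O, Q. change (- - 0 = 0). ring. }
    assert (E3 : RInt h (- (PI / 2)) (PI / 2) = 0).
    { rewrite <- (RInt_Chasles (V := R_CompleteNormedModule) h _ 0 _) by (now apply ex_RInt_cont).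
      rewrite E1, E2. unfold plus; simpl. ring. }
    assert (C : RInt (fun x => scal (om * dlt (ps x)) (h (ps x))) 0 PI = RInt h (ps 0) (ps PI)).
    { apply (RInt_comp (V := R_CompleteNormedModule) h ps (fun x => om * dlt (ps x))).
      - auto.
      - split; [auto|].
        apply (continuous_mult (K := R_AbsRing)); cnt.
        apply continuous_comp.
        + apply (ex_derive_continuous (V := R_NormedModule)). eexists. apply psd.
        + apply (ex_derive_continuous (V := R_NormedModule)). eexists. apply dlt_derive. }
    unfold ps in C at 3 4. rewrite s00, spi, podd, pT, E3 in C.
    assert (cc : forall x, continuous (fun x => cos (Th x)) x).
    { intros x. apply (continuous_ext (fun x => 1 - 2 * m * sin (ps x) ^ 2)); auto.
      cnt. }
    rewrite (RInt_ext _ (fun x => om * cos (Th x))) in C.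
    + rewrite RInt_Rscal in C by auto. nra.
    + intros x _. rewrite cosTh. unfold scal; simpl. unfold mult; simpl. unfold h.
      pose proof (dlt_pos (ps x)). field. lra.
Qed.

End Elliptic.

(** At [m = 1 / 2] the numerator of the integrand is [cos^2], so [Ell] is positive; near [m = 1] the
    logarithmic divergence of [K] makes it negative. The intermediate value theorem does the
    rest. *)
Lemma Ell_root : exists m, 1 / 2 < m < 1 /\ Ell m = 0.
Proof.
  assert (PIp := PI_RGT_0).
  set (g := fun y m => (1 - 2 * m * sin y ^ 2) / sqrt (1 - m * sin y ^ 2)).
  assert (Arg : forall y m, 0 < m < 1 -> 0 < 1 - m * sin y ^ 2).
  { intros y m Hm. pose proof (SIN_bound y). assert (sin y ^ 2 <= 1) by nra. nra. }
  set (P := fun m => 0 < m < 1).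
  assert (OP : opn P).
  { intros m [H1 H2]. apply filter_and; [apply (open_gt 0); exact H1|apply (open_lt 1); exact H2]. }
  assert (S : CK P 0 (fun y _ => sin y)) by (apply (CK_sincos _ 0 (fun y _ => y)), CK_fst).
  assert (Gc : CK P 0 g).
  { apply CK_mult.
    - apply CK_minus; [apply CK_const|]. apply CK_mult; [apply CK_mult; [apply CK_const|apply CK_snd]|].
      apply (CK_ext _ 0 OP (fun y t => sin y * sin y)); pos. now apply CK_mult.
    - apply CK_inv.
      + intros y m Hm. pose proof (sqrt_lt_R0 _ (Arg y m Hm)). lra.
      + apply CK_sqrt; auto.
        apply CK_minus; [apply CK_const|]. apply CK_mult; [apply CK_snd|].
        apply (CK_ext _ 0 OP (fun y t => sin y * sin y)); pos. now apply CK_mult. }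
  assert (Gy : forall m, P m -> forall y, continuous (fun y => g y m) y).
  { intros m Hm y. apply cont2_slice1. now apply (CK_cont P 0). }
  assert (Ec : forall m, P m -> continuous Ell m).
  { intros m Hm. apply (cont2_slice2 (fun x m => RInt (fun y => g y m) 0 x) (PI / 2)).
    apply (cont2_RInt P); [auto|]. intros; now apply (CK_cont P 0). }
  assert (Pos : 0 < Ell (1 / 2)).
  { assert (Ph : P (1 / 2)) by (unfold P; lra).
    apply RInt_gt_0; [lra| |intros; now apply Gy].
    intros x Hx. apply Rdiv_lt_0_compat; [|apply sqrt_lt_R0, Arg; lra].
    assert (0 < cos x) by (apply cos_gt_0; lra). pose proof (sin2_cos2 x) as SC. unfold Rsqr in SC.
    nra. }
  set (eta := exp (Ropp 4)). assert (eta0 : 0 < eta) by apply exp_pos.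
  assert (eta1 : eta < 1 / 2).
  { unfold eta. rewrite exp_Ropp. pose proof (exp_ineq1 4 ltac:(lra)).
    replace (1 / 2) with (/ 2) by field. apply Rinv_lt_contravar; lra. }
  set (m1 := 1 - eta ^ 2). assert (Pm1 : P m1) by (unfold P, m1; split; nra).
  assert (Neg : Ell m1 < 0).
  (* With [d] the square root, the integrand is [2 d - 1 / d], while [d <= 1] and
     [d <= PI / 2 - y + eta]. The integral of [h] is [PI - 4 - ln (PI / 2 + eta)], negative since
     [PI <= 4]; this is why [eta] is the exponential of -4. *)
  { set (h := fun y => 2 - / (PI / 2 - y + eta)).
    assert (hb : forall y, 0 <= y <= PI / 2 -> g y m1 <= h y).
    { intros y Hy. unfold g, h. pose proof (Arg y m1 Pm1) as Ay.
      set (d := sqrt (1 - m1 * sin y ^ 2)). assert (d0 : 0 < d) by (apply sqrt_lt_R0; exact Ay).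
      assert (d2 : d ^ 2 = 1 - m1 * sin y ^ 2) by (apply pow2_sqrt; lra).
      replace ((1 - 2 * m1 * sin y ^ 2) / d) with (2 * d - / d).
      - assert (d <= 1). { apply Rle_trans with (sqrt 1); [|rewrite sqrt_1; lra]. apply sqrt_le_1_alt.
          destruct Pm1 as [Pm _]. nra. }
        assert (d <= PI / 2 - y + eta).
        { apply Rsqr_incr_0_var; [|lra]. unfold Rsqr. replace (d * d) with (d ^ 2) by ring. rewrite d2.
          pose proof (sin2_cos2 y) as SC. unfold Rsqr in SC.
          assert (C1 : 0 <= cos y <= PI / 2 - y).
          { split; [apply cos_ge_0; lra|]. rewrite <- sin_shift.
            destruct (Req_dec y (PI / 2)) as [->|N]; [rewrite Rminus_diag, sin_0; lra|].
            left. apply sin_lt_x. lra. }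
          unfold m1. nra. }
        assert (/ (PI / 2 - y + eta) <= / d) by (apply Rinv_le_contravar; lra). lra.
      - replace (1 - 2 * m1 * sin y ^ 2) with (2 * d ^ 2 - 1) by lra. field. lra. }
    assert (EI : is_RInt h 0 (PI / 2) (minus (2 * (PI / 2) + ln (PI / 2 - PI / 2 + eta)) (2 * 0 + ln (PI / 2 - 0 + eta)))).
    {
      assert (R2 : Rmax 0 (PI / 2) = PI / 2) by (apply Rmax_right; lra).
      apply (is_RInt_derive (fun y => 2 * y + ln (PI / 2 - y + eta))); intros y Hy.
      - unfold h. auto_derive; [lra|]. field. lra.
      - apply (ex_derive_continuous (V := R_NormedModule)). unfold h. auto_derive. lra. }
    assert (Le : Ell m1 <= RInt h 0 (PI / 2)).
    { apply RInt_le; [lra|apply ex_RInt_cont, Gy, Pm1|eexists; exact EI|]. intros y Hy. apply hb. lra. }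
    rewrite (is_RInt_unique _ _ _ _ EI) in Le. unfold minus, plus, opp in Le; simpl in Le.
    replace (PI / 2 - PI / 2 + eta) with eta in Le by ring. unfold eta in Le at 1. rewrite ln_exp in Le.
    assert (0 < ln (PI / 2 - 0 + eta)).
    { pose proof PI2_1. pose proof (ln_increasing 1 (PI / 2 - 0 + eta) Rlt_0_1 ltac:(lra)) as LI. rewrite ln_1 in LI. exact LI. }
    pose proof PI_4. lra. }
  destruct (IVT_value (fun m => - Ell m) (1 / 2) m1 0) as [m [Hm Em]].
  - unfold m1. nra.
  - intros x Hx. apply (continuous_opp (V := R_NormedModule)), Ec. unfold P, m1 in *. nra.
  - lra.
  - exists m. assert (Ell m = 0) by lra. split; [|exact H].
    split; [|destruct Pm1; lra]. destruct Hm as [[H1|H1] _]; [exact H1|]. subst m. lra.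
Qed.

Lemma teardrop_exists : exists Th Th1 W2 Ls th0, teardrop Th Th1 W2 Ls th0.
Proof.
  destruct Ell_root as [m [[H1 H2] HE]]. apply (teardrop_of_modulus m); lra.
Qed.

(** * Coercivity of the second variation at the teardrop *)

Lemma ex_RInt_on (f : R -> R) (a b : R) : a <= b -> (forall x, a <= x <= b -> continuous f x) -> ex_RInt f a b.
Proof.
  intros H C. apply (ex_RInt_continuous (V := R_CompleteNormedModule)).
  rewrite Rmin_left, Rmax_right by lra. exact C.
Qed.

Lemma is_RInt_on (f : R -> R) (a b : R) : a <= b -> (forall x, a <= x <= b -> continuous f x) -> is_RInt f a b (RInt f a b).
Proof. intros. apply (RInt_correct (V := R_CompleteNormedModule)). now apply ex_RInt_on. Qed.

Lemma is_RInt_exact_on (F f : R -> R) (a b : R) : a <= b -> (forall x, a <= x <= b -> is_derive F x (f x)) ->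
  (forall x, a <= x <= b -> continuous f x) -> is_RInt f a b (F b - F a).
Proof.
  intros H D C. apply (is_RInt_derive (V := R_CompleteNormedModule) F f); rewrite Rmin_left, Rmax_right by exact H; assumption.
Qed.

Lemma RInt_le_on (f g : R -> R) (a b : R) : a <= b -> (forall x, a <= x <= b -> continuous f x) ->
  (forall x, a <= x <= b -> continuous g x) -> (forall x, a <= x <= b -> f x <= g x) -> RInt f a b <= RInt g a b.
Proof.
  intros H Cf Cg L. apply RInt_le; [exact H|now apply ex_RInt_on|now apply ex_RInt_on|].
  intros x Hx. apply L. lra.
Qed.

Lemma RInt_nonneg_on (f : R -> R) (a b : R) : a <= b -> (forall x, a <= x <= b -> continuous f x) ->
  (forall x, a <= x <= b -> 0 <= f x) -> 0 <= RInt f a b.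
Proof.
  intros H Cf L. apply RInt_ge_0; [exact H|now apply ex_RInt_on|]. intros x Hx. apply L. lra.
Qed.

Lemma RInt_const_le (f : R -> R) (a b M : R) : a <= b -> (forall x, a <= x <= b -> continuous f x) ->
  (forall x, a <= x <= b -> f x <= M) -> RInt f a b <= (b - a) * M.
Proof.
  intros H Cf L. apply Rle_trans with (RInt (fun _ => M) a b).
  - apply RInt_le_on; auto. cnt.
  - rewrite RInt_const. unfold scal; simpl; unfold mult; simpl. lra.
Qed.

Lemma RInt_abs_le (f : R -> R) (a b : R) : a <= b -> (forall x, a <= x <= b -> continuous f x) ->
  Rabs (RInt f a b) <= RInt (fun x => Rabs (f x)) a b.
Proof. intros H Cf. apply abs_RInt_le; [exact H|now apply ex_RInt_on]. Qed.

Lemma RInt_sup_le (f : R -> R) (a b M : R) : a <= b -> (forall x, continuous f x) ->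
  (forall x, a <= x <= b -> Rabs (f x) <= M) -> Rabs (RInt f a b) <= (b - a) * M.
Proof.
  intros H C L. eapply Rle_trans; [apply RInt_abs_le; auto|]. apply RInt_const_le; [exact H|cnt|exact L].
Qed.

Lemma RInt_split (f : R -> R) (a b c : R) : (forall x, continuous f x) -> RInt f a c = RInt f a b + RInt f b c.
Proof. symmetry. apply (RInt_Chasles (V := R_CompleteNormedModule)); now apply ex_RInt_cont. Qed.

Lemma Rabs_cos (x : R) : Rabs (cos x) <= 1.
Proof. apply Rabs_le_between, COS_bound. Qed.

Lemma Rabs_sin (x : R) : Rabs (sin x) <= 1.
Proof. apply Rabs_le_between, SIN_bound. Qed.

Lemma RInt_sqr_CS (f : R -> R) (a b : R) : a <= b -> (forall x, a <= x <= b -> continuous f x) ->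
  RInt f a b ^ 2 <= (b - a) * RInt (fun x => f x ^ 2) a b.
Proof.
  intros [H|<-] C.
  2: { rewrite !RInt_point. change (0 ^ 2 <= (a - a) * 0). lra. }
  set (I := RInt f a b). set (J := RInt (fun x => f x ^ 2) a b). set (c := I / (b - a)).
  assert (C2 : forall x, a <= x <= b -> continuous (fun x => f x ^ 2) x) by cnt.
  assert (P : 0 <= RInt (fun x => (f x - c) ^ 2) a b).
  { apply RInt_nonneg_on; pos.
    cnt. }
  replace (RInt (fun x => (f x - c) ^ 2) a b) with (J - 2 * c * I + (b - a) * c ^ 2) in P.
  - unfold c in P. apply Rmult_le_compat_l with (r := b - a) in P; [|lra].
    replace ((b - a) * (J - 2 * (I / (b - a)) * I + (b - a) * (I / (b - a)) ^ 2)) with ((b - a) * J - I ^ 2) in P by (field; lra). lra.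
  - symmetry. apply is_RInt_unique.
    apply (is_RInt_ext (V := R_NormedModule) (fun x => (f x ^ 2 - 2 * c * f x) + c ^ 2)); pos.
    apply (is_RInt_plus (V := R_NormedModule)); [apply (is_RInt_minus (V := R_NormedModule))|].
    + now apply is_RInt_on; [lra|].
    + apply (is_RInt_scal (V := R_NormedModule)). apply is_RInt_on; [lra|exact C].
    + apply (is_RInt_const (V := R_NormedModule)).
Qed.

(** Picone's identity: the two integrands differ by the exact derivative of [P' / P f^2]. A positive
    solution of the Jacobi equation thus exhibits a quadratic form as a perfect square plus boundary
    terms. *)
Lemma Picone (f f1 P P1 P2 : R -> R) (a b : R) : a <= b ->
  (forall x, is_derive f x (f1 x)) -> (forall x, continuous f1 x) ->
  (forall x, is_derive P x (P1 x)) -> (forall x, is_derive P1 x (P2 x)) -> (forall x, continuous P2 x) ->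
  (forall x, a <= x <= b -> 0 < P x) ->
  is_RInt (fun x => f1 x ^ 2 + P2 x / P x * f x ^ 2) a b
    (RInt (fun x => (f1 x - P1 x / P x * f x) ^ 2) a b + (P1 b / P b * f b ^ 2 - P1 a / P a * f a ^ 2)).
Proof.
  intros Hab Df Cf1 DP DP1 CP2 Ppos.
  assert (Cf : forall x, continuous f x) by cnt.
  assert (CP : forall x, continuous P x) by cnt.
  assert (CP1 : forall x, continuous P1 x) by cnt.
  assert (CI : forall x, a <= x <= b -> continuous (fun x => / P x) x).
  { intros x Hx. apply continuous_comp; [apply CP|]. apply continuous_Rinv. specialize (Ppos x Hx). lra. }
  assert (CD : forall x, a <= x <= b -> continuous (fun x => (f1 x - P1 x / P x * f x) ^ 2) x).
  { intros x Hx. apply continuous_Rsqr_c.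
    apply continuous_Rminus_c; [auto|]. apply continuous_Rmult_c; [|apply Cf].
    apply continuous_Rmult_c; auto. }
  set (g := fun x => (P2 x / P x - P1 x ^ 2 / P x ^ 2) * f x ^ 2 + P1 x / P x * (2 * f x * f1 x)).
  apply (is_RInt_ext (V := R_NormedModule) (fun x => (f1 x - P1 x / P x * f x) ^ 2 + g x)).
  { intros x Hx. rewrite Rmin_left, Rmax_right in Hx by lra.
    pose proof (Ppos x ltac:(lra)).
    change ((f1 x - P1 x / P x * f x) ^ 2 + ((P2 x / P x - P1 x ^ 2 / P x ^ 2) * f x ^ 2 + P1 x / P x * (2 * f x * f1 x)) = f1 x ^ 2 + P2 x / P x * f x ^ 2).
    field. lra. }
  apply (is_RInt_plus (V := R_NormedModule)); [now apply is_RInt_on|].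
  apply (is_RInt_exact_on (fun x => P1 x / P x * f x ^ 2)); [lra| |].
  - intros x Hx. pose proof (Ppos x Hx).
    apply (is_derive_Rmult (fun x => P1 x / P x) (fun x => f x ^ 2)); [|der].
    replace (P2 x / P x - P1 x ^ 2 / P x ^ 2) with ((P2 x * P x - P1 x * P1 x) / P x ^ 2) by (field; lra).
    apply is_derive_div; [auto|apply DP|lra].
  - intros x Hx. pose proof (CI x Hx). unfold g.
    assert (continuous (fun x => / P x ^ 2) x).
    { apply (continuous_ext (fun x => / P x * / P x)).
      - intros y. rewrite <- Rinv_mult. f_equal. ring.
      - now apply continuous_Rmult_c. }
    unfold Rdiv. cnt.
Qed.

Lemma is_RInt_fold (F : R -> R) : (forall x, continuous F x) ->
  RInt F 0 PI = RInt (fun x => F x + F (PI - x)) (PI / 2) PI.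
Proof.
  intros C.
  assert (C' : forall x, continuous (fun x => F (PI - x)) x) by cnt.
  rewrite (RInt_Rplus F (fun x => F (PI - x))) by auto.
  rewrite <- (RInt_Chasles (V := R_CompleteNormedModule) F 0 (PI / 2) PI) by (now apply ex_RInt_cont).
  assert (E : RInt F 0 (PI / 2) = RInt (fun x => F (PI - x)) (PI / 2) PI).
  { pose proof (RInt_comp (V := R_CompleteNormedModule) F (fun x => PI - x) (fun _ => -1) (PI / 2) PI) as H.
    rewrite Rminus_diag in H. replace (PI - PI / 2) with (PI / 2) in H by field.
    rewrite <- (opp_RInt_swap (V := R_CompleteNormedModule)), <- H.
    - rewrite <- (RInt_opp (V := R_CompleteNormedModule)).
      + apply RInt_ext. intros x _. unfold opp, scal; simpl. unfold mult; simpl. Rring.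
      + apply ex_RInt_cont. intros x. apply continuous_Rmult_c; cnt.
    - auto.
    - split; [der|cnt].
    - now apply ex_RInt_cont. }
  rewrite E. change (RInt (fun x => F (PI - x)) (PI / 2) PI + RInt F (PI / 2) PI = RInt F (PI / 2) PI + RInt (fun x => F (PI - x)) (PI / 2) PI).
  lra.
Qed.

(** Used to remove the regularisation [eta] added to comparison functions that vanish at one end. *)
Lemma Rle_of_eps (x y C : R) : 0 <= C -> (forall e, 0 < e <= 1 -> x <= y + C * e) -> x <= y.
Proof.
  intros HC H. apply Rnot_lt_le. intros L.
  set (e := Rmin 1 ((x - y) / (2 * (C + 1)))).
  assert (0 < (x - y) / (2 * (C + 1))) by pos.
  assert (0 < e <= 1) by (unfold e; split; [apply Rmin_pos; lra|apply Rmin_l]).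
  specialize (H e H1). assert (e <= (x - y) / (2 * (C + 1))) by apply Rmin_r.
  assert (C * e <= (C + 1) * ((x - y) / (2 * (C + 1)))) by (apply Rmult_le_compat; lra).
  replace ((C + 1) * ((x - y) / (2 * (C + 1)))) with ((x - y) / 2) in H3 by (field; lra). lra.
Qed.

Lemma even_part_alg (k h G A : R) : 0 <= h -> 0 <= A ->
  2 * k ^ 2 * G ^ 2 + (4 * (k * h) ^ 2 + 4) * h * A <= (2 * k ^ 2 + (4 * (k * h) ^ 2 + 4) * h) * (G ^ 2 + A).
Proof.
  intros Hh HA. pose proof (Rmult_le_pos _ _ (pow2_ge_0 k) HA).
  assert (0 <= (4 * (k * h) ^ 2 + 4) * h * G ^ 2) by pos.
  lra.
Qed.

Lemma is_derive_reflect (f : R -> R) (c x l : R) : is_derive f (c - x) l -> is_derive (fun x => f (c - x)) x (- l).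
Proof.
  intros H. replace (- l) with (-1 * l) by ring.
  apply (is_derive_comp (V := R_NormedModule) f (fun x => c - x)); [exact H|]. der.
Qed.
#[global] Hint Resolve is_derive_reflect : deriv.

Section Coercivity.
Context {Th Th1 : R -> R} {W2 Ls th0 : R}.
Hypothesis TD : teardrop Th Th1 W2 Ls th0.

Let h := PI / 2.
Lemma h_pos : 0 < h. Proof. unfold h. pose proof PI_RGT_0. lra. Qed.
Lemma h_PI : h < PI. Proof. unfold h. pose proof PI_RGT_0. lra. Qed.

Lemma Th_cont x : continuous Th x. Proof. eapply continuous_of_derive, (td_d1 TD). Qed.
Lemma Th1_cont x : continuous Th1 x. Proof. eapply continuous_of_derive, (td_d2 TD). Qed.
#[local] Hint Resolve Th_cont Th1_cont : cont.

Lemma Th_mid : Th h = 0.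
Proof. pose proof (td_odd TD h) as H. replace (PI - h) with h in H by (unfold h; field). lra. Qed.

Lemma Th1_sym x : Th1 (PI - x) = Th1 x.
Proof.
  assert (D1 : is_derive (fun x => Th (PI - x)) x (- Th1 (PI - x))) by der.
  assert (D2 : is_derive (fun x => Th (PI - x)) x (- Th1 x)).
  { apply (is_derive_ext (fun x => - Th x)); [intros t; symmetry; apply TD|]. der. }
  pose proof (is_derive_inj _ _ _ _ D1 D2). lra.
Qed.

Lemma cosTh_sym x : cos (Th (PI - x)) = cos (Th x).
Proof. rewrite (td_odd TD). apply cos_neg. Qed.

Lemma Th1_ge0 x : 0 <= x <= PI -> 0 <= Th1 x.
Proof.
  destruct (Req_dec x 0) as [->|N0]; [rewrite (td_left TD); lra|].
  destruct (Req_dec x PI) as [->|N1]; [rewrite (td_right TD); lra|].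
  left. apply TD. lra.
Qed.

Lemma Th_mono x y : 0 <= x -> x <= y -> y <= PI -> Th x <= Th y.
Proof.
  intros H1 H2 H3. assert (- Th y <= - Th x); [|lra].
  apply (nonincreasing_of_derive (fun x => - Th x) (fun x => - Th1 x) x y H2).
  - cnt.
  - intros z Hz. split; [der|]. pose proof (Th1_ge0 z ltac:(lra)). lra.
Qed.

Lemma Th_range x : h <= x <= PI -> 0 <= Th x <= th0.
Proof.
  pose proof h_pos. rewrite <- Th_mid, <- (td_th0 TD). split; apply Th_mono; lra.
Qed.

Lemma sinTh_ge0 x : h <= x <= PI -> 0 <= sin (Th x).
Proof. intros H. pose proof (Th_range x H). pose proof (td_th0_range TD). apply sin_ge_0; lra. Qed.

Lemma Th1_anti x y : h <= x -> x <= y -> y <= PI -> Th1 y <= Th1 x.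
Proof.
  intros H1 H2 H3.
  apply (nonincreasing_of_derive Th1 (fun x => - W2 * sin (Th x)) x y H2).
  - cnt.
  - intros z Hz. split; [apply TD|]. pose proof (sinTh_ge0 z ltac:(lra)). pose proof (td_W2 TD). nra.
Qed.

Lemma Ls_eq : Ls = - 2 * W2 * cos th0.
Proof.
  pose proof (td_first TD PI) as H. rewrite (td_right TD), (td_th0 TD) in H. lra.
Qed.

(** Closing on the half interval makes constants orthogonal to [cos Th]. This lets an even function
    be shifted by a constant inside the quadratic form. *)
Lemma closed_half : RInt (fun x => cos (Th x)) h PI = 0.
Proof.
  pose proof (td_closed TD) as H.
  assert (C : forall x, continuous (fun x => cos (Th x)) x) by cnt.
  rewrite is_RInt_fold in H by auto.
  rewrite (RInt_ext _ (fun x => 2 * cos (Th x))) in H by (intros; rewrite cosTh_sym; Rring).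
  rewrite RInt_Rscal in H by auto. unfold h.
  lra.
Qed.

Lemma sin_ge_min t a b : 0 <= a <= t -> t <= b <= PI -> Rmin (sin a) (sin b) <= sin t.
Proof.
  intros H1 H2. destruct (Rle_dec t (PI / 2)).
  - le_via Rmin_l. apply sin_incr_1; lra.
  - le_via Rmin_r. apply sin_decr_1; lra.
Qed.

Let xm := 3 * PI / 4.
Lemma xm_range : h < xm < PI. Proof. unfold h, xm. pose proof PI_RGT_0. lra. Qed.

Lemma Th_xm_pos : 0 < Th xm < th0.
Proof.
  pose proof xm_range. pose proof h_pos.
  destruct (mvt_all Th Th1 h xm) as [c [Hc E]]; [lra|apply TD|].
  destruct (mvt_all Th Th1 xm PI) as [d [Hd E']]; [lra|apply TD|].
  rewrite Th_mid in E. rewrite (td_th0 TD) in E'.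
  pose proof (td_incr TD c ltac:(lra)). pose proof (td_incr TD d ltac:(lra)). nra.
Qed.

(** Near [PI] the slope of [Th1] is [- W2 sin Th], bounded away from zero; further left [Th1] is
    bounded below by monotonicity. The linear bound controls divisions by [Th1 + eta] uniformly in
    [eta]. *)
Lemma Th1_lower : exists c, 0 < c /\ forall x, h <= x <= PI -> c * (PI - x) <= Th1 x.
Proof.
  pose proof xm_range. pose proof h_pos. pose proof Th_xm_pos. pose proof (td_th0_range TD).
  pose proof (td_W2 TD).
  assert (S0 : 0 < Rmin (sin (Th xm)) (sin th0)) by (apply Rmin_pos; apply sin_gt_0; lra).
  assert (T0 : 0 < Th1 xm) by (apply TD; lra).
  set (c1 := W2 * Rmin (sin (Th xm)) (sin th0)). set (c2 := Th1 xm / PI).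
  assert (0 < c1) by (unfold c1; nra). assert (0 < c2) by (apply Rdiv_lt_0_compat; lra).
  exists (Rmin c1 c2). split; [now apply Rmin_pos|]. intros x Hx.
  destruct (Rle_dec x xm) as [L|L].
  - apply Rle_trans with (c2 * PI).
    + apply Rmult_le_compat; try lra; [apply Rmin_glb; lra|apply Rmin_r].
    + unfold c2. replace (Th1 xm / PI * PI) with (Th1 xm) by (field; lra). apply Th1_anti; lra.
  - destruct (Req_dec x PI) as [->|N]; [rewrite (td_right TD); lra|].
    destruct (mvt_all Th1 (fun x => - W2 * sin (Th x)) x PI) as [d [Hd E]]; [lra|apply TD|].
    rewrite (td_right TD) in E.
    assert (Rmin (sin (Th xm)) (sin th0) <= sin (Th d)) by (apply sin_ge_min; [split; [lra|apply Th_mono; lra]|split; [apply Th_range; lra|lra]]).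
    apply Rle_trans with (c1 * (PI - x)); [apply Rmult_le_compat_r; [lra|apply Rmin_l]|].
    unfold c1. assert (W2 * Rmin (sin (Th xm)) (sin th0) <= W2 * sin (Th d)) by (apply Rmult_le_compat_l; lra).
    nra.
Qed.

Lemma bounded_on (f : R -> R) (a b : R) : a <= b -> (forall x, continuous f x) ->
  exists V, 0 <= V /\ forall x, a <= x <= b -> Rabs (f x) <= V.
Proof.
  intros H C. destruct (continuity_ab_maj (fun x => Rabs (f x)) a b H) as [M [HM _]].
  - intros c _. apply continuity_pt_filterlim. apply continuous_abs_comp, C.
  - exists (Rabs (f M)). split; [pos|exact HM].
Qed.

(** This linear bound on [f^2] compensates the linear vanishing of the comparison function, so that
    [eta f^2 / P] is [O(eta)]. *)
Lemma vanish_quadratic (f f1 : R -> R) (x0 : R) : h <= x0 <= PI ->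
  (forall x, is_derive f x (f1 x)) -> (forall x, continuous f1 x) -> f x0 = 0 ->
  exists V, 0 <= V /\ forall x, h <= x <= PI -> f x ^ 2 <= V * Rabs (x - x0).
Proof.
  intros H0 D C Z. destruct (bounded_on f1 h PI ltac:(lra) C) as [V [V0 HV]].
  pose proof PI_RGT_0. exists (V ^ 2 * PI). split; [pos|]. intros x Hx.
  assert (B : Rabs (f x) <= V * Rabs (x - x0)).
  { destruct (MVT_gen f x0 x f1) as [c [Hc E]].
    - auto.
    - intros y _. apply continuity_pt_filterlim. eapply continuous_of_derive, D.
    - rewrite Z, Rminus_0_r in E. rewrite E, Rabs_mult. apply Rmult_le_compat_r; pos.
      apply HV. unfold Rmin, Rmax in Hc. destruct Rle_dec; lra. }
  rewrite <- pow2_abs. pose proof (Rabs_pos (f x)). pose proof (Rabs_pos (x - x0)).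
  assert (Rabs (x - x0) <= PI) by (pose proof h_pos; apply Rabs_le_between; lra).
  assert (Rabs (f x) ^ 2 <= (V * Rabs (x - x0)) ^ 2) by (apply pow_incr; lra).
  eapply Rle_trans; [exact H4|].
  replace ((V * Rabs (x - x0)) ^ 2) with (V ^ 2 * (Rabs (x - x0) * Rabs (x - x0))) by ring.
  rewrite Rmult_assoc. apply Rmult_le_compat_l; pos. nra.
Qed.

Definition Qh (f f1 : R -> R) : R := RInt (fun x => f1 x ^ 2 - W2 * cos (Th x) * f x ^ 2) h PI.

(** On the half interval [Th1] is a positive Jacobi field with zero slope at [PI / 2] and value zero
    at [PI], so the form is nonnegative and degenerates only along [Th1]. That direction is detected
    by the first variation of closing, since [cos Th * Th1] integrates to [sin th0]. Writing
    [v = P H] with [P] the regularised field, the form controls [H'] in mean square and the closing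
    integral controls [H h]. *)
Lemma even_part (v v1 : R -> R) :
  (forall x, is_derive v x (v1 x)) -> (forall x, continuous v1 x) -> v PI = 0 ->
  forall x, h <= x <= PI -> v x ^ 2 <=
    (2 * ((Th1 h + 1) / sin th0) ^ 2 + (4 * (((Th1 h + 1) / sin th0) * h) ^ 2 + 4) * h) *
    (RInt (fun x => cos (Th x) * v x) h PI ^ 2 + Qh v v1).
Proof.
  intros Dv Cv1 Z x Hx.
  pose proof h_pos as hp. pose proof (td_W2 TD) as W0.
  destruct (vanish_quadratic v v1 PI ltac:(lra) Dv Cv1 Z) as [V [V0 HV]].
  destruct Th1_lower as [c [c0 Hc]].
  assert (St : 0 < sin th0) by (pose proof (td_th0_range TD); apply sin_gt_0; lra).
  set (G := RInt (fun x => cos (Th x) * v x) h PI).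
  set (k := (Th1 h + 1) / sin th0).
  set (CC := 2 * k ^ 2 + (4 * (k * h) ^ 2 + 4) * h).
  assert (CC0 : 0 <= CC).
  { unfold CC. pos. }
  apply (Rle_of_eps _ _ (CC * (W2 * (V / c) * h))).
  { pos. }
  intros eta [He He1].
  (* [P2] is the potential applied to [Th1], not to [P]; the mismatch is the [O(eta)] error
     estimated in [AQ]. *)
  set (P := fun x => Th1 x + eta). set (P1 := fun x => - W2 * sin (Th x)). set (P2 := fun x => - W2 * (Th1 x * cos (Th x))).
  assert (Ppos : forall x, h <= x <= PI -> 0 < P x) by (intros y Hy; unfold P; pose proof (Th1_ge0 y ltac:(lra)); lra).
  assert (DP : forall x, is_derive P x (P1 x)).
  { unfold P, P1. der. }
  assert (DP1 : forall x, is_derive P1 x (P2 x)).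
  { unfold P1, P2. der. }
  assert (CP2 : forall x, continuous P2 x).
  { unfold P2. cnt. }
  pose proof (Picone v v1 P P1 P2 h PI ltac:(lra) Dv Cv1 DP DP1 CP2 Ppos) as Pic.
  (* The term at [PI] vanishes with [v], the one at the midpoint because [Th] vanishes there and so
     does the slope of [Th1]. *)
  assert (B0 : P1 PI / P PI * v PI ^ 2 - P1 h / P h * v h ^ 2 = 0).
  { rewrite Z. unfold P1 at 2. rewrite Th_mid, sin_0. lra. }
  rewrite B0, Rplus_0_r in Pic.
  set (D := fun x => v1 x - P1 x / P x * v x) in *. set (A := RInt (fun x => D x ^ 2) h PI) in *.
  assert (CIP : forall y, h <= y <= PI -> continuous (fun x => / P x) y).
  { intros y Hy. apply continuous_comp; cnt. apply continuous_Rinv. specialize (Ppos y Hy). lra. }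
  assert (CD : forall y, h <= y <= PI -> continuous D y).
  { unfold D, Rdiv. cnt. }
  assert (AQ : A <= Qh v v1 + W2 * (V / c) * h * eta).
  { change A with (RInt (fun x => (v1 x - P1 x / P x * v x) ^ 2) h PI). rewrite <- (is_RInt_unique _ _ _ _ Pic). unfold Qh.
    apply Rle_trans with (RInt (fun x => (v1 x ^ 2 - W2 * cos (Th x) * v x ^ 2) + W2 * (V / c) * eta) h PI).
    - apply RInt_le_on; [lra|intros y Hy; specialize (CIP y Hy); unfold Rdiv; cnt|cnt|].
      + intros y Hy. pose proof (Ppos y Hy) as Py. unfold P2.
        replace (v1 y ^ 2 + - W2 * (Th1 y * cos (Th y)) / P y * v y ^ 2) with
          ((v1 y ^ 2 - W2 * cos (Th y) * v y ^ 2) + W2 * (cos (Th y) * (v y ^ 2 * eta / P y))) by (unfold P in *; field; lra).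
        apply Rplus_le_compat_l. rewrite Rmult_assoc. apply Rmult_le_compat_l; [lra|].
        pose proof (COS_bound (Th y)).
        assert (E0 : 0 <= v y ^ 2 * eta / P y <= V / c * eta).
        { split; pos.
          apply Rmult_le_reg_r with (c * P y); [nra|].
          replace (v y ^ 2 * eta / P y * (c * P y)) with (c * v y ^ 2 * eta) by (field; lra).
          replace (V / c * eta * (c * P y)) with (V * P y * eta) by (field; lra).
          apply Rmult_le_compat_r; [lra|]. specialize (HV y Hy). rewrite Rabs_left1 in HV by lra.
          specialize (Hc y Hy). unfold P.
          nra. }
        nra.
    - right. rewrite RInt_Rplus, RInt_cst by cnt. replace (PI - h) with h by (unfold h; field). Rring. }
  assert (A0 : 0 <= A) by (apply RInt_nonneg_on; [lra|cnt|pos]).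
  set (H := fun x => v x / P x).
  assert (DH : forall y, h <= y <= PI -> is_derive H y (D y / P y)).
  { intros y Hy. pose proof (Ppos y Hy).
    replace (D y / P y) with ((v1 y * P y - v y * P1 y) / P y ^ 2) by (unfold D; field; lra).
    apply is_derive_div; [apply Dv|apply DP|lra]. }
  set (J := RInt (fun x => Rabs (D x)) h PI).
  assert (CaD : forall y, h <= y <= PI -> continuous (fun x => Rabs (D x)) y) by cnt.
  assert (J2 : J ^ 2 <= h * A).
  { eapply Rle_trans; [apply RInt_sqr_CS; [lra|exact CaD]|].
    replace (PI - h) with h by (unfold h; field). right. f_equal. apply RInt_ext. intros y _. apply pow2_abs. }
  assert (Panti : forall y z, h <= y -> y <= z -> z <= PI -> P z <= P y).
  { intros y z H1 H2 H3. unfold P. pose proof (Th1_anti y z H1 H2 H3). lra. }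
  assert (vb : Rabs (v x) <= P h * Rabs (H h) + J).
  { pose proof (Ppos x Hx) as Px.
    assert (I : is_RInt (fun y => D y / P y) h x (H x - H h)).
    { apply is_RInt_exact_on; [lra|intros; apply DH; lra|]. intros y Hy.
      apply continuous_Rmult_c; [apply CD; lra|apply CIP; lra]. }
    assert (E : v x = P x * H h + P x * (H x - H h)) by (unfold H; field; split; [apply Rgt_not_eq, Ppos; lra|lra]).
    rewrite E. le_via Rabs_triang. rewrite !Rabs_mult, (Rabs_pos_eq (P x)) by lra.
    apply Rplus_le_compat.
    - apply Rmult_le_compat_r; pos. apply Panti; lra.
    - rewrite <- (is_RInt_unique _ _ _ _ I).
      assert (CDP : forall y, h <= y <= x -> continuous (fun y => D y / P y) y).
      { intros y Hy. apply continuous_Rmult_c; [apply CD; lra|apply CIP; lra]. }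
      eapply Rle_trans; [apply Rmult_le_compat_l; [lra|apply RInt_abs_le; [lra|exact CDP]]|].
      apply Rle_trans with (RInt (fun y => Rabs (D y)) h x).
      + replace (P x * RInt (fun y => Rabs (D y / P y)) h x) with (RInt (fun y => scal (P x) (Rabs (D y / P y))) h x).
        2: { apply (RInt_scal (V := R_CompleteNormedModule)). apply ex_RInt_on; [lra|]. cnt. }
        apply RInt_le_on; [lra| |intros y Hy; apply CaD; lra|].
        * intros y Hy. apply continuous_Rmult_c; [cnt|]. cnt.
        * intros y Hy. unfold scal; simpl; unfold mult; simpl. pose proof (Ppos y ltac:(lra)) as Py.
          unfold Rdiv. rewrite Rabs_mult, Rabs_inv, (Rabs_pos_eq (P y)) by lra.
          pose proof (Panti y x ltac:(lra) ltac:(lra) ltac:(lra)). pose proof (Rabs_pos (D y)).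
          apply Rmult_le_reg_r with (P y); [exact Py|].
          replace (P x * (Rabs (D y) * / P y) * P y) with (P x * Rabs (D y)) by (field; lra). nra.
      + unfold J. rewrite <- (RInt_Chasles (V := R_CompleteNormedModule) (fun y => Rabs (D y)) h x PI).
        * unfold plus; simpl. assert (0 <= RInt (fun y => Rabs (D y)) x PI); [|lra].
          apply RInt_nonneg_on; [lra|intros y Hy; apply CaD; lra|pos].
        * apply ex_RInt_on; [lra|intros y Hy; apply CaD; lra].
        * apply ex_RInt_on; [lra|intros y Hy; apply CaD; lra]. }
  (* integrate [cos Th * v = K' * (v / P)] by parts with the primitive [K] of [cos Th * P] vanishing at [PI] *)
  set (S := fun x => RInt (fun y => cos (Th y)) h x).
  assert (cc : forall y, continuous (fun y => cos (Th y)) y) by cnt.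
  assert (DS : forall y, is_derive S y (cos (Th y))) by (intros y; apply (is_derive_RInt_var (fun y => cos (Th y))); exact cc).
  set (K := fun x => sin (Th x) - sin th0 + eta * S x).
  assert (DK : forall y, is_derive K y (cos (Th y) * P y)).
  { unfold K, P. der. }
  assert (KP : K PI = 0).
  { unfold K, S. rewrite closed_half, (td_th0 TD). ring. }
  assert (Kh : K h = - sin th0).
  { unfold K, S. rewrite RInt_point, Th_mid, sin_0. change (0 - sin th0 + eta * 0 = - sin th0). ring. }
  (* [K] vanishes at [PI] and has slope [cos Th * P] with [P] decreasing. This cancels the singular
     factor [1 / P] in [K H' = K D / P]. *)
  assert (Kb : forall y, h <= y <= PI -> Rabs (K y) <= h * P y).
  { intros y Hy. destruct (Req_dec y PI) as [->|N].
    - rewrite KP, Rabs_R0. pose proof (Ppos PI ltac:(lra)). nra.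
    - destruct (mvt_all K (fun y => cos (Th y) * P y) y PI ltac:(lra) DK) as [d [Hd E]].
      replace (K y) with (- (cos (Th d) * P d * (PI - y))) by lra.
      rewrite Rabs_Ropp, !Rabs_mult, (Rabs_pos_eq (PI - y)) by lra.
      pose proof (Ppos d ltac:(lra)). rewrite (Rabs_pos_eq (P d)) by lra.
      pose proof (Panti y d ltac:(lra) ltac:(lra) ltac:(lra)).
      assert (Rabs (cos (Th d)) <= 1) by (apply Rabs_le_between, COS_bound). pose proof (Rabs_pos (cos (Th d))).
      assert (PI - y <= h) by (unfold h in *; lra).
      apply Rle_trans with (1 * P y * h); [|lra]. apply Rmult_le_compat; [nra|lra|nra|lra]. }
  assert (EG : is_RInt (fun y => cos (Th y) * v y + K y * (D y / P y)) h PI (K PI * H PI - K h * H h)).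
  { apply (is_RInt_exact_on (fun x => K x * H x)); [lra| |].
    - intros y Hy. pose proof (Ppos y Hy).
      replace (cos (Th y) * v y + K y * (D y / P y)) with (cos (Th y) * P y * H y + K y * (D y / P y)) by (unfold H; field; lra).
      der.
    - unfold Rdiv. cnt. }
  rewrite KP, Kh in EG. replace (0 * H PI - - sin th0 * H h) with (sin th0 * H h) in EG by ring.
  assert (CKD : forall y, h <= y <= PI -> continuous (fun y => K y * (D y / P y)) y).
  { unfold Rdiv. cnt. }
  assert (EG2 : sin th0 * H h = G + RInt (fun y => K y * (D y / P y)) h PI).
  { rewrite <- (is_RInt_unique _ _ _ _ EG). apply (RInt_plus (V := R_CompleteNormedModule)).
    - apply ex_RInt_cont. cnt.
    - apply ex_RInt_on; [lra|auto]. }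
  assert (KJ : Rabs (RInt (fun y => K y * (D y / P y)) h PI) <= h * J).
  { eapply Rle_trans; [apply RInt_abs_le; [lra|exact CKD]|].
    unfold J. replace (h * RInt (fun x => Rabs (D x)) h PI) with (RInt (fun x => scal h (Rabs (D x))) h PI).
    2: { apply (RInt_scal (V := R_CompleteNormedModule)). apply ex_RInt_on; [lra|auto]. }
    apply RInt_le_on; [lra|intros y Hy; apply continuous_abs_comp; now apply CKD| |].
    - intros y Hy. apply continuous_Rmult_c; cnt.
    - intros y Hy. unfold scal; simpl; unfold mult; simpl. pose proof (Ppos y Hy) as Py.
      unfold Rdiv. rewrite !Rabs_mult, Rabs_inv, (Rabs_pos_eq (P y)) by lra. specialize (Kb y Hy).
      pose proof (Rabs_pos (D y)).
      apply Rmult_le_reg_r with (P y); [exact Py|].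
      replace (Rabs (K y) * (Rabs (D y) * / P y) * P y) with (Rabs (K y) * Rabs (D y)) by (field; lra). nra. }
  assert (Hh : Rabs (H h) <= (Rabs G + h * J) / sin th0).
  { apply Rmult_le_reg_r with (sin th0); [exact St|].
    replace ((Rabs G + h * J) / sin th0 * sin th0) with (Rabs G + h * J) by (field; lra).
    rewrite <- (Rabs_pos_eq (sin th0)) by lra. rewrite <- Rabs_mult, Rmult_comm, EG2.
    le_via Rabs_triang. lra. }
  assert (Ph : 0 < P h <= Th1 h + 1) by (split; [apply Ppos; lra|unfold P; lra]).
  assert (fin : Rabs (v x) <= k * Rabs G + (k * h + 1) * J).
  { eapply Rle_trans; [exact vb|].
    apply Rle_trans with ((Th1 h + 1) * ((Rabs G + h * J) / sin th0) + J).
    - apply Rplus_le_compat_r. apply Rmult_le_compat; pos.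
    - unfold k. lra. }
  pose proof (Rabs_pos (v x)).
  apply Rle_trans with ((k * Rabs G + (k * h + 1) * J) ^ 2).
  { rewrite <- pow2_abs. apply pow_incr. lra. }
  apply Rle_trans with (2 * k ^ 2 * G ^ 2 + 2 * (k * h + 1) ^ 2 * J ^ 2).
  { rewrite <- (pow2_abs G). pose proof (pow2_ge_0 (k * Rabs G - (k * h + 1) * J)). nra. }
  assert (k1 : 2 * (k * h + 1) ^ 2 <= 4 * (k * h) ^ 2 + 4) by (pose proof (pow2_ge_0 (k * h - 1)); nra).
  set (A' := Qh v v1 + W2 * (V / c) * h * eta) in *.
  apply Rle_trans with (CC * (G ^ 2 + A')); [|unfold A'; right; ring].
  assert (A'0 : 0 <= A') by lra.
  apply Rle_trans with (2 * k ^ 2 * G ^ 2 + (4 * (k * h) ^ 2 + 4) * h * A').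
  - apply Rplus_le_compat_l. rewrite (Rmult_assoc _ h A').
    apply Rmult_le_compat; pos.
    nra.
  - apply (even_part_alg k h G A' (Rlt_le _ _ hp) A'0).
Qed.

(** A Lame eigenfunction: it vanishes at [PI / 2], has zero slope at [PI] and is positive in
    between. It is therefore the ground state of the form on functions odd about the midpoint, with
    eigenvalue [nu]. *)
Definition hsin (x : R) : R := sin (Th x / 2).
Definition hsin1 (x : R) : R := Th1 x / 2 * cos (Th x / 2).
Definition nu : R := W2 * (1 - cos th0) / 2.

Lemma half_derive x : is_derive (fun x => Th x / 2) x (Th1 x / 2).
Proof.
  unfold Rdiv. der.
Qed.

Lemma hsin_derive x : is_derive hsin x (hsin1 x).
Proof. apply (is_derive_sin_comp (fun x => Th x / 2)), half_derive. Qed.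

Lemma hsin1_derive x : is_derive hsin1 x (- (nu + W2 * cos (Th x)) * hsin x).
Proof.
  unfold hsin1.
  replace (- (nu + W2 * cos (Th x)) * hsin x) with
    (- W2 * sin (Th x) / 2 * cos (Th x / 2) + Th1 x / 2 * (Th1 x / 2 * - sin (Th x / 2))).
  - der. field.
  - unfold hsin, nu. pose proof (td_first TD x) as F. rewrite Ls_eq in F.
    assert (S : sin (Th x) = 2 * sin (Th x / 2) * cos (Th x / 2)) by (rewrite <- sin_2a; f_equal; field).
    assert (C : cos (Th x) = 2 * cos (Th x / 2) * cos (Th x / 2) - 1) by (rewrite <- cos_2a_cos; f_equal; field).
    replace (Th1 x / 2 * (Th1 x / 2 * - sin (Th x / 2))) with (- (Th1 x ^ 2) / 4 * sin (Th x / 2)) by field.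
    rewrite F, S, C. field.
Qed.
#[local] Hint Resolve hsin_derive hsin1_derive half_derive : deriv.

Lemma nu_pos : 0 < nu.
Proof.
  unfold nu. pose proof (td_W2 TD). pose proof (td_th0_range TD).
  assert (cos th0 < cos 0) by (apply cos_decreasing_1; lra). rewrite cos_0 in *. nra.
Qed.

Lemma hsin_mono x y : h <= x -> x <= y -> y <= PI -> hsin x <= hsin y.
Proof.
  intros H1 H2 H3. pose proof (Th_range x ltac:(lra)). pose proof (Th_range y ltac:(lra)).
  pose proof (td_th0_range TD). pose proof (Th_mono x y ltac:(pose proof h_pos; lra) H2 H3).
  apply sin_incr_1; lra.
Qed.

Lemma hsin_h : hsin h = 0.
Proof. unfold hsin. rewrite Th_mid. unfold Rdiv. rewrite Rmult_0_l. apply sin_0. Qed.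

Lemma hsin_lower : exists c, 0 < c /\ forall x, h <= x <= PI -> c * (x - h) <= hsin x.
Proof.
  pose proof xm_range. pose proof h_pos. pose proof Th_xm_pos. pose proof (td_th0_range TD).
  assert (C0 : 0 < cos (th0 / 2)) by (apply cos_gt_0; lra).
  assert (T0 : 0 < Th1 xm) by (apply TD; lra).
  assert (S0 : 0 < hsin xm) by (apply sin_gt_0; lra).
  set (c1 := Th1 xm / 2 * cos (th0 / 2)). set (c2 := hsin xm / PI).
  assert (0 < c1) by (unfold c1; nra). assert (0 < c2) by (apply Rdiv_lt_0_compat; lra).
  exists (Rmin c1 c2). split; [now apply Rmin_pos|]. intros x Hx.
  destruct (Rle_dec x xm) as [L|L].
  - destruct (Req_dec x h) as [->|N]; [rewrite hsin_h; lra|].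
    destruct (mvt_all hsin hsin1 h x ltac:(lra) hsin_derive) as [d [Hd E]]. rewrite hsin_h in E.
    apply Rle_trans with (c1 * (x - h)); [apply Rmult_le_compat_r; [lra|apply Rmin_l]|].
    replace (hsin x) with (hsin1 d * (x - h)) by lra. apply Rmult_le_compat_r; [lra|].
    pose proof (Th1_anti d xm ltac:(lra) ltac:(lra) ltac:(lra)). pose proof (Th_range d ltac:(lra)).
    apply Rmult_le_compat; try lra. apply cos_decr_1; lra.
  - apply Rle_trans with (c2 * PI).
    + apply Rmult_le_compat; try lra; [apply Rmin_glb; lra|apply Rmin_r].
    + unfold c2. replace (hsin xm / PI * PI) with (hsin xm) by (field; lra). apply hsin_mono; lra.
Qed.

(** Picone's identity against the regularised ground state [hsin + eta]; the boundary terms vanish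
    by [u h = 0] and [hsin1 PI = 0]. *)
Lemma odd_part (u u1 : R -> R) :
  (forall x, is_derive u x (u1 x)) -> (forall x, continuous u1 x) -> u h = 0 ->
  nu * RInt (fun x => u x ^ 2) h PI <= Qh u u1.
Proof.
  intros Du Cu1 Z.
  pose proof h_pos as hp. pose proof h_PI as hP. pose proof (td_W2 TD) as W0. pose proof nu_pos as N0.
  destruct (vanish_quadratic u u1 h ltac:(lra) Du Cu1 Z) as [V [V0 HV]].
  destruct hsin_lower as [c [c0 Hc]].
  apply (Rle_of_eps _ _ (h * ((nu + W2) * (V / c)))); [pos|].
  intros eta [He He1].
  set (P := fun x => hsin x + eta). set (P2 := fun x => - (nu + W2 * cos (Th x)) * hsin x).
  assert (s0 : forall x, h <= x <= PI -> 0 <= hsin x).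
  { intros x Hx. specialize (Hc x Hx). assert (0 <= c * (x - h)) by pos. lra. }
  assert (Ppos : forall x, h <= x <= PI -> 0 < P x) by (intros y Hy; unfold P; pose proof (s0 y Hy); lra).
  assert (DP : forall x, is_derive P x (hsin1 x)).
  { unfold P. der. }
  assert (Chs : forall y, continuous hsin y) by (intros y; eapply continuous_of_derive, hsin_derive).
  assert (CP2 : forall x, continuous P2 x).
  { unfold P2. cnt. }
  pose proof (Picone u u1 P hsin1 P2 h PI ltac:(lra) Du Cu1 DP hsin1_derive CP2 Ppos) as Pic.
  assert (B0 : hsin1 PI / P PI * u PI ^ 2 - hsin1 h / P h * u h ^ 2 = 0).
  { rewrite Z. unfold hsin1 at 1. rewrite (td_right TD). lra. }
  rewrite B0, Rplus_0_r in Pic.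
  assert (CIP : forall y, h <= y <= PI -> continuous (fun x => / P x) y).
  { intros y Hy. apply continuous_comp; cnt. apply continuous_Rinv. specialize (Ppos y Hy). lra. }
  assert (CL : forall y, h <= y <= PI -> continuous (fun x => u1 x ^ 2 + P2 x / P x * u x ^ 2) y).
  { unfold Rdiv. cnt. }
  assert (I0 : 0 <= RInt (fun x => u1 x ^ 2 + P2 x / P x * u x ^ 2) h PI).
  { rewrite (is_RInt_unique _ _ _ _ Pic). apply RInt_nonneg_on; pos.
    assert (Ch := hsin1_derive). unfold Rdiv. cnt. }
  assert (LE : RInt (fun x => u1 x ^ 2 + P2 x / P x * u x ^ 2) h PI <=
    RInt (fun x => (u1 x ^ 2 - W2 * cos (Th x) * u x ^ 2) - nu * u x ^ 2 + (nu + W2) * (V / c) * eta) h PI).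
  { apply RInt_le_on; [lra|exact CL|cnt|].
    - intros y Hy. pose proof (Ppos y Hy) as Py. unfold P2.
      replace (u1 y ^ 2 + - (nu + W2 * cos (Th y)) * hsin y / P y * u y ^ 2) with
        ((u1 y ^ 2 - W2 * cos (Th y) * u y ^ 2) - nu * u y ^ 2 + (nu + W2 * cos (Th y)) * (u y ^ 2 * eta / P y))
        by (unfold P in *; field; lra).
      apply Rplus_le_compat_l. rewrite (Rmult_assoc (nu + W2)).
      pose proof (COS_bound (Th y)).
      assert (E0 : 0 <= u y ^ 2 * eta / P y <= V / c * eta).
      { split; pos.
        apply Rmult_le_reg_r with (c * P y); [nra|].
        replace (u y ^ 2 * eta / P y * (c * P y)) with (c * u y ^ 2 * eta) by (field; lra).
        replace (V / c * eta * (c * P y)) with (V * P y * eta) by (field; lra).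
        apply Rmult_le_compat_r; [lra|]. specialize (HV y Hy). rewrite Rabs_pos_eq in HV by lra.
        specialize (Hc y Hy). unfold P.
        nra. }
      apply Rle_trans with ((nu + W2) * (u y ^ 2 * eta / P y)).
      + apply Rmult_le_compat_r; [lra|]. nra.
      + apply Rmult_le_compat_l; lra. }
  pose proof (Rle_trans _ _ _ I0 LE) as I1. rewrite RInt_Rplus, RInt_Rminus, RInt_Rscal, RInt_cst in I1 by cnt.
  replace (PI - h) with h in I1 by (unfold h; field). unfold Qh. lra.
Qed.

(** The cross term [2 b S G] is split by Young's inequality; its part in [b^2] is absorbed using
    [b^2 <= CC X]. Hence [X] is controlled by the even form and [G^2]. *)
Lemma coercivity_alg (CC S K Qe Qo Io G N b X Q : R) : 0 < CC -> 0 < S -> 0 < K ->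
  X = G ^ 2 + (Qe + 2 * b * S * G) -> b ^ 2 <= CC * X -> K * Io <= Qo -> 0 <= Io ->
  Q = 2 * Qe + 2 * Qo -> N <= Q + 2 * S * (4 * h * CC * X + Io) ->
  N <= (1 + 2 * S * (4 * h * CC + / (2 * K))) * Q
     + 2 * S * (4 * h * CC * 2 * (1 + 2 * CC * S ^ 2) + (1 + 2 * CC * S ^ 2) / K) * G ^ 2.
Proof.
  intros C0 S0 K0 EX Hb HI I0 EQ HN. pose proof h_pos as hp.
  set (c := 1 + 2 * CC * S ^ 2).
  assert (X1 : X <= 2 * (Qe + c * G ^ 2)).
  { assert (2 * b * S * G <= X / 2 + 2 * CC * S ^ 2 * G ^ 2).
    { pose proof (pow2_ge_0 (b - 2 * CC * S * G)). nra. }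
    unfold c. nra. }
  assert (X0 : 0 <= X) by (pose proof (pow2_ge_0 b); nra).
  assert (Qo0 : 0 <= Qo) by nra.
  assert (X2 : X <= Q + 2 * c * G ^ 2) by lra.
  assert (Io2 : Io <= (Q / 2 + c * G ^ 2) * / K).
  { apply Rmult_le_reg_r with K; [lra|]. rewrite Rmult_assoc, Rinv_l by lra. lra. }
  eapply Rle_trans; [exact HN|].
  replace ((1 + 2 * S * (4 * h * CC + / (2 * K))) * Q + 2 * S * (4 * h * CC * 2 * c + c / K) * G ^ 2) with
    (Q + 2 * S * (4 * h * CC * (Q + 2 * c * G ^ 2) + (Q / 2 + c * G ^ 2) * / K)) by (field; lra).
  apply Rplus_le_compat_l. apply Rmult_le_compat_l; [lra|]. apply Rplus_le_compat; [|lra].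
  apply Rmult_le_compat_l; [|exact X2]. pos.
Qed.

(** Mean zero removes the rotations. As [cos Th] is symmetric about the midpoint, the form splits
    into the even and odd parts of [f]. The odd part has the spectral gap [nu], and the even part
    degenerates only in a direction seen by the closing integral. *)
Lemma coercivity : exists C1 C2, 0 < C1 /\ 0 < C2 /\ forall f f1 : R -> R,
  (forall x, is_derive f x (f1 x)) -> (forall x, continuous f1 x) -> RInt f 0 PI = 0 ->
  RInt (fun x => f1 x ^ 2) 0 PI <= C1 * RInt (fun x => f1 x ^ 2 - W2 * cos (Th x) * f x ^ 2) 0 PI
     + C2 * RInt (fun x => cos (Th x) * f x) 0 PI ^ 2.
Proof.
  pose proof h_pos as hp. pose proof (td_W2 TD) as W0. pose proof nu_pos as N0.
  set (CC := (2 * ((Th1 h + 1) / sin th0) ^ 2 + (4 * (((Th1 h + 1) / sin th0) * h) ^ 2 + 4) * h)).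
  assert (C0 : 0 < CC).
  { unfold CC. pose proof (pow2_ge_0 ((Th1 h + 1) / sin th0)). pose proof (pow2_ge_0 ((Th1 h + 1) / sin th0 * h)). nra. }
  exists (1 + 2 * W2 * (4 * h * CC + / (2 * nu))).
  exists (2 * W2 * (4 * h * CC * 2 * (1 + 2 * CC * W2 ^ 2) + (1 + 2 * CC * W2 ^ 2) / nu) / 4).
  split; [|split].
  { pos. }
  { pos. }
  intros f f1 D C1 M.
  assert (Cf : forall x, continuous f x) by cnt.
  set (e := fun x => / 2 * (f x + f (PI - x))). set (o := fun x => / 2 * (f x - f (PI - x))).
  set (e1 := fun x => / 2 * (f1 x - f1 (PI - x))). set (o1 := fun x => / 2 * (f1 x + f1 (PI - x))).
  assert (De : forall x, is_derive e x (e1 x)) by (unfold e, e1; der).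
  assert (Do : forall x, is_derive o x (o1 x)) by (unfold o, o1; der).
  assert (Ce1 : forall x, continuous e1 x) by (unfold e1; cnt).
  assert (Co1 : forall x, continuous o1 x) by (unfold o1; cnt).
  (* [even_part] requires a zero at [PI]. The subtracted constant is recovered from the mean-zero
     condition, which bounds it by the mean of [v]. *)
  set (b := e PI). set (v := fun x => e x - b).
  assert (Dv : forall x, is_derive v x (e1 x)) by (unfold v; der).
  assert (Cv : forall x, continuous v x) by cnt.
  set (G := RInt (fun x => cos (Th x) * v x) h PI). set (X := G ^ 2 + Qh v e1).
  assert (vb : forall x, h <= x <= PI -> v x ^ 2 <= CC * X) by (apply even_part; [exact Dv|auto|unfold v, b; ring]).
  assert (E1 : forall g : R -> R, (forall x, continuous g x) -> RInt g 0 PI = RInt (fun x => g x + g (PI - x)) h PI) by (intros; now apply is_RInt_fold).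
  assert (HG : RInt (fun x => cos (Th x) * f x) 0 PI = 2 * G).
  { rewrite E1 by cnt.
    rewrite (RInt_ext _ (fun x => 2 * (cos (Th x) * v x) + 2 * b * cos (Th x))) by (intros; rewrite cosTh_sym; unfold v, e; Rfield).
    rlin. rewrite closed_half. fold G. Rring. }
  assert (PIh : PI - h = h) by (unfold h; field).
  assert (Hm : h * b = - RInt v h PI).
  { rewrite E1, (RInt_ext _ (fun x => 2 * v x + 2 * b)) in M by (exact Cf || (intros; unfold v, e; Rfield)).
    revert M. rlin. rewrite PIh. intros E. change (2 * RInt v h PI + 2 * (h * b) = 0) in E. lra. }
  assert (Hb : b ^ 2 <= CC * X).
  { assert (h ^ 2 * b ^ 2 <= h ^ 2 * (CC * X)); [|apply Rmult_le_reg_l with (h ^ 2); [apply pow_lt; lra|assumption]].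
    replace (h ^ 2 * b ^ 2) with ((h * b) ^ 2) by ring. rewrite Hm.
    replace ((- RInt v h PI) ^ 2) with (RInt v h PI ^ 2) by Rring.
    eapply Rle_trans; [apply RInt_sqr_CS; [lra|intros; apply Cv]|].
    rewrite PIh. replace (h ^ 2 * (CC * X)) with (h * (h * (CC * X))) by ring.
    apply Rmult_le_compat_l; [lra|].
    eapply Rle_trans; [apply (RInt_const_le (fun x => v x ^ 2) h PI (CC * X)); [lra|cnt|exact vb]|].
    rewrite PIh. lra. }
  assert (Qev : Qh v e1 = Qh e e1 + 2 * b * W2 * G).
  { unfold Qh. rewrite (RInt_ext _ (fun x => (e1 x ^ 2 - W2 * cos (Th x) * e x ^ 2) + (2 * b * W2 * (cos (Th x) * v x) + W2 * b ^ 2 * cos (Th x))))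
      by (intros; unfold v; Rring).
    rlin. rewrite closed_half. fold G. Rring. }
  assert (HQ : RInt (fun x => f1 x ^ 2 - W2 * cos (Th x) * f x ^ 2) 0 PI = 2 * Qh e e1 + 2 * Qh o o1).
  { rewrite E1 by cnt.
    rewrite (RInt_ext _ (fun x => 2 * (e1 x ^ 2 - W2 * cos (Th x) * e x ^ 2) + 2 * (o1 x ^ 2 - W2 * cos (Th x) * o x ^ 2)))
      by (intros; rewrite cosTh_sym; unfold e, e1, o, o1; Rfield).
    rewrite RInt_Rplus, !RInt_Rscal by cnt. reflexivity. }
  set (Io := RInt (fun x => o x ^ 2) h PI).
  assert (Io0 : 0 <= Io) by (apply RInt_nonneg_on; [lra|cnt|pos]).
  assert (HI : nu * Io <= Qh o o1).
  { apply odd_part; auto. unfold o. rewrite PIh. ring. }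
  assert (HN : RInt (fun x => f1 x ^ 2) 0 PI <= RInt (fun x => f1 x ^ 2 - W2 * cos (Th x) * f x ^ 2) 0 PI + 2 * W2 * (4 * h * CC * X + Io)).
  { apply Rle_trans with (RInt (fun x => (f1 x ^ 2 - W2 * cos (Th x) * f x ^ 2) + W2 * f x ^ 2) 0 PI).
    - apply RInt_le_on; [lra|cnt|cnt|].
      + intros y _. pose proof (COS_bound (Th y)). pose proof (pow2_ge_0 (f y)).
        assert (W2 * (cos (Th y) * f y ^ 2) <= W2 * (1 * f y ^ 2)) by (apply Rmult_le_compat_l; [lra|apply Rmult_le_compat_r; lra]). lra.
    - rewrite RInt_Rplus by cnt. apply Rplus_le_compat_l. rewrite RInt_Rscal by cnt.
      rewrite (Rmult_comm 2 W2), Rmult_assoc. apply Rmult_le_compat_l; [lra|].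
      rewrite E1 by cnt. rewrite (RInt_ext _ (fun x => 2 * e x ^ 2 + 2 * o x ^ 2)) by (intros; unfold e, o; Rfield).
      rewrite RInt_Rplus, !RInt_Rscal by cnt. fold Io.
      assert (RInt (fun x => e x ^ 2) h PI <= (PI - h) * (4 * (CC * X))).
      { apply RInt_const_le; [lra|cnt|]. intros x Hx. specialize (vb x Hx).
        replace (e x) with (v x + b) by (unfold v; ring). nra. }
      rewrite PIh in H. lra. }
  rewrite HG.
  replace (2 * W2 * (4 * h * CC * 2 * (1 + 2 * CC * W2 ^ 2) + (1 + 2 * CC * W2 ^ 2) / nu) / 4 * (2 * G) ^ 2) with
   (2 * W2 * (4 * h * CC * 2 * (1 + 2 * CC * W2 ^ 2) + (1 + 2 * CC * W2 ^ 2) / nu) * G ^ 2) by lra.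
  apply (coercivity_alg CC W2 nu (Qh e e1) (Qh o o1) Io G _ b X _ C0 W0 N0); try assumption.
  unfold X. lra.
Qed.
End Coercivity.

(** * The nonlinearity on Fourier coefficients *)

Lemma Wb_plus A B r f g : Wb A r f -> Wb B r g -> Wb (A + B) r (fun n => f n + g n).
Proof.
  intros Hf Hg n. le_via Rabs_triang. specialize (Hf n). specialize (Hg n).
  lra.
Qed.

Lemma Wb_scal c A r f : Wb A r f -> Wb (Rabs c * A) r (fun n => c * f n).
Proof.
  intros Hf n. rewrite Rabs_mult, !Rmult_assoc. apply Rmult_le_compat_l; pos.
  rewrite <- Rmult_assoc. apply Hf.
Qed.

Lemma Wb_le A r f g : (forall n, Rabs (f n) <= Rabs (g n)) -> Wb A r g -> Wb A r f.
Proof. intros H Hg n. eapply Rle_trans; auto. Qed.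

Lemma Wb_ext A r f g : (forall n, f n = g n) -> Wb A r g -> Wb A r f.
Proof. intros H. apply Wb_le. intros n. rewrite H. lra. Qed.

(** For [b] the cosine coefficients of the angle, [qs] holds the sine coefficients of [th_x] and
    [ps] the cosine coefficients of [th_xx]. Because two sines multiply with a minus sign, [q2s]
    represents [- th_x^2], [q3s] the sine series of [- th_x^3], and [q4s] represents [th_x^4]. *)
Definition qs (b : Z -> R) (n : Z) : R := - IZR n * b n.
Definition ps (b : Z -> R) (n : Z) : R := - IZR n ^ 2 * b n.
Definition q2s (b : Z -> R) : Z -> R := conv (qs b) (qs b).
Definition q3s (b : Z -> R) : Z -> R := conv (q2s b) (qs b).
Definition q4s (b : Z -> R) : Z -> R := conv (q2s b) (q2s b).
Definition pps (b : Z -> R) : Z -> R := conv (ps b) (ps b).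
Definition Pc (b : Z -> R) (L : R) (n : Z) : R := 2 * pps b n - q4s b n - L * q2s b n.
(** Sine coefficients of the primitive of [Pc] minus its mean, where [Pc] represents
    [2 th_xx^2 - th_x^4 + L th_x^2]. It is the nonlocal part of the tangential velocity. *)
Definition Rc (b : Z -> R) (L : R) (n : Z) : R := if Z.eq_dec n 0 then 0 else Pc b L n / IZR n.
(** Coefficients of [-5 th_x^2 th_xx + L th_xx + th_x R]; the factor [5 / 3] arises from writing the
    cubic term as a derivative of [th_x^3]. *)
Definition Nc (b : Z -> R) (L : R) (n : Z) : R :=
  5 / 3 * (IZR n * q3s b n) + L * ps b n - conv (qs b) (Rc b L) n.

Lemma IZR_abs_ge_1 n : n <> 0%Z -> 1 <= Rabs (IZR n).
Proof. intros H. rewrite <- abs_IZR. apply IZR_le. lia. Qed.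

Lemma w2_n n : Rabs (IZR n) * w n ^ 2 <= w n.
Proof.
  unfold w. pose proof (w_den n). rewrite <- (pow2_abs (IZR n)) in *. set (x := Rabs (IZR n)) in *.
  apply Rmult_le_reg_r with ((1 + x ^ 2)^2); [nra|].
  replace (x * (/ (1 + x ^ 2)) ^ 2 * (1 + x ^ 2) ^ 2) with x by (field; lra).
  replace (/ (1 + x ^ 2) * (1 + x ^ 2) ^ 2) with (1 + x ^ 2) by (field; lra).
  nra.
Qed.

Lemma w2_n2 n : IZR n ^ 2 * w n ^ 2 <= w n.
Proof.
  unfold w. pose proof (w_den n). set (x := IZR n) in *.
  apply Rmult_le_reg_r with ((1 + x ^ 2)^2); [nra|].
  replace (x ^ 2 * (/ (1 + x ^ 2)) ^ 2 * (1 + x ^ 2) ^ 2) with (x ^ 2) by (field; lra).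
  replace (/ (1 + x ^ 2) * (1 + x ^ 2) ^ 2) with (1 + x ^ 2) by (field; lra). lra.
Qed.

(** Mode zero is left free: it is the mean angle, on which the nonlinearity does not depend because
    it sees only derivatives. *)
Definition Wb2 (A r : R) (b : Z -> R) : Prop :=
  forall n, n <> 0%Z -> Rabs (b n) <= A * w n ^ 2 * exp (- (r * Rabs (IZR n))).

Lemma qs_Wb A r b : 0 <= A -> Wb2 A r b -> Wb A r (qs b).
Proof.
  intros HA H n. unfold qs. destruct (Z.eq_dec n 0) as [->|Hn].
  - rewrite Ropp_0, Rmult_0_l, Rabs_R0. repeat apply Rmult_le_pos; [lra|left; apply w_pos|pos].
  - rewrite Rabs_mult, Rabs_Ropp. eapply Rle_trans; [apply Rmult_le_compat_l; [apply Rabs_pos|now apply H]|].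
    rewrite <- !Rmult_assoc. apply Rmult_le_compat_r; pos.
    rewrite (Rmult_comm _ A), Rmult_assoc. apply Rmult_le_compat_l; [lra|apply w2_n].
Qed.

Lemma ps_Wb A r b : 0 <= A -> Wb2 A r b -> Wb A r (ps b).
Proof.
  intros HA H n. unfold ps. destruct (Z.eq_dec n 0) as [->|Hn].
  - replace (- 0 ^ 2 * b 0%Z) with 0 by ring.
    rewrite Rabs_R0. repeat apply Rmult_le_pos; [lra|left; apply w_pos|pos].
  - rewrite Rabs_mult, Rabs_Ropp, (Rabs_pos_eq (IZR n ^ 2)) by pos.
    eapply Rle_trans; [apply Rmult_le_compat_l; [apply pow2_ge_0|now apply H]|].
    rewrite <- !Rmult_assoc. apply Rmult_le_compat_r; pos.
    rewrite (Rmult_comm _ A), Rmult_assoc. apply Rmult_le_compat_l; [lra|apply w2_n2].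
Qed.

(** The constants named with [k] bound the sequences above, those named with [l] bound their
    Lipschitz dependence on [b] and [L]; [Lm] bounds [L]. *)
Definition k2 (K : R) := 4 * Sw * K * K.
Definition l2 (K : R) := 4 * Sw * (K + K).
Definition k3 (K : R) := 4 * Sw * k2 K * K.
Definition l3 (K : R) := 4 * Sw * (l2 K * K + k2 K).
Definition k4 (K : R) := 4 * Sw * k2 K * k2 K.
Definition l4 (K : R) := 4 * Sw * (l2 K * k2 K + k2 K * l2 K).
Definition kP (K Lm : R) := 2 * k2 K + k4 K + Lm * k2 K.
Definition lP (K Lm : R) := 2 * l2 K + l4 K + Lm * l2 K + k2 K.
Definition kN (K Lm : R) := 5 / 3 * k3 K + Lm * K + 4 * Sw * K * kP K Lm.
Definition lN (K Lm : R) := 5 / 3 * l3 K + (Lm + K) + 4 * Sw * (kP K Lm + K * lP K Lm).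

Lemma k_nonneg K Lm : 0 <= K -> 0 <= Lm ->
  0 <= k2 K /\ 0 <= l2 K /\ 0 <= k3 K /\ 0 <= l3 K /\ 0 <= k4 K /\ 0 <= l4 K /\
  0 <= kP K Lm /\ 0 <= lP K Lm /\ 0 <= kN K Lm /\ 0 <= lN K Lm.
Proof.
  intros HK HL. pose proof Sw_ge_1 as S.
  assert (0 <= k2 K) by (unfold k2; repeat apply Rmult_le_pos; lra).
  assert (0 <= l2 K) by (unfold l2; repeat apply Rmult_le_pos; lra).
  assert (0 <= k3 K) by (unfold k3; repeat apply Rmult_le_pos; lra).
  assert (0 <= l3 K) by (unfold l3; apply Rmult_le_pos; [lra|]; pose proof (Rmult_le_pos _ _ H0 HK); lra).
  assert (0 <= k4 K) by (unfold k4; repeat apply Rmult_le_pos; lra).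
  assert (0 <= l4 K) by (unfold l4; apply Rmult_le_pos; [lra|]; pose proof (Rmult_le_pos _ _ H0 H); lra).
  assert (0 <= kP K Lm) by (unfold kP; pose proof (Rmult_le_pos _ _ HL H); lra).
  assert (0 <= lP K Lm) by (unfold lP; pose proof (Rmult_le_pos _ _ HL H0); lra).
  repeat split; auto.
  - unfold kN. pos.
  - unfold lN. pos.
Qed.

Lemma q2s_Wb A r b : 0 <= r -> 0 <= A -> Wb2 A r b -> Wb (k2 A) r (q2s b).
Proof. intros Hr HA H. apply conv_Wb; auto; now apply qs_Wb. Qed.

Lemma q3s_Wb A r b : 0 <= r -> 0 <= A -> Wb2 A r b -> Wb (k3 A) r (q3s b).
Proof. intros Hr HA H. apply conv_Wb; auto; [now apply q2s_Wb|now apply qs_Wb]. Qed.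

Lemma q4s_Wb A r b : 0 <= r -> 0 <= A -> Wb2 A r b -> Wb (k4 A) r (q4s b).
Proof. intros Hr HA H. apply conv_Wb; auto; now apply q2s_Wb. Qed.

Lemma pps_Wb A r b : 0 <= r -> 0 <= A -> Wb2 A r b -> Wb (k2 A) r (pps b).
Proof. intros Hr HA H. apply conv_Wb; auto; now apply ps_Wb. Qed.

Lemma Pc_Wb A r b L Lm : 0 <= r -> 0 <= A -> Rabs L <= Lm -> Wb2 A r b -> Wb (kP A Lm) r (Pc b L).
Proof.
  intros Hr HA HL H.
  apply (Wb_mono (Rabs 2 * k2 A + Rabs (-1) * k4 A + Rabs (- L) * k2 A)).
  - unfold kP. rewrite (Rabs_left (-1)), (Rabs_pos_eq 2), Rabs_Ropp by lra.
    destruct (k_nonneg A 0 HA (Rle_refl 0)) as [H2 _].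
    pose proof (Rmult_le_compat_r _ _ _ H2 HL). lra.
  - apply (Wb_ext _ _ _ (fun n => 2 * pps b n + (-1) * q4s b n + - L * q2s b n)); [intros; unfold Pc; ring|].
    repeat apply Wb_plus; apply Wb_scal; [now apply pps_Wb|now apply q4s_Wb|now apply q2s_Wb].
Qed.

Lemma Rc_abs b L n : Rabs (Rc b L n) <= Rabs (Pc b L n).
Proof.
  unfold Rc. destruct Z.eq_dec as [_|Hn]; [rewrite Rabs_R0; apply Rabs_pos|].
  unfold Rdiv. rewrite Rabs_mult, Rabs_inv. rewrite <- (Rmult_1_r (Rabs (Pc b L n))) at 2.
  apply Rmult_le_compat_l; pos.
  rewrite <- Rinv_1. apply Rinv_le_contravar; [lra|now apply IZR_abs_ge_1].
Qed.

Lemma Rc_Wb A r b L Lm : 0 <= r -> 0 <= A -> Rabs L <= Lm -> Wb2 A r b -> Wb (kP A Lm) r (Rc b L).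
Proof. intros. eapply Wb_le; [apply Rc_abs|now apply Pc_Wb]. Qed.

(** Only the cubic term carries a factor [n]. Relative to [w^2] the loss is of third order, less
    than the four orders gained from the linear part. *)
Lemma Nc_bound A r b L Lm n : 0 <= r -> 0 <= A -> Rabs L <= Lm -> Wb2 A r b ->
  Rabs (Nc b L n) <= kN A Lm * (1 + Rabs (IZR n)) * w n * exp (- (r * Rabs (IZR n))).
Proof.
  intros Hr HA HL H.
  pose proof (q3s_Wb A r b Hr HA H n) as B3.
  pose proof (ps_Wb A r b HA H n) as Bp.
  pose proof (conv_Wb A (kP A Lm) r _ _ Hr (qs_Wb A r b HA H) (Rc_Wb A r b L Lm Hr HA HL H) n) as BR.
  assert (Lm0 : 0 <= Lm) by (pose proof (Rabs_pos L); lra).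
  destruct (k_nonneg A Lm HA Lm0) as [? [? [? [? [? [? [? [? [? ?]]]]]]]]].
  set (e := w n * exp (- (r * Rabs (IZR n)))) in *. rewrite Rmult_assoc in B3, Bp, BR. fold e in B3, Bp, BR.
  assert (e0 : 0 <= e) by (apply Rmult_le_pos; left; [apply w_pos|pos]).
  rewrite Rmult_assoc. fold e. unfold Nc.
  pose proof (Rabs_pos (IZR n)) as n0. set (x := Rabs (IZR n)) in *.
  assert (T1 : Rabs (5 / 3 * (IZR n * q3s b n)) <= 5 / 3 * x * (k3 A * e)).
  { rewrite !Rabs_mult, (Rabs_pos_eq (5 / 3)) by lra. fold x. nra. }
  assert (T2 : Rabs (L * ps b n) <= Lm * (A * e)).
  { rewrite Rabs_mult. apply Rmult_le_compat; pos. }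
  set (u := 5 / 3 * (IZR n * q3s b n)) in *. set (v := L * ps b n) in *.
  set (c := conv (qs b) (Rc b L) n) in *.
  pose proof (Rabs_triang (u + v) (- c)). pose proof (Rabs_triang u v). rewrite Rabs_Ropp in H10.
  unfold Rminus.
  unfold kN.
  assert (0 <= (Lm * A + 4 * Sw * A * kP A Lm) * x * e).
  { pose proof Sw_ge_1. pos. }
  nra.
Qed.

Definition lipdata (K d : R) (b b' : Z -> R) : Prop :=
  Wb2 K 0 b /\ Wb2 K 0 b' /\ Wb2 d 0 (fun n => b n - b' n).

Lemma qs_lip K d b b' : 0 <= d -> lipdata K d b b' -> Wb d 0 (fun n => qs b n - qs b' n).
Proof. intros Hd [_ [_ H]]. eapply Wb_ext; [|apply (qs_Wb d 0 _ Hd H)]. intros n. unfold qs. ring. Qed.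
Lemma ps_lip K d b b' : 0 <= d -> lipdata K d b b' -> Wb d 0 (fun n => ps b n - ps b' n).
Proof. intros Hd [_ [_ H]]. eapply Wb_ext; [|apply (ps_Wb d 0 _ Hd H)]. intros n. unfold ps. ring. Qed.

Lemma Wb_conv_lip A d B e f g f' g' l : Wb A 0 f' -> Wb B 0 g ->
  Wb d 0 (fun n => f n - f' n) -> Wb e 0 (fun n => g n - g' n) -> 4 * Sw * (d * B + A * e) = l ->
  Wb l 0 (fun n => conv f g n - conv f' g' n).
Proof. intros ? ? ? ? <-. now apply conv_lip. Qed.

Lemma q2s_lip K d b b' : 0 <= K -> 0 <= d -> lipdata K d b b' -> Wb (l2 K * d) 0 (fun n => q2s b n - q2s b' n).
Proof.
  intros HK Hd H. pose proof (qs_lip _ _ _ _ Hd H). destruct H as [H1 [H2 H3]].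
  apply (Wb_conv_lip K d K d); try assumption; [now apply qs_Wb|now apply qs_Wb|]. unfold l2. ring.
Qed.

Lemma q3s_lip K d b b' : 0 <= K -> 0 <= d -> lipdata K d b b' -> Wb (l3 K * d) 0 (fun n => q3s b n - q3s b' n).
Proof.
  intros HK Hd H. pose proof (qs_lip _ _ _ _ Hd H). pose proof (q2s_lip _ _ _ _ HK Hd H). destruct H as [H1' [H2 H3]].
  apply (Wb_conv_lip (k2 K) (l2 K * d) K d); try assumption; [apply q2s_Wb; try assumption; lra|now apply qs_Wb|]. unfold l3. ring.
Qed.

Lemma q4s_lip K d b b' : 0 <= K -> 0 <= d -> lipdata K d b b' -> Wb (l4 K * d) 0 (fun n => q4s b n - q4s b' n).
Proof.
  intros HK Hd H. pose proof (q2s_lip _ _ _ _ HK Hd H). destruct H as [H1' [H2 H3]].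
  apply (Wb_conv_lip (k2 K) (l2 K * d) (k2 K) (l2 K * d)); try assumption; [apply q2s_Wb; try assumption; lra|apply q2s_Wb; try assumption; lra|]. unfold l4. ring.
Qed.

Lemma pps_lip K d b b' : 0 <= K -> 0 <= d -> lipdata K d b b' -> Wb (l2 K * d) 0 (fun n => pps b n - pps b' n).
Proof.
  intros HK Hd H. pose proof (ps_lip _ _ _ _ Hd H). destruct H as [H1 [H2 H3]].
  apply (Wb_conv_lip K d K d); try assumption; [now apply ps_Wb|now apply ps_Wb|]. unfold l2. ring.
Qed.

Lemma Pc_lip K d b b' L L' Lm : 0 <= K -> 0 <= d -> lipdata K d b b' ->
  Rabs L <= Lm -> Rabs (L - L') <= d -> Wb (lP K Lm * d) 0 (fun n => Pc b L n - Pc b' L' n).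
Proof.
  intros HK Hd H HL HLL.
  pose proof (pps_lip _ _ _ _ HK Hd H) as P1. pose proof (q4s_lip _ _ _ _ HK Hd H) as P2.
  pose proof (q2s_lip _ _ _ _ HK Hd H) as P3. destruct H as [H1 [H2 H3]].
  pose proof (q2s_Wb K 0 b' (Rle_refl 0) HK H2) as P4.
  assert (Lm0 : 0 <= Lm) by (pose proof (Rabs_pos L); lra).
  destruct (k_nonneg K Lm HK Lm0) as [? [? _]].
  apply (Wb_mono (Rabs 2 * (l2 K * d) + Rabs (-1) * (l4 K * d) + Rabs (- L) * (l2 K * d) + Rabs (- (L - L')) * k2 K)).
  - rewrite (Rabs_left (-1)), (Rabs_pos_eq 2), !Rabs_Ropp by lra. unfold lP.
    pose proof (Rmult_le_compat_r (l2 K * d) _ _ ltac:(now apply Rmult_le_pos) HL).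
    nra.
  - apply (Wb_ext _ _ _ (fun n => 2 * (pps b n - pps b' n) + (-1) * (q4s b n - q4s b' n) +
       - L * (q2s b n - q2s b' n) + - (L - L') * q2s b' n)); [intros; unfold Pc; ring|].
    repeat apply Wb_plus; now apply Wb_scal.
Qed.

Lemma Rc_lip K d b b' L L' Lm : 0 <= K -> 0 <= d -> lipdata K d b b' ->
  Rabs L <= Lm -> Rabs (L - L') <= d -> Wb (lP K Lm * d) 0 (fun n => Rc b L n - Rc b' L' n).
Proof.
  intros HK Hd H HL HLL. eapply Wb_le; [|apply (Pc_lip K d b b' L L' Lm HK Hd H HL HLL)].
  intros n. unfold Rc. destruct Z.eq_dec as [_|Hn].
  - rewrite Rminus_diag, Rabs_R0. pos.
  - replace (Pc b L n / IZR n - Pc b' L' n / IZR n) with ((Pc b L n - Pc b' L' n) * / IZR n) by lra.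
    rewrite Rabs_mult, Rabs_inv. rewrite <- (Rmult_1_r (Rabs (Pc b L n - Pc b' L' n))) at 2.
    apply Rmult_le_compat_l; pos.
    rewrite <- Rinv_1. apply Rinv_le_contravar; [lra|now apply IZR_abs_ge_1].
Qed.

Lemma Nc_lip K d b b' L L' Lm n : 0 <= K -> 0 <= d -> lipdata K d b b' ->
  Rabs L <= Lm -> Rabs L' <= Lm -> Rabs (L - L') <= d ->
  Rabs (Nc b L n - Nc b' L' n) <= lN K Lm * d * (1 + Rabs (IZR n)) * w n.
Proof.
  intros HK Hd H HL HL' HLL.
  assert (Lm0 : 0 <= Lm) by (pose proof (Rabs_pos L); lra).
  destruct (k_nonneg K Lm HK Lm0) as [? [? [? [? [? [? [? [? [? ?]]]]]]]]].
  pose proof (Wb_w _ _ _ (Rle_refl 0) (q3s_lip _ _ _ _ HK Hd H) n) as P1.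
  pose proof (Wb_w _ _ _ (Rle_refl 0) (ps_lip _ _ _ _ Hd H) n) as P2.
  pose proof (qs_lip _ _ _ _ Hd H) as P3.
  pose proof (Rc_lip K d b b' L L' Lm HK Hd H HL HLL) as P4.
  destruct H as [B1 [B2 B3]].
  pose proof (Wb_w _ _ _ (Rle_refl 0) (ps_Wb K 0 b' HK B2) n) as P5.
  assert (P6 : Wb (4 * Sw * (d * kP K Lm + K * (lP K Lm * d))) 0
      (fun n => conv (qs b) (Rc b L) n - conv (qs b') (Rc b' L') n)) by (apply conv_lip; auto; [now apply qs_Wb|apply Rc_Wb; auto; lra]).
  pose proof (Wb_w _ _ _ (Rle_refl 0) P6 n) as P7.
  pose proof (w_pos n) as w0. pose proof (Rabs_pos (IZR n)) as n0. set (x := Rabs (IZR n)) in *.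
  unfold Nc.
  set (u := 5 / 3 * (IZR n * (q3s b n - q3s b' n))).
  set (v := L * (ps b n - ps b' n)). set (v' := (L - L') * ps b' n).
  set (c := conv (qs b) (Rc b L) n - conv (qs b') (Rc b' L') n) in *.
  replace (_ - _) with (u + v + v' + - c) by (unfold u, v, v', c; ring).
  assert (T1 : Rabs u <= 5 / 3 * x * (l3 K * d * w n)).
  { unfold u. rewrite !Rabs_mult, (Rabs_pos_eq (5 / 3)) by lra. fold x. nra. }
  assert (T2 : Rabs v <= Lm * (d * w n)).
  { unfold v. rewrite Rabs_mult. apply Rmult_le_compat; pos. }
  assert (T3 : Rabs v' <= d * (K * w n)).
  { unfold v'. rewrite Rabs_mult. apply Rmult_le_compat; pos. }
  pose proof (Rabs_triang (u + v + v') (- c)). pose proof (Rabs_triang (u + v) v'). pose proof (Rabs_triang u v).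
  rewrite Rabs_Ropp in H.
  unfold lN.
  assert (dw : 0 <= d * w n) by pos.
  assert (0 <= 4 * Sw * (kP K Lm + K * lP K Lm)).
  { pose proof Sw_ge_1. pos. }
  assert (0 <= (Lm + K + 4 * Sw * (kP K Lm + K * lP K Lm)) * x * (d * w n)) by pos.
  nra.
Qed.

Lemma conv_continuous (A B : R) (f g : Z -> R -> R) (n : Z) (t : R) :
  (forall s, Wb A 0 (fun n => f n s)) -> (forall s, Wb B 0 (fun n => g n s)) ->
  (forall n, continuous (f n) t) -> (forall n, continuous (g n) t) ->
  continuous (fun s => conv (fun n => f n s) (fun n => g n s) n) t.
Proof.
  intros Hf Hg Cf Cg.
  apply (sumZ_lim (locally t) (fun k s => f k s * g (n - k)%Z s) _
     (fun k => A * B * w n * exp (- (0 * Rabs (IZR n))) * (2 * w k + 2 * w (n - k)%Z))).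
  - apply summ_scal, summ_ww.
  - apply filter_forall. intros s k. exact (conv_term A B 0 _ _ n k (Rle_refl 0) (Hf s) (Hg s)).
  - intros k. apply (continuous_mult (K := R_AbsRing) (f k) (g (n - k)%Z)); auto.
Qed.

Section NcCont.
Variables (b : Z -> R -> R) (L : R -> R) (K Lm t : R).
Hypothesis K0 : 0 <= K.
Hypothesis b_bd : forall s, Wb2 K 0 (fun n => b n s).
Hypothesis L_bd : forall s, Rabs (L s) <= Lm.
Hypothesis b_cont : forall n, continuous (b n) t.
Hypothesis L_cont : continuous L t.

Lemma qs_cont n : continuous (fun s => qs (fun n => b n s) n) t.
Proof. apply (continuous_mult (K := R_AbsRing)); cnt. Qed.
Lemma ps_cont n : continuous (fun s => ps (fun n => b n s) n) t.
Proof. apply (continuous_mult (K := R_AbsRing)); cnt. Qed.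
Lemma q2s_cont n : continuous (fun s => q2s (fun n => b n s) n) t.
Proof.
  apply (conv_continuous K K (fun n s => qs (fun n => b n s) n) (fun n s => qs (fun n => b n s) n) n t);
  try (intros; apply qs_cont); intros s; now apply qs_Wb.
Qed.
Lemma q3s_cont n : continuous (fun s => q3s (fun n => b n s) n) t.
Proof.
  apply (conv_continuous (k2 K) K (fun n s => q2s (fun n => b n s) n) (fun n s => qs (fun n => b n s) n) n t);
  try (intros; apply qs_cont); try (intros; apply q2s_cont); intros s; [apply q2s_Wb; auto; lra|now apply qs_Wb].
Qed.
Lemma q4s_cont n : continuous (fun s => q4s (fun n => b n s) n) t.
Proof.
  apply (conv_continuous (k2 K) (k2 K) (fun n s => q2s (fun n => b n s) n) (fun n s => q2s (fun n => b n s) n) n t);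
  try (intros; apply q2s_cont); intros s; apply q2s_Wb; auto; lra.
Qed.
Lemma pps_cont n : continuous (fun s => pps (fun n => b n s) n) t.
Proof.
  apply (conv_continuous K K (fun n s => ps (fun n => b n s) n) (fun n s => ps (fun n => b n s) n) n t);
  try (intros; apply ps_cont); intros s; now apply ps_Wb.
Qed.
#[local] Hint Resolve qs_cont ps_cont q2s_cont q3s_cont q4s_cont pps_cont : cont.
Lemma Pc_cont n : continuous (fun s => Pc (fun n => b n s) (L s) n) t.
Proof. unfold Pc. cnt. Qed.
#[local] Hint Resolve Pc_cont : cont.
Lemma Rc_cont n : continuous (fun s => Rc (fun n => b n s) (L s) n) t.
Proof. unfold Rc. destruct Z.eq_dec; cnt. Qed.
Lemma Nc_cont n : continuous (fun s => Nc (fun n => b n s) (L s) n) t.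
Proof.
  apply continuous_Rminus_c; [cnt|].
  apply (conv_continuous K (kP K Lm) (fun n s => qs (fun n => b n s) n) (fun n s => Rc (fun n => b n s) (L s) n) n t);
    try (intros; apply qs_cont); try (intros; apply Rc_cont); intros s; [now apply qs_Wb|].
    apply Rc_Wb; auto; lra.
Qed.
End NcCont.

(** * The truncated angle equation *)

Definition clampR (c x : R) : R := Rmax (- c) (Rmin c x).

Lemma clampR_abs c x : 0 <= c -> Rabs (clampR c x) <= c.
Proof. intros H. unfold clampR, Rmax, Rmin. apply Rabs_le_between. repeat destruct Rle_dec; lra. Qed.
Lemma clampR_id c x : Rabs x <= c -> clampR c x = x.
Proof. intros H. apply Rabs_le_between in H. unfold clampR, Rmax, Rmin. repeat destruct Rle_dec; lra. Qed.
Lemma clampR_lip c x y : Rabs (clampR c x - clampR c y) <= Rabs (x - y).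
Proof. unfold clampR, Rmax, Rmin, Rabs. repeat destruct Rle_dec; repeat destruct Rcase_abs; lra. Qed.

Lemma continuous_Rmax (f g : R -> R) t : continuous f t -> continuous g t -> continuous (fun s => Rmax (f s) (g s)) t.
Proof.
  intros Hf Hg. apply (continuous_ext (fun s => (f s + g s + Rabs (f s - g s)) / 2)).
  { intros s. unfold Rmax, Rabs. destruct Rle_dec; destruct Rcase_abs; lra. }
  cnt.
Qed.
Lemma continuous_Rmin (f g : R -> R) t : continuous f t -> continuous g t -> continuous (fun s => Rmin (f s) (g s)) t.
Proof.
  intros Hf Hg. apply (continuous_ext (fun s => - Rmax (- f s) (- g s))).
  { intros s. unfold Rmax, Rmin. repeat destruct Rle_dec; lra. }
  apply (continuous_opp (V := R_NormedModule)). apply continuous_Rmax; cnt.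
Qed.
#[local] Hint Resolve continuous_Rmax continuous_Rmin : cont.

Section Truncated.

Variables (K T0 L1 L2 L0 : R) (a0 : Z -> R).
Hypothesis K0 : 0 < K.
Hypothesis T00 : 0 <= T0.
Hypothesis L10 : 0 < L1.
Hypothesis L12 : L1 <= L2.
Hypothesis a0_even : forall n, a0 (- n)%Z = a0 n.
Hypothesis a0_bd : exists A, forall n, Rabs (a0 n) <= A * w n ^ 2.

(** Freezes all quantities at their initial values for negative times, so that continuity statements
    hold on the whole line. *)
Definition tpos (t : R) : R := Rmax 0 t.
Lemma pos_ge t : 0 <= tpos t. Proof. apply Rmax_l. Qed.
Lemma pos_id t : 0 <= t -> tpos t = t. Proof. now apply Rmax_right. Qed.
Lemma pos_le_abs t : tpos t <= Rabs t.
Proof. unfold tpos, Rmax, Rabs. destruct Rle_dec; destruct Rcase_abs; lra. Qed.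
Lemma pos_cont t : continuous tpos t.
Proof. apply continuous_Rmax; cnt. Qed.

(** The clamping level. Its exponential rate grows linearly with time up to [T0], so a solution
    lying below it has gained an analyticity strip at every positive time, from initial data of mere
    [w^2] decay. *)
Definition lev (n : Z) (t : R) : R := K * w n ^ 2 * exp (- (Rmin (tpos t) T0 * Rabs (IZR n))).
Lemma lev_pos n t : 0 < lev n t.
Proof. unfold lev. pose proof (w_pos n). pos. Qed.

Definition tb (a : Z -> R -> R) (n : Z) (t : R) : R := clampR (lev n t) (a n t).
Definition tL (L : R -> R) (t : R) : R := Rmax L1 (Rmin L2 (L t)).

Lemma tL_range L t : L1 <= tL L t <= L2.
Proof. unfold tL, Rmax, Rmin. repeat destruct Rle_dec; lra. Qed.
Lemma tL_abs L t : Rabs (tL L t) <= L2.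
Proof. pose proof (tL_range L t). apply Rabs_le_between. lra. Qed.
Lemma tL_lip L L' t : Rabs (tL L t - tL L' t) <= Rabs (L t - L' t).
Proof. unfold tL, Rmax, Rmin, Rabs. repeat destruct Rle_dec; repeat destruct Rcase_abs; lra. Qed.

Lemma tb_Wb a t : Wb2 K (Rmin (tpos t) T0) (fun n => tb a n t).
Proof. intros n _. apply clampR_abs. pos. Qed.

Lemma tb_Wb0 a t : Wb2 K 0 (fun n => tb a n t).
Proof.
  intros n Hn. eapply Rle_trans; [now apply (tb_Wb a t)|].
  rewrite Rmult_0_l, Ropp_0, exp_0. apply Rmult_le_compat_l.
  - apply Rmult_le_pos; pos.
  - apply exp_decay_le_1. apply Rmin_glb; [apply pos_ge|lra].
Qed.

Lemma tb_cont a n t : continuous (a n) t -> continuous (tb a n) t.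
Proof.
  intros H.
  assert (C : continuous (lev n) t).
  { apply (continuous_mult (K := R_AbsRing)); cnt.
    apply continuous_comp; [|apply continuous_exp].
    apply (continuous_opp (V := R_NormedModule)). apply (continuous_mult (K := R_AbsRing)); cnt.
    apply continuous_Rmin; [apply pos_cont|cnt]. }
  apply continuous_Rmax; [cnt|].
  cnt.
Qed.

Lemma tL_cont L t : continuous L t -> continuous (tL L) t.
Proof.
  intros H. apply continuous_Rmax; cnt.
  apply continuous_Rmin; cnt.
Qed.

Definition n4 (n : Z) : R := 2 * IZR n ^ 4.
Lemma n4_ge n : 0 <= n4 n.
Proof. unfold n4. nra. Qed.

Definition aP (f : option Z * R -> R) (n : Z) (t : R) : R := f (Some n, t).
Definition LP (f : option Z * R -> R) (t : R) : R := f (None, t).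
Definition Nf (f : option Z * R -> R) (n : Z) (s : R) : R := Nc (fun n => tb (aP f) n s) (tL (LP f) s) n.
Definition PL (f : option Z * R -> R) (s : R) : R := Pc (fun n => tb (aP f) n s) (tL (LP f) s) 0.

(** The Duhamel formula, with the nonlinearity evaluated at clamped arguments. Index [None] carries
    the scalar [L], so one fixed point treats the coupled system. *)
Definition Phi (f : option Z * R -> R) (i : option Z * R) : R :=
  match fst i with
  | Some n => exp (- (n4 n * tpos (snd i))) * (a0 n + RInt (fun s => exp (n4 n * s) * Nf f n s) 0 (tpos (snd i)))
  | None => L0 + RInt (fun s => -2 * tL (LP f) s * PL f s) 0 (tpos (snd i))
  end.

Definition good (f : option Z * R -> R) : Prop :=
  (forall o t, continuous (fun s => f (o, s)) t) /\ forall n t, f (Some (- n)%Z, t) = f (Some n, t).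

Lemma Nf_cont f n t : good f -> continuous (Nf f n) t.
Proof.
  intros [C _]. apply (Nc_cont (tb (aP f)) (tL (LP f)) K L2 t (Rlt_le _ _ K0)).
  - apply tb_Wb0. - apply tL_abs.
  - intros m. apply tb_cont. apply C. - apply tL_cont. apply C.
Qed.

Lemma Pf_cont f t : good f -> continuous (PL f) t.
Proof.
  intros [C _]. apply (Pc_cont (tb (aP f)) (tL (LP f)) K t (Rlt_le _ _ K0)).
  - apply tb_Wb0.
  - intros m. apply tb_cont. apply C. - apply tL_cont. apply C.
Qed.

Lemma eNf_cont f n t : good f -> continuous (fun s => exp (n4 n * s) * Nf f n s) t.
Proof.
  intros H. apply (continuous_mult (K := R_AbsRing)); [|now apply Nf_cont].
  apply (ex_derive_continuous (V := R_NormedModule)). auto_derive. auto.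
Qed.

Lemma LPf_cont f t : good f -> continuous (fun s => -2 * tL (LP f) s * PL f s) t.
Proof.
  intros H. apply (continuous_mult (K := R_AbsRing)); [|now apply Pf_cont].
  apply (continuous_mult (K := R_AbsRing)); cnt. apply tL_cont. apply H.
Qed.

Lemma Nc_even b L r A n : 0 <= A -> 0 <= r -> (forall m, b (- m)%Z = b m) -> Wb2 A r b -> Nc b L (- n)%Z = Nc b L n.
Proof.
  intros HA Hr He H.
  assert (Eq : forall m, qs b (- m)%Z = -1 * qs b m) by (intros m; unfold qs; rewrite opp_IZR, He; ring).
  assert (Ep : forall m, ps b (- m)%Z = 1 * ps b m) by (intros m; unfold ps; rewrite opp_IZR, He; ring).
  pose proof (qs_Wb A r b HA H) as Wq. pose proof (ps_Wb A r b HA H) as Wp.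
  pose proof (q2s_Wb A r b Hr HA H) as Wq2.
  assert (E2 : forall m, q2s b (- m)%Z = 1 * q2s b m).
  { replace 1 with (-1 * -1) by ring. apply conv_parity; auto.
    intros j. now apply (conv_summ A A r). }
  assert (E3 : forall m, q3s b (- m)%Z = -1 * q3s b m).
  { intros m. replace (-1) with (1 * -1) at 1 by ring. apply conv_parity; auto.
    intros j. now apply (conv_summ (k2 A) A r). }
  assert (E4 : forall m, q4s b (- m)%Z = 1 * q4s b m).
  { intros m. replace 1 with (1 * 1) at 1 by ring. apply conv_parity; auto.
    intros j. now apply (conv_summ (k2 A) (k2 A) r). }
  assert (E5 : forall m, pps b (- m)%Z = 1 * pps b m).
  { intros m. replace 1 with (1 * 1) at 1 by ring. apply conv_parity; auto.
    intros j. now apply (conv_summ A A r). }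
  assert (ER : forall m, Rc b L (- m)%Z = -1 * Rc b L m).
  { intros m. unfold Rc, Pc. destruct (Z.eq_dec m 0) as [->|Hm]; [simpl; ring|].
    destruct (Z.eq_dec (- m) 0) as [E|_]; [lia|]. rewrite E2, E4, E5, opp_IZR. field. now apply not_0_IZR. }
  assert (EqR : forall m, conv (qs b) (Rc b L) (- m)%Z = -1 * -1 * conv (qs b) (Rc b L) m).
  { apply conv_parity; auto. intros j. apply (conv_summ A (kP A (Rabs L)) r); auto.
    apply Rc_Wb; auto. lra. }
  unfold Nc. rewrite E3, Ep, EqR, opp_IZR. ring.
Qed.

Lemma Phi_good f : good f -> good (Phi f).
Proof.
  split.
  - intros [n|] t.
    + apply (continuous_mult (K := R_AbsRing)).
      * apply (continuous_comp tpos (fun x => exp (- (n4 n * x)))); [apply pos_cont|].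
        apply (ex_derive_continuous (V := R_NormedModule)). auto_derive. auto.
      * apply (continuous_plus (V := R_NormedModule)); cnt.
        apply continuous_comp; [apply pos_cont|].
        apply ex_derive_continuous. eexists.
        apply is_derive_RInt_var. intros; now apply eNf_cont.
    + apply (continuous_plus (V := R_NormedModule)); cnt.
      apply continuous_comp; [apply pos_cont|].
      apply ex_derive_continuous. eexists.
      apply is_derive_RInt_var. intros; now apply LPf_cont.
  - intros n t. unfold Phi; simpl.
    assert (En : n4 (- n) = n4 n) by (unfold n4; rewrite opp_IZR; ring).
    rewrite En, a0_even. f_equal. f_equal. apply RInt_ext. intros s _. f_equal.
    apply (Nc_even _ _ (Rmin (tpos s) T0) K); [lra| | |apply tb_Wb].
    + apply Rmin_glb; [apply pos_ge|lra].
    + intros m. unfold tb, aP, lev. destruct H as [_ H]. rewrite H.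
      unfold w. rewrite opp_IZR, Rabs_Ropp. now replace ((- IZR m) ^ 2) with (IZR m ^ 2) by ring.
Qed.

Definition cN : R := kN K L2 + lN K L2 + 1.
(** With [c = 8 cN], the summands [c] and [c^4] serve the inequality [c x^3 <= x^4 + c^4] in [gain].
    The third summand makes the equation for [L] contract by one half. *)
Definition MM : R := 4 * cN * 2 + (4 * cN * 2) ^ 4 + 4 * (kP K L2 + L2 * lP K L2) + 1.

Lemma consts_nonneg : 0 <= kN K L2 /\ 0 <= lN K L2 /\ 0 <= kP K L2 /\ 0 <= lP K L2.
Proof.
  destruct (k_nonneg K L2) as [? [? [? [? [? [? [? [? [? ?]]]]]]]]]; [lra|lra|]. auto.
Qed.

Lemma MM_pos : 1 <= MM /\ 4 * (kP K L2 + L2 * lP K L2) <= MM /\ 1 <= cN.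
Proof.
  destruct consts_nonneg as [? [? [? ?]]]. unfold MM. assert (1 <= cN) by (unfold cN; lra).
  nra.
Qed.

(* The weight [exp (MM t)] makes the second-order loss of the nonlinearity small against [2 n^4]. *)
Lemma gain n : cN * (1 + Rabs (IZR n)) * w n / (n4 n + MM) <= / 2 * w n ^ 2.
Proof.
  destruct consts_nonneg as [? [? [? ?]]]. destruct MM_pos as [M1 [_ c1]].
  unfold w, n4. replace (IZR n ^ 4) with ((IZR n ^ 2)^2) by ring. rewrite <- (pow2_abs (IZR n)).
  set (x := Rabs (IZR n)). assert (x0 : 0 <= x) by apply Rabs_pos.
  assert (D1 : 0 < 1 + x ^ 2) by nra. assert (D2 : 0 < 2 * (x ^ 2) ^ 2 + MM) by (pose proof (pow2_ge_0 (x^2)); lra).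
  apply Rmult_le_reg_r with (2 * (1 + x ^ 2) ^ 2 * (2 * (x ^ 2) ^ 2 + MM)); [nra|].
  replace (cN * (1 + x) * / (1 + x ^ 2) / (2 * (x ^ 2) ^ 2 + MM) * (2 * (1 + x ^ 2) ^ 2 * (2 * (x ^ 2) ^ 2 + MM)))
    with (2 * cN * ((1 + x) * (1 + x ^ 2))) by (field; lra).
  replace (/ 2 * (/ (1 + x ^ 2)) ^ 2 * (2 * (1 + x ^ 2) ^ 2 * (2 * (x ^ 2) ^ 2 + MM)))
    with (2 * (x ^ 2) ^ 2 + MM) by (field; lra).
  set (c := 4 * cN * 2).
  assert (P1 : (1 + x) * (1 + x ^ 2) <= 4 + 4 * x ^ 3) by nra.
  assert (P2 : c * x ^ 3 <= x ^ 4 + c ^ 4).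
  { assert (0 <= x ^ 3) by pos. assert (0 <= c ^ 4) by (apply pow_le; unfold c; lra).
    destruct (Rle_dec c x).
    - assert (c * x ^ 3 <= x * x ^ 3) by (apply Rmult_le_compat_r; lra). lra.
    - assert (x ^ 3 <= c ^ 3) by (apply pow_incr; lra).
      nra. }
  assert (P3 : 2 * cN * ((1 + x) * (1 + x ^ 2)) <= c + c * x ^ 3).
  { unfold c. apply Rmult_le_compat_l with (r := 2 * cN) in P1; lra. }
  unfold MM. fold c. nra.
Qed.

Lemma Duhamel_bound (g : R -> R) (n : Z) (t d : R) : 0 <= d -> (forall s, continuous g s) ->
  (forall s, Rabs (g s) <= cN * d * (1 + Rabs (IZR n)) * w n * exp (MM * tpos s)) ->
  Rabs (exp (- (n4 n * tpos t)) * RInt (fun s => exp (n4 n * s) * g s) 0 (tpos t)) <= d / 2 * w n ^ 2 * exp (MM * tpos t).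
Proof.
  intros Hd Hg Hb. destruct MM_pos as [M1 [_ c1]]. pose proof (n4_ge n) as Hn.
  pose proof (pos_ge t) as Ht. set (T := tpos t) in *. pose proof (w_pos n) as w0. pose proof (Rabs_pos (IZR n)).
  rewrite Rabs_mult, (Rabs_pos_eq (exp (- (n4 n * T)))) by pos.
  assert (I : Rabs (RInt (fun s => exp (n4 n * s) * g s) 0 T) <=
     (cN * d * (1 + Rabs (IZR n)) * w n) / (n4 n + MM) * exp ((n4 n + MM) * T)).
  { apply Rabs_RInt_exp_pos; [lra| |exact Ht| |].
    - repeat apply Rmult_le_pos; lra.
    - intros s. apply (continuous_mult (K := R_AbsRing)); [|apply Hg].
      apply (ex_derive_continuous (V := R_NormedModule)). auto_derive. auto.
    - intros s Hs. rewrite Rabs_mult, (Rabs_pos_eq (exp (n4 n * s))) by pos.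
      rewrite Rmult_plus_distr_r, exp_plus. specialize (Hb s). rewrite (pos_id s) in Hb by lra.
      pose proof (exp_pos (n4 n * s)). nra. }
  apply Rmult_le_compat_l with (r := exp (- (n4 n * T))) in I; pos.
  eapply Rle_trans; [exact I|].
  replace (exp ((n4 n + MM) * T)) with (exp (n4 n * T) * exp (MM * T)) by (rewrite <- exp_plus; f_equal; ring).
  rewrite exp_Ropp. pose proof (exp_pos (n4 n * T)). pose proof (exp_pos (MM * T)).
  replace (/ exp (n4 n * T) * (cN * d * (1 + Rabs (IZR n)) * w n / (n4 n + MM) * (exp (n4 n * T) * exp (MM * T))))
    with (d * (cN * (1 + Rabs (IZR n)) * w n / (n4 n + MM)) * exp (MM * T)) by (field; lra).
  apply Rmult_le_compat_r; [lra|]. pose proof (gain n) as G.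
  nra.
Qed.

Definition wt (i : option Z * R) : R :=
  match fst i with Some n => w n ^ 2 * exp (MM * tpos (snd i)) | None => exp (MM * tpos (snd i)) end.

(** Clamping makes the nonlinearity globally bounded and Lipschitz, so the weight [exp (MM t)]
    yields a contraction for all times without smallness. *)
Lemma truncated_exists : exists (a : Z -> R -> R) (L : R -> R),
  (forall n t, continuous (a n) t) /\ (forall t, continuous L t) /\ (forall n t, a (- n)%Z t = a n t) /\
  (forall n s, continuous (fun s => Nc (fun n => tb a n s) (tL L s) n) s) /\
  (forall s, continuous (fun s => Pc (fun n => tb a n s) (tL L s) 0) s) /\
  (forall n t, a n t = exp (- (n4 n * tpos t)) *
      (a0 n + RInt (fun s => exp (n4 n * s) * Nc (fun n => tb a n s) (tL L s) n) 0 (tpos t))) /\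
  (forall t, L t = L0 + RInt (fun s => -2 * tL L s * Pc (fun n => tb a n s) (tL L s) 0) 0 (tpos t)).
Proof.
  destruct a0_bd as [A0 HA0].
  destruct consts_nonneg as [? [? [? ?]]]. destruct MM_pos as [M1 [M2 c1]].
  assert (A00 : 0 <= A0).
  { specialize (HA0 0%Z). pose proof (Rabs_pos (a0 0%Z)). pose proof (w_pos 0). assert (0 < w 0 ^ 2) by nra. nra. }
  assert (Hwt : forall i, 0 <= wt i) by (intros [[n|] t]; unfold wt; simpl fst; cbv iota; [pos|]; left; apply exp_pos).
  (* Clamping is 1-Lipschitz, so distances in the weighted norm pass unchanged to the clamped
     coefficients. *)
  assert (Hlip : forall f g d, 0 <= d -> (forall i, Rabs (f i - g i) <= d * wt i) -> forall s,
     lipdata K (d * exp (MM * tpos s)) (fun n => tb (aP f) n s) (fun n => tb (aP g) n s) /\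
     Rabs (tL (LP f) s - tL (LP g) s) <= d * exp (MM * tpos s)).
  { intros f g d Hd D s. split.
    - split; [apply tb_Wb0|]. split; [apply tb_Wb0|]. intros n _. rewrite Rmult_0_l, Ropp_0, exp_0.
      le_via clampR_lip. specialize (D (Some n, s)). unfold wt in D; simpl fst in D; simpl snd in D.
      unfold aP. lra.
    - le_via tL_lip. apply D. }
  set (M := A0 + 1 + Rabs L0 + L2).
  destruct (weighted_fixpoint wt good Phi (fun _ => 0) M) as [f [Gf Ff]].
  - exact Hwt.
  - split; [cnt|auto].
  - apply Phi_good.
  - assert (G0 : good (fun _ => 0)) by (split; [cnt|auto]).
    intros [[n|] t]; unfold Phi, wt; simpl fst; simpl snd; rewrite Rminus_0_r.
    + rewrite Rmult_plus_distr_l. le_via Rabs_triang.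
      assert (E1 : 1 <= exp (MM * tpos t)).
      { rewrite <- exp_0. apply exp_mono. apply Rmult_le_pos; [lra|apply pos_ge]. }
      pose proof (w_pos n).
      assert (B1 : Rabs (exp (- (n4 n * tpos t)) * a0 n) <= A0 * (w n ^ 2 * exp (MM * tpos t))).
      { rewrite Rabs_mult, (Rabs_pos_eq (exp _)) by pos.
        assert (exp (- (n4 n * tpos t)) <= 1).
        { rewrite <- exp_0. apply exp_mono. pose proof (Rmult_le_pos _ _ (n4_ge n) (pos_ge t)). lra. }
        apply Rle_trans with (1 * (A0 * w n ^ 2)).
        - apply Rmult_le_compat; [pos|pos|lra|auto].
        - rewrite Rmult_1_l, <- Rmult_assoc. rewrite <- (Rmult_1_r (A0 * w n ^ 2)) at 1.
          apply Rmult_le_compat_l; pos. }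
      assert (B2 : Rabs (exp (- (n4 n * tpos t)) * RInt (fun s => exp (n4 n * s) * Nf (fun _ => 0) n s) 0 (tpos t))
         <= 1 / 2 * w n ^ 2 * exp (MM * tpos t)).
      { apply Duhamel_bound; [lra|intros; now apply Nf_cont|]. intros s.
        eapply Rle_trans; [apply (Nc_bound K 0 _ _ L2); [lra|lra|apply tL_abs|apply tb_Wb0]|].
        rewrite Rmult_0_l, Ropp_0, exp_0, !Rmult_1_r.
        assert (1 <= exp (MM * tpos s)).
        { rewrite <- exp_0. apply exp_mono. apply Rmult_le_pos; [lra|apply pos_ge]. }
        assert (0 <= (1 + Rabs (IZR n)) * w n) by pos.
        apply Rle_trans with (cN * ((1 + Rabs (IZR n)) * w n) * 1).
        - rewrite Rmult_1_r, Rmult_assoc. apply Rmult_le_compat_r; [lra|]. unfold cN. lra.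
        - rewrite <- (Rmult_assoc cN). apply Rmult_le_compat_l; [|lra].
          pos. }
      assert (0 <= w n ^ 2 * exp (MM * tpos t)) by pos.
      unfold M. pose proof (Rabs_pos L0). nra.
    + assert (B : Rabs (RInt (fun s => -2 * tL (LP (fun _ => 0)) s * PL (fun _ => 0) s) 0 (tpos t)) <=
        (2 * L2 * (kP K L2)) / MM * exp (MM * tpos t)).
      { apply Rabs_RInt_exp_pos; [lra|pos|apply pos_ge|intros; now apply LPf_cont|].
        intros s Hs. rewrite !Rabs_mult, (Rabs_left (-2)) by lra.
        pose proof (tL_abs (LP (fun _ => 0)) s) as T1.
        assert (T2 : Rabs (PL (fun _ => 0) s) <= kP K L2).
        { eapply Rle_trans; [apply (Wb_w (kP K L2) 0); [lra|apply Pc_Wb; [lra|lra|apply tL_abs|apply tb_Wb0]]|].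
          rewrite <- (Rmult_1_r (kP K L2)) at 2. apply Rmult_le_compat_l; [lra|apply w_le_1]. }
        assert (1 <= exp (MM * s)).
        { rewrite <- exp_0. apply exp_mono. pos. }
        apply Rle_trans with (2 * L2 * kP K L2 * 1); [|apply Rmult_le_compat_l; [repeat apply Rmult_le_pos; lra|lra]].
        rewrite Rmult_1_r. apply Rmult_le_compat; [|pos| |exact T2].
        - pose proof (Rabs_pos (tL (LP (fun _ => 0)) s)). lra.
        - lra. }
      le_via Rabs_triang.
      assert (E1 : 1 <= exp (MM * tpos t)).
      { rewrite <- exp_0. apply exp_mono. apply Rmult_le_pos; [lra|apply pos_ge]. }
      assert (Q : 2 * L2 * kP K L2 / MM <= L2).
      { apply Rmult_le_reg_r with MM; [lra|].
        replace (2 * L2 * kP K L2 / MM * MM) with (L2 * (2 * kP K L2)) by (field; lra).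
        nra. }
      pose proof (Rabs_pos L0).
      unfold M. nra.
  - intros f g d Hd Gf Gg D. pose proof (Hlip f g d Hd D) as HL.
    intros [[n|] t]; unfold Phi, wt; simpl fst; simpl snd.
    + replace (_ - _) with (exp (- (n4 n * tpos t)) *
        (RInt (fun s => exp (n4 n * s) * Nf f n s) 0 (tpos t) - RInt (fun s => exp (n4 n * s) * Nf g n s) 0 (tpos t))) by Rring.
      replace (RInt (fun s => exp (n4 n * s) * Nf f n s) 0 (tpos t) - RInt (fun s => exp (n4 n * s) * Nf g n s) 0 (tpos t))
        with (RInt (fun s => exp (n4 n * s) * (Nf f n s - Nf g n s)) 0 (tpos t)).
      * rewrite <- Rmult_assoc. apply Duhamel_bound; [exact Hd| |].
        -- intros s. apply (continuous_minus (V := R_NormedModule)); now apply Nf_cont.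
        -- intros s. destruct (HL s) as [HL1 HL2].
           assert (0 <= d * exp (MM * tpos s)) by pos.
           eapply Rle_trans; [apply (Nc_lip K (d * exp (MM * tpos s)) _ _ _ _ L2); auto; try apply tL_abs; lra|].
           assert (0 <= (1 + Rabs (IZR n)) * w n) by (apply Rmult_le_pos; [pos|left; apply w_pos]).
           replace (cN * d * (1 + Rabs (IZR n)) * w n * exp (MM * tpos s))
             with (cN * ((d * exp (MM * tpos s)) * ((1 + Rabs (IZR n)) * w n))) by ring.
           replace (lN K L2 * (d * exp (MM * tpos s)) * (1 + Rabs (IZR n)) * w n)
             with (lN K L2 * ((d * exp (MM * tpos s)) * ((1 + Rabs (IZR n)) * w n))) by ring.
           apply Rmult_le_compat_r; pos. unfold cN. lra.
      * etransitivity; [|apply (RInt_minus (V := R_CompleteNormedModule) (fun s => exp (n4 n * s) * Nf f n s))];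
          [|apply ex_RInt_cont; intros; now apply eNf_cont|apply ex_RInt_cont; intros; now apply eNf_cont].
        apply RInt_ext. intros s _. unfold minus, plus, opp; simpl. ring.
    + replace (_ - _) with (RInt (fun s => -2 * tL (LP f) s * PL f s) 0 (tpos t) - RInt (fun s => -2 * tL (LP g) s * PL g s) 0 (tpos t)) by Rring.
      replace (RInt (fun s => -2 * tL (LP f) s * PL f s) 0 (tpos t) - RInt (fun s => -2 * tL (LP g) s * PL g s) 0 (tpos t))
        with (RInt (fun s => -2 * tL (LP f) s * PL f s - -2 * tL (LP g) s * PL g s) 0 (tpos t)).
      2: { apply (RInt_minus (V := R_CompleteNormedModule)); apply ex_RInt_cont; intros; now apply LPf_cont. }
      apply Rle_trans with (2 * (kP K L2 + L2 * lP K L2) * d / MM * exp (MM * tpos t)).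
      * apply Rabs_RInt_exp_pos; [lra|pos|apply pos_ge| |].
        { intros s. apply (continuous_minus (V := R_NormedModule)); now apply LPf_cont. }
        intros s Hs. destruct (HL s) as [HL1 HL2]. rewrite (pos_id s) in * by lra.
        assert (dE : 0 <= d * exp (MM * s)) by pos.
        assert (T2 : Rabs (PL g s) <= kP K L2).
        { eapply Rle_trans; [apply (Wb_w (kP K L2) 0); [lra|apply Pc_Wb; [lra|lra|apply tL_abs|apply tb_Wb0]]|].
          rewrite <- (Rmult_1_r (kP K L2)) at 2. apply Rmult_le_compat_l; [lra|apply w_le_1]. }
        assert (T3 : Rabs (PL f s - PL g s) <= lP K L2 * (d * exp (MM * s))).
        { eapply Rle_trans.
          - apply (Wb_w _ 0 _ (Rle_refl 0) (Pc_lip K (d * exp (MM * s)) _ _ _ _ L2 (Rlt_le _ _ K0) dE HL1 (tL_abs _ s) HL2)).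
          - rewrite <- (Rmult_1_r (lP K L2 * (d * exp (MM * s)))) at 2. apply Rmult_le_compat_l; [|apply w_le_1].
            pos. }
        replace (_ - _) with (-2 * ((tL (LP f) s - tL (LP g) s) * PL g s + tL (LP f) s * (PL f s - PL g s))) by ring.
        rewrite Rabs_mult, (Rabs_left (-2)) by lra.
        apply Rle_trans with (2 * ((d * exp (MM * s)) * kP K L2 + L2 * (lP K L2 * (d * exp (MM * s))))); [|lra].
        replace (- -2) with 2 by ring. apply Rmult_le_compat_l; [lra|].
        le_via Rabs_triang. rewrite !Rabs_mult.
        apply Rplus_le_compat; apply Rmult_le_compat; pos. apply tL_abs.
      * apply Rmult_le_compat_r; pos.
        apply Rmult_le_reg_r with MM; [lra|].
        replace (2 * (kP K L2 + L2 * lP K L2) * d / MM * MM) with (2 * (kP K L2 + L2 * lP K L2) * d) by (field; lra).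
        nra.
  - intros F f HF HFf. split.
    + intros o t.
      apply (continuous_of_approx (fun k s => F k (o, s)) _ t (2 * M * exp (MM * (Rabs t + 1)))); [|intros; apply HF].
      exists (mkposreal 1 Rlt_0_1). intros s Bs k. eapply Rle_trans; auto.
      ballR Bs.
      replace (2 * M * exp (MM * (Rabs t + 1)) * (1 / 2) ^ k) with (2 * M * (1 / 2) ^ k * exp (MM * (Rabs t + 1))) by ring.
      apply Rmult_le_compat_l.
      { unfold M. pos. }
      assert (exp (MM * tpos s) <= exp (MM * (Rabs t + 1))).
      { apply exp_mono. apply Rmult_le_compat_l; [lra|]. pose proof (pos_le_abs s).
        apply Rabs_lt_between in Bs. eapply Rle_trans; [exact H3|]. unfold Rabs. repeat destruct Rcase_abs; lra. }
      unfold wt. destruct o as [n|]; simpl fst; simpl snd; [|exact H3].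
      eapply Rle_trans; [|exact H3]. rewrite <- (Rmult_1_l (exp (MM * tpos s))) at 2.
      apply Rmult_le_compat_r; pos. pose proof (w_pos n). pose proof (w_le_1 n). nra.
    + intros n t. apply Rminus_diag_uniq.
      enough (Z : Rabs (f (Some (- n)%Z, t) - f (Some n, t)) <= 0).
      { pose proof (Rabs_pos (f (Some (- n)%Z, t) - f (Some n, t))). apply Rabs_eq_0. lra. }
      apply (Rle_of_geometric _ (2 * M * (wt (Some (- n)%Z, t) + wt (Some n, t)))). intros k.
      pose proof (HFf k (Some (- n)%Z, t)) as A. pose proof (HFf k (Some n, t)) as B.
      destruct (HF k) as [_ Ev]. rewrite Ev in A.
      apply Rabs_le_between in A. apply Rabs_le_between in B. apply Rabs_le_between. lra.
  - unfold M. pos.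
  - exists (aP f), (LP f). destruct Gf as [C Ev]. split; [|split; [|split; [|split; [|split; [|split]]]]].
    + intros; apply C. + intros; apply C. + auto.
    + intros; apply Nf_cont; split; assumption. + intros; apply Pf_cont; split; assumption.
    + symmetry. apply (Ff (Some n, t)).
    + symmetry. apply (Ff (None, t)).
Qed.

End Truncated.

Lemma qs_ps_ext b b' : (forall n, n <> 0%Z -> b n = b' n) -> qs b = qs b' /\ ps b = ps b'.
Proof.
  split; apply functional_extensionality; intros n; unfold qs, ps;
  (destruct (Z.eq_dec n 0) as [->|Hn]; [lra|now rewrite H]).
Qed.

Lemma Pc_modes b b' L : (forall n, n <> 0%Z -> b n = b' n) -> Pc b L = Pc b' L.
Proof.
  intros H. destruct (qs_ps_ext b b' H) as [E1 E2].
  unfold Pc, q4s, pps, q2s. now rewrite E1, E2.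
Qed.

Lemma Nc_modes b b' L : (forall n, n <> 0%Z -> b n = b' n) -> Nc b L = Nc b' L.
Proof.
  intros H. destruct (qs_ps_ext b b' H) as [E1 E2].
  unfold Nc, Rc, q3s, q2s. now rewrite (Pc_modes b b' L H), E1, E2.
Qed.

(** Between [s] and [t] the level loses at most the factor [exp (x (t - s))], where [x = |n|]. The
    linear decay at rate [2 x^4] absorbs it and leaves a rate of at least [x^4], because
    [x >= 1]. *)
Lemma Duhamel_decay (g : R -> R) (C T0 t : R) (n : Z) : n <> 0%Z -> 0 <= C -> 0 <= T0 -> 0 <= t ->
  (forall s, continuous g s) ->
  (forall s, 0 <= s -> Rabs (g s) <= C * exp (- (Rmin s T0 * Rabs (IZR n)))) ->
  Rabs (exp (- (n4 n * t)) * RInt (fun s => exp (n4 n * s) * g s) 0 t)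
    <= C / Rabs (IZR n) ^ 4 * exp (- (Rmin t T0 * Rabs (IZR n))).
Proof.
  intros Hn HC HT Ht Hg Hb. pose proof (IZR_abs_ge_1 n Hn) as X. set (x := Rabs (IZR n)) in *.
  assert (E4 : n4 n = 2 * x ^ 4).
  { unfold n4, x. replace (Rabs (IZR n) ^ 4) with ((Rabs (IZR n) ^ 2) ^ 2) by ring.
    rewrite pow2_abs. ring. }
  assert (x1 : x <= x ^ 4). { assert (1 <= x ^ 3) by (apply pow_R1_Rle; lra). nra. }
  rewrite E4, Rabs_mult, (Rabs_pos_eq (exp (- (2 * x ^ 4 * t)))) by pos.
  set (e := C * exp (- (Rmin t T0 * x)) * exp (x * t)).
  assert (e0 : 0 <= e) by (repeat apply Rmult_le_pos; [lra|pos|pos]).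
  assert (I : Rabs (RInt (fun s => exp (2 * x ^ 4 * s) * g s) 0 t) <= e / (2 * x ^ 4 - x) * exp ((2 * x ^ 4 - x) * t)).
  { apply Rabs_RInt_exp_pos; [lra|exact e0|exact Ht| |].
    - intros s. apply (continuous_mult (K := R_AbsRing)); [|apply Hg].
      apply (ex_derive_continuous (V := R_NormedModule)). auto_derive. auto.
    - intros s Hs. rewrite Rabs_mult, (Rabs_pos_eq (exp (2 * x ^ 4 * s))) by pos.
      apply Rle_trans with (exp (2 * x ^ 4 * s) * (C * exp (- (Rmin s T0 * x)))).
      + apply Rmult_le_compat_l; pos. apply Hb. lra.
      + unfold e.
        replace (exp (2 * x ^ 4 * s) * (C * exp (- (Rmin s T0 * x)))) with (C * (exp (2 * x ^ 4 * s) * exp (- (Rmin s T0 * x)))) by ring.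
        replace (C * exp (- (Rmin t T0 * x)) * exp (x * t) * exp ((2 * x ^ 4 - x) * s))
          with (C * (exp (- (Rmin t T0 * x)) * exp (x * t) * exp ((2 * x ^ 4 - x) * s))) by ring.
        apply Rmult_le_compat_l; [exact HC|]. rewrite <- !exp_plus. apply exp_mono.
        assert (Rmin t T0 <= Rmin s T0 + (t - s)) by (unfold Rmin; repeat destruct Rle_dec; lra).
        nra. }
  apply Rmult_le_compat_l with (r := exp (- (2 * x ^ 4 * t))) in I; pos.
  eapply Rle_trans; [exact I|].
  replace (exp (- (2 * x ^ 4 * t)) * (e / (2 * x ^ 4 - x) * exp ((2 * x ^ 4 - x) * t)))
    with (e * (exp (- (2 * x ^ 4 * t)) * exp ((2 * x ^ 4 - x) * t)) * / (2 * x ^ 4 - x)) by lra.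
  rewrite <- exp_plus. unfold e.
  replace (C * exp (- (Rmin t T0 * x)) * exp (x * t) * exp (- (2 * x ^ 4 * t) + (2 * x ^ 4 - x) * t))
    with (C * exp (- (Rmin t T0 * x)) * (exp (x * t) * exp (- (2 * x ^ 4 * t) + (2 * x ^ 4 - x) * t))) by ring.
  rewrite <- exp_plus. replace (x * t + (- (2 * x ^ 4 * t) + (2 * x ^ 4 - x) * t)) with 0 by ring.
  rewrite exp_0, Rmult_1_r.
  rewrite (Rmult_comm (C * / x ^ 4)). rewrite <- Rmult_assoc, (Rmult_comm (exp _) C).
  apply Rmult_le_compat_l; pos.
  apply Rinv_le_contravar; lra.
Qed.

(** The initial data use half of the level and Duhamel's term is at most [4 kN / |n|] times [w^2].
    Beyond [|n| = 8 kN / K] the clamp is therefore inactive by itself, and only finitely many modes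
    remain to be controlled. Where neither clamp acts, the original equations hold. *)
Lemma truncated_flow (K T0 L1 L2 L0 : R) (a0 : Z -> R) :
  0 < K -> 0 <= T0 -> 0 < L1 -> L1 <= L2 ->
  (forall n, a0 (- n)%Z = a0 n) ->
  (forall n, n <> 0%Z -> Rabs (a0 n) <= K / 2 * w n ^ 2) ->
  exists (a : Z -> R -> R) (L : R -> R),
  (forall n t, continuous (a n) t) /\ (forall t, continuous L t) /\ (forall n t, a (- n)%Z t = a n t) /\
  (forall n, a n 0 = a0 n) /\ L 0 = L0 /\
  (exists A, 0 <= A /\ forall t, Wb2 A (Rmin (tpos t) T0) (fun n => a n t)) /\
  (forall n t, 0 <= t -> n <> 0%Z -> 8 * kN K L2 / K <= Rabs (IZR n) ->
     Rabs (a n t) <= K * w n ^ 2 * exp (- (Rmin t T0 * Rabs (IZR n)))) /\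
  (forall t, 0 < t -> Wb2 K (Rmin t T0) (fun n => a n t) -> L1 <= L t <= L2 ->
     (forall n, is_derive (a n) t (- (n4 n) * a n t + Nc (fun n => a n t) (L t) n)) /\
     is_derive L t (-2 * L t * Pc (fun n => a n t) (L t) 0)).
Proof.
  intros HK HT HL1 HL12 He Ha.
  assert (Hbd : exists A, forall n, Rabs (a0 n) <= A * w n ^ 2).
  { exists (K / 2 + Rabs (a0 0%Z)). intros n. pose proof (Rabs_pos (a0 0%Z)).
    destruct (Z.eq_dec n 0) as [->|Hn].
    - assert (E : w 0 = 1) by (unfold w; simpl; field). rewrite E. lra.
    - specialize (Ha n Hn). nra. }
  destruct (truncated_exists K T0 L1 L2 L0 a0 HK HT HL1 HL12 He Hbd) as [a [L [Ca [CL [Ev [CN [CP [Da DL]]]]]]]].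
  assert (Dec : forall n t, 0 <= t -> n <> 0%Z -> Rabs (a n t) <=
     (K / 2 * w n ^ 2 + kN K L2 * (1 + Rabs (IZR n)) * w n / Rabs (IZR n) ^ 4) * exp (- (Rmin t T0 * Rabs (IZR n)))).
  { intros n t Ht Hn. rewrite Da, (pos_id t Ht), Rmult_plus_distr_l, Rmult_plus_distr_r.
    le_via Rabs_triang. apply Rplus_le_compat.
    - rewrite Rabs_mult, (Rabs_pos_eq (exp _)) by pos. rewrite Rmult_comm.
      apply Rmult_le_compat; [pos|pos|auto|].
      apply exp_mono. pose proof (IZR_abs_ge_1 n Hn).
      assert (Rabs (IZR n) <= n4 n).
      { unfold n4. replace (IZR n ^ 4) with ((Rabs (IZR n) ^ 2)^2) by (rewrite pow2_abs; ring).
        assert (1 <= Rabs (IZR n) ^ 3) by (apply pow_R1_Rle; lra).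
        nra. }
      pose proof (Rmin_l t T0). nra.
    - apply Duhamel_decay; auto.
      + destruct (consts_nonneg K L1 L2 HK HL1 HL12) as [? _]. pose proof (w_pos n). pos.
      + intros s Hs. replace (Rmin s T0) with (Rmin (tpos s) T0) by (now rewrite pos_id). apply Nc_bound.
        * apply Rmin_glb; [apply pos_ge|exact HT].
        * lra.
        * now apply tL_abs.
        * now apply tb_Wb. }
  exists a, L. split; [exact Ca|]. split; [exact CL|]. split; [exact Ev|].
  destruct (consts_nonneg K L1 L2 HK HL1 HL12) as [kN0 _].
  assert (Tail : forall n, n <> 0%Z -> kN K L2 * (1 + Rabs (IZR n)) * w n / Rabs (IZR n) ^ 4 <= 4 * kN K L2 / Rabs (IZR n) * w n ^ 2).
  { intros n Hn. pose proof (IZR_abs_ge_1 n Hn). unfold w. rewrite <- (pow2_abs (IZR n)). set (x := Rabs (IZR n)) in *.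
    assert (x4 : 0 < x ^ 4) by pos.
    apply Rmult_le_reg_r with ((1 + x ^ 2)^2 * x ^ 4); [nra|].
    replace (kN K L2 * (1 + x) * / (1 + x ^ 2) / x ^ 4 * ((1 + x ^ 2) ^ 2 * x ^ 4)) with (kN K L2 * ((1 + x) * (1 + x ^ 2))) by (field; split; nra).
    replace (4 * kN K L2 / x * (/ (1 + x ^ 2)) ^ 2 * ((1 + x ^ 2) ^ 2 * x ^ 4)) with (kN K L2 * ((2 * x) * (2 * x ^ 2))) by (field; split; nra).
    apply Rmult_le_compat; nra. }
  split; [|split; [|split; [|split]]].
  - intros n. rewrite Da, pos_id by lra. rewrite RInt_point, Rmult_0_r, Ropp_0, exp_0.
    change (1 * (a0 n + 0) = a0 n). ring.
  - rewrite DL, pos_id by lra. rewrite RInt_point. change (L0 + 0 = L0). ring.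
  - exists (K / 2 + 4 * kN K L2). split; [lra|]. intros t n Hn.
    replace (a n t) with (a n (tpos t)) by (rewrite !Da, (pos_id (tpos t)) by apply pos_ge; reflexivity).
    eapply Rle_trans; [apply Dec; [apply pos_ge|exact Hn]|].
    apply Rmult_le_compat_r; pos. rewrite Rmult_plus_distr_r. apply Rplus_le_compat_l.
    eapply Rle_trans; auto. apply Rmult_le_compat_r; pos.
    pose proof (IZR_abs_ge_1 n Hn). apply Rmult_le_reg_r with (Rabs (IZR n)); [lra|].
    unfold Rdiv. rewrite Rmult_assoc, Rinv_l by lra. nra.
  - intros n t Ht Hn Hbig. eapply Rle_trans; auto.
    apply Rmult_le_compat_r; pos.
    assert (4 * kN K L2 / Rabs (IZR n) <= K / 2).
    { pose proof (IZR_abs_ge_1 n Hn). apply Rmult_le_reg_r with (Rabs (IZR n)); [lra|].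
      unfold Rdiv at 1. rewrite Rmult_assoc, Rinv_l by lra.
      apply Rmult_le_compat_r with (r := K / 2) in Hbig; [|lra].
      replace (8 * kN K L2 / K * (K / 2)) with (4 * kN K L2) in Hbig by (field; lra). lra. }
    pose proof (Tail n Hn). nra.
  - intros t Ht Hin HLt.
    assert (Etb : forall n, n <> 0%Z -> tb K T0 a n t = a n t).
    { intros n Hn. apply clampR_id. unfold lev. rewrite pos_id by lra. auto. }
    assert (EL : tL L1 L2 L t = L t).
    { unfold tL, Rmax, Rmin. repeat destruct Rle_dec; lra. }
    assert (Loc : locally t (fun s => 0 < s)) by (apply (open_gt 0); exact Ht).
    split.
    + intros n.
      apply (is_derive_ext_loc (fun t => exp (- (n4 n * t)) *
        (a0 n + RInt (fun s => exp (n4 n * s) * Nc (fun n => tb K T0 a n s) (tL L1 L2 L s) n) 0 t))).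
      { apply (filter_imp (fun s => 0 < s)); [|auto]. intros s Hs. rewrite Da, pos_id by lra. reflexivity. }
      replace (- n4 n * a n t + Nc (fun n => a n t) (L t) n) with
        (- n4 n * exp (- (n4 n * t)) * (a0 n + RInt (fun s => exp (n4 n * s) * Nc (fun n => tb K T0 a n s) (tL L1 L2 L s) n) 0 t)
         + exp (- (n4 n * t)) * (exp (n4 n * t) * Nc (fun n => tb K T0 a n t) (tL L1 L2 L t) n)).
      * apply (is_derive_Rmult (fun t => exp (- (n4 n * t)))
          (fun t => a0 n + RInt (fun s => exp (n4 n * s) * Nc (fun n => tb K T0 a n s) (tL L1 L2 L s) n) 0 t)).
        -- auto_derive; [auto|]. ring.
        -- apply is_derive_const_plus.
           apply (is_derive_RInt_var (fun s => exp (n4 n * s) * Nc (fun n => tb K T0 a n s) (tL L1 L2 L s) n)).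
           intros s. apply (continuous_mult (K := R_AbsRing)); [|apply CN].
           apply (ex_derive_continuous (V := R_NormedModule)). auto_derive. auto.
      * rewrite (Nc_modes _ _ _ Etb), EL. rewrite (Da n t), (pos_id t) by lra.
        rewrite <- (Rmult_assoc (exp (- (n4 n * t)))), <- exp_plus.
        replace (- (n4 n * t) + n4 n * t) with 0 by ring. rewrite exp_0. Rring.
    + apply (is_derive_ext_loc (fun t => L0 + RInt (fun s => -2 * tL L1 L2 L s * Pc (fun n => tb K T0 a n s) (tL L1 L2 L s) 0) 0 t)).
      { apply (filter_imp (fun s => 0 < s)); [|auto]. intros s Hs. rewrite DL, pos_id by lra. reflexivity. }
      rewrite <- (Pc_modes _ _ _ Etb).
      replace (-2 * L t * Pc (fun n => tb K T0 a n t) (L t) 0) with (-2 * tL L1 L2 L t * Pc (fun n => tb K T0 a n t) (tL L1 L2 L t) 0) by (now rewrite EL).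
      apply is_derive_const_plus.
      apply (is_derive_RInt_var (fun s => -2 * tL L1 L2 L s * Pc (fun n => tb K T0 a n s) (tL L1 L2 L s) 0)).
      intros s.
      apply (continuous_mult (K := R_AbsRing)); cnt. now apply tL_cont.
Qed.

(** * Curves close to the teardrop *)

Ltac prodpos := repeat match goal with |- 0 < _ * _ => apply Rmult_lt_0_compat | |- 0 < _ ^ _ => apply pow_lt end; try lra.

Lemma le_of_derive (f df : R -> R) (x : R) : 0 <= x -> (forall y, is_derive f y (df y)) ->
  (forall y, 0 <= y -> df y <= 0) -> f x <= f 0.
Proof.
  intros Hx D H. apply (nonincreasing_of_derive f df 0 x Hx).
  - cnt.
  - split; [apply D|apply H; lra].
Qed.

Lemma cos_quadratic (x : R) : 0 <= x -> 1 - cos x <= x ^ 2 / 2 /\ 1 - cos x <= 2 * x.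
Proof.
  split.
  - assert ((1 - cos x) - x ^ 2 / 2 <= (1 - cos 0) - 0 ^ 2 / 2); [|rewrite cos_0 in *; lra].
    apply (le_of_derive (fun x => (1 - cos x) - x ^ 2 / 2) (fun x => sin x - x) x H).
    + intros y. auto_derive; [auto|field].
    + intros y Hy. destruct (Req_dec y 0) as [->|N]; [rewrite sin_0; lra|]. pose proof (sin_lt_x y ltac:(lra)). lra.
  -
    assert (1 - cos x - 2 * x <= 1 - cos 0 - 2 * 0); [|rewrite cos_0 in *; lra].
    apply (le_of_derive (fun x => 1 - cos x - 2 * x) (fun x => sin x - 2) x H).
    + der.
    + intros y Hy. pose proof (SIN_bound y). lra.
Qed.

Lemma sin_cubic (x : R) : 0 <= x -> 0 <= x - sin x <= x ^ 3 / 6 /\ x - sin x <= x ^ 2.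
Proof.
  split; [split|].
  - destruct (Req_dec x 0) as [->|N]; [rewrite sin_0; lra|]. pose proof (sin_lt_x x ltac:(lra)). lra.
  - assert ((x - sin x) - x ^ 3 / 6 <= (0 - sin 0) - 0 ^ 3 / 6); [|rewrite sin_0 in *; lra].
    apply (le_of_derive (fun x => (x - sin x) - x ^ 3 / 6) (fun x => (1 - cos x) - x ^ 2 / 2) x H).
    + intros y. auto_derive; [auto|field].
    + intros y Hy. pose proof (cos_quadratic y Hy). lra.
  - assert ((x - sin x) - x ^ 2 <= (0 - sin 0) - 0 ^ 2); [|rewrite sin_0 in *; lra].
    apply (le_of_derive (fun x => (x - sin x) - x ^ 2) (fun x => (1 - cos x) - 2 * x) x H).
    + der.
    + intros y Hy. pose proof (cos_quadratic y Hy). lra.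
Qed.

Lemma cos_cubic (x : R) : 0 <= x -> 0 <= cos x - 1 + x ^ 2 / 2 <= x ^ 3 / 3.
Proof.
  split; [pose proof (cos_quadratic x H); lra|].
  assert ((cos x - 1 + x ^ 2 / 2) - x ^ 3 / 3 <= (cos 0 - 1 + 0 ^ 2 / 2) - 0 ^ 3 / 3); [|rewrite cos_0 in *; lra].
  apply (le_of_derive (fun x => (cos x - 1 + x ^ 2 / 2) - x ^ 3 / 3) (fun x => (x - sin x) - x ^ 2) x H).
  - intros y. auto_derive; [auto|field].
  - intros y Hy. pose proof (sin_cubic y Hy). lra.
Qed.

Lemma sin_taylor (a x : R) : Rabs (sin (a + x) - sin a - x * cos a) <= 2 * x ^ 2.
Proof.
  assert (P : forall a x, 0 <= x -> Rabs (sin (a + x) - sin a - x * cos a) <= 2 * x ^ 2).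
  { clear. intros a x H. rewrite sin_plus. pose proof (SIN_bound a). pose proof (COS_bound a).
    pose proof (cos_quadratic x H) as [c1 _]. pose proof (sin_cubic x H) as [[s0 _] s1]. pose proof (COS_bound x).
    replace (sin a * cos x + cos a * sin x - sin a - x * cos a) with (- (sin a * (1 - cos x) + cos a * (x - sin x))) by ring.
    rewrite Rabs_Ropp. le_via Rabs_triang. rewrite !Rabs_mult.
    rewrite (Rabs_pos_eq (1 - cos x)), (Rabs_pos_eq (x - sin x)) by lra.
    assert (Rabs (sin a) <= 1) by (apply Rabs_le_between; lra). assert (Rabs (cos a) <= 1) by (apply Rabs_le_between; lra).
    nra. }
  destruct (Rle_dec 0 x) as [H|H]; [auto|].
  specialize (P (- a) (- x) ltac:(lra)). rewrite <- Ropp_plus_distr, !sin_neg, cos_neg in P.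
  replace (- sin (a + x) - - sin a - - x * cos a) with (- (sin (a + x) - sin a - x * cos a)) in P by ring.
  rewrite Rabs_Ropp in P. lra.
Qed.

Lemma cos_taylor (a x : R) : Rabs (cos (a + x) - cos a + x * sin a + x ^ 2 / 2 * cos a) <= Rabs x ^ 3.
Proof.
  assert (P : forall a x, 0 <= x -> Rabs (cos (a + x) - cos a + x * sin a + x ^ 2 / 2 * cos a) <= x ^ 3).
  { clear. intros a x H. rewrite cos_plus. pose proof (SIN_bound a). pose proof (COS_bound a).
    pose proof (cos_cubic x H) as c1. pose proof (sin_cubic x H) as [[s0 s2] _].
    replace (cos a * cos x - sin a * sin x - cos a + x * sin a + x ^ 2 / 2 * cos a) with
      (cos a * (cos x - 1 + x ^ 2 / 2) + sin a * (x - sin x)) by field.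
    le_via Rabs_triang. rewrite !Rabs_mult.
    rewrite (Rabs_pos_eq (cos x - 1 + x ^ 2 / 2)), (Rabs_pos_eq (x - sin x)) by lra.
    assert (Rabs (sin a) <= 1) by (apply Rabs_le_between; lra). assert (Rabs (cos a) <= 1) by (apply Rabs_le_between; lra).
    nra. }
  destruct (Rle_dec 0 x) as [H|H]; [rewrite (Rabs_pos_eq x) by lra; now apply P|].
  specialize (P (- a) (- x) ltac:(lra)). rewrite <- Ropp_plus_distr, !cos_neg, sin_neg in P. rewrite (Rabs_left x) by lra.
  replace (- x * - sin a) with (x * sin a) in P by ring. replace ((- x) ^ 2) with (x ^ 2) in P by ring. exact P.
Qed.

(** The mean value theorem for the primitive gives a zero of [f]; Cauchy-Schwarz bounds the
    increment from there. *)
Lemma sup_mean_zero (f f1 : R -> R) : (forall x, is_derive f x (f1 x)) -> (forall x, continuous f1 x) ->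
  RInt f 0 PI = 0 -> forall x, 0 <= x <= PI -> f x ^ 2 <= PI * RInt (fun x => f1 x ^ 2) 0 PI.
Proof.
  intros D C M x Hx. pose proof PI_RGT_0 as pi0.
  assert (Cf : forall x, continuous f x) by cnt.
  assert (C2 : forall x, continuous (fun x => f1 x ^ 2) x) by cnt.
  destruct (mvt_all (fun y => RInt f 0 y) f 0 PI pi0) as [c [Hc E]].
  { intros y. now apply (is_derive_RInt_var f). }
  rewrite M, RInt_point in E. change (0 - 0 = f c * (PI - 0)) in E. assert (f c = 0) by nra.
  assert (K : forall a b, 0 <= a -> a <= b -> b <= PI -> (f b - f a) ^ 2 <= PI * RInt (fun x => f1 x ^ 2) 0 PI).
  { intros a b H1 H2 H3. rewrite <- (RInt_exact f f1 a b D C).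
    eapply Rle_trans; [apply RInt_sqr_CS; [exact H2|intros; apply C]|].
    apply Rmult_le_compat; [lra| |lra|].
    - apply RInt_nonneg_on; [exact H2|auto|pos].
    - rewrite (RInt_split (fun x => f1 x ^ 2) 0 a PI), (RInt_split (fun x => f1 x ^ 2) a b PI) by cnt.
      assert (0 <= RInt (fun x => f1 x ^ 2) 0 a) by (apply RInt_nonneg_on; [lra|cnt|pos]).
      assert (0 <= RInt (fun x => f1 x ^ 2) b PI) by (apply RInt_nonneg_on; [lra|cnt|pos]). lra. }
  destruct (Rle_dec c x).
  - specialize (K c x ltac:(lra) ltac:(lra) ltac:(lra)). rewrite H, Rminus_0_r in K. exact K.
  - specialize (K x c ltac:(lra) ltac:(lra) ltac:(lra)). nra.
Qed.

Section Near.
Context {Th Th1 : R -> R} {W2 Ls th0 : R}.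
Hypothesis TD : teardrop Th Th1 W2 Ls th0.

Let cTh := Th_cont TD.
Let cTh1 := Th1_cont TD.

Lemma RInt_odd_zero (g : R -> R) : (forall x, continuous g x) -> (forall x, g (PI - x) = - g x) -> RInt g 0 PI = 0.
Proof.
  intros C O. rewrite is_RInt_fold by auto. rewrite (RInt_ext _ (fun _ => 0)).
  - rewrite RInt_cst. Rring.
  - intros x _. rewrite O. lra.
Qed.

Lemma Th_mean : RInt Th 0 PI = 0.
Proof. apply RInt_odd_zero; [auto|apply TD]. Qed.

Lemma sinTh_mean : RInt (fun x => sin (Th x)) 0 PI = 0.
Proof.
  apply RInt_odd_zero; [cnt|]. intros x. rewrite (td_odd TD). apply sin_neg.
Qed.

Lemma Th1_energy : RInt (fun x => Th1 x ^ 2) 0 PI = PI * Ls.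
Proof.
  rewrite (RInt_ext _ (fun x => Ls + 2 * W2 * cos (Th x))) by (intros; apply TD).
  rlin. rewrite (td_closed TD). Rring.
Qed.

(** Uses [Th1' = - W2 sin Th] and the zeros of [Th1] at the ends. It shows that [W2] is the Lagrange
    multiplier of the closing condition: the first variation of bending is a multiple of that of the
    end vector. *)
Lemma Th1_by_parts (f f1 : R -> R) : (forall x, is_derive f x (f1 x)) -> (forall x, continuous f1 x) ->
  RInt (fun x => Th1 x * f1 x) 0 PI = W2 * RInt (fun x => sin (Th x) * f x) 0 PI.
Proof.
  intros D C.
  assert (E : RInt (fun x => Th1 x * f1 x - W2 * (sin (Th x) * f x)) 0 PI = 0).
  { rewrite (RInt_exact (fun x => Th1 x * f x) (fun x => Th1 x * f1 x - W2 * (sin (Th x) * f x))).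
    - rewrite (td_left TD), (td_right TD). Rring.
    - der.
    - cnt. }
  revert E. rlin. lra.
Qed.

Lemma RInt_rotate (f : R -> R) (b X Y : R) : (forall x, continuous f x) ->
  RInt (fun x => cos (f x)) 0 PI = X -> RInt (fun x => sin (f x)) 0 PI = Y ->
  RInt (fun x => cos (f x - b)) 0 PI = X * cos b + Y * sin b /\
  RInt (fun x => sin (f x - b)) 0 PI = Y * cos b - X * sin b.
Proof.
  intros C <- <-. split.
  - rewrite (RInt_ext _ (fun x => cos b * cos (f x) + sin b * sin (f x))) by (intros; rewrite cos_minus; Rring). rlin. Rring.
  - rewrite (RInt_ext _ (fun x => cos b * sin (f x) - sin b * cos (f x))) by (intros; rewrite sin_minus; Rring). rlin. Rring.
Qed.

(** Comparing derivatives only, it measures the distance to the whole circle of rotated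
    teardrops. *)
Definition gap (q : R -> R) : R := RInt (fun x => (q x - Th1 x) ^ 2) 0 PI.

Section Curve.
Variables (th q : R -> R) (b eps : R).
Hypothesis th_d : forall x, is_derive th x (q x).
Hypothesis q_c : forall x, continuous q x.
Hypothesis th_mean : RInt th 0 PI = PI * b.
Hypothesis cos_int : RInt (fun x => cos (th x)) 0 PI = eps.
Hypothesis sin_int : RInt (fun x => sin (th x)) 0 PI = 0.

(** Deviation from the teardrop rotated by the mean angle [b]. This choice of rotation gives mean
    zero, as the coercivity estimate requires. *)
Definition dev (x : R) : R := th x - b - Th x.
Definition dev1 (x : R) : R := q x - Th1 x.

Lemma dev_d x : is_derive dev x (dev1 x).
Proof. unfold dev, dev1. der. Qed.
#[local] Hint Resolve dev_d : deriv.

Lemma dev1_c x : continuous dev1 x.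
Proof. unfold dev1. cnt. Qed.

Lemma dev_c x : continuous dev x.
Proof. eapply continuous_of_derive, dev_d. Qed.

Lemma th_c x : continuous th x.
Proof. eapply continuous_of_derive, th_d. Qed.
#[local] Hint Resolve dev_c dev1_c th_c : cont.

Lemma dev_mean : RInt dev 0 PI = 0.
Proof.
  unfold dev. rlin. change (RInt th 0 PI - (PI - 0) * b - RInt Th 0 PI = 0). rewrite Th_mean, th_mean. ring.
Qed.

Lemma dev_sup x : 0 <= x <= PI -> dev x ^ 2 <= PI * gap q.
Proof. exact (sup_mean_zero dev dev1 dev_d dev1_c dev_mean x). Qed.

Lemma gap_nonneg : 0 <= gap q.
Proof.
  apply RInt_nonneg_on; [pose proof PI_RGT_0; lra| |pos].
  cnt.
Qed.

Lemma dev_abs x : 0 <= x <= PI -> Rabs (dev x) <= sqrt (PI * gap q).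
Proof.
  intros Hx. rewrite <- sqrt_Rsqr_abs. apply sqrt_le_1_alt. pose proof (dev_sup x Hx). unfold Rsqr. lra.
Qed.

Lemma cos_dev_int : RInt (fun x => cos (Th x + dev x)) 0 PI = eps * cos b.
Proof.
  rewrite (RInt_ext _ (fun x => cos (th x - b))) by (intros; f_equal; unfold dev; Rring).
  rewrite (proj1 (RInt_rotate th b eps 0 th_c cos_int sin_int)). Rring.
Qed.

Lemma sin_dev_int : RInt (fun x => sin (Th x + dev x)) 0 PI = - eps * sin b.
Proof.
  rewrite (RInt_ext _ (fun x => sin (th x - b))) by (intros; f_equal; unfold dev; Rring).
  rewrite (proj2 (RInt_rotate th b eps 0 th_c cos_int sin_int)). Rring.
Qed.

(* first variation of the two closing conditions *)
Lemma cosTh_dev : Rabs (RInt (fun x => cos (Th x) * dev x) 0 PI) <= Rabs eps + 2 * PI * (PI * gap q).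
Proof.
  pose proof PI_RGT_0 as pi0.
  set (r := fun x => sin (Th x + dev x) - sin (Th x) - cos (Th x) * dev x).
  assert (E : RInt r 0 PI = - eps * sin b - 0 - RInt (fun x => cos (Th x) * dev x) 0 PI).
  { unfold r. rlin. rewrite sin_dev_int, sinTh_mean. reflexivity. }
  assert (Br : Rabs (RInt r 0 PI) <= 2 * PI * (PI * gap q)).
  { eapply Rle_trans; [apply (RInt_sup_le r 0 PI (2 * (PI * gap q))); [lra|unfold r; cnt|]|lra].
    intros x Hx. pose proof (sin_taylor (Th x) (dev x)) as T. rewrite (Rmult_comm (dev x)) in T. pose proof (dev_sup x Hx).
    eapply Rle_trans; [exact T|]. lra. }
  replace (RInt (fun x => cos (Th x) * dev x) 0 PI) with (- (eps * sin b) - RInt r 0 PI) by lra.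
  le_via Rabs_triang. rewrite !Rabs_Ropp, Rabs_mult.
  assert (Rabs (sin b) <= 1) by (apply Rabs_sin). pose proof (Rabs_pos eps).
  nra.
Qed.

(** Second-order Taylor expansion of the horizontal closing condition. It trades the linear term of
    the energy for half the potential term of the quadratic form plus [eps cos b]. *)
Lemma sinTh_dev : Rabs (RInt (fun x => sin (Th x) * dev x) 0 PI + / 2 * RInt (fun x => cos (Th x) * dev x ^ 2) 0 PI + eps * cos b)
  <= PI * (PI * gap q * sqrt (PI * gap q)).
Proof.
  pose proof PI_RGT_0 as pi0.
  set (r := fun x => (cos (Th x + dev x) - cos (Th x)) + (sin (Th x) * dev x + / 2 * (cos (Th x) * dev x ^ 2))).
  assert (E : RInt r 0 PI = RInt (fun x => sin (Th x) * dev x) 0 PI + / 2 * RInt (fun x => cos (Th x) * dev x ^ 2) 0 PI + eps * cos b).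
  { unfold r. rlin. rewrite cos_dev_int, (td_closed TD). Rring. }
  rewrite <- E. eapply Rle_trans; [apply (RInt_sup_le r 0 PI (PI * gap q * sqrt (PI * gap q))); [lra|unfold r; cnt|]|lra].
  intros x Hx. pose proof (cos_taylor (Th x) (dev x)) as T. pose proof (dev_sup x Hx) as D2. pose proof (dev_abs x Hx) as D1.
  unfold r. replace (cos (Th x + dev x) - cos (Th x) + (sin (Th x) * dev x + / 2 * (cos (Th x) * dev x ^ 2))) with
    (cos (Th x + dev x) - cos (Th x) + dev x * sin (Th x) + dev x ^ 2 / 2 * cos (Th x)) by field.
  eapply Rle_trans; [exact T|]. replace (Rabs (dev x) ^ 3) with (Rabs (dev x) ^ 2 * Rabs (dev x)) by ring. rewrite pow2_abs.
  apply Rmult_le_compat; pos.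
Qed.

Lemma energy_expand : RInt (fun x => q x ^ 2) 0 PI - PI * Ls =
  gap q + 2 * W2 * RInt (fun x => sin (Th x) * dev x) 0 PI.
Proof.
  rewrite Rmult_assoc, <- (Th1_by_parts dev dev1 dev_d dev1_c), <- Th1_energy.
  rewrite (RInt_ext (fun x => q x ^ 2) (fun x => Th1 x ^ 2 + (dev1 x ^ 2 + 2 * (Th1 x * dev1 x)))) by (intros; unfold dev1; Rring).
  rlin. unfold gap. change (fun x => (q x - Th1 x) ^ 2) with (fun x => dev1 x ^ 2). Rring.
Qed.

Lemma quad_form : RInt (fun x => dev1 x ^ 2 - W2 * cos (Th x) * dev x ^ 2) 0 PI =
  gap q - W2 * RInt (fun x => cos (Th x) * dev x ^ 2) 0 PI.
Proof.
  rlin_as (fun x => dev1 x ^ 2 - W2 * (cos (Th x) * dev x ^ 2)). reflexivity.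
Qed.
End Curve.

(** [energy_expand] and [sinTh_dev] together say that the second variation at [dev] equals the
    energy excess plus [2 W2 eps cos b], up to a cubic error. Coercivity bounds the gap by this form
    and by the squared closing integral, which is [O(eps + gap)]. *)
Lemma energy_near : exists r0 C1 C2, 0 < r0 /\ 0 < C1 /\ 0 < C2 /\ forall (th q : R -> R) (b eps : R),
  (forall x, is_derive th x (q x)) -> (forall x, continuous q x) -> RInt th 0 PI = PI * b ->
  RInt (fun x => cos (th x)) 0 PI = eps -> RInt (fun x => sin (th x)) 0 PI = 0 ->
  gap q <= r0 ->
  gap q <= C1 * (RInt (fun x => q x ^ 2) 0 PI - PI * Ls + 2 * W2 * eps * cos b) + C2 * eps ^ 2.
Proof.
  destruct (coercivity TD) as [K1 [K2 [P1 [P2 Co]]]].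
  pose proof (td_W2 TD) as W0. pose proof PI_RGT_0 as pi0.
  (* Chosen so that, for a gap below the threshold, the cubic remainder and the squared closing
     error each cost at most a quarter of the gap and can be absorbed. *)
  set (M1 := 4 * (K1 * (2 * W2) * PI * PI)). set (M2 := 4 * (K2 * 2 * (2 * PI * PI) ^ 2)).
  assert (m1 : 0 < M1) by (unfold M1; prodpos).
  assert (m2 : 0 < M2) by (unfold M2; prodpos).
  assert (i1 : 0 < / M1) by pos. assert (i2 : 0 < / M2) by pos.
  exists (Rmin ((/ M1) ^ 2 / PI) (/ M2)), (2 * K1), (4 * K2).
  split; [apply Rmin_pos; [pos|]; assumption|]. split; [lra|]. split; [lra|].
  intros th q b eps D C M HC HS Hr.
  pose proof (gap_nonneg q C) as g0.
  pose proof (Co (dev th b) (dev1 q) (dev_d th q b D) (dev1_c q C) (dev_mean th q b D M)) as H.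
  change (RInt (fun x => dev1 q x ^ 2) 0 PI) with (gap q) in H. rewrite (quad_form th q b D C) in H.
  pose proof (energy_expand th q b D C) as EE. pose proof (sinTh_dev th q b eps D C M HC HS) as S1.
  pose proof (cosTh_dev th q b eps D C M HC HS) as S2.
  set (Y := RInt (fun x => cos (Th x) * dev th b x ^ 2) 0 PI) in *.
  set (Z := RInt (fun x => cos (Th x) * dev th b x) 0 PI) in *.
  set (E := RInt (fun x => q x ^ 2) 0 PI - PI * Ls) in *.
  set (g := gap q) in *. set (s := sqrt (PI * g)) in *.
  assert (s1 : s <= / M1).
  { rewrite <- (sqrt_pow2 (/ M1)) by lra. apply sqrt_le_1_alt.
    assert (g <= (/ M1) ^ 2 / PI) by (eapply Rle_trans; [exact Hr|apply Rmin_l]).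
    apply Rmult_le_compat_l with (r := PI) in H0; [|lra]. eapply Rle_trans; [exact H0|right; field; lra]. }
  assert (g1 : g <= / M2) by (eapply Rle_trans; [exact Hr|apply Rmin_r]).
  assert (T1 : g - W2 * Y <= E + 2 * W2 * eps * cos b + 2 * W2 * (PI * (PI * g * s))).
  { apply Rabs_le_between in S1. nra. }
  assert (T2 : K1 * (2 * W2 * (PI * (PI * g * s))) <= g / 4).
  { replace (K1 * (2 * W2 * (PI * (PI * g * s)))) with (M1 / 4 * g * s) by (unfold M1; field).
    replace (g / 4) with (M1 / 4 * g * / M1) by (field; lra). apply Rmult_le_compat_l; [|exact s1]. pos. }
  assert (T3 : Z ^ 2 <= 2 * eps ^ 2 + 2 * (2 * PI * PI) ^ 2 * g ^ 2).
  { rewrite <- pow2_abs. apply Rle_trans with ((Rabs eps + 2 * PI * (PI * g)) ^ 2); [apply pow_incr; split; [apply Rabs_pos|exact S2]|].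
    rewrite <- (pow2_abs eps). pose proof (pow2_ge_0 (Rabs eps - 2 * PI * (PI * g))). nra. }
  assert (T4 : K2 * (2 * (2 * PI * PI) ^ 2 * g ^ 2) <= g / 4).
  { replace (K2 * (2 * (2 * PI * PI) ^ 2 * g ^ 2)) with (M2 / 4 * g * g) by (unfold M2; field).
    replace (g / 4) with (M2 / 4 * g * / M2) by (field; lra). apply Rmult_le_compat_l; [|exact g1]. pos. }
  nra.
Qed.

(** * Lower bound for the dissipation, and sign of the height *)

Lemma sin_lip (u v : R) : Rabs (sin u - sin v) <= Rabs (u - v).
Proof.
  destruct (MVT_gen sin v u cos) as [c [_ E]].
  - intros; der.
  - intros; apply continuity_sin.
  - rewrite E, Rabs_mult. rewrite <- (Rmult_1_l (Rabs (u - v))) at 2. apply Rmult_le_compat_r; pos.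
    apply Rabs_cos.
Qed.

(** Integration by parts turns it into [W2] times the integral of [sin^2 Th]. *)
Lemma kinetic_pos : 0 < RInt (fun x => Th1 x ^ 2 * cos (Th x)) 0 PI.
Proof.
  pose proof h_PI as hP. pose proof (td_W2 TD) as W0.
  rewrite (RInt_ext _ (fun x => Th1 x * (Th1 x * cos (Th x)))) by pos.
  rewrite (Th1_by_parts (fun x => sin (Th x)) (fun x => Th1 x * cos (Th x))).
  - apply Rmult_lt_0_compat; [exact W0|]. rewrite is_RInt_fold by cnt.
    apply RInt_gt_0; [exact hP| |].
    + intros x Hx.
      assert (0 < Th x).
      { destruct (mvt_all Th Th1 (PI / 2) x ltac:(lra)) as [c [Hc E]]; [apply TD|]. rewrite (Th_mid TD) in E.
        pose proof (td_incr TD c ltac:(lra)). nra. }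
      pose proof (Th_range TD x ltac:(lra)). pose proof (td_th0_range TD).
      assert (0 < sin (Th x)) by (apply sin_gt_0; lra). nra.
    + cnt.
  - der.
  - cnt.
Qed.

(** For the exact teardrop rotated by [b] the moment of [sin (b + Th)] is [sin b] times
    [kinetic_pos], since the term with [sin Th] is odd about the midpoint. The rest is Lipschitz
    dependence on [q] and [th]. *)
Lemma moment_near : exists K, 0 < K /\ forall (th q : R -> R) (b : R),
  (forall x, is_derive th x (q x)) -> (forall x, continuous q x) -> RInt th 0 PI = PI * b ->
  sqrt (PI * gap q) <= 1 ->
  Rabs (RInt (fun x => q x ^ 2 * sin (th x)) 0 PI - sin b * RInt (fun x => Th1 x ^ 2 * cos (Th x)) 0 PI) <= K * sqrt (PI * gap q).
Proof.
  pose proof PI2_1 as pi1.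
  destruct (bounded_on Th1 0 PI ltac:(lra) cTh1) as [M [M0 HM]].
  exists (1 + 2 * M + PI * M ^ 2). split; [nra|].
  intros th q b D C HM0 Hs.
  pose proof (gap_nonneg q C) as g0.
  set (s := sqrt (PI * gap q)) in *. assert (s0 : 0 <= s) by apply sqrt_pos.
  assert (ss : s ^ 2 = PI * gap q) by (unfold s; apply pow2_sqrt; apply Rmult_le_pos; lra).
  pose proof (dev1_c q C) as Cd.
  assert (Z : RInt (fun x => Th1 x ^ 2 * sin (Th x)) 0 PI = 0).
  { apply RInt_odd_zero; [cnt|]. intros x. rewrite (Th1_sym TD), (td_odd TD), sin_neg. ring. }
  assert (E : RInt (fun x => Th1 x ^ 2 * sin (b + Th x)) 0 PI = sin b * RInt (fun x => Th1 x ^ 2 * cos (Th x)) 0 PI).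
  { rewrite (RInt_ext _ (fun x => sin b * (Th1 x ^ 2 * cos (Th x)) + cos b * (Th1 x ^ 2 * sin (Th x)))) by (intros; rewrite sin_plus; Rring).
    rlin. rewrite Z. Rring. }
  rewrite <- E, <- (RInt_Rminus (fun x => q x ^ 2 * sin (th x)) (fun x => Th1 x ^ 2 * sin (b + Th x))) by cnt.
  eapply Rle_trans; [apply RInt_abs_le; [lra|cnt]|].
  apply Rle_trans with (RInt (fun x => dev1 q x ^ 2 + (2 * M * Rabs (dev1 q x) + M ^ 2 * s)) 0 PI).
  - apply RInt_le_on; [lra|cnt|cnt|].
    + intros x Hx. specialize (HM x Hx). pose proof (dev_abs th q b D C HM0 x Hx) as Hd. fold s in Hd.
      replace (q x ^ 2 * sin (th x) - Th1 x ^ 2 * sin (b + Th x)) with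
        (dev1 q x ^ 2 * sin (th x) + (2 * Th1 x * dev1 q x * sin (th x) + Th1 x ^ 2 * (sin (th x) - sin (b + Th x)))) by (unfold dev1; ring).
      assert (Rabs (sin (th x)) <= 1) by (apply Rabs_sin).
      pose proof (sin_lip (th x) (b + Th x)) as SL. replace (th x - (b + Th x)) with (dev th b x) in SL by (unfold dev; ring).
      le_via Rabs_triang. apply Rplus_le_compat.
      * rewrite Rabs_mult, (Rabs_pos_eq (dev1 q x ^ 2)) by pos. nra.
      * le_via Rabs_triang. apply Rplus_le_compat.
        -- rewrite !Rabs_mult, (Rabs_pos_eq 2) by lra. pose proof (Rabs_pos (dev1 q x)).
           rewrite <- (Rmult_1_r (2 * M * Rabs (dev1 q x))). apply Rmult_le_compat; pos.
           apply Rmult_le_compat_r; lra.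
        -- rewrite Rabs_mult, (Rabs_pos_eq (Th1 x ^ 2)) by pos. apply Rmult_le_compat; pos.
           rewrite <- pow2_abs. apply pow_incr. split; pos.
  - rewrite RInt_Rplus, RInt_Rplus, RInt_Rscal, RInt_cst by cnt.
    change (RInt (fun x => dev1 q x ^ 2) 0 PI) with (gap q).
    assert (A : RInt (fun x => Rabs (dev1 q x)) 0 PI <= s).
    { rewrite <- (sqrt_pow2 (RInt (fun x => Rabs (dev1 q x)) 0 PI)).
      - apply sqrt_le_1_alt. eapply Rle_trans; [apply RInt_sqr_CS; [lra|cnt]|].
        rewrite Rminus_0_r. right. f_equal. apply RInt_ext. intros. apply pow2_abs.
      - apply RInt_nonneg_on; [lra|cnt|pos]. }
    nra.
Qed.

(** Were the normal velocity zero, the elastic force would be constant. Its vertical component would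
    then be a nonzero multiple of [sin b] by the virial identity, while torque balance about the
    start forces its product with [eps] to vanish. Quantifying both identities bounds [eps |sin b|]
    by the integral of the velocity. *)
Lemma drive (s0 : R) : 0 < s0 -> exists r c, 0 < r /\ 0 < c /\ forall (th q q1 q2 : R -> R) (b eps Lam : R),
  (forall x, is_derive th x (q x)) -> (forall x, is_derive q x (q1 x)) -> (forall x, is_derive q1 x (q2 x)) ->
  (forall x, continuous q2 x) -> RInt th 0 PI = PI * b ->
  RInt (fun x => cos (th x)) 0 PI = eps -> RInt (fun x => sin (th x)) 0 PI = 0 -> q 0 = 0 -> q PI = 0 ->
  0 <= eps <= 1 -> gap q <= r -> s0 <= Rabs (sin b) ->
  c * eps <= RInt (fun x => Rabs (-2 * q2 x - q x ^ 3 + Lam * q x)) 0 PI.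
Proof.
  intros Hs. destruct moment_near as [K [K0 HK]]. pose proof kinetic_pos as I0.
  pose proof PI_RGT_0 as pi0.
  set (I := RInt (fun x => Th1 x ^ 2 * cos (Th x)) 0 PI) in *. set (m := s0 * I / 2).
  assert (m0 : 0 < m) by (unfold m; apply Rdiv_lt_0_compat; [pos|lra]).
  set (s1 := Rmin 1 (m / K)). assert (s1p : 0 < s1) by (apply Rmin_pos; [lra|pos]).
  exists (s1 ^ 2 / PI), (3 * m / (2 * PI ^ 2 + PI)).
  assert (d0 : 0 < 2 * PI ^ 2 + PI) by pos.
  split; pos. split; [pos|].
  intros th q q1 q2 b eps Lam D Dq Dq1 C2 HM HC HS ql qr He Hr Hb.
  assert (Cq : forall x, continuous q x) by cnt.
  assert (Hs1 : sqrt (PI * gap q) <= s1).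
  { rewrite <- (sqrt_pow2 s1) by lra. apply sqrt_le_1_alt. apply Rmult_le_compat_l with (r := PI) in Hr; [|lra].
    eapply Rle_trans; [exact Hr|right; field; lra]. }
  pose proof (HK th q b D Cq HM ltac:(eapply Rle_trans; [exact Hs1|apply Rmin_l])) as HK1.
  set (Mq := RInt (fun x => q x ^ 2 * sin (th x)) 0 PI) in *.
  assert (HMq : m <= Rabs Mq).
  { assert (K * sqrt (PI * gap q) <= m).
    { apply Rle_trans with (K * (m / K)); [|right; field; lra]. apply Rmult_le_compat_l; [lra|].
      eapply Rle_trans; [exact Hs1|apply Rmin_r]. }
    assert (2 * m <= Rabs (sin b * I)).
    { rewrite Rabs_mult, (Rabs_pos_eq I) by lra. unfold m. nra. }
    pose proof (Rabs_triang_inv (sin b * I) Mq) as T. rewrite Rabs_minus_sym in T. lra. }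
  set (W := fun x => -2 * q2 x - q x ^ 3 + Lam * q x).
  assert (CW : forall x, continuous W x).
  { unfold W. cnt. }
  set (J := RInt (fun x => Rabs (W x)) 0 PI).
  (* Components of the elastic force, the Noether current of translations: its derivative is minus
     the normal velocity times the normal. *)
  set (Py := fun x => (q x ^ 2 - Lam) * sin (th x) + 2 * q1 x * cos (th x)).
  set (Px := fun x => (q x ^ 2 - Lam) * cos (th x) - 2 * q1 x * sin (th x)).
  assert (DPy : forall x, is_derive Py x (- (W x * cos (th x)))) by (unfold Py, W; der).
  assert (DPx : forall x, is_derive Px x (W x * sin (th x))) by (unfold Px, W; der).
  set (Gx := fun x => RInt (fun y => cos (th y)) 0 x). set (Gy := fun x => RInt (fun y => sin (th y)) 0 x).
  assert (DGx : forall x, is_derive Gx x (cos (th x))) by (intros; apply (is_derive_RInt_var (fun y => cos (th y))); cnt).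
  assert (DGy : forall x, is_derive Gy x (sin (th x))) by (intros; apply (is_derive_RInt_var (fun y => sin (th y))); cnt).
  assert (bG : forall x, 0 <= x <= PI -> Rabs (Gx x) <= PI /\ Rabs (Gy x) <= PI).
  { split.
    - eapply Rle_trans; [apply (Rabs_RInt_le (fun y => cos (th y)) 0 x 1); [cnt|]|rewrite Rabs_pos_eq; lra].
      intros; apply Rabs_cos.
    - eapply Rle_trans; [apply (Rabs_RInt_le (fun y => sin (th y)) 0 x 1); [cnt|]|rewrite Rabs_pos_eq; lra].
      intros; apply Rabs_sin. }
  assert (wJ : forall (g : R -> R) (B : R), 0 <= B -> (forall x, continuous g x) -> (forall x, 0 <= x <= PI -> Rabs (g x) <= B) ->
    forall a, 0 <= a <= PI -> Rabs (RInt (fun x => W x * g x) a PI) <= B * J).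
  { intros g B B0 Cg Hg a Ha.
    eapply Rle_trans; [apply RInt_abs_le; [lra|cnt]|].
    apply Rle_trans with (RInt (fun x => B * Rabs (W x)) a PI).
    - apply RInt_le_on; [lra|cnt|cnt|].
      + intros x Hx. rewrite Rabs_mult, Rmult_comm. apply Rmult_le_compat_r; pos. apply Hg; lra.
    - rewrite RInt_Rscal by cnt. apply Rmult_le_compat_l; [exact B0|].
      unfold J. rewrite (RInt_split (fun x => Rabs (W x)) 0 a PI) by cnt.
      assert (0 <= RInt (fun x => Rabs (W x)) 0 a) by (apply RInt_nonneg_on; [lra|cnt|pos]). lra. }
  (* Virial identity: up to a multiple of [sin th], the difference of the integrands is the
     derivative of [2 q cos th], and [q] vanishes at the ends. *)
  assert (A1 : 3 * Mq = RInt Py 0 PI).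
  { assert (E : RInt (fun x => (Py x - 3 * (q x ^ 2 * sin (th x))) + Lam * sin (th x)) 0 PI = 0).
    { rewrite (RInt_ext _ (fun x => 2 * q1 x * cos (th x) + 2 * q x * (q x * - sin (th x)))) by (intros; unfold Py; Rring).
      rewrite (RInt_exact (fun x => 2 * q x * cos (th x)) (fun x => 2 * q1 x * cos (th x) + 2 * q x * (q x * - sin (th x)))).
      - rewrite ql, qr. Rring.
      - der.
      - cnt. }
    revert E. rlin. fold Mq. rewrite HS. change (RInt (fun x => Py x) 0 PI) with (RInt Py 0 PI).
    lra. }
  assert (A2 : forall x, 0 <= x <= PI -> Rabs (Py x - Py PI) <= 1 * J).
  { intros x Hx. assert (E : Py PI - Py x = - RInt (fun x => W x * cos (th x)) x PI).
    { rewrite <- (RInt_exact Py (fun x => - (W x * cos (th x))) x PI DPy).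
      - rlin_as (fun x => (-1) * (W x * cos (th x))). Rring.
      - cnt. }
    rewrite Rabs_minus_sym, E, Rabs_Ropp. apply wJ; [lra|cnt| |exact Hx]. intros; apply Rabs_cos. }
  assert (A3 : Rabs (RInt Py 0 PI - PI * Py PI) <= PI * J).
  { replace (PI * Py PI) with (RInt (fun _ => Py PI) 0 PI) by (rewrite RInt_cst; Rring).
    rewrite <- (RInt_Rminus Py (fun _ => Py PI)) by cnt.
    eapply Rle_trans; [apply (RInt_sup_le (fun x => Py x - Py PI) 0 PI (1 * J)); [lra|cnt|exact A2]|]. right; ring. }
  (* Torque balance, the Noether identity of rotations: [Py Gx - Px Gy - 2 q] vanishes at the start
     and equals [Py PI * eps] at the end. *)
  assert (A4 : Rabs (Py PI * eps) <= 2 * PI * J).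
  { set (g := fun x => cos (th x) * Gx x + sin (th x) * Gy x).
    assert (Cg : forall x, continuous g x).
    { unfold g. cnt. }
    assert (E : Py PI * eps = - RInt (fun x => W x * g x) 0 PI).
    { assert (E1 : RInt (fun x => - (W x * g x)) 0 PI = Py PI * eps).
      { rewrite (RInt_exact (fun x => Py x * Gx x - Px x * Gy x - 2 * q x) (fun x => - (W x * g x))).
        - rewrite ql, qr. unfold Gx, Gy. rewrite !RInt_point, HC, HS. change (Py PI * eps - Px PI * 0 - 2 * 0 - (Py 0 * 0 - Px 0 * 0 - 2 * 0) = Py PI * eps). ring.
        - der.
          + pose proof (sin2_cos2 (th x)) as SC. unfold Rsqr in SC.
            assert (SP : Py x * cos (th x) - Px x * sin (th x) = 2 * q1 x * (sin (th x) * sin (th x) + cos (th x) * cos (th x))) by (unfold Py, Px; ring).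
            rewrite SC in SP. unfold g. lra.
        - cnt. }
      rewrite <- E1. rlin_as (fun x => (-1) * (W x * g x)). Rring. }
    rewrite E, Rabs_Ropp. apply wJ; [lra|exact Cg| |lra].
    intros x Hx. destruct (bG x Hx) as [b1 b2]. le_via Rabs_triang. rewrite !Rabs_mult.
    assert (Rabs (cos (th x)) <= 1) by (apply Rabs_cos). assert (Rabs (sin (th x)) <= 1) by (apply Rabs_sin).
    assert (Rabs (cos (th x)) * Rabs (Gx x) <= 1 * PI) by (apply Rmult_le_compat; auto; apply Rabs_pos).
    assert (Rabs (sin (th x)) * Rabs (Gy x) <= 1 * PI) by (apply Rmult_le_compat; auto; apply Rabs_pos). lra. }
  assert (F : 3 * m * eps <= (2 * PI ^ 2 + PI) * J).
  { rewrite <- A1 in A3.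
    assert (B1 : 3 * Rabs Mq * eps = Rabs (3 * Mq * eps)) by (rewrite !Rabs_mult, (Rabs_pos_eq 3), (Rabs_pos_eq eps) by lra; reflexivity).
    assert (B2 : 3 * m * eps <= 3 * Rabs Mq * eps) by (apply Rmult_le_compat_r; lra).
    eapply Rle_trans; [exact B2|]. rewrite B1.
    replace (3 * Mq * eps) with (PI * (Py PI * eps) + (3 * Mq - PI * Py PI) * eps) by ring.
    le_via Rabs_triang.
    assert (Rabs (PI * (Py PI * eps)) <= PI * (2 * PI * J)).
    { rewrite Rabs_mult, (Rabs_pos_eq PI) by lra. apply Rmult_le_compat_l; [lra|exact A4]. }
    assert (Rabs ((3 * Mq - PI * Py PI) * eps) <= PI * J * 1).
    { rewrite Rabs_mult. apply Rmult_le_compat; pos. rewrite Rabs_pos_eq; lra. }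
    lra. }
  apply Rmult_le_reg_l with (2 * PI ^ 2 + PI); [exact d0|].
  replace ((2 * PI ^ 2 + PI) * (3 * m / (2 * PI ^ 2 + PI) * eps)) with (3 * m * eps) by (field; lra). exact F.
Qed.

Lemma sinTh_primitive x : RInt (fun y => sin (Th y)) 0 x = - Th1 x / W2.
Proof.
  pose proof (td_W2 TD) as W0.
  rewrite (RInt_exact (fun x => - / W2 * Th1 x) (fun y => sin (Th y))).
  - rewrite (td_left TD). lra.
  - der. field. lra.
  - cnt.
Qed.

(** The exact teardrop has height [- Th1 / W2], negative inside but vanishing at both ends. A
    uniform perturbation is harmless in the middle; near an end the sign of [sin th] itself,
    integrated from that end, decides. *)
Lemma sign_of_height : exists k, 0 < k <= 1 /\ forall (th : R -> R), (forall x, continuous th x) ->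
  (forall x, 0 <= x <= PI -> Rabs (th x - Th x) <= k) -> RInt (fun x => sin (th x)) 0 PI = 0 ->
  forall x, 0 < x < PI -> RInt (fun y => sin (th y)) 0 x < 0.
Proof.
  pose proof (td_W2 TD) as W0. pose proof (td_th0_range TD) as t0.
  assert (T0 : Th 0 = - th0) by (pose proof (td_odd TD 0) as H; rewrite Rminus_0_r, (td_th0 TD) in H; lra).
  assert (X : exists x0, 0 < x0 < PI / 2 /\ forall x, 0 <= x <= x0 -> Th x <= - th0 / 2).
  { pose proof (cTh 0) as C. assert (e : 0 < th0 / 2) by lra.
    destruct (C (fun y => Rabs (y - Th 0) < th0 / 2)) as [d Hd]; [exists (mkposreal _ e); intros y Hy; exact Hy|].
    exists (Rmin (d / 2) (PI / 4)). pose proof (cond_pos d).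
    pose proof (Rmin_l (d / 2) (PI / 4)). pose proof (Rmin_r (d / 2) (PI / 4)). split; [split; [apply Rmin_pos|]; lra|].
    intros x Hx. assert (B : Rabs (x - 0) < d) by (rewrite Rminus_0_r, Rabs_pos_eq; lra).
    specialize (Hd x B). apply Rabs_def2 in Hd. lra. }
  destruct X as [x0 [Hx0 HX]].
  set (m := Rmin (Th1 x0) (Th1 (PI / 2)) / W2).
  assert (m0 : 0 < m) by (apply Rdiv_lt_0_compat; [apply Rmin_pos; apply TD; lra|exact W0]).
  assert (Hm : forall x, x0 <= x <= PI - x0 -> m <= Th1 x / W2).
  { intros x Hx. apply Rmult_le_compat_r; pos. le_via Rmin_l.
    destruct (Rle_dec (PI / 2) x) as [H|H].
    - rewrite <- (Th1_sym TD x0). apply (Th1_anti TD); lra.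
    - rewrite <- (Th1_sym TD x0), <- (Th1_sym TD x). apply (Th1_anti TD); lra. }
  (* The second and third bounds keep the size of the perturbed angle strictly between [0] and [PI]
     near the ends, where that of [Th] lies between [th0 / 2] and [th0]. The last keeps half of the
     depth [m] in the middle. *)
  set (k := Rmin 1 (Rmin (th0 / 4) (Rmin ((PI - th0) / 2) (m / (2 * PI))))).
  assert (mp : 0 < m / (2 * PI)) by pos.
  assert (k1 : k <= 1) by apply Rmin_l.
  assert (k2 : k <= th0 / 4) by (eapply Rle_trans; [apply Rmin_r|apply Rmin_l]).
  assert (k3 : k <= (PI - th0) / 2) by (eapply Rle_trans; [apply Rmin_r|eapply Rle_trans; [apply Rmin_r|apply Rmin_l]]).
  assert (k4 : k <= m / (2 * PI)) by (eapply Rle_trans; [apply Rmin_r|eapply Rle_trans; [apply Rmin_r|apply Rmin_r]]).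
  exists k. split; [split; [repeat apply Rmin_pos; lra|exact k1]|].
  intros th C Hk Z x Hx.
  assert (lo : forall y, 0 <= y <= PI -> - th0 <= Th y).
  { intros y Hy. rewrite <- T0. apply (Th_mono TD); lra. }
  assert (hi : forall y, 0 <= y <= PI -> Th y <= th0).
  { intros y Hy. rewrite <- (td_th0 TD). apply (Th_mono TD); lra. }
  destruct (Rlt_dec x x0) as [L|L]; [|destruct (Rlt_dec (PI - x0) x) as [L'|L']].
  - assert (P : 0 < RInt (fun y => - sin (th y)) 0 x).
    { apply RInt_gt_0; [lra| |].
      - intros y Hy. pose proof (Hk y ltac:(lra)) as B. apply Rabs_le_between in B. pose proof (HX y ltac:(lra)). pose proof (lo y ltac:(lra)).
        rewrite <- sin_neg. apply sin_gt_0; lra.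
      - cnt. }
    revert P. rlin_as (fun y => (-1) * sin (th y)). lra.
  - assert (P : 0 < RInt (fun y => sin (th y)) x PI).
    { apply RInt_gt_0; [lra| |cnt].
      intros y Hy. pose proof (Hk y ltac:(lra)) as B. apply Rabs_le_between in B. pose proof (hi y ltac:(lra)).
      pose proof (HX (PI - y) ltac:(lra)) as HT. rewrite (td_odd TD) in HT. apply sin_gt_0; lra. }
    rewrite (RInt_split (fun y => sin (th y)) 0 x PI) in Z by cnt. lra.
  - pose proof (Hm x ltac:(lra)) as M. pose proof (sinTh_primitive x) as SP.
    assert (B : Rabs (RInt (fun y => sin (th y) - sin (Th y)) 0 x) <= x * k).
    { eapply Rle_trans; [apply (RInt_sup_le (fun y => sin (th y) - sin (Th y)) 0 x k); [lra|cnt|]|lra].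
      intros y Hy. eapply Rle_trans; [apply sin_lip|apply Hk; lra]. }
    rewrite RInt_Rminus, SP in B by cnt. apply Rabs_le_between in B.
    assert (x * k <= PI * (m / (2 * PI))) by (apply Rmult_le_compat; try lra; left; repeat apply Rmin_pos; lra).
    replace (PI * (m / (2 * PI))) with (m / 2) in H by (field; lra).
    lra.
Qed.
End Near.

Arguments gap : clear implicits.
Arguments dev : clear implicits.

(** * The angle equation *)

Lemma sumZ_delta0 v : sumZ (fun n => if Z.eq_dec n 0 then v else 0) = v.
Proof.
  apply is_series_unique. eapply is_series_ext; [|apply (is_series_single (nz 0) v)].
  intros n. simpl. destruct (Nat.eqb_spec n (nz 0)) as [->|N]; auto.
  destruct (Z.eq_dec (zn n) 0) as [Z0|]; [|lra]. exfalso. apply N. rewrite <- Z0. now rewrite nz_zn.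
Qed.

Lemma summ_delta0 v : summ (fun n => if Z.eq_dec n 0 then v else 0).
Proof.
  apply (summ_dom _ (fun n => Rabs v * w n)); [apply summ_scal, summ_w|].
  intros n. destruct (Z.eq_dec n 0) as [->|_].
  - unfold w. lra.
  - rewrite Rabs_R0. apply Rmult_le_pos; [pos|left; apply w_pos].
Qed.

Lemma ev_sin_zero f k : ev (PI / 2) f (IZR k * PI) = 0.
Proof.
  transitivity (sumZ (fun n => 0 * w n)); [|rewrite sumZ_scal; ring].
  apply sumZ_ext. intros n. rewrite cos_plus, cos_PI2.
  replace (IZR n * (IZR k * PI)) with (IZR (n * k) * PI) by (rewrite mult_IZR; ring).
  rewrite (sin_eq_0_1 (IZR (n * k) * PI)); [ring|]. now exists (n * k)%Z.
Qed.

Lemma pow_exp_decay (j : nat) (r x : R) : 0 < r -> 0 <= x ->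
  x ^ j * exp (- (r * x)) <= INR (fact j) / r ^ j.
Proof.
  intros Hr Hx. pose proof (exp_ge_taylor (r * x) j ltac:(nra)) as T.
  assert (S : (r * x) ^ j / INR (fact j) <= exp (r * x)).
  { eapply Rle_trans; [|exact T]. destruct j; [simpl; lra|]. rewrite tech5.
    enough (0 <= sum_f_R0 (fun k => (r * x) ^ k / INR (fact k)) j) by lra.
    apply cond_pos_sum. intros k. apply Rmult_le_pos; [pos|].
    left. apply Rinv_0_lt_compat, INR_fact_lt_0. }
  pose proof (INR_fact_lt_0 j). pose proof (exp_pos (r * x)). assert (rj : 0 < r ^ j) by pos.
  rewrite exp_Ropp, Rpow_mult_distr in *.
  apply Rmult_le_reg_r with (r ^ j * exp (r * x) / INR (fact j)).
  { pos. }
  replace (x ^ j * / exp (r * x) * (r ^ j * exp (r * x) / INR (fact j))) with (r ^ j * x ^ j / INR (fact j)) by (field; lra).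
  replace (INR (fact j) / r ^ j * (r ^ j * exp (r * x) / INR (fact j))) with (exp (r * x)) by (field; lra).
  exact S.
Qed.

Definition dec (j : nat) (r : R) : R := INR (fact j) / r ^ j.
Lemma dec_pos j r : 0 < r -> 0 < dec j r.
Proof. intros. apply Rdiv_lt_0_compat; [apply INR_fact_lt_0|pos]. Qed.

Lemma Wb_dec (A r : R) (f : Z -> R) (j : nat) : 0 < r -> 0 <= A ->
  (forall n, Rabs (f n) <= A * w n * exp (- (r * Rabs (IZR n)))) ->
  forall n, Rabs (IZR n ^ j * f n) <= A * dec j r * w n.
Proof.
  intros Hr HA H n. rewrite Rabs_mult, <- RPow_abs.
  eapply Rle_trans; [apply Rmult_le_compat_l; [apply pow_le, Rabs_pos|apply H]|].
  pose proof (pow_exp_decay j r (Rabs (IZR n)) Hr (Rabs_pos _)) as D.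
  replace (Rabs (IZR n) ^ j * (A * w n * exp (- (r * Rabs (IZR n)))))
    with (A * w n * (Rabs (IZR n) ^ j * exp (- (r * Rabs (IZR n))))) by ring.
  replace (A * dec j r * w n) with (A * w n * dec j r) by ring.
  apply Rmult_le_compat_l; [|exact D]. apply Rmult_le_pos; [exact HA|left; apply w_pos].
Qed.

Ltac cont2_tac := repeat match goal with
  | |- cont2 (fun x t => @?f x t + @?g x t) _ _ => apply (cont2_plus f g)
  | |- cont2 (fun x t => @?f x t * @?g x t) _ _ => apply (cont2_mult f g)
  | |- cont2 (fun x t => ?c) _ _ => apply (cont2_const c)
  | |- _ => assumption
  end.
Ltac CK_tac := repeat match goal with
  | |- CK _ _ (fun x t => @?f x t + @?g x t) => apply (CK_plus _ _ f g)
  | |- CK _ _ (fun x t => @?f x t * @?g x t) => apply (CK_mult _ _ f g)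
  | |- CK ?P ?k (fun x t => ?c) => apply (CK_const P k c)
  | |- _ => assumption
  end.

Lemma locally_bd (f : R -> R) (t : R) : continuous f t -> locally t (fun s => Rabs (f s) <= Rabs (f t) + 1).
Proof.
  intros C. pose proof (proj1 (filterlim_locally _ _) C (mkposreal 1 Rlt_0_1)) as H.
  eapply filter_imp; [|exact H]. intros s Hs. ballR Hs.
  pose proof (Rabs_triang_inv (f s) (f t)). unfold Rminus in H0 at 2. lra.
Qed.

Lemma is_derive_cube (f : R -> R) (x l : R) : is_derive f x l -> is_derive (fun x => f x ^ 3) x (3 * f x ^ 2 * l).
Proof.
  intros D. apply (is_derive_ext (fun x => f x * f x ^ 2)); auto. der.
Qed.
#[global] Hint Resolve is_derive_cube : deriv.

Lemma RInt_CS (f g : R -> R) (a b : R) : a <= b -> (forall x, continuous f x) -> (forall x, continuous g x) ->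
  RInt (fun x => f x * g x) a b ^ 2 <= RInt (fun x => f x ^ 2) a b * RInt (fun x => g x ^ 2) a b.
Proof.
  intros H Cf Cg.
  set (F := RInt (fun x => f x ^ 2) a b : R). set (G := RInt (fun x => g x ^ 2) a b : R). set (I := RInt (fun x => f x * g x) a b : R).
  assert (F0 : 0 <= F) by (apply RInt_nonneg_on; [exact H|cnt|pos]).
  assert (G0 : 0 <= G) by (apply RInt_nonneg_on; [exact H|cnt|pos]).
  assert (Q : forall l, 0 <= F - 2 * l * I + l ^ 2 * G).
  { intros l. assert (E : RInt (fun x => (f x - l * g x) ^ 2) a b = F - 2 * l * I + l ^ 2 * G).
    { rlin_as (fun x => (f x ^ 2 - 2 * l * (f x * g x)) + l ^ 2 * g x ^ 2). reflexivity. }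
    rewrite <- E. apply RInt_nonneg_on; [exact H|cnt|pos]. }
  clearbody F G I. destruct (Req_dec G 0) as [Z|Z].
  - assert (I = 0); [|subst; lra]. destruct (Req_dec I 0) as [W|W]; [exact W|].
    specialize (Q ((F + 1) / I)). rewrite Z in Q. replace (F - 2 * ((F + 1) / I) * I + ((F + 1) / I) ^ 2 * 0) with (- F - 2) in Q by (field; exact W). lra.
  - specialize (Q (I / G)). apply Rmult_le_compat_r with (r := G) in Q; [|exact G0].
    replace ((F - 2 * (I / G) * I + (I / G) ^ 2 * G) * G) with (F * G - I ^ 2) in Q by (field; exact Z). lra.
Qed.

(** The series are continuous at all times, but the equations hold only on [P]. It will be the empty
    set for facts at a fixed time, a bounded interval during the continuation argument, and finally
    all positive times. *)
Record base_flow (P : R -> Prop) (a : Z -> R -> R) (L : R -> R) (T0 A : R) : Prop := {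
  bf_open : opn P;
  bf_pos : forall t, P t -> 0 < t;
  bf_T0 : 0 < T0;
  bf_A : 0 <= A;
  bf_ac : forall n t, continuous (a n) t;
  bf_Lc : forall t, continuous L t;
  bf_even : forall n t, a (- n)%Z t = a n t;
  bf_dec : forall t, Wb2 A (Rmin (tpos t) T0) (fun n => a n t);
  bf_ode : forall n t, P t -> is_derive (a n) t (- (n4 n) * a n t + Nc (fun n => a n t) (L t) n);
  bf_Lode : forall t, P t -> is_derive L t (-2 * L t * Pc (fun n => a n t) (L t) 0)
}.

Section FlowFacts.
Context {P : R -> Prop} {a : Z -> R -> R} {L : R -> R} {T0 A : R}.
Hypothesis BF : base_flow P a L T0 A.
Let P_open := bf_open _ _ _ _ _ BF.
Let P_pos := bf_pos _ _ _ _ _ BF.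
Let T0_pos := bf_T0 _ _ _ _ _ BF.
Let A_pos := bf_A _ _ _ _ _ BF.
Let a_cont := bf_ac _ _ _ _ _ BF.
Let L_cont := bf_Lc _ _ _ _ _ BF.
Let a_even := bf_even _ _ _ _ _ BF.
Let a_dec := bf_dec _ _ _ _ _ BF.
Let a_ode := bf_ode _ _ _ _ _ BF.
Let L_ode := bf_Lode _ _ _ _ _ BF.

Definition rate (t : R) : R := Rmin (tpos t) T0.
Lemma rate_pos t : 0 < t -> 0 < rate t.
Proof. intros H. apply Rmin_glb_lt; [rewrite pos_id; lra|lra]. Qed.
Lemma rate_nonneg t : 0 <= rate t.
Proof. apply Rmin_glb; [apply pos_ge|lra]. Qed.
Lemma rate_mono t s : t <= s -> rate t <= rate s.
Proof. unfold rate, tpos, Rmax, Rmin. repeat destruct Rle_dec; lra. Qed.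

Definition c1 (n : Z) (t : R) : R := if Z.eq_dec n 0 then 0 else a n t.
Lemma c1_bd t n : Rabs (c1 n t) <= A * w n * exp (- (rate t * Rabs (IZR n))).
Proof.
  unfold c1. destruct (Z.eq_dec n 0) as [->|Hn].
  - rewrite Rabs_R0. repeat apply Rmult_le_pos; [lra|left; apply w_pos|pos].
  - eapply Rle_trans; [now apply a_dec|]. apply Rmult_le_compat_r; pos.
    apply Rmult_le_compat_l; [lra|]. pose proof (w_pos n). pose proof (w_le_1 n). nra.
Qed.

(** Each derivative in [x] multiplies by [n] and advances the phase by a quarter turn, so this is
    the [j]-th derivative of the angle as a single formula. *)
Definition Aj (j : nat) (x t : R) : R := ev (INR j * (PI / 2)) (fun n => IZR n ^ j * a n t) x.

Lemma coef_dom j t1 : 0 < t1 -> forall t n, t1 <= t -> n <> 0%Z ->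
  Rabs (IZR n ^ j * a n t) <= A * dec j (rate t1) * w n.
Proof.
  intros H1 t n Ht Hn.
  pose proof (Wb_dec A (rate t1) (fun n => c1 n t) j (rate_pos t1 H1) A_pos) as D.
  unfold c1 in D at 2.
  specialize (fun H => D H n). destruct (Z.eq_dec n 0); [contradiction|]. apply D.
  intros m. le_via c1_bd. apply Rmult_le_compat_l.
  - apply Rmult_le_pos; [lra|left; apply w_pos].
  - apply exp_mono. pose proof (rate_mono t1 t Ht). pose proof (Rabs_pos (IZR m)). nra.
Qed.

(** Up to two derivatives the factor [w^2] suffices without exponential decay. This gives continuity
    down to time zero, where the strip has width zero. *)
Lemma coef_dom_low j : (j <= 2)%nat -> forall t n, n <> 0%Z -> Rabs (IZR n ^ j * a n t) <= A * w n.
Proof.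
  intros Hj t n Hn. rewrite Rabs_mult, <- RPow_abs.
  assert (B : Rabs (a n t) <= A * w n ^ 2).
  { eapply Rle_trans; [now apply a_dec|]. rewrite <- (Rmult_1_r (A * w n ^ 2)) at 2.
    apply Rmult_le_compat_l; pos.
    apply exp_decay_le_1. apply rate_nonneg. }
  assert (Q : Rabs (IZR n) ^ j * w n ^ 2 <= w n).
  { destruct j as [|[|[|j]]]; [|rewrite pow_1; apply w2_n|rewrite pow2_abs; apply w2_n2|lia].
    pose proof (w_pos n). pose proof (w_le_1 n). nra. }
  apply Rle_trans with (Rabs (IZR n) ^ j * (A * w n ^ 2)).
  - apply Rmult_le_compat_l; pos.
  - replace (Rabs (IZR n) ^ j * (A * w n ^ 2)) with (A * (Rabs (IZR n) ^ j * w n ^ 2)) by ring.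
    now apply Rmult_le_compat_l.
Qed.

Definition majorant (C B : R) (n : Z) : R := C * w n + if Z.eq_dec n 0 then B else 0.
Lemma majorant_summ C B : summ (majorant C B).
Proof. apply summ_plus; [apply summ_scal, summ_w|apply summ_delta0]. Qed.

Lemma majorant_ge j C B t : 0 <= C -> Rabs (a 0 t) <= B ->
  (forall n, n <> 0%Z -> Rabs (IZR n ^ j * a n t) <= C * w n) ->
  forall n, Rabs (IZR n ^ j * a n t) <= majorant C B n.
Proof.
  intros HC HB H n. unfold majorant. destruct (Z.eq_dec n 0) as [->|Hn].
  - pose proof (Rmult_le_pos _ _ HC (Rlt_le _ _ (w_pos 0))). destruct j.
    + rewrite Rmult_1_l. lra.
    + rewrite pow_i by lia. rewrite Rmult_0_l, Rabs_R0. pose proof (Rabs_pos (a 0 t)). lra.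
  - rewrite Rplus_0_r. now apply H.
Qed.

Lemma mono_cont j n t : continuous (fun s => IZR n ^ j * a n s) t.
Proof. cnt. Qed.
#[local] Hint Resolve mono_cont : cont.

Lemma locally_half t : 0 < t -> locally t (fun s => t / 2 <= s).
Proof.
  intros H. apply (filter_imp (fun s => t / 2 < s)); [pos|].
  apply open_gt. lra.
Qed.

Lemma Aj_cont2 j x t : 0 < t -> cont2 (Aj j) x t.
Proof.
  intros Ht. assert (H2 : 0 < t / 2) by lra.
  apply (ev_cont2 _ (fun n s => IZR n ^ j * a n s) (majorant (A * dec j (rate (t / 2))) (Rabs (a 0 t) + 1))).
  - apply majorant_summ.
  - eapply filter_imp; [|apply (filter_and _ _ (locally_half t Ht) (locally_bd (a 0%Z) t (a_cont 0%Z t)))].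
    intros s [Hs Bs]. apply majorant_ge; [|exact Bs|].
    + apply Rmult_le_pos; [lra|]. left. now apply dec_pos, rate_pos.
    + intros n Hn. now apply coef_dom.
  - cnt.
Qed.

Lemma Aj_cont2_low j x t : (j <= 2)%nat -> cont2 (Aj j) x t.
Proof.
  intros Hj.
  apply (ev_cont2 _ (fun n s => IZR n ^ j * a n s) (majorant A (Rabs (a 0 t) + 1))).
  - apply majorant_summ.
  - eapply filter_imp; [|apply (locally_bd (a 0%Z)), a_cont].
    intros s Bs. apply majorant_ge; auto. now apply coef_dom_low.
  - cnt.
Qed.

Lemma Aj_summ j t : 0 < t -> summ (fun n => IZR n ^ j * a n t).
Proof.
  intros Ht. apply (summ_dom _ (majorant (A * dec j (rate t)) (Rabs (a 0 t)))); [apply majorant_summ|].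
  apply majorant_ge; [|lra|].
  - apply Rmult_le_pos; [lra|]. left. now apply dec_pos, rate_pos.
  - intros n Hn. apply coef_dom; auto. lra.
Qed.

Lemma Aj_summ_low j t : (j <= 2)%nat -> summ (fun n => IZR n ^ j * a n t).
Proof.
  intros Hj. apply (summ_dom _ (majorant A (Rabs (a 0 t)))); [apply majorant_summ|].
  apply majorant_ge; pos. now apply coef_dom_low.
Qed.

Lemma phase_S j : INR j * (PI / 2) + PI / 2 = INR (S j) * (PI / 2).
Proof. rewrite S_INR. ring. Qed.

Lemma Aj_dx_gen j x t : summ (fun n => IZR n ^ j * a n t) -> summ (fun n => IZR n ^ (S j) * a n t) ->
  is_derive (fun y => Aj j y t) x (Aj (S j) x t).
Proof.
  intros H1 H2. unfold Aj. rewrite <- phase_S.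
  rewrite (ev_ext _ (fun n => IZR n ^ S j * a n t) (fun n => IZR n * (IZR n ^ j * a n t))) by (intros; simpl; ring).
  apply ev_dx; [exact H1|].
  eapply ex_series_ext; [|exact H2]. intros m. simpl. f_equal. ring.
Qed.

Lemma Aj_dx j x t : 0 < t -> is_derive (fun y => Aj j y t) x (Aj (S j) x t).
Proof. intros Ht. apply Aj_dx_gen; now apply Aj_summ. Qed.
#[local] Hint Resolve Aj_dx : deriv.

Lemma Aj_dx_low j x t : (j <= 1)%nat -> is_derive (fun y => Aj j y t) x (Aj (S j) x t).
Proof. intros Ht. apply Aj_dx_gen; apply Aj_summ_low; lia. Qed.

Lemma Aj_bd j t1 : (1 <= j)%nat -> 0 < t1 -> exists C, 0 <= C /\ forall x t, t1 <= t -> Rabs (Aj j x t) <= C.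
Proof.
  intros Hj H1. exists (sumZ (fun n => A * dec j (rate t1) * w n)).
  assert (C0 : 0 <= A * dec j (rate t1)).
  { apply Rmult_le_pos; [lra|]. left. now apply dec_pos, rate_pos. }
  assert (D : forall t, t1 <= t -> forall n, Rabs (IZR n ^ j * a n t) <= A * dec j (rate t1) * w n).
  { intros t Ht n. destruct (Z.eq_dec n 0) as [->|Hn].
    - rewrite pow_i by lia. rewrite Rmult_0_l, Rabs_R0. apply Rmult_le_pos; [exact C0|left; apply w_pos].
    - now apply coef_dom. }
  split.
  - rewrite sumZ_scal. apply Rmult_le_pos; [exact C0|]. pose proof Sw_ge_1. unfold Sw in H. lra.
  - intros x t Ht. apply sumZ_dom; [apply summ_scal, summ_w|].
    intros n. le_via Rabs_mult_cos. now apply D.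
Qed.

(** Odd derivatives are sine series. This yields the natural boundary condition and all the higher
    ones used in integrations by parts. *)
Lemma Aj_zero j k t : Aj (S (2 * j)) (IZR k * PI) t = 0.
Proof.
  unfold Aj. rewrite S_INR, mult_INR.
  assert (G : forall i f y, ev ((1 + 1) * INR i * (PI / 2) + PI / 2) f y = (-1) ^ i * ev (PI / 2) f y).
  { induction i as [|i IH]; intros f y.
    - rewrite Rmult_0_r, Rmult_0_l, Rplus_0_l, Rmult_1_l. reflexivity.
    - rewrite S_INR. replace ((1 + 1) * (INR i + 1) * (PI / 2) + PI / 2) with ((1 + 1) * INR i * (PI / 2) + PI / 2 + PI) by field.
      rewrite ev_phase_PI, IH. simpl. ring. }
  rewrite Rmult_plus_distr_r, Rmult_1_l, G, ev_sin_zero. ring.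
Qed.

(** * Summing the nonlinearity at a fixed positive time *)

Section Slice.
Variable t : R.
Hypothesis t_pos : 0 < t.
Let b := fun n => a n t.
Let r := rate t.

Lemma b_Wb2 : Wb2 A r b. Proof. apply a_dec. Qed.
Lemma r_pos : 0 < r. Proof. now apply rate_pos. Qed.
Lemma r_nonneg : 0 <= r. Proof. left. exact r_pos. Qed.

Lemma qs_odd n : qs b (- n)%Z = - qs b n.
Proof. unfold qs, b. rewrite opp_IZR, a_even. ring. Qed.
Lemma ps_even n : ps b (- n)%Z = ps b n.
Proof. unfold ps, b. rewrite opp_IZR, a_even. ring. Qed.
Lemma q2s_even n : q2s b (- n)%Z = q2s b n.
Proof.
  replace (q2s b n) with (-1 * -1 * q2s b n) by ring. apply conv_parity; try (intros; rewrite qs_odd; ring).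
  intros m. apply (conv_summ A A r); [exact r_nonneg| |]; now apply qs_Wb; [|exact b_Wb2].
Qed.

Lemma ev_qs x : ev (PI / 2) (qs b) x = - Aj 1 x t /\ ev 0 (qs b) x = 0.
Proof.
  split.
  - unfold Aj. rewrite Rmult_1_l.
    replace (- ev (PI / 2) (fun n => IZR n ^ 1 * a n t) x) with ((-1) * ev (PI / 2) (fun n => IZR n ^ 1 * a n t) x) by ring.
    rewrite <- ev_scal. apply ev_ext. intros n. unfold qs, b. ring.
  - apply ev_odd_cos; [|apply qs_odd]. apply (Wb_summ A r); [exact r_nonneg|apply qs_Wb; [exact A_pos|exact b_Wb2]].
Qed.

Lemma ev_ps x : ev 0 (ps b) x = Aj 2 x t /\ ev (PI / 2) (ps b) x = 0.
Proof.
  split.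
  - unfold Aj. replace (INR 2 * (PI / 2)) with (0 + PI) by (simpl; field). rewrite ev_phase_PI.
    replace (- ev 0 (fun n => IZR n ^ 2 * a n t) x) with ((-1) * ev 0 (fun n => IZR n ^ 2 * a n t) x) by ring.
    rewrite <- ev_scal. apply ev_ext. intros n. unfold ps, b. ring.
  - apply ev_even_sin; [|apply ps_even]. apply (Wb_summ A r); [exact r_nonneg|apply ps_Wb; [exact A_pos|exact b_Wb2]].
Qed.

Lemma ev_q2s x : ev 0 (q2s b) x = - Aj 1 x t ^ 2 /\ ev (PI / 2) (q2s b) x = 0.
Proof.
  destruct (ev_qs x) as [E1 E2]. pose proof (qs_Wb A r b A_pos b_Wb2) as Wq. split.
  - replace 0 with (0 + 0) at 1 by ring. unfold q2s. rewrite (ev_conv A A r _ _ 0 0 x r_nonneg Wq Wq).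
    rewrite Rplus_0_l, E1, E2. ring.
  - apply ev_even_sin; [|apply q2s_even]. apply (Wb_summ (k2 A) r); [exact r_nonneg|].
    apply q2s_Wb; [exact r_nonneg|lra|exact b_Wb2].
Qed.

Lemma ev_q3s x : ev (PI / 2) (q3s b) x = Aj 1 x t ^ 3.
Proof.
  destruct (ev_qs x) as [E1 E2]. destruct (ev_q2s x) as [E3 E4].
  pose proof (qs_Wb A r b A_pos b_Wb2) as Wq. pose proof (q2s_Wb A r b r_nonneg A_pos b_Wb2) as Wq2.
  replace (PI / 2) with (0 + PI / 2) by ring. unfold q3s.
  rewrite (ev_conv (k2 A) A r _ _ 0 (PI / 2) x r_nonneg Wq2 Wq). rewrite Rplus_0_l, E1, E3, E4. ring.
Qed.

(** Obtained by differentiating the series of [q3s] and comparing with the derivative of the cube,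
    which avoids another product of series. *)
Lemma ev_nq3s x : ev 0 (fun n => IZR n * q3s b n) x = - (3 * Aj 1 x t ^ 2 * Aj 2 x t).
Proof.
  pose proof (q3s_Wb A r b r_nonneg A_pos b_Wb2) as W3.
  destruct (k_nonneg A 0 A_pos (Rle_refl 0)) as [_ [_ [K3 _]]].
  assert (S1 : summ (fun n => IZR n * q3s b n)).
  { apply (summ_dom _ (fun n => k3 A * dec 1 r * w n)); [apply summ_scal, summ_w|].
    intros n. rewrite <- (pow_1 (IZR n)). apply Wb_dec; [exact r_pos|exact K3|exact W3]. }
  pose proof (ev_dx (PI / 2) (q3s b) x (Wb_summ _ _ _ r_nonneg W3) S1) as D.
  replace (PI / 2 + PI / 2) with (0 + PI) in D by field. rewrite ev_phase_PI in D.
  assert (D2 : is_derive (fun y => Aj 1 y t ^ 3) x (3 * Aj 1 x t ^ 2 * Aj 2 x t)) by (apply (is_derive_cube (fun y => Aj 1 y t)), Aj_dx, t_pos).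
  apply (is_derive_ext _ _ _ _ ev_q3s) in D.
  pose proof (is_derive_inj _ _ _ _ D D2). lra.
Qed.

Definition Pf (x t : R) : R := 2 * Aj 2 x t ^ 2 - Aj 1 x t ^ 4 + L t * Aj 1 x t ^ 2.

Lemma ev_Pc x : ev 0 (Pc b (L t)) x = Pf x t.
Proof.
  destruct (ev_q2s x) as [E3 E4]. destruct (ev_ps x) as [E5 E6].
  pose proof (ps_Wb A r b A_pos b_Wb2) as Wp. pose proof (q2s_Wb A r b r_nonneg A_pos b_Wb2) as Wq2.
  pose proof (pps_Wb A r b r_nonneg A_pos b_Wb2) as Wpp. pose proof (q4s_Wb A r b r_nonneg A_pos b_Wb2) as Wq4.
  assert (E7 : ev 0 (pps b) x = Aj 2 x t ^ 2).
  { replace 0 with (0 + 0) by ring. unfold pps. rewrite (ev_conv A A r _ _ 0 0 x r_nonneg Wp Wp).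
    rewrite Rplus_0_l, E5, E6. ring. }
  assert (E8 : ev 0 (q4s b) x = Aj 1 x t ^ 4).
  { replace 0 with (0 + 0) by ring. unfold q4s. rewrite (ev_conv (k2 A) (k2 A) r _ _ 0 0 x r_nonneg Wq2 Wq2).
    rewrite Rplus_0_l, E3, E4. ring. }
  rewrite (ev_ext 0 (Pc b (L t)) (fun n => (2 * pps b n + (-1) * q4s b n) + - L t * q2s b n)) by (intros; unfold Pc; ring).
  pose proof (Wb_summ _ _ _ r_nonneg Wpp). pose proof (Wb_summ _ _ _ r_nonneg Wq4). pose proof (Wb_summ _ _ _ r_nonneg Wq2).
  rewrite (ev_plus 0 (fun n => 2 * pps b n + (-1) * q4s b n) (fun n => - L t * q2s b n)), (ev_plus 0 (fun n => 2 * pps b n) (fun n => (-1) * q4s b n)), !ev_scal, E7, E8, E3.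
  - unfold Pf. ring.
  - now apply summ_scal. - now apply summ_scal.
  - apply summ_plus; now apply summ_scal.
  - now apply summ_scal.
Qed.

Definition P0 (t : R) : R := Pc (fun n => a n t) (L t) 0.
Definition Rf (x t : R) : R := - ev (PI / 2) (Rc (fun n => a n t) (L t)) x.

Lemma Rc_dec : exists C, 0 <= C /\ Wb C r (Rc b (L t)).
Proof.
  exists (kP A (Rabs (L t))). split.
  - destruct (k_nonneg A (Rabs (L t)) A_pos (Rabs_pos _)) as [? [? [? [? [? [? [? ?]]]]]]]. assumption.
  - apply Rc_Wb; [exact r_nonneg|lra|lra|exact b_Wb2].
Qed.

Lemma Rf_dx x : is_derive (fun y => Rf y t) x (Pf x t - P0 t).
Proof.
  destruct Rc_dec as [C [C0 WR]].
  assert (S1 : summ (fun n => IZR n * Rc b (L t) n)).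
  { apply (summ_dom _ (fun n => C * dec 1 r * w n)); [apply summ_scal, summ_w|].
    intros n. replace (IZR n * Rc b (L t) n) with (IZR n ^ 1 * Rc b (L t) n) by ring.
    apply Wb_dec; [exact r_pos|exact C0|exact WR]. }
  pose proof (ev_dx (PI / 2) (Rc b (L t)) x (Wb_summ _ _ _ r_nonneg WR) S1) as D.
  replace (PI / 2 + PI / 2) with (0 + PI) in D by field. rewrite ev_phase_PI in D.
  replace (Pf x t - P0 t) with (- - ev 0 (fun n => IZR n * Rc b (L t) n) x).
  - apply (is_derive_opp (V := R_NormedModule)). exact D.
  - rewrite <- ev_Pc.
    rewrite (ev_ext 0 (Pc b (L t)) (fun n => IZR n * Rc b (L t) n + if Z.eq_dec n 0 then P0 t else 0)).
    + rewrite ev_plus by (try exact S1; apply summ_delta0).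
      replace (ev 0 (fun n => if Z.eq_dec n 0 then P0 t else 0) x) with (P0 t); [ring|].
      rewrite <- (sumZ_delta0 (P0 t)) at 1. apply sumZ_ext. intros n. destruct (Z.eq_dec n 0) as [->|_]; [|ring].
      rewrite Rmult_0_l, Rplus_0_l, cos_0. ring.
    + intros n. unfold Rc. destruct (Z.eq_dec n 0) as [->|Hn]; [unfold P0, b; ring|].
      field. now apply not_0_IZR.
Qed.

Lemma Rf_zero k : Rf (IZR k * PI) t = 0.
Proof. unfold Rf. rewrite ev_sin_zero. ring. Qed.

(** The [j]-th space derivative of the right-hand side of the angle equation, hence the time
    derivative of [Aj j]. *)
Definition Gj (j : nat) (x t : R) : R :=
  ev (INR j * (PI / 2)) (fun n => IZR n ^ j * (- (n4 n) * a n t + Nc (fun n => a n t) (L t) n)) x.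

Lemma Nc_dec j Lm : Rabs (L t) <= Lm -> forall n, Rabs (IZR n ^ j * Nc b (L t) n) <=
  kN A Lm * (dec j r + dec (S j) r) * w n.
Proof.
  intros HL n.
  assert (Lm0 : 0 <= Lm) by (pose proof (Rabs_pos (L t)); lra).
  destruct (k_nonneg A Lm A_pos Lm0) as [_ [_ [_ [_ [_ [_ [_ [_ [K9 _]]]]]]]]].
  pose proof (Nc_bound A r b (L t) Lm n r_nonneg A_pos HL b_Wb2) as B.
  rewrite Rabs_mult, <- RPow_abs. set (x := Rabs (IZR n)) in *.
  assert (x0 : 0 <= x) by apply Rabs_pos.
  pose proof (pow_exp_decay j r x r_pos x0) as D1. pose proof (pow_exp_decay (S j) r x r_pos x0) as D2.
  fold (dec j r) in D1. fold (dec (S j) r) in D2. pose proof (w_pos n).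
  apply Rle_trans with (x ^ j * (kN A Lm * (1 + x) * w n * exp (- (r * x)))).
  - apply Rmult_le_compat_l; pos.
  - replace (x ^ j * (kN A Lm * (1 + x) * w n * exp (- (r * x)))) with
      (kN A Lm * w n * (x ^ j * exp (- (r * x)) + x ^ S j * exp (- (r * x)))) by (simpl; ring).
    replace (kN A Lm * (dec j r + dec (S j) r) * w n) with (kN A Lm * w n * (dec j r + dec (S j) r)) by ring.
    apply Rmult_le_compat_l; pos.
Qed.

Lemma n4_dec j n : Rabs (IZR n ^ j * (n4 n * a n t)) <= 2 * (A * dec (j + 4) r * w n).
Proof.
  unfold n4. replace (IZR n ^ j * (2 * IZR n ^ 4 * a n t)) with (2 * (IZR n ^ (j + 4) * a n t)) by (rewrite pow_add; ring).
  rewrite Rabs_mult, (Rabs_pos_eq 2) by lra. apply Rmult_le_compat_l; [lra|].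
  destruct (Z.eq_dec n 0) as [->|Hn].
  - rewrite pow_i by lia. rewrite Rmult_0_l, Rabs_R0.
    pose proof (w_pos 0). pose proof (dec_pos (j + 4) r r_pos).
    pos.
  - apply coef_dom; auto. lra.
Qed.

Lemma Gj_coef_bd j Lm : Rabs (L t) <= Lm -> forall n,
  Rabs (IZR n ^ j * (- (n4 n) * a n t + Nc b (L t) n)) <=
  (2 * (A * dec (j + 4) r) + kN A Lm * (dec j r + dec (S j) r)) * w n.
Proof.
  intros HL n.
  replace (IZR n ^ j * (- n4 n * a n t + Nc b (L t) n)) with
    (- (IZR n ^ j * (n4 n * a n t)) + IZR n ^ j * Nc b (L t) n) by ring.
  le_via Rabs_triang. rewrite Rabs_Ropp.
  pose proof (n4_dec j n). pose proof (Nc_dec j Lm HL n). lra.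
Qed.

Lemma Gj_summ j : summ (fun n => IZR n ^ j * (- (n4 n) * a n t + Nc b (L t) n)).
Proof. eapply summ_dom; [|apply (Gj_coef_bd j (Rabs (L t)) (Rle_refl _))]. apply summ_scal, summ_w. Qed.

Lemma Gj_dx j x : is_derive (fun y => Gj j y t) x (Gj (S j) x t).
Proof.
  unfold Gj. rewrite <- phase_S.
  rewrite (ev_ext (INR j * (PI / 2) + PI / 2) _ (fun n => IZR n * (IZR n ^ j * (- (n4 n) * a n t + Nc b (L t) n)))) by (intros; simpl; unfold b; ring).
  apply ev_dx; [apply Gj_summ|].
  eapply ex_series_ext; [|apply (Gj_summ (S j))]. intros m. simpl. f_equal. ring.
Qed.

Lemma G0_eq x : Gj 0 x t = -2 * Aj 4 x t - 5 * Aj 1 x t ^ 2 * Aj 2 x t + L t * Aj 2 x t + Aj 1 x t * Rf x t.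
Proof.
  unfold Gj. rewrite Rmult_0_l.
  destruct (ev_qs x) as [E1 E2]. destruct (ev_ps x) as [E5 E6]. destruct Rc_dec as [C [C0 WR]].
  pose proof (qs_Wb A r b A_pos b_Wb2) as Wq. pose proof (ps_Wb A r b A_pos b_Wb2) as Wp.
  pose proof (q3s_Wb A r b r_nonneg A_pos b_Wb2) as W3.
  destruct (k_nonneg A 0 A_pos (Rle_refl 0)) as [_ [_ [K3 _]]].
  assert (S1 : summ (fun n => IZR n * q3s b n)).
  { apply (summ_dom _ (fun n => k3 A * dec 1 r * w n)); [apply summ_scal, summ_w|].
    intros n. rewrite <- (pow_1 (IZR n)). apply Wb_dec; [exact r_pos|exact K3|exact W3]. }
  pose proof (Wb_summ _ _ _ r_nonneg Wp) as Sp.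
  pose proof (Wb_summ _ _ _ r_nonneg (conv_Wb _ _ _ _ _ r_nonneg Wq WR)) as Sc.
  pose proof (Aj_summ 4 t t_pos) as S4.
  rewrite (ev_ext 0 _ (fun n => ((-2) * (IZR n ^ 4 * a n t) + 5 / 3 * (IZR n * q3s b n)) +
     (L t * ps b n + (-1) * conv (qs b) (Rc b (L t)) n))) by (intros; unfold Nc, n4, b; simpl pow; ring).
  rewrite (ev_plus 0 (fun n => (-2) * (IZR n ^ 4 * a n t) + 5 / 3 * (IZR n * q3s b n))),
    (ev_plus 0 (fun n => (-2) * (IZR n ^ 4 * a n t))), (ev_plus 0 (fun n => L t * ps b n)), !ev_scal, ev_nq3s, E5;
    try (repeat apply summ_plus; now apply summ_scal).
  replace (ev 0 (conv (qs b) (Rc b (L t))) x) with (- (Aj 1 x t * Rf x t)).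
  2: { replace 0 with (0 + 0) by ring. rewrite (ev_conv A C r _ _ 0 0 x r_nonneg Wq WR).
    rewrite Rplus_0_l, E1, E2. unfold Rf, b. ring. }
  replace (ev 0 (fun n => IZR n ^ 4 * a n t) x) with (Aj 4 x t); [field|].
  unfold Aj. replace (INR 4 * (PI / 2)) with (0 + PI + PI) by (simpl; field). rewrite !ev_phase_PI. ring.
Qed.

End Slice.

Lemma dec_mono j s t : 0 < t -> t <= s -> dec j (rate s) <= dec j (rate t).
Proof.
  intros Ht H. pose proof (rate_pos t Ht). pose proof (rate_mono t s H).
  apply Rmult_le_compat_l; [apply pos_INR|]. apply Rinv_le_contravar; [pos|apply pow_incr; lra].
Qed.

Lemma Aj_dt j x t : P t -> is_derive (fun s => Aj j x s) t (Gj j x t).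
Proof.
  intros Pt. pose proof (P_pos t Pt) as Ht. assert (H2 : 0 < t / 2) by lra.
  pose proof (filter_and _ _ (filter_and _ _ (P_open t Pt) (locally_half t Ht)) (locally_bd L t (L_cont t))) as [d Hd].
  set (Lm := Rabs (L t) + 1) in *. set (rr := rate (t / 2)).
  assert (Lm0 : 0 <= Lm) by (unfold Lm; pose proof (Rabs_pos (L t)); lra).
  destruct (k_nonneg A Lm A_pos Lm0) as [_ [_ [_ [_ [_ [_ [_ [_ [K9 _]]]]]]]]].
  assert (Hball : forall s, Rabs (s - t) < d -> (P s /\ t / 2 <= s) /\ Rabs (L s) <= Lm) by auto.
  apply (sumZ_derive (fun n s => IZR n ^ j * a n s * cos (IZR n * x + INR j * (PI / 2)))
    (fun n s => IZR n ^ j * (- (n4 n) * a n s + Nc (fun n => a n s) (L s) n) * cos (IZR n * x + INR j * (PI / 2)))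
    (fun n => (2 * (A * dec (j + 4) rr) + kN A Lm * (dec j rr + dec (S j) rr)) * w n) t d).
  - apply summ_scal, summ_w.
  - intros s Hs. destruct (Hball s Hs) as [[_ H] _]. apply ev_summ, Aj_summ. lra.
  - intros n s Hs. destruct (Hball s Hs) as [[Ps Hts] HLs]. assert (s0 : 0 < s) by lra. split.
    +
      der.
    + le_via Rabs_mult_cos. le_via (Gj_coef_bd s s0 j Lm HLs).
      apply Rmult_le_compat_r; [left; apply w_pos|].
      pose proof (dec_mono (j + 4) s (t / 2) H2 Hts). pose proof (dec_mono j s (t / 2) H2 Hts).
      pose proof (dec_mono (S j) s (t / 2) H2 Hts). fold rr in H, H0, H1.
      nra.
Qed.

#[local] Hint Resolve Aj_dt : deriv.

Lemma Pf_cont2 x t : 0 < t -> cont2 Pf x t.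
Proof.
  intros Ht. unfold Pf. pose proof (Aj_cont2 1 x t Ht). pose proof (Aj_cont2 2 x t Ht).
  assert (cont2 (fun _ t => L t) x t) by (apply (cont2_comp1 L (fun _ t => t)); [apply cont2_snd|auto]).
  apply (cont2_ext (fun _ => True) (fun x t => (2 * (Aj 2 x t * Aj 2 x t) + (-1) * ((Aj 1 x t * Aj 1 x t) * (Aj 1 x t * Aj 1 x t)))
     + L t * (Aj 1 x t * Aj 1 x t))); [apply filter_forall; auto|pos|].
  cont2_tac.
Qed.

#[local] Hint Resolve Rf_dx Gj_dx : deriv.

Lemma Rf_int x t : 0 < t -> Rf x t = RInt (fun y => Pf y t) 0 x - x * P0 t.
Proof.
  intros Ht.
  assert (C : forall y, continuous (fun y => Pf y t) y) by (intros; apply cont2_slice1, Pf_cont2, Ht).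
  assert (E : RInt (fun y => Pf y t) 0 x = Rf x t + x * P0 t - (Rf 0 t + 0 * P0 t)).
  { apply (RInt_exact (fun y => Rf y t + y * P0 t)); [|exact C].
    der. }
  pose proof (Rf_zero t 0) as Z. rewrite Rmult_0_l in Z. lra.
Qed.

Lemma P0_int t : 0 < t -> RInt (fun y => Pf y t) 0 PI = PI * P0 t.
Proof.
  intros Ht. pose proof (Rf_int PI t Ht) as E. pose proof (Rf_zero t 1) as Z. rewrite Rmult_1_l in Z.
  lra.
Qed.

(** Syntax for differential polynomials in the flow quantities. It is closed under [fdx], so every
    [Gj j] is one of them, and regularity of arbitrary order becomes an induction on expressions. *)
Inductive fexp :=
  | EA (j : nat) | EL | ER | EP | EC (c : R) | EAdd (e f : fexp) | EMul (e f : fexp).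

Fixpoint fev (e : fexp) (x t : R) : R :=
  match e with
  | EA j => Aj j x t | EL => L t | ER => Rf x t | EP => P0 t | EC c => c
  | EAdd e f => fev e x t + fev f x t | EMul e f => fev e x t * fev f x t
  end.

Definition PfE : fexp :=
  EAdd (EMul (EC 2) (EMul (EA 2) (EA 2)))
    (EAdd (EMul (EC (-1)) (EMul (EMul (EA 1) (EA 1)) (EMul (EA 1) (EA 1)))) (EMul EL (EMul (EA 1) (EA 1)))).
Definition G0E : fexp :=
  EAdd (EAdd (EMul (EC (-2)) (EA 4)) (EMul (EC (-5)) (EMul (EMul (EA 1) (EA 1)) (EA 2))))
    (EAdd (EMul EL (EA 2)) (EMul (EA 1) ER)).

Fixpoint fdx (e : fexp) : fexp :=
  match e with
  | EA j => EA (S j) | EL | EP | EC _ => EC 0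
  | ER => EAdd PfE (EMul (EC (-1)) EP)
  | EAdd e f => EAdd (fdx e) (fdx f)
  | EMul e f => EAdd (EMul (fdx e) f) (EMul e (fdx f))
  end.

Lemma fev_dx e x t : 0 < t -> is_derive (fun y => fev e y t) x (fev (fdx e) x t).
Proof.
  intros Ht. induction e; simpl.
  - now apply Aj_dx.
  - apply is_derive_cst.
  - replace (_ + _) with (Pf x t - P0 t) by (unfold Pf; ring). der.
  - apply is_derive_cst.
  - apply is_derive_cst.
  - now apply (is_derive_Rplus (fun y => fev e1 y t) (fun y => fev e2 y t)).
  - now apply (is_derive_Rmult (fun y => fev e1 y t) (fun y => fev e2 y t)).
Qed.

Lemma Gj_fev j : forall x t, 0 < t -> Gj j x t = fev (Nat.iter j fdx G0E) x t.
Proof.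
  induction j as [|j IH]; intros x t Ht.
  - rewrite G0_eq by lra. simpl. ring.
  - pose proof (Gj_dx t Ht j x) as D1. pose proof (fev_dx (Nat.iter j fdx G0E) x t Ht) as D2.
    apply (is_derive_inj (fun y => Gj j y t) x); [exact D1|].
    eapply is_derive_ext; [|exact D2]. symmetry. auto.
Qed.

Lemma CK_P0_Rf k : (forall j, CK P k (Aj j)) -> CK P k (fun _ t => L t) -> CK P k (fun _ t => P0 t) /\ CK P k Rf.
Proof.
  intros HA HL.
  assert (HP : CK P k Pf).
  { apply (CK_ext P k P_open (fun x t => (2 * (Aj 2 x t * Aj 2 x t) + (-1) * ((Aj 1 x t * Aj 1 x t) * (Aj 1 x t * Aj 1 x t)))
     + L t * (Aj 1 x t * Aj 1 x t))); [intros; unfold Pf; ring|].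
    pose proof (HA 1%nat). pose proof (HA 2%nat). CK_tac. }
  assert (HI : CK P k (fun x t => RInt (fun y => Pf y t) 0 x)) by (apply CK_RInt; assumption).
  assert (HP0 : CK P k (fun _ t => P0 t)).
  { apply (CK_ext P k P_open (fun _ t => / PI * RInt (fun y => Pf y t) 0 PI)).
    - intros x t Pt. rewrite P0_int by auto. field. apply PI_neq0.
    - apply CK_mult; [apply CK_const|].
      apply (CK_comp2 P P k P_open P_open (fun x t => RInt (fun y => Pf y t) 0 x) (fun _ _ => PI) (fun _ t => t)); auto;
      [apply CK_const|apply CK_snd]. }
  split; [auto|].
  apply (CK_ext P k P_open (fun x t => RInt (fun y => Pf y t) 0 x - x * P0 t)).
  - symmetry. apply Rf_int. auto.
  - apply CK_minus; [exact HI|]. apply CK_mult; [apply CK_fst|auto].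
Qed.

Lemma CK_fev k : (forall j, CK P k (Aj j)) -> CK P k (fun _ t => L t) -> forall e, CK P k (fev e).
Proof.
  intros HA HL. destruct (CK_P0_Rf k HA HL) as [HP HR].
  induction e; simpl.
  - apply HA. - exact HL. - exact HR. - exact HP. - apply CK_const.
  - now apply CK_plus. - now apply CK_mult.
Qed.

(** Induction on [k] for all [j] at once: the space derivative of [Aj j] is [Aj (S j)], and its time
    derivative is a differential polynomial, of class [k] by the induction hypothesis. *)
Lemma CK_flow k : (forall j, CK P k (Aj j)) /\ CK P k (fun _ t => L t).
Proof.
  induction k as [|k [HA HL]].
  - split; (split; [|exact I]); intros x t Pt.
    + apply Aj_cont2. auto.
    + apply cont2_comp1; [apply cont2_snd|auto].
  - split.
    + split; [intros x t Pt; apply Aj_cont2; now apply P_pos|].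
      exists (Aj (S j)), (Gj j). split; [|split; [apply HA|]].
      * split; [der|der].
      * apply (CK_ext P k P_open (fev (Nat.iter j fdx G0E))); [|now apply CK_fev].
        symmetry. apply Gj_fev. auto.
    + split; [intros x t Pt; apply (cont2_comp1 L (fun _ t => t)); [apply cont2_snd|apply L_cont]|].
      exists (fun _ _ => 0), (fun _ t => -2 * L t * P0 t). split; [|split; [apply CK_const|]].
      * split; [der|auto].
      * destruct (CK_P0_Rf k HA HL) as [HP _]. CK_tac.
Qed.

Lemma CK_flow_fev e k : CK P k (fev e).
Proof. destruct (CK_flow k). now apply CK_fev. Qed.

(** [Wf] is the normal velocity and [Sf] the tangential one. The latter satisfies
    [S_x = th_x W - P0], which keeps the speed of the parametrization constant along the curve. *)
Definition Wf (x t : R) : R := -2 * Aj 3 x t - Aj 1 x t ^ 3 + L t * Aj 1 x t.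
Definition Wxf (x t : R) : R := -2 * Aj 4 x t - 3 * Aj 1 x t ^ 2 * Aj 2 x t + L t * Aj 2 x t.
Definition Sf (x t : R) : R := -2 * Aj 1 x t * Aj 2 x t + Rf x t.

Lemma Wf_dx x t : 0 < t -> is_derive (fun y => Wf y t) x (Wxf x t).
Proof.
  unfold Wf. der. unfold Wxf. ring.
Qed.

Lemma Sf_dx x t : 0 < t -> is_derive (fun y => Sf y t) x (Aj 1 x t * Wf x t - P0 t).
Proof.
  unfold Sf. der. unfold Wf, Pf. ring.
Qed.
#[local] Hint Resolve Wf_dx Sf_dx : deriv.

Lemma G0_WS x t : 0 < t -> Gj 0 x t = Wxf x t + Sf x t * Aj 1 x t.
Proof. intros Ht. rewrite G0_eq by lra. unfold Wxf, Sf. ring. Qed.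

Lemma A1_zero k t : Aj 1 (IZR k * PI) t = 0.
Proof. exact (Aj_zero 0 k t). Qed.
Lemma Wf_zero k t : Wf (IZR k * PI) t = 0.
Proof. unfold Wf. rewrite A1_zero. pose proof (Aj_zero 1 k t) as H. simpl Nat.mul in H. lra. Qed.
Lemma Sf_zero k t : Sf (IZR k * PI) t = 0.
Proof. unfold Sf. rewrite A1_zero, Rf_zero. ring. Qed.

Lemma cont_Wf t : 0 < t -> forall x, continuous (fun y => Wf y t) x.
Proof. intros Ht x. eapply continuous_of_derive. now apply Wf_dx. Qed.
Lemma cont_Sf t : 0 < t -> forall x, continuous (fun y => Sf y t) x.
Proof. intros Ht x. eapply continuous_of_derive. now apply Sf_dx. Qed.
Lemma cont_Aj j t : 0 < t -> forall x, continuous (fun y => Aj j y t) x.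
Proof. intros Ht x. eapply continuous_of_derive. now apply Aj_dx. Qed.
Lemma cont_Gj j t : 0 < t -> forall x, continuous (fun y => Gj j y t) x.
Proof. intros Ht x. eapply continuous_of_derive. now apply Gj_dx. Qed.
#[local] Hint Resolve cont_Wf cont_Sf cont_Aj cont_Gj : cont.

Lemma cont2_Gj j x t : P t -> cont2 (Gj j) x t.
Proof.
  intros Pt. apply (cont2_ext P (fev (Nat.iter j fdx G0E))); auto.
  - symmetry. apply Gj_fev. auto.
  - now apply (CK_cont P 0 _ (CK_flow_fev _ 0)).
Qed.

Definition Bf (t : R) : R := RInt (fun x => Aj 1 x t ^ 2) 0 PI.
Definition Df (t : R) : R := RInt (fun x => Wf x t ^ 2) 0 PI.

Lemma AW_int t : 0 < t -> RInt (fun x => Aj 1 x t * Wf x t) 0 PI = PI * P0 t.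
Proof.
  intros Ht.
  assert (E : RInt (fun x => Aj 1 x t * Wf x t) 0 PI = (Sf PI t + PI * P0 t) - (Sf 0 t + 0 * P0 t)).
  { apply (RInt_exact (fun x => Sf x t + x * P0 t)).
    - der.
    - cnt. }
  pose proof (Sf_zero 1 t) as Z1. pose proof (Sf_zero 0 t) as Z0. rewrite Rmult_1_l in Z1. rewrite Rmult_0_l in Z0.
  lra.
Qed.

(** Two integrations by parts produce the dissipation; the other terms combine through [AW_int] into
    the effect of the dilation rate [P0]. *)
Lemma Bf_derive t : P t -> is_derive Bf t (- Df t + P0 t * (PI * L t - Bf t)).
Proof.
  intros Pt. pose proof (P_pos t Pt) as Ht.
  assert (D : is_derive Bf t (RInt (fun x => 2 * Aj 1 x t * Gj 1 x t) 0 PI)).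
  { apply (is_derive_RInt_time P (fun x t => Aj 1 x t ^ 2) (fun x t => 2 * Aj 1 x t * Gj 1 x t) 0 PI t P_open Pt).
    - der.
    - intros y s Ps. apply (cont2_comp1 (fun z => z ^ 2) (Aj 1)); [apply Aj_cont2; now apply P_pos|].
      cnt.
    - intros y s Ps. apply cont2_mult; [|now apply cont2_Gj].
      apply cont2_mult; [apply cont2_const|apply Aj_cont2; now apply P_pos]. }
  replace (- Df t + P0 t * (PI * L t - Bf t)) with (RInt (fun x => 2 * Aj 1 x t * Gj 1 x t) 0 PI); [exact D|].
  (* Collects all boundary terms; they vanish because [th_x] and the normal velocity do so at both
     ends. *)
  set (F := fun x => 2 * Aj 1 x t * Gj 0 x t - 2 * Aj 2 x t * Wf x t - Sf x t * Aj 1 x t ^ 2).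
  assert (E : RInt (fun x => 2 * Aj 1 x t * Gj 1 x t - ((-1) * Wf x t ^ 2 + L t * (Aj 1 x t * Wf x t) - P0 t * Aj 1 x t ^ 2)) 0 PI = F PI - F 0).
  { apply RInt_exact; [|cnt]. unfold F. der. rewrite (G0_WS x t Ht). unfold Wf. ring. }
  assert (Z : forall k, F (IZR k * PI) = 0).
  { intros k. unfold F. rewrite A1_zero, Wf_zero. ring. }
  pose proof (Z 1%Z) as Z1. pose proof (Z 0%Z) as Z0. rewrite Rmult_1_l in Z1. rewrite Rmult_0_l in Z0.
  revert E. rlin. rewrite (AW_int t Ht). fold (Df t) (Bf t). lra.
Qed.

(** The terms in [P0] cancel, as they must for a scale-invariant quantity, leaving only the
    dissipation. *)
Lemma energy_derive t : P t -> 0 < L t ->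
  is_derive (fun t => (Bf t + PI * L t) ^ 2 / L t) t (- (2 * (Bf t + PI * L t) / L t) * Df t).
Proof.
  intros Pt HL. pose proof (Bf_derive t Pt) as DB. pose proof (L_ode t Pt) as DL. fold (P0 t) in DL.
  assert (D1 : is_derive (fun t => Bf t + PI * L t) t ((- Df t + P0 t * (PI * L t - Bf t)) + PI * (-2 * L t * P0 t))) by der.
  apply is_derive_sqr in D1.
  pose proof (is_derive_div (fun t => (Bf t + PI * L t) ^ 2) L t _ _ D1 DL ltac:(lra)) as D.
  replace (- (2 * (Bf t + PI * L t) / L t) * Df t) with
    ((2 * (Bf t + PI * L t) * (- Df t + P0 t * (PI * L t - Bf t) + PI * (-2 * L t * P0 t)) * L t - (Bf t + PI * L t) ^ 2 * (-2 * L t * P0 t)) / L t ^ 2); [exact D|].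
  field. lra.
Qed.

(** * Motion of the unscaled curve and of the mean angle *)

Definition Xf (x t : R) : R := RInt (fun y => cos (Aj 0 y t)) 0 x.
Definition Yf (x t : R) : R := RInt (fun y => sin (Aj 0 y t)) 0 x.

Lemma Aj0_cont t x : continuous (fun y => Aj 0 y t) x.
Proof. apply cont2_slice1, Aj_cont2_low. lia. Qed.
Lemma cosA_cont t x : continuous (fun y => cos (Aj 0 y t)) x.
Proof. apply continuous_cos_comp, Aj0_cont. Qed.
Lemma sinA_cont t x : continuous (fun y => sin (Aj 0 y t)) x.
Proof. apply continuous_sin_comp, Aj0_cont. Qed.
#[local] Hint Resolve Aj0_cont : cont.

(** Integrating the angle equation against the tangent recovers the velocity vector: normal part
    [Wf], tangential part [Sf], and the dilation [P0] of the position, which the factor [ell] will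
    compensate. *)
Lemma XY_derive x t : P t ->
  is_derive (Xf x) t (- Wf x t * sin (Aj 0 x t) + Sf x t * cos (Aj 0 x t) + P0 t * Xf x t) /\
  is_derive (Yf x) t (Wf x t * cos (Aj 0 x t) + Sf x t * sin (Aj 0 x t) + P0 t * Yf x t).
Proof.
  intros Pt. pose proof (P_pos t Pt) as Ht.
  assert (CP := fun k => proj1 (CK_flow k) 0%nat).
  assert (Z1 := Wf_zero 0 t). assert (Z2 := Sf_zero 0 t). rewrite Rmult_0_l in Z1, Z2.
  assert (DX : forall y, is_derive (fun y => Xf y t) y (cos (Aj 0 y t))) by (intros y; apply (is_derive_RInt_var (fun y => cos (Aj 0 y t))); cnt).
  assert (DY : forall y, is_derive (fun y => Yf y t) y (sin (Aj 0 y t))) by (intros y; apply (is_derive_RInt_var (fun y => sin (Aj 0 y t))); cnt).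
  split.
  - assert (D : is_derive (Xf x) t (RInt (fun y => Gj 0 y t * - sin (Aj 0 y t)) 0 x)).
    { apply (is_derive_RInt_time P (fun y t => cos (Aj 0 y t)) (fun y t => Gj 0 y t * - sin (Aj 0 y t)) 0 x t P_open Pt).
      - der.
      - intros y s Ps. apply (CK_cont P 0 _ (proj2 (CK_sincos P 0 _ (CP 0%nat)))). exact Ps.
      - intros y s Ps. apply cont2_mult; [now apply cont2_Gj|].
        apply (CK_cont P 0 _ (CK_opp P 0 _ (proj1 (CK_sincos P 0 _ (CP 0%nat))))). exact Ps. }
    replace (- Wf x t * sin (Aj 0 x t) + Sf x t * cos (Aj 0 x t) + P0 t * Xf x t) with (RInt (fun y => Gj 0 y t * - sin (Aj 0 y t)) 0 x); [exact D|].
    rewrite (RInt_exact (fun y => - Wf y t * sin (Aj 0 y t) + Sf y t * cos (Aj 0 y t) + P0 t * Xf y t)).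
    + rewrite Z1, Z2. unfold Xf at 2. rewrite RInt_point.
      change (- Wf x t * sin (Aj 0 x t) + Sf x t * cos (Aj 0 x t) + P0 t * Xf x t - (- 0 * sin (Aj 0 0 t) + 0 * cos (Aj 0 0 t) + P0 t * 0) = - Wf x t * sin (Aj 0 x t) + Sf x t * cos (Aj 0 x t) + P0 t * Xf x t). ring.
    + intros y. rewrite (G0_WS y t Ht). der.
    + cnt.
  - assert (D : is_derive (Yf x) t (RInt (fun y => Gj 0 y t * cos (Aj 0 y t)) 0 x)).
    { apply (is_derive_RInt_time P (fun y t => sin (Aj 0 y t)) (fun y t => Gj 0 y t * cos (Aj 0 y t)) 0 x t P_open Pt).
      - der.
      - intros y s Ps. apply (CK_cont P 0 _ (proj1 (CK_sincos P 0 _ (CP 0%nat)))). exact Ps.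
      - intros y s Ps. apply cont2_mult; [now apply cont2_Gj|].
        apply (CK_cont P 0 _ (proj2 (CK_sincos P 0 _ (CP 0%nat)))). exact Ps. }
    replace (Wf x t * cos (Aj 0 x t) + Sf x t * sin (Aj 0 x t) + P0 t * Yf x t) with (RInt (fun y => Gj 0 y t * cos (Aj 0 y t)) 0 x); [exact D|].
    rewrite (RInt_exact (fun y => Wf y t * cos (Aj 0 y t) + Sf y t * sin (Aj 0 y t) + P0 t * Yf y t)).
    + rewrite Z1, Z2. unfold Yf at 2. rewrite RInt_point.
      change (Wf x t * cos (Aj 0 x t) + Sf x t * sin (Aj 0 x t) + P0 t * Yf x t - (0 * cos (Aj 0 0 t) + 0 * sin (Aj 0 0 t) + P0 t * 0) = Wf x t * cos (Aj 0 x t) + Sf x t * sin (Aj 0 x t) + P0 t * Yf x t). ring.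
    + intros y. rewrite (G0_WS y t Ht). der.
    + cnt.
Qed.

Lemma coef_int t n : RInt (fun x => Aj 0 x t * cos (IZR n * x)) 0 PI = PI * a n t.
Proof.
  pose proof (Aj_summ_low 0 t ltac:(lia)) as S0. pose proof (Aj_summ_low 1 t ltac:(lia)) as S1.
  pose proof (ev_coeff (fun n => IZR n ^ 0 * a n t) n) as E.
  apply is_RInt_unique.
  replace (PI * a n t) with (PI * (IZR n ^ 0 * a n t)) by lra.
  eapply is_RInt_ext; [|apply E].
  - unfold Aj. now rewrite !Rmult_0_l.
  - eapply ex_series_ext; [|exact S1]. intros m. simpl. f_equal. ring.
  - exact S0.
  - intros m. now rewrite a_even.
Qed.

Lemma mean_int t : RInt (fun x => Aj 0 x t) 0 PI = PI * a 0 t.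
Proof.
  rewrite <- coef_int. apply RInt_ext. intros x _. now rewrite Rmult_0_l, cos_0, Rmult_1_r.
Qed.

Lemma mean_derive t : P t -> is_derive (a 0) t (/ PI * RInt (fun x => Sf x t * Aj 1 x t) 0 PI).
Proof.
  intros Pt. pose proof (P_pos t Pt) as Ht.
  assert (D : is_derive (fun t => RInt (fun x => Aj 0 x t) 0 PI) t (RInt (fun x => Gj 0 x t) 0 PI)).
  { apply (is_derive_RInt_time P (Aj 0) (Gj 0) 0 PI t P_open Pt).
    - der.
    - intros y s Ps. apply Aj_cont2. auto.
    - now apply cont2_Gj. }
  apply (is_derive_ext _ (fun t => PI * a 0 t)) in D; [|intros; apply mean_int].
  assert (E : RInt (fun x => Gj 0 x t) 0 PI = RInt (fun x => Sf x t * Aj 1 x t) 0 PI).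
  { assert (M : RInt (fun x => Gj 0 x t - Sf x t * Aj 1 x t) 0 PI = Wf PI t - Wf 0 t).
    { apply (RInt_exact (fun x => Wf x t)); [|cnt]. der. rewrite (G0_WS x t Ht). ring. }
    pose proof (Wf_zero 1 t) as Z1. pose proof (Wf_zero 0 t) as Z0. rewrite Rmult_1_l in Z1. rewrite Rmult_0_l in Z0.
    revert M. rlin. lra. }
  rewrite E in D.
  apply (is_derive_ext (fun t => / PI * (PI * a 0 t))).
  { intros s. rewrite <- Rmult_assoc, Rinv_l by apply PI_neq0. Rring. }
  now apply (is_derive_scal (fun t => PI * a 0 t)).
Qed.

(** * Continuity down to time zero, energy decay and conserved closing *)

Notation th t := (fun x => Aj 0 x t).
Notation q t := (fun x => Aj 1 x t).

Lemma slice_d t x : is_derive (th t) x (Aj 1 x t).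
Proof. apply Aj_dx_low. lia. Qed.

Lemma slice_c t x : continuous (q t) x.
Proof. apply cont2_slice1, Aj_cont2_low. lia. Qed.
#[local] Hint Resolve slice_c : cont.

Lemma slice_mean t : RInt (th t) 0 PI = PI * a 0%Z t.
Proof. exact (mean_int t). Qed.

Lemma slice_left t : Aj 1 0 t = 0.
Proof. pose proof (A1_zero 0 t) as H. now rewrite Rmult_0_l in H. Qed.

Lemma slice_right t : Aj 1 PI t = 0.
Proof. pose proof (A1_zero 1 t) as H. now rewrite Rmult_1_l in H. Qed.

Lemma time_int (f : R -> R -> R) (t : R) : (forall x s, cont2 f x s) -> continuous (fun s => RInt (fun x => f x s) 0 PI) t.
Proof.
  intros C. apply (cont2_slice2 (fun x s => RInt (fun y => f y s) 0 x)).
  apply (cont2_RInt (fun _ => True)); [now exists (mkposreal 1 Rlt_0_1)|auto].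
Qed.

Lemma q_cont2 x t : cont2 (Aj 1) x t.
Proof. apply Aj_cont2_low. lia. Qed.

Lemma th_cont2 x t : cont2 (Aj 0) x t.
Proof. apply Aj_cont2_low. lia. Qed.

Lemma Bf_time t : continuous Bf t.
Proof.
  apply time_int. intros x s.
  apply (cont2_comp1 (fun y => y ^ 2) (Aj 1)); [apply q_cont2|]. cnt.
Qed.

Lemma gap_time (Th1 : R -> R) t : (forall x, continuous Th1 x) -> continuous (fun t => gap Th1 (q t)) t.
Proof.
  intros C. apply time_int. intros x s.
  apply (cont2_comp1 (fun y => y ^ 2) (fun x t => Aj 1 x t - Th1 x)).
  - apply cont2_comp2.
    + apply q_cont2.
    + apply cont2_comp1; [apply cont2_fst|apply C].
    + apply (continuous_minus (V := R_NormedModule) (U := prod_UniformSpace R_UniformSpace R_UniformSpace) fst snd); [apply continuous_fst|apply continuous_snd].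
  - cnt.
Qed.

Lemma X_time t : continuous (Xf PI) t.
Proof.
  apply time_int. intros x s. apply cont2_comp1; [apply th_cont2|].
  cnt.
Qed.

Lemma Y_time t : continuous (Yf PI) t.
Proof.
  apply time_int. intros x s. apply cont2_comp1; [apply th_cont2|].
  cnt.
Qed.

(** The square of the bending energy plus [lambda] times the length, divided by [lambda]; the square
    removes [sqrt (L t)] from the formula. *)
Definition E2 (t : R) : R := (Bf t + PI * L t) ^ 2 / L t.

Lemma Bf_nonneg t : 0 <= Bf t.
Proof.
  apply RInt_nonneg_on; [pose proof PI_RGT_0; lra|cnt|pos].
Qed.

Lemma Df_nonneg t : 0 < t -> 0 <= Df t.
Proof.
  intros Ht. apply RInt_nonneg_on; [pose proof PI_RGT_0; lra|cnt|pos].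
Qed.

Lemma energy_mono T : 0 <= T -> (forall s, 0 < s < T -> P s) -> (forall s, 0 <= s <= T -> 0 < L s) -> E2 T <= E2 0.
Proof.
  intros HT HP HL. apply (nonincreasing_of_derive E2 (fun t => - (2 * (Bf t + PI * L t) / L t) * Df t) 0 T HT).
  - intros s Hs. specialize (HL s Hs). apply continuous_Rmult_c.
    + pose proof Bf_time. cnt.
    + apply continuous_comp; [auto|apply continuous_Rinv; lra].
  - intros s Hs. specialize (HL s ltac:(lra)). split.
    + apply (energy_derive); auto.
    + pose proof (Bf_nonneg s). pose proof (Df_nonneg s ltac:(lra)). pose proof PI_RGT_0.
      assert (0 <= 2 * (Bf s + PI * L s) / L s) by pos. nra.
Qed.

(** The velocities vanish at [PI], so the end vector changes only by dilation at rate [P0], while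
    [sqrt (L t)] changes at rate [- P0]. This is the fixed-endpoint condition. *)
Lemma closing_conserved T : 0 <= T -> (forall s, 0 < s < T -> P s) -> (forall s, 0 <= s <= T -> 0 < L s) ->
  sqrt (L T) * Xf PI T = sqrt (L 0) * Xf PI 0 /\ sqrt (L T) * Yf PI T = sqrt (L 0) * Yf PI 0.
Proof.
  intros HT HP HL.
  assert (Cs : forall s, 0 <= s <= T -> continuous (fun s => sqrt (L s)) s).
  { intros s Hs. apply continuous_comp; [auto|]. apply continuous_sqrt. }
  assert (Ds : forall s, 0 < s < T -> is_derive (fun s => sqrt (L s)) s (- P0 s * sqrt (L s))).
  { intros s Hs. specialize (HL s ltac:(lra)).
    replace (- P0 s * sqrt (L s)) with ((-2 * L s * P0 s) / (2 * sqrt (L s))).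
    - apply is_derive_sqrt; auto.
    - pose proof (sqrt_lt_R0 _ HL). rewrite <- (sqrt_sqrt (L s)) at 1 by lra. field. lra. }
  assert (W0 : forall s, Wf PI s = 0) by (intros s; pose proof (Wf_zero 1 s) as H; now rewrite Rmult_1_l in H).
  assert (S0 : forall s, Sf PI s = 0) by (intros s; pose proof (Sf_zero 1 s) as H; now rewrite Rmult_1_l in H).
  split.
  - apply (constant_of_derive (fun s => sqrt (L s) * Xf PI s) 0 T HT).
    + pose proof X_time. cnt.
    + intros s Hs. destruct (XY_derive PI s (HP s Hs)) as [D _].
      rewrite W0, S0 in D. der.
  - apply (constant_of_derive (fun s => sqrt (L s) * Yf PI s) 0 T HT).
    + pose proof Y_time. cnt.
    + intros s Hs. destruct (XY_derive PI s (HP s Hs)) as [_ D].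
      rewrite W0, S0 in D. der.
Qed.

(** The tangential velocity is a primitive of [th_x W] minus its mean, hence bounded by twice the
    integral of [|th_x W|]. Cauchy-Schwarz twice then gives the bound by the dissipation. *)
Lemma mean_speed t : 0 < t -> (/ PI * RInt (fun x => Sf x t * Aj 1 x t) 0 PI) ^ 2 <= 4 / PI * Bf t ^ 2 * Df t.
Proof.
  intros Ht. pose proof PI_RGT_0 as pi0.
  set (u := RInt (fun x => Rabs (Aj 1 x t) * Rabs (Wf x t)) 0 PI : R).
  assert (u2 : u ^ 2 <= Bf t * Df t).
  { eapply Rle_trans; [apply (RInt_CS (fun x => Rabs (Aj 1 x t)) (fun x => Rabs (Wf x t))); [lra|cnt|cnt]|].
    right. f_equal; apply RInt_ext; intros; apply pow2_abs. }
  assert (part : forall x, 0 <= x <= PI -> Rabs (RInt (fun y => Aj 1 y t * Wf y t) 0 x) <= u).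
  { intros x Hx. eapply Rle_trans; [apply RInt_abs_le; [lra|cnt]|].
    rewrite (RInt_ext _ (fun y => Rabs (Aj 1 y t) * Rabs (Wf y t))) by (intros; apply Rabs_mult).
    unfold u. rewrite (RInt_split (fun y => Rabs (Aj 1 y t) * Rabs (Wf y t)) 0 x PI) by cnt.
    assert (0 <= RInt (fun y => Rabs (Aj 1 y t) * Rabs (Wf y t)) x PI) by (apply RInt_nonneg_on; [lra|cnt|pos]).
    lra. }
  assert (p0 : Rabs (PI * P0 t) <= u).
  { rewrite <- (AW_int t Ht). apply part. lra. }
  assert (HS : forall x, 0 <= x <= PI -> Rabs (Sf x t) <= 2 * u).
  { intros x Hx. assert (E : Sf x t = RInt (fun y => Aj 1 y t * Wf y t) 0 x - x * P0 t).
    { pose proof (RInt_exact (fun y => Sf y t) (fun y => Aj 1 y t * Wf y t - P0 t) 0 x) as E.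
      rewrite (RInt_Rminus (fun y => Aj 1 y t * Wf y t) (fun _ => P0 t)), RInt_cst in E by cnt.
      pose proof (Sf_zero 0 t) as Z. rewrite Rmult_0_l in Z. rewrite Z, !Rminus_0_r in E. symmetry. apply E.
      - der.
      - cnt. }
    rewrite E. le_via Rabs_triang. rewrite Rabs_Ropp.
    assert (Rabs (x * P0 t) <= u).
    { eapply Rle_trans; [|exact p0]. rewrite !Rabs_mult. apply Rmult_le_compat_r; pos. rewrite !Rabs_pos_eq; lra. }
    specialize (part x Hx). lra. }
  set (v := RInt (fun x => Rabs (Aj 1 x t)) 0 PI : R).
  assert (v2 : v ^ 2 <= PI * Bf t).
  { eapply Rle_trans; [apply RInt_sqr_CS; [lra|cnt]|]. rewrite Rminus_0_r. right. f_equal. apply RInt_ext. intros; apply pow2_abs. }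
  set (I := RInt (fun x => Sf x t * Aj 1 x t) 0 PI : R).
  assert (HI : Rabs I <= 2 * u * v).
  { eapply Rle_trans; [apply RInt_abs_le; [lra|cnt]|]. unfold v.
    rewrite <- (RInt_Rscal (2 * u) (fun x => Rabs (Aj 1 x t))) by cnt.
    apply RInt_le_on; [lra|cnt|cnt|].
    intros x Hx. rewrite Rabs_mult. apply Rmult_le_compat_r; [pos|auto]. }
  assert (I2 : I ^ 2 <= 4 * (Bf t * Df t) * (PI * Bf t)).
  { rewrite <- pow2_abs. apply Rle_trans with ((2 * u * v) ^ 2); [apply pow_incr; split; [apply Rabs_pos|exact HI]|].
    nra. }
  apply Rmult_le_reg_l with (PI ^ 2); pos.
  replace (PI ^ 2 * (/ PI * I) ^ 2) with (I ^ 2) by (field; lra).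
  replace (PI ^ 2 * (4 / PI * Bf t ^ 2 * Df t)) with (4 * (Bf t * Df t) * (PI * Bf t)) by (field; lra). exact I2.
Qed.
End FlowFacts.

Arguments Aj : clear implicits.
Arguments Pf : clear implicits.
Arguments P0 : clear implicits.
Arguments Rf : clear implicits.
Arguments Gj : clear implicits.
Arguments Wf : clear implicits.
Arguments Wxf : clear implicits.
Arguments Sf : clear implicits.
Arguments Bf : clear implicits.
Arguments Df : clear implicits.
Arguments Xf : clear implicits.
Arguments Yf : clear implicits.
Arguments E2 : clear implicits.

(** * Initial data *)

(** A class stable under multiplication by [cos x], so that polynomials in [cos x] serve as test
    functions for uniqueness of cosine coefficients. *)
Definition cosort (G : R -> R) : Prop :=
  (forall x, continuous G x) /\ forall n : Z, RInt (fun x => G x * cos (IZR n * x)) 0 PI = 0.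

Lemma cosn_cont (n : Z) (x : R) : continuous (fun x => cos (IZR n * x)) x.
Proof. apply continuous_cos_comp. apply continuous_Rmult_c; cnt. Qed.
#[global] Hint Resolve cosn_cont : cont.

Lemma cosort_cos (G : R -> R) : cosort G -> cosort (fun x => G x * cos x).
Proof.
  intros [C H]. split; [cnt|]. intros n.
  rewrite (RInt_ext _ (fun x => / 2 * (G x * cos (IZR (n + 1) * x)) + / 2 * (G x * cos (IZR (n - 1) * x)))).
  - rlin. rewrite !H. Rring.
  - intros x _. rewrite plus_IZR, minus_IZR.
    replace ((IZR n + 1) * x) with (IZR n * x + x) by ring. replace ((IZR n - 1) * x) with (IZR n * x - x) by ring.
    rewrite cos_plus, cos_minus. Rfield.
Qed.

Lemma cosort_lin (G H : R -> R) (a b : R) : cosort G -> cosort H -> cosort (fun x => a * G x + b * H x).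
Proof.
  intros [C1 H1] [C2 H2]. split; [cnt|]. intros n.
  rlin_as (fun x => a * (G x * cos (IZR n * x)) + b * (H x * cos (IZR n * x))). rewrite H1, H2. Rring.
Qed.

(** A polynomial in [cos x] with values in [[0, 1]] when [c] is a cosine, equal to one exactly where
    [cos x = c]; its powers concentrate there. *)
Definition peak (c x : R) : R := 1 - (cos x - c) ^ 2 / 4.

Lemma cosort_peak (G : R -> R) (c : R) (N : nat) : cosort G -> cosort (fun x => G x * peak c x ^ N).
Proof.
  intros H. induction N as [|N IH].
  - replace (fun x => G x * peak c x ^ 0) with G; [exact H|]. apply functional_extensionality; intros; ring.
  - set (K := fun x => G x * peak c x ^ N) in *.
    replace (fun x => G x * peak c x ^ S N) with
      (fun x => 1 * ((1 - c ^ 2 / 4) * K x + (c / 2) * (K x * cos x)) + (- / 4) * (K x * cos x * cos x)).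
    + apply cosort_lin.
      * apply cosort_lin; [exact IH|now apply cosort_cos].
      * now apply (cosort_cos (fun x => K x * cos x)), cosort_cos.
    + apply functional_extensionality; intros x. unfold K, peak. simpl. field.
Qed.

(* the peaks concentrate at [x0], so a function orthogonal to all of them cannot be positive there *)
Lemma cosort_nonpos (G : R -> R) (x0 : R) : cosort G -> 0 < x0 < PI -> G x0 <= 0.
Proof.
  intros H Hx0. apply Rnot_lt_le. intros d0. pose proof (proj1 H) as C.
  set (c := cos x0). set (d := G x0) in *.
  destruct (bounded_on G 0 PI ltac:(lra) C) as [M [M0 HM]].
  assert (X : exists e, 0 < e /\ 0 < x0 - e /\ x0 + e < PI /\ forall x, Rabs (x - x0) < e -> d / 2 < G x).
  { assert (e : 0 < d / 2) by lra.
    destruct (C x0 (fun y => Rabs (y - d) < d / 2)) as [k Hk]; [exists (mkposreal _ e); intros y Hy; exact Hy|].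
    pose proof (cond_pos k). set (e' := Rmin (k / 2) (Rmin (x0 / 2) ((PI - x0) / 2))).
    assert (e' <= k / 2) by apply Rmin_l. assert (e' <= x0 / 2) by (eapply Rle_trans; [apply Rmin_r|apply Rmin_l]).
    assert (e' <= (PI - x0) / 2) by (eapply Rle_trans; [apply Rmin_r|apply Rmin_r]).
    assert (0 < e') by (repeat apply Rmin_pos; lra).
    exists e'. repeat split; try lra. intros x Hx. assert (B : Rabs (x - x0) < k) by lra. specialize (Hk x B).
    apply Rabs_def2 in Hk. lra. }
  destruct X as [e [e0 [e1 [e2 He]]]].
  set (mu := Rmin (cos (x0 - e) - c) (c - cos (x0 + e))).
  assert (mu0 : 0 < mu).
  { apply Rmin_pos; unfold c.
    - assert (cos x0 < cos (x0 - e)) by (apply cos_decreasing_1; lra). lra.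
    - assert (cos (x0 + e) < cos x0) by (apply cos_decreasing_1; lra). lra. }
  assert (mu1 : mu <= 2).
  { le_via Rmin_r. pose proof (COS_bound x0). pose proof (COS_bound (x0 + e)). unfold c. lra. }
  assert (Out : forall x, 0 <= x <= PI -> e <= Rabs (x - x0) -> mu <= Rabs (cos x - c)).
  { intros x Hx Ho. destruct (Rle_dec x x0) as [L|L].
    - rewrite Rabs_left1 in Ho by lra. le_via Rmin_l.
      assert (cos (x0 - e) <= cos x) by (apply cos_decr_1; lra). eapply Rle_trans; [|apply Rle_abs]. lra.
    - rewrite Rabs_pos_eq in Ho by lra. le_via Rmin_r.
      assert (cos x <= cos (x0 + e)) by (apply cos_decr_1; lra). rewrite Rabs_minus_sym. eapply Rle_trans; [|apply Rle_abs]. lra. }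
  set (rho := 1 - mu ^ 2 / 4). set (sg := 1 - mu ^ 2 / 16).
  assert (m2 : 0 < mu ^ 2 <= 4) by (split; [pos|nra]).
  assert (rho0 : 0 <= rho) by (unfold rho; lra). assert (sg0 : rho < sg) by (unfold rho, sg; lra).
  assert (pk : forall x, 0 <= peak c x <= 1).
  { intros x. unfold peak. pose proof (COS_bound x). pose proof (COS_bound x0). fold c in H1. pose proof (pow2_ge_0 (cos x - c)). split; nra. }
  assert (pout : forall x, 0 <= x <= PI -> e <= Rabs (x - x0) -> peak c x <= rho).
  { intros x Hx Ho. specialize (Out x Hx Ho). unfold peak, rho. rewrite <- (pow2_abs (cos x - c)).
    nra. }
  set (z := Rmin e (mu / 4)). assert (z0 : 0 < z) by (apply Rmin_pos; lra).
  assert (ze : z <= e) by apply Rmin_l. assert (zm : z <= mu / 4) by apply Rmin_r.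
  assert (pin : forall x, Rabs (x - x0) <= z -> sg <= peak c x).
  { intros x Hx. assert (B : Rabs (cos x - c) <= mu / 4).
    { unfold c. rewrite <- (sin_shift x), <- (sin_shift x0). le_via sin_lip.
      replace (PI / 2 - x - (PI / 2 - x0)) with (- (x - x0)) by ring. rewrite Rabs_Ropp. lra. }
    unfold peak, sg. rewrite <- (pow2_abs (cos x - c)).
    assert (Rabs (cos x - c) ^ 2 <= (mu / 4) ^ 2) by (apply pow_incr; split; [pos|lra]). lra. }
  assert (Main : forall N : nat, z * d * sg ^ N <= PI * M * rho ^ N).
  { intros N. destruct (cosort_peak G c N H) as [CP HP]. specialize (HP 0%Z).
    rewrite (RInt_ext _ (fun x => G x * peak c x ^ N)) in HP by (intros; change (IZR 0) with 0; rewrite Rmult_0_l, cos_0; Rring).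
    set (F := fun x => G x * peak c x ^ N + M * rho ^ N).
    assert (CF : forall x, continuous F x) by (unfold F, peak; cnt).
    assert (E : RInt F 0 PI = PI * M * rho ^ N).
    { unfold F. rewrite RInt_Rplus, HP, RInt_cst by (unfold peak; cnt). Rring. }
    assert (rN : 0 <= M * rho ^ N) by pos.
    assert (F0 : forall x, 0 <= x <= PI -> 0 <= F x).
    { intros x Hx. unfold F. assert (pN : 0 <= peak c x ^ N) by (apply pow_le, pk).
      destruct (Rlt_dec (Rabs (x - x0)) e) as [I|I].
      - specialize (He x I). pos.
      - assert (peak c x ^ N <= rho ^ N) by (apply pow_incr; split; [apply pk|apply pout; lra]).
        specialize (HM x Hx). apply Rabs_le_between in HM.
        nra. }
    rewrite <- E.
    rewrite (RInt_split F 0 (x0 - z) PI), (RInt_split F (x0 - z) (x0 + z) PI) by cnt.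
    assert (0 <= RInt F 0 (x0 - z)) by (apply RInt_nonneg_on; [lra|auto|intros; apply F0; lra]).
    assert (0 <= RInt F (x0 + z) PI) by (apply RInt_nonneg_on; [lra|auto|intros; apply F0; lra]).
    assert (RInt (fun _ => d / 2 * sg ^ N) (x0 - z) (x0 + z) <= RInt F (x0 - z) (x0 + z)).
    { apply RInt_le; [lra|apply ex_RInt_const|now apply ex_RInt_cont|]. intros x Hx.
      assert (B : Rabs (x - x0) < z) by (apply Rabs_def1; lra). pose proof (He x ltac:(lra)).
      assert (sg ^ N <= peak c x ^ N) by (apply pow_incr; split; [lra|apply pin; lra]).
      assert (0 <= sg ^ N) by pos. unfold F.
      nra. }
    rewrite RInt_cst in H2. lra. }
  assert (rs : Rabs (rho / sg) < 1).
  { rewrite Rabs_pos_eq; pos.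
    apply Rmult_lt_reg_r with sg; [lra|]. replace (rho / sg * sg) with rho by (field; lra). lra. }
  assert (zd : 0 < z * d) by pos.
  assert (pm : 0 < PI * M + 1) by nra.
  destruct (pow_lt_1_zero (rho / sg) rs (z * d / (PI * M + 1)) ltac:(now apply Rdiv_lt_0_compat)) as [N HN].
  specialize (HN N (le_n N)). specialize (Main N).
  rewrite Rabs_pos_eq in HN by pos.
  unfold Rdiv in HN at 1. rewrite Rpow_mult_distr, pow_inv in HN.
  assert (sN : 0 < sg ^ N) by pos. assert (rN : 0 <= rho ^ N) by pos.
  apply Rmult_lt_compat_r with (r := sg ^ N * (PI * M + 1)) in HN; pos.
  replace (rho ^ N * / sg ^ N * (sg ^ N * (PI * M + 1))) with (rho ^ N * (PI * M + 1)) in HN by (field; lra).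
  replace (z * d / (PI * M + 1) * (sg ^ N * (PI * M + 1))) with (z * d * sg ^ N) in HN by (field; lra).
  lra.
Qed.

(** Identifies the series at time zero, built from the coefficients of the initial angle, with that
    angle itself. *)
Lemma cos_coef_unique (f g : R -> R) : (forall x, continuous f x) -> (forall x, continuous g x) ->
  (forall n : Z, RInt (fun x => f x * cos (IZR n * x)) 0 PI = RInt (fun x => g x * cos (IZR n * x)) 0 PI) ->
  forall x, 0 < x < PI -> f x = g x.
Proof.
  assert (K : forall f g : R -> R, (forall x, continuous f x) -> (forall x, continuous g x) ->
    (forall n : Z, RInt (fun x => f x * cos (IZR n * x)) 0 PI = RInt (fun x => g x * cos (IZR n * x)) 0 PI) ->
    forall x, 0 < x < PI -> f x <= g x).
  { clear. intros f g Cf Cg H x Hx. assert (f x - g x <= 0); [|lra].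
    apply (cosort_nonpos (fun x => f x - g x) x); [|exact Hx]. split; [cnt|].
    intros n. rlin_as (fun x => f x * cos (IZR n * x) - g x * cos (IZR n * x)). rewrite H. Rring. }
  intros Cf Cg H x Hx. apply Rle_antisym; auto.
Qed.

(** * Fourth-order decay of the initial coefficients *)

Lemma cos_coef_parts (G G1 G2 : R -> R) (n : Z) : n <> 0%Z ->
  (forall x, is_derive G x (G1 x)) -> (forall x, is_derive G1 x (G2 x)) -> (forall x, continuous G2 x) ->
  G1 0 = 0 -> G1 PI = 0 ->
  RInt (fun x => G x * cos (IZR n * x)) 0 PI = - / IZR n ^ 2 * RInt (fun x => G2 x * cos (IZR n * x)) 0 PI.
Proof.
  intros Hn D D1 C2 Z0 Z1. assert (N0 : IZR n <> 0) by now apply not_0_IZR.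
  assert (E : RInt (fun x => IZR n ^ 2 * (G x * cos (IZR n * x)) + G2 x * cos (IZR n * x)) 0 PI = 0).
  { rewrite (RInt_exact (fun x => IZR n * G x * sin (IZR n * x) + G1 x * cos (IZR n * x))
      (fun x => IZR n ^ 2 * (G x * cos (IZR n * x)) + G2 x * cos (IZR n * x))).
    - rewrite Z0, Z1, Rmult_0_r, sin_0, (sin_eq_0_1 (IZR n * PI)) by (now exists n). Rring.
    - der.
    - cnt. }
  rewrite RInt_Rplus, RInt_Rscal in E by cnt.
  apply Rmult_eq_reg_l with (IZR n ^ 2); [|now apply pow_nonzero].
  transitivity (- RInt (fun x => G2 x * cos (IZR n * x)) 0 PI); [|field; exact N0].
  lra.
Qed.

Lemma atan_le (y : R) : Rabs (atan y) <= Rabs y.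
Proof.
  destruct (MVT_gen atan 0 y (fun x => / (1 + x ^ 2))) as [c [_ E]].
  - intros; auto_derive; [auto|simpl; field; nra].
  - intros. apply derivable_continuous_pt, derivable_pt_atan.
  - rewrite atan_0, !Rminus_0_r in E. rewrite E, Rabs_mult. rewrite <- (Rmult_1_l (Rabs y)) at 2. apply Rmult_le_compat_r; pos.
    pose proof (pow2_ge_0 c). rewrite Rabs_pos_eq; pos.
    pose proof (Rinv_le_contravar 1 (1 + c ^ 2) Rlt_0_1 ltac:(lra)) as I. lra.
Qed.

Section Initial.
Context {Th Th1 : R -> R} {W2 Ls th0 : R}.
Hypothesis TD : teardrop Th Th1 W2 Ls th0.

Let cTh := Th_cont TD.
Let cTh1 := Th1_cont TD.

Lemma comp_second (F F1 F2 : R -> R) : (forall y, is_derive F y (F1 y)) -> (forall y, is_derive F1 y (F2 y)) ->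
  (forall x, is_derive (fun x => F (Th x)) x (Th1 x * F1 (Th x))) /\
  (forall x, is_derive (fun x => Th1 x * F1 (Th x)) x (F2 (Th x) * (Ls + 2 * W2 * cos (Th x)) - W2 * sin (Th x) * F1 (Th x))).
Proof.
  intros D D1. split; intros x.
  - apply (is_derive_comp F Th); [apply D|apply TD].
  - rewrite <- (td_first TD). replace (F2 (Th x) * Th1 x ^ 2 - W2 * sin (Th x) * F1 (Th x)) with
      (- W2 * sin (Th x) * F1 (Th x) + Th1 x * (Th1 x * F2 (Th x))) by ring.
    apply (is_derive_Rmult Th1 (fun x => F1 (Th x))); [apply TD|]. apply (is_derive_comp F1 Th); [apply D1|apply TD].
Qed.

(** By the first integral of the pendulum, the second derivative of [F (Th x)] is again a function
    [E] of [Th], and the first derivative carries the factor [Th1] vanishing at the ends. Parts can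
    thus be taken four times without boundary terms, giving the decay [w^2]. *)
Lemma smooth_coef (F F1 F2 E E1 E2 : R -> R) :
  (forall y, is_derive F y (F1 y)) -> (forall y, is_derive F1 y (F2 y)) ->
  (forall y, F2 y * (Ls + 2 * W2 * cos y) - W2 * sin y * F1 y = E y) ->
  (forall y, is_derive E y (E1 y)) -> (forall y, is_derive E1 y (E2 y)) -> (forall y, continuous E2 y) ->
  exists C, 0 <= C /\ forall n : Z, n <> 0%Z -> Rabs (/ PI * RInt (fun x => F (Th x) * cos (IZR n * x)) 0 PI) <= C * w n ^ 2.
Proof.
  intros D D1 EE DE DE1 C2. pose proof PI_RGT_0 as pi0.
  destruct (comp_second F F1 F2 D D1) as [A1 A2]. destruct (comp_second E E1 E2 DE DE1) as [B1 B2].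
  set (H := fun x => E2 (Th x) * (Ls + 2 * W2 * cos (Th x)) - W2 * sin (Th x) * E1 (Th x)) in *.
  assert (CH : forall x, continuous H x).
  { intros x. assert (continuous (fun x => E2 (Th x)) x) by (apply (continuous_comp Th E2); [auto|apply C2]).
    assert (continuous (fun x => E1 (Th x)) x) by (apply (continuous_comp Th E1); [auto|cnt]).
    unfold H. cnt. }
  destruct (bounded_on H 0 PI ltac:(lra) CH) as [M [M0 HM]].
  exists (4 * M). split; [lra|]. intros n Hn.
  rewrite (cos_coef_parts (fun x => F (Th x)) (fun x => Th1 x * F1 (Th x)) (fun x => E (Th x)) n Hn A1).
  - rewrite (cos_coef_parts (fun x => E (Th x)) (fun x => Th1 x * E1 (Th x)) H n Hn B1 B2 CH).
    + assert (Ba : Rabs (RInt (fun x => H x * cos (IZR n * x)) 0 PI) <= PI * M).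
      { eapply Rle_trans; [apply (RInt_sup_le (fun x => H x * cos (IZR n * x)) 0 PI M); [lra|cnt|]|lra].
        intros x Hx. eapply Rle_trans; [apply Rabs_mult_cos|auto]. }
      set (I := RInt (fun x => H x * cos (IZR n * x)) 0 PI) in *.
      set (N2 := IZR n ^ 2). assert (n1 : 1 <= N2).
      { unfold N2. assert (1 <= Rabs (IZR n)) by (rewrite <- abs_IZR; apply (IZR_le 1); lia).
        rewrite <- pow2_abs. nra. }
      replace (/ PI * (- / N2 * (- / N2 * I))) with (/ PI * (/ N2 * / N2) * I) by lra.
      rewrite Rabs_mult, Rabs_pos_eq by pos.
      assert (i2 : 0 < / N2) by pos.
      apply Rle_trans with (/ PI * (/ N2 * / N2) * (PI * M)).
      * apply Rmult_le_compat_l; pos.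
      * replace (/ PI * (/ N2 * / N2) * (PI * M)) with (M * (/ N2 * / N2)) by (field; split; lra).
        rewrite (Rmult_comm 4 M), Rmult_assoc. apply Rmult_le_compat_l; [exact M0|].
        unfold w. fold N2. assert (h2 : / N2 <= 2 * / (1 + N2)).
        { apply Rmult_le_reg_l with (N2 * (1 + N2)); [nra|].
          replace (N2 * (1 + N2) * / N2) with (1 + N2) by (field; lra).
          replace (N2 * (1 + N2) * (2 * / (1 + N2))) with (2 * N2) by (field; lra). lra. }
        nra.
    + rewrite (td_left TD). ring.
    + rewrite (td_right TD). ring.
  - intros x. rewrite <- EE. apply A2.
  - cnt.
  - rewrite (td_left TD). ring.
  - rewrite (td_right TD). ring.
Qed.

Definition coef (f : R -> R) (n : Z) : R := / PI * RInt (fun x => f x * cos (IZR n * x)) 0 PI.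

Lemma coef_id : exists C, 0 <= C /\ forall n : Z, n <> 0%Z -> Rabs (coef Th n) <= C * w n ^ 2.
Proof.
  apply (smooth_coef (fun y => y) (fun _ => 1) (fun _ => 0) (fun y => - W2 * sin y) (fun y => - W2 * cos y) (fun y => W2 * sin y)).
  1-2, 4-5: der. all: cnt. ring.
Qed.

Lemma coef_sin : exists C, 0 <= C /\ forall n : Z, n <> 0%Z -> Rabs (coef (fun x => sin (Th x)) n) <= C * w n ^ 2.
Proof.
  apply (smooth_coef sin cos (fun y => - sin y) (fun y => - Ls * sin y - 3 * W2 * (sin y * cos y))
    (fun y => - Ls * cos y - 3 * W2 * (cos y * cos y - sin y * sin y)) (fun y => Ls * sin y + 12 * W2 * (sin y * cos y))).
  1-2, 4-5: der. all: cnt. ring.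
Qed.

Lemma coef_cos : exists C, 0 <= C /\ forall n : Z, n <> 0%Z -> Rabs (coef (fun x => cos (Th x)) n) <= C * w n ^ 2.
Proof.
  apply (smooth_coef cos (fun y => - sin y) (fun y => - cos y) (fun y => - Ls * cos y - 2 * W2 * (cos y * cos y) + W2 * (sin y * sin y))
    (fun y => Ls * sin y + 6 * W2 * (sin y * cos y)) (fun y => Ls * cos y + 6 * W2 * (cos y * cos y - sin y * sin y))).
  1-2, 4-5: der. all: cnt. ring.
Qed.

Lemma coef_lin (b p q : R) (n : Z) : n <> 0%Z ->
  coef (fun x => b + Th x + (p * sin (Th x) + q * cos (Th x))) n = coef Th n + (p * coef (fun x => sin (Th x)) n + q * coef (fun x => cos (Th x)) n).
Proof.
  intros Hn. unfold coef.
  rewrite (RInt_ext _ (fun x => (b * cos (IZR n * x) + Th x * cos (IZR n * x)) + (p * (sin (Th x) * cos (IZR n * x)) + q * (cos (Th x) * cos (IZR n * x))))) by pos.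
  assert (Z : RInt (fun x => cos (IZR n * x)) 0 PI = 0).
  { assert (N0 : IZR n <> 0) by now apply not_0_IZR.
    rewrite (RInt_exact (fun x => / IZR n * sin (IZR n * x)) (fun x => cos (IZR n * x))).
    - rewrite Rmult_0_r, sin_0, (sin_eq_0_1 (IZR n * PI)) by (now exists n). Rring.
    - der. field. exact N0.
    - cnt. }
  rlin. rewrite Z. Rring.
Qed.

Lemma cos_taylor1 (a x : R) : Rabs (cos (a + x) - cos a + x * sin a) <= 2 * x ^ 2.
Proof.
  pose proof (sin_taylor (PI / 2 + a) x) as H. rewrite Rplus_assoc, <- !cos_sin in H.
  replace (cos (PI / 2 + a)) with (- sin a) in H by (rewrite sin_cos; ring).
  replace (cos (a + x) - cos a - x * - sin a) with (cos (a + x) - cos a + x * sin a) in H by ring. exact H.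
Qed.

Let I0 : R := RInt (fun x => Th1 x ^ 2 * cos (Th x)) 0 PI.

Lemma sin2_int : RInt (fun x => sin (Th x) * sin (Th x)) 0 PI = I0 / W2.
Proof.
  pose proof (td_W2 TD) as W0.
  apply Rmult_eq_reg_l with W2; [|lra]. replace (W2 * (I0 / W2)) with I0 by (field; lra). symmetry. unfold I0.
  rewrite (RInt_ext _ (fun x => Th1 x * (Th1 x * cos (Th x)))) by pos.
  apply (Th1_by_parts TD (fun x => sin (Th x)) (fun x => Th1 x * cos (Th x))).
  - der.
  - cnt.
Qed.

(** Insert the first integral for [Th1^2] into [I0]; its constant term drops out by closing. *)
Lemma cos2_int : RInt (fun x => cos (Th x) * cos (Th x)) 0 PI = I0 / (2 * W2).
Proof.
  pose proof (td_W2 TD) as W0.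
  apply Rmult_eq_reg_l with (2 * W2); [|lra]. replace (2 * W2 * (I0 / (2 * W2))) with I0 by (field; lra). symmetry. unfold I0.
  rewrite (RInt_ext _ (fun x => Ls * cos (Th x) + 2 * W2 * (cos (Th x) * cos (Th x)))) by (intros; rewrite (td_first TD); Rring).
  rlin. rewrite (td_closed TD). Rring.
Qed.

Lemma sincos_int : RInt (fun x => sin (Th x) * cos (Th x)) 0 PI = 0.
Proof.
  apply RInt_odd_zero.
  - cnt.
  - intros x. rewrite (td_odd TD), sin_neg, cos_neg. ring.
Qed.

Section Perturbation.
Variable b0 : R.
(** The two first variations of closing are diagonal on [sin Th] and [cos Th] by [sincos_int]. These
    constants make the end vector open at unit speed in direction [(cos b0, - sin b0)], which the
    rotation by [b0] turns onto the positive axis. Functions of [Th] also keep the boundary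
    condition and the coefficient decay. *)
Let A := - cos b0 * W2 / I0.
Let B := - sin b0 * (2 * W2) / I0.
Definition pert (x : R) : R := A * sin (Th x) + B * cos (Th x).
Definition pert1 (x : R) : R := Th1 x * (A * cos (Th x) - B * sin (Th x)).

Lemma I0_pos : 0 < I0. Proof. exact (kinetic_pos TD). Qed.

Lemma pert_d x : is_derive pert x (pert1 x).
Proof. unfold pert, pert1. der. Qed.
#[local] Hint Resolve pert_d : deriv.

Lemma pert1_c x : continuous pert1 x.
Proof. unfold pert1. cnt. Qed.

Lemma pert_c x : continuous pert x.
Proof. eapply continuous_of_derive, pert_d. Qed.
#[local] Hint Resolve pert1_c pert_c : cont.

Lemma pert_abs x : Rabs (pert x) <= Rabs A + Rabs B.
Proof.
  le_via Rabs_triang. rewrite !Rabs_mult.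
  assert (Rabs (sin (Th x)) <= 1) by (apply Rabs_sin). assert (Rabs (cos (Th x)) <= 1) by (apply Rabs_cos).
  pose proof (Rabs_pos A). pose proof (Rabs_pos B). apply Rplus_le_compat; nra.
Qed.

Lemma pert_sin : RInt (fun x => sin (Th x) * pert x) 0 PI = - cos b0.
Proof.
  pose proof (td_W2 TD) as W0. pose proof I0_pos as i0.
  rewrite (RInt_ext _ (fun x => A * (sin (Th x) * sin (Th x)) + B * (sin (Th x) * cos (Th x)))) by (intros; unfold pert; Rring).
  rlin. rewrite sin2_int, sincos_int. change (A * (I0 / W2) + B * 0 = - cos b0). unfold A. field. split; lra.
Qed.

Lemma pert_cos : RInt (fun x => cos (Th x) * pert x) 0 PI = - sin b0.
Proof.
  pose proof (td_W2 TD) as W0. pose proof I0_pos as i0.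
  rewrite (RInt_ext _ (fun x => A * (sin (Th x) * cos (Th x)) + B * (cos (Th x) * cos (Th x)))) by (intros; unfold pert; Rring).
  rlin. rewrite cos2_int, sincos_int. change (A * 0 + B * (I0 / (2 * W2)) = - sin b0). unfold B. field. split; lra.
Qed.

Lemma pert_mean : RInt pert 0 PI = 0.
Proof. unfold pert. rlin. rewrite (sinTh_mean TD), (td_closed TD). Rring. Qed.

Lemma pert_Th1 : RInt (fun x => Th1 x * pert1 x) 0 PI = - W2 * cos b0.
Proof. rewrite (Th1_by_parts TD pert pert1 pert_d pert1_c), pert_sin. Rring. Qed.

(** [Zx] and [Zy] are the components of the end vector of the teardrop perturbed by [s * pert]. *)
Definition Zx (s : R) : R := RInt (fun x => cos (Th x + s * pert x)) 0 PI.
Definition Zy (s : R) : R := RInt (fun x => sin (Th x + s * pert x)) 0 PI.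

Lemma Z_cont s : continuous Zx s /\ continuous Zy s.
Proof.
  assert (C : forall y t, cont2 (fun x t => Th x + t * pert x) y t).
  { intros y t. apply cont2_plus.
    - apply cont2_comp1; [apply cont2_fst|auto].
    - apply cont2_mult; [apply cont2_snd|].
      apply cont2_comp1; [apply cont2_fst|cnt]. }
  assert (K : forall g : R -> R, (forall y, continuous g y) -> continuous (fun s => RInt (fun x => g (Th x + s * pert x)) 0 PI) s).
  { intros g Cg. apply (cont2_slice2 (fun x s => RInt (fun y => g (Th y + s * pert y)) 0 x)).
    apply (cont2_RInt (fun _ => True) (fun y s => g (Th y + s * pert y))); [now exists (mkposreal 1 Rlt_0_1)|].
    intros y t _. apply cont2_comp1; auto. }
  split; [apply (K cos)|apply (K sin)]; cnt.
Qed.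

Let F := 2 * PI * (Rabs A + Rabs B) ^ 2.
Lemma F_nonneg : 0 <= F.
Proof. apply Rmult_le_pos; [pose proof PI_RGT_0; lra|pos]. Qed.

Lemma Z_expand s : Rabs (Zx s - s * cos b0) <= F * s ^ 2 /\ Rabs (Zy s + s * sin b0) <= F * s ^ 2.
Proof.
  pose proof PI_RGT_0 as pi0.
  assert (bd : forall g : R -> R, (forall x, continuous g x) -> (forall x, Rabs (g x) <= 2 * (s * pert x) ^ 2) -> Rabs (RInt g 0 PI) <= F * s ^ 2).
  { intros g Cg Hg. eapply Rle_trans; [apply (RInt_sup_le g 0 PI (2 * ((Rabs A + Rabs B) ^ 2 * s ^ 2))); [lra|exact Cg|]|].
    - intros x _. le_via Hg. apply Rmult_le_compat_l; [lra|]. rewrite Rpow_mult_distr, (Rmult_comm (s ^ 2)).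
      apply Rmult_le_compat_r; pos. rewrite <- pow2_abs. apply pow_incr. split; [pos|apply pert_abs].
    - unfold F. right. ring. }
  split.
  - set (g := fun x => cos (Th x + s * pert x) - cos (Th x) + s * (sin (Th x) * pert x)).
    assert (E : RInt g 0 PI = Zx s - s * cos b0).
    { unfold g. rlin. rewrite pert_sin, (td_closed TD). fold (Zx s). Rring. }
    rewrite <- E. apply bd; [unfold g; cnt|]. intros x. unfold g.
    replace (s * (sin (Th x) * pert x)) with (s * pert x * sin (Th x)) by ring. apply cos_taylor1.
  - set (g := fun x => sin (Th x + s * pert x) - sin (Th x) - s * (cos (Th x) * pert x)).
    assert (E : RInt g 0 PI = Zy s + s * sin b0).
    { unfold g. rlin. rewrite pert_cos, (sinTh_mean TD). fold (Zy s). Rring. }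
    rewrite <- E. apply bd; [unfold g; cnt|]. intros x. unfold g.
    replace (s * (cos (Th x) * pert x)) with (s * pert x * cos (Th x)) by ring. apply sin_taylor.
Qed.

(* [F] bounds the quadratic remainder of the closing defect; [p], [v] are its coordinates in the frame turned by [b0] *)
Lemma opening_exists : exists C e1, 0 < C /\ 0 < e1 <= 1 /\ forall eps, 0 < eps <= e1 ->
  exists s b, 0 <= s <= 2 * eps /\ Rabs (b - b0) <= C * eps /\ Rabs (s - eps) <= C * eps ^ 2 /\
    Zx s * cos b - Zy s * sin b = eps /\ Zx s * sin b + Zy s * cos b = 0.
Proof.
  pose proof F_nonneg as F0. set (G := F + 1). set (s1 := / (4 * G)).
  assert (s1p : 0 < s1) by (apply Rinv_0_lt_compat; unfold G; lra).
  assert (Gs : 4 * G * s1 = 1) by (unfold s1; field; unfold G; lra).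
  assert (HZ : forall s, 0 <= s -> exists p v, p = Zx s * cos b0 - Zy s * sin b0 /\ v = Zx s * sin b0 + Zy s * cos b0 /\
     Rabs (p - s) <= 2 * G * s ^ 2 /\ Rabs v <= 2 * G * s ^ 2 /\ Zx s ^ 2 + Zy s ^ 2 = p ^ 2 + v ^ 2).
  { intros s Hs. exists (Zx s * cos b0 - Zy s * sin b0), (Zx s * sin b0 + Zy s * cos b0).
    destruct (Z_expand s) as [HX HY]. set (ex := Zx s - s * cos b0) in *. set (ey := Zy s + s * sin b0) in *.
    pose proof (sin2_cos2 b0) as SC. unfold Rsqr in SC. pose proof (pow2_ge_0 s).
    assert (Rabs (sin b0) <= 1) by (apply Rabs_sin). assert (Rabs (cos b0) <= 1) by (apply Rabs_cos).
    assert (M : forall e c, Rabs e <= F * s ^ 2 -> Rabs c <= 1 -> Rabs (e * c) <= G * s ^ 2).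
    { intros e c He Hc. rewrite Rabs_mult. apply Rle_trans with (F * s ^ 2 * 1); [|unfold G; lra].
      apply Rmult_le_compat; pos. }
    split; [lra|]. split; [lra|]. split; [|split].
    - replace (Zx s * cos b0 - Zy s * sin b0 - s) with (ex * cos b0 + - (ey * sin b0) + s * (sin b0 * sin b0 + cos b0 * cos b0 - 1)) by (unfold ex, ey; ring).
      rewrite Rminus_diag_eq, Rmult_0_r, Rplus_0_r by lra.
      le_via Rabs_triang. rewrite Rabs_Ropp. pose proof (M ex _ HX H1). pose proof (M ey _ HY H0). lra.
    - replace (Zx s * sin b0 + Zy s * cos b0) with (ex * sin b0 + ey * cos b0) by (unfold ex, ey; ring).
      le_via Rabs_triang. pose proof (M ex _ HX H0). pose proof (M ey _ HY H1). lra.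
    - replace ((Zx s * cos b0 - Zy s * sin b0) ^ 2 + (Zx s * sin b0 + Zy s * cos b0) ^ 2) with
        ((Zx s ^ 2 + Zy s ^ 2) * (sin b0 * sin b0 + cos b0 * cos b0)) by ring. rewrite SC. ring. }
  assert (half : forall s, 0 <= s <= s1 -> 2 * G * s ^ 2 <= s / 2).
  { intros s Hs. nra. }
  set (C := 16 * G + 8 * G + 64 * G ^ 2).
  exists C, (Rmin 1 (Rmin (s1 / 2) (/ (16 * G)))).
  assert (g1 : 1 <= G) by (unfold G; lra). assert (g2 : 0 < / (16 * G)) by pos.
  assert (g3 : 0 < G ^ 2) by pos.
  split; [unfold C; lra|]. split; [split; [repeat apply Rmin_pos; lra|apply Rmin_l]|].
  intros eps [e0 He].
  assert (h1 : eps <= 1) by (eapply Rle_trans; [exact He|apply Rmin_l]).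
  assert (h2 : eps <= s1 / 2) by (eapply Rle_trans; [exact He|eapply Rle_trans; [apply Rmin_r|apply Rmin_l]]).
  assert (h3 : eps <= / (16 * G)) by (eapply Rle_trans; [exact He|eapply Rle_trans; [apply Rmin_r|apply Rmin_r]]).
  (* The amplitude is fixed by the length of the end vector alone; its direction is then corrected
     by a rotation, so a one-dimensional argument suffices. *)
  destruct (IVT_value (fun s => Zx s ^ 2 + Zy s ^ 2) 0 s1 (eps ^ 2) ltac:(lra)) as [s [Hs Es]].
  { intros s _. destruct (Z_cont s) as [c1 c2]. cnt. }
  { split.
  { destruct (HZ 0 (Rle_refl 0)) as [p [v [_ [_ [Hp [Hv E]]]]]].
    apply Rabs_le_between in Hp. apply Rabs_le_between in Hv. nra. }
  { destruct (HZ s1 ltac:(lra)) as [p [v [_ [_ [Hp [Hv E]]]]]]. pose proof (half s1 ltac:(lra)).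
    apply Rabs_le_between in Hp. nra. } }
  destruct (HZ s ltac:(lra)) as [p [v [Ep [Ev [Hp [Hv E]]]]]]. rewrite Es in E.
  pose proof (half s Hs) as Hh. apply Rabs_le_between in Hp.
  assert (ps : s / 2 <= p) by lra.
  assert (pe : p <= eps).
  { apply Rnot_lt_le. intros L. assert (eps ^ 2 < p ^ 2) by (simpl; rewrite !Rmult_1_r; apply Rmult_le_0_lt_compat; lra). pose proof (pow2_ge_0 v). lra. }
  assert (Hv2 : Rabs v <= 8 * G * eps ^ 2) by nra.
  assert (Ge : 16 * G * eps <= 1) by (apply Rle_trans with (16 * G * / (16 * G)); [apply Rmult_le_compat_l; lra|right; field; lra]).
  assert (vh : Rabs v <= eps / 2) by nra.
  assert (v2 : v ^ 2 <= (eps / 2) ^ 2) by (rewrite <- pow2_abs; apply pow_incr; split; [pos|exact vh]).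
  assert (p2 : eps / 2 <= p) by nra.
  (* The extra angle annihilates the transverse component [v]. It is [O(eps)] because [v] is
     quadratic in [eps] while [p] is of order [eps]. *)
  set (b := b0 + atan (- v / p)). exists s, b.
  assert (cs : cos (atan (- v / p)) = p / eps /\ sin (atan (- v / p)) = - v / eps).
  { rewrite cos_atan, sin_atan. assert (Q : sqrt (1 + (- v / p)²) = eps / p).
    { replace (1 + (- v / p)²) with ((eps / p) ^ 2).
      - apply sqrt_pow2. pos.
      - unfold Rsqr. replace ((eps / p) ^ 2) with (eps ^ 2 / p ^ 2) by (field; lra). rewrite E. field. lra. }
    rewrite Q. split; field; lra. }
  destruct cs as [cE sE].
  split; [lra|]. split; [|split; [|split]].
  - unfold b. replace (b0 + atan (- v / p) - b0) with (atan (- v / p)) by ring. le_via atan_le.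
    unfold Rdiv. rewrite Rabs_mult, Rabs_Ropp, Rabs_inv, (Rabs_pos_eq p) by lra.
    apply Rmult_le_reg_r with p; [lra|]. rewrite Rmult_assoc, Rinv_l, Rmult_1_r by lra.
    apply Rle_trans with (16 * G * eps * (eps / 2)); pos.
    apply Rmult_le_compat; pos. apply Rmult_le_compat_r; [lra|unfold C; lra].
  - assert (R1 : Rabs (s - p) <= 8 * G * eps ^ 2).
    {
      apply Rle_trans with (2 * G * s ^ 2); [apply Rabs_le_between; lra|].
      nra. }
    assert (R2 : Rabs (p - eps) <= 64 * G ^ 2 * eps ^ 2).
    { rewrite Rabs_left1 by lra.
      assert (eps * (eps - p) <= v ^ 2) by nra.
      assert (v ^ 2 <= (8 * G * eps ^ 2) ^ 2) by (rewrite <- pow2_abs; apply pow_incr; split; [pos|lra]).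
      nra. }
    replace (s - eps) with ((s - p) + (p - eps)) by ring. le_via Rabs_triang.
    unfold C. nra.
  - unfold b. rewrite cos_plus, sin_plus, cE, sE.
    replace (Zx s * (cos b0 * (p / eps) - sin b0 * (- v / eps)) - Zy s * (sin b0 * (p / eps) + cos b0 * (- v / eps)))
      with (((Zx s * cos b0 - Zy s * sin b0) * p + (Zx s * sin b0 + Zy s * cos b0) * v) / eps) by lra.
    rewrite <- Ep, <- Ev. replace (p * p + v * v) with (eps ^ 2) by lra. field. lra.
  - unfold b. rewrite cos_plus, sin_plus, cE.
    nra.
Qed.

(** The perturbed teardrop of [opening_exists], rotated by [b]. Its bending changes to first order
    by [2 s] times [pert_Th1], which is exactly the leading term [- 2 W2 eps cos b]; all else is of
    second order. *)
Lemma initial_data : exists K C e1, 0 < K /\ 0 < C /\ 0 < e1 <= 1 /\ forall eps, 0 < eps <= e1 ->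
  exists (th q : R -> R) (b : R),
    (forall x, is_derive th x (q x)) /\ (forall x, continuous q x) /\
    (forall n : Z, n <> 0%Z -> Rabs (coef th n) <= K * w n ^ 2) /\ RInt th 0 PI = PI * b /\
    RInt (fun x => cos (th x)) 0 PI = eps /\ RInt (fun x => sin (th x)) 0 PI = 0 /\
    Rabs (b - b0) <= C * eps /\ gap Th1 q <= C * eps ^ 2 /\
    RInt (fun x => q x ^ 2) 0 PI - PI * Ls <= - 2 * W2 * eps * cos b + C * eps ^ 2.
Proof.
  destruct opening_exists as [C [e1 [C0 [E1 H]]]]. pose proof (td_W2 TD) as W0. pose proof PI_RGT_0 as pi0.
  destruct (coef_id) as [Ka [Ka0 HKa]]. destruct coef_sin as [Kb [Kb0 HKb]]. destruct coef_cos as [Kc [Kc0 HKc]].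
  set (Fq := RInt (fun x => pert1 x ^ 2) 0 PI : R).
  assert (Fq0 : 0 <= Fq) by (apply RInt_nonneg_on; [lra|cnt|pos]).
  exists (Ka + 2 * Rabs A * Kb + 2 * Rabs B * Kc + 1), (C + 4 * Fq + 4 * W2 * C), e1.
  pose proof (Rabs_pos A) as A0. pose proof (Rabs_pos B) as B0.
  assert (0 <= 2 * Rabs A * Kb) by pos. assert (0 <= 2 * Rabs B * Kc) by pos.
  assert (0 < 4 * W2 * C) by pos.
  split; [lra|]. split; [lra|]. split; [exact E1|]. intros eps He.
  destruct (H eps He) as [s [b [Hs [Hb [Hse [HX HY]]]]]].
  assert (Rs : Rabs s <= 2) by (rewrite Rabs_pos_eq; lra).
  exists (fun x => b + (Th x + s * pert x)), (fun x => Th1 x + s * pert1 x), b.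
  assert (Dth : forall x, is_derive (fun x => b + (Th x + s * pert x)) x (Th1 x + s * pert1 x)) by der.
  split; [auto|]. split; [cnt|]. split; [|split; [|split; [|split; [|split; [|split]]]]].
  - intros n Hn. replace (coef (fun x => b + (Th x + s * pert x)) n) with (coef (fun x => b + Th x + (s * A * sin (Th x) + s * B * cos (Th x))) n).
    2: { unfold coef. f_equal. apply RInt_ext. intros x _. unfold pert. Rring. }
    rewrite coef_lin by auto. specialize (HKa n Hn). specialize (HKb n Hn). specialize (HKc n Hn).
    pose proof (pow2_ge_0 (w n)) as w0.
    le_via Rabs_triang.
    assert (T1 : Rabs (s * A * coef (fun x => sin (Th x)) n) <= 2 * Rabs A * (Kb * w n ^ 2)).
    { rewrite !Rabs_mult. apply Rmult_le_compat; pos. apply Rmult_le_compat_r; lra. }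
    assert (T2 : Rabs (s * B * coef (fun x => cos (Th x)) n) <= 2 * Rabs B * (Kc * w n ^ 2)).
    { rewrite !Rabs_mult. apply Rmult_le_compat; pos. apply Rmult_le_compat_r; lra. }
    pose proof (Rabs_triang (s * A * coef (fun x => sin (Th x)) n) (s * B * coef (fun x => cos (Th x)) n)). lra.
  - rlin. change (RInt (fun x => Th x) 0 PI) with (RInt Th 0 PI). change (RInt (fun x => pert x) 0 PI) with (RInt pert 0 PI).
    rewrite (Th_mean TD), pert_mean. Rring.
  - rewrite <- HX. rewrite (RInt_ext _ (fun x => cos ((Th x + s * pert x) - (- b)))) by (intros; f_equal; Rring).
    rewrite (proj1 (RInt_rotate (fun x => Th x + s * pert x) (- b) (Zx s) (Zy s) ltac:(cnt) eq_refl eq_refl)), cos_neg, sin_neg. Rring.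
  - rewrite (RInt_ext _ (fun x => sin ((Th x + s * pert x) - (- b)))) by (intros; f_equal; Rring).
    rewrite (proj2 (RInt_rotate (fun x => Th x + s * pert x) (- b) (Zx s) (Zy s) ltac:(cnt) eq_refl eq_refl)), cos_neg, sin_neg, <- HY. Rring.
  - eapply Rle_trans; [exact Hb|]. apply Rmult_le_compat_r; lra.
  - unfold gap. rewrite (RInt_ext _ (fun x => s ^ 2 * pert1 x ^ 2)) by pos.
    rlin. fold Fq.
    assert (s ^ 2 <= (2 * eps) ^ 2) by (apply pow_incr; lra). nra.
  - rewrite (RInt_ext _ (fun x => Th1 x ^ 2 + (2 * s * (Th1 x * pert1 x) + s ^ 2 * pert1 x ^ 2))) by pos.
    rlin. rewrite (Th1_energy TD), pert_Th1. fold Fq.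
    assert (S2 : s ^ 2 * Fq <= 4 * Fq * eps ^ 2).
    { assert (s ^ 2 <= (2 * eps) ^ 2) by (apply pow_incr; lra). nra. }
    assert (Cb : Rabs (cos b0 - cos b) <= C * eps).
    { rewrite <- !sin_shift. le_via sin_lip. replace (PI / 2 - b0 - (PI / 2 - b)) with (b - b0) by ring. exact Hb. }
    assert (T1 : Rabs ((s - eps) * cos b0) <= C * eps ^ 2).
    { rewrite Rabs_mult. rewrite <- (Rmult_1_r (C * eps ^ 2)). apply Rmult_le_compat; [pos|pos|lra|apply Rabs_cos]. }
    assert (T2 : Rabs (eps * (cos b0 - cos b)) <= C * eps ^ 2).
    { rewrite Rabs_mult, (Rabs_pos_eq eps) by lra. nra. }
    apply Rabs_le_between in T1. apply Rabs_le_between in T2.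
    nra.
Qed.
End Perturbation.
End Initial.

(** * Closeness and descent *)

(** [B0] and [B] stand for the bending at time zero and later, [et] for the later opening, [cb] and
    [c] for the cosines of the mean angles, [N] for the gap. Energy decay bounds [B - PI Ls] above
    by [- 2 W2 eps cb], and nonnegativity of the gap bounds it below by [- 2 W2 et c], both up to
    [O(eps^2)]. Dividing by [eps] shows that [c] cannot fall noticeably below [cb]. *)
Lemma closeness (W2 Ls C C1 C2 : R) : 0 < W2 -> 0 < Ls -> 0 < C -> 0 < C1 -> 0 < C2 ->
  exists D, 0 < D /\ forall eps B0 B L N cb c et : R,
  0 < eps <= 1 -> B0 - PI * Ls <= - 2 * W2 * eps * cb + C * eps ^ 2 ->
  0 <= C1 * (B0 - PI * Ls + 2 * W2 * eps * cb) + C2 * eps ^ 2 ->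
  -1 <= cb <= 1 -> -1 <= c <= 1 -> Ls / 2 <= L <= 2 * Ls ->
  (B + PI * L) ^ 2 / L <= (B0 + PI * Ls) ^ 2 / Ls -> 0 < et -> L * et ^ 2 = Ls * eps ^ 2 ->
  0 <= N -> N <= C1 * (B - PI * Ls + 2 * W2 * et * c) + C2 * et ^ 2 ->
  N <= D * eps /\ (L - Ls) ^ 2 <= D * eps /\ cb - Rabs (L - Ls) / Ls - D * eps <= c /\ et <= 2 * eps /\ eps / 2 <= et.
Proof.
  intros W0 L0 C0 C10 C20. pose proof PI_RGT_0 as pi0.
  set (k := C2 / C1). assert (k0 : 0 < k) by now apply Rdiv_lt_0_compat.
  set (c5 := 2 * W2 + C + k). set (c7 := C + c5 ^ 2 / (4 * PI * Ls)).
  assert (c50 : 0 < c5) by (unfold c5; lra).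
  assert (q0 : 0 < c5 ^ 2 / (4 * PI * Ls)) by pos.
  assert (c70 : 0 < c7) by (unfold c7; lra).
  set (c9 := 4 * W2 + 4 * k). set (c12 := 2 * W2 + c7 + c9).
  set (D1 := C1 * (2 * W2 + c7 + 4 * W2) + 4 * C2).
  set (D2 := (2 * (2 * Ls * (4 * PI * c12)) + 2 * c12 ^ 2) / PI ^ 2).
  set (D3 := (c7 + 4 * k) / W2).
  assert (c90 : 0 < c9) by (unfold c9; lra). assert (c120 : 0 < c12) by (unfold c12; lra).
  assert (D10 : 0 < D1) by (unfold D1; assert (0 < C1 * (2 * W2 + c7 + 4 * W2)) by (apply Rmult_lt_0_compat; lra); lra).
  assert (D20 : 0 < D2).
  { unfold D2. pos. }
  assert (D30 : 0 < D3) by (unfold D3; apply Rdiv_lt_0_compat; lra).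
  exists (D1 + D2 + D3). split; [lra|].
  intros eps B0 B L N cb c et [e0 e1] Hd HN0 Hcb Hc HL HE et0 Het N0 HN.
  assert (e2 : 0 < eps ^ 2) by pos. assert (e21 : eps ^ 2 <= eps) by nra.
  assert (Lp : 0 < L) by lra.
  assert (et2 : et ^ 2 <= 2 * eps ^ 2 /\ eps ^ 2 <= 2 * et ^ 2) by (split; apply Rmult_le_reg_l with Ls; try lra; nra).
  assert (et_u : et <= 2 * eps) by nra.
  assert (et_l : eps / 2 <= et) by nra.
  set (d := B0 - PI * Ls) in *.
  assert (dlo : - 2 * W2 * eps * cb - k * eps ^ 2 <= d).
  { assert (0 <= (d + 2 * W2 * eps * cb) + k * eps ^ 2); [|lra].
    apply Rmult_le_reg_l with C1; [lra|]. rewrite Rmult_0_r. eapply Rle_trans; [exact HN0|]. right. unfold k. field. lra. }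
  assert (wc : forall y z, 0 <= y -> -1 <= z <= 1 -> - (2 * W2 * y) <= 2 * W2 * y * z <= 2 * W2 * y).
  { intros y z Hy Hz. assert (0 <= 2 * W2 * y) by pos. nra. }
  pose proof (wc eps cb ltac:(lra) Hcb) as w1. pose proof (wc et c ltac:(lra) Hc) as w2.
  assert (w3 : 2 * W2 * et <= 4 * W2 * eps) by (assert (2 * W2 * et <= 2 * W2 * (2 * eps)) by (apply Rmult_le_compat_l; lra); lra).
  assert (ke : k * eps ^ 2 <= k * eps) by (apply Rmult_le_compat_l; lra).
  assert (Ce : C * eps ^ 2 <= C * eps) by (apply Rmult_le_compat_l; lra).
  assert (pe : 0 <= C * eps /\ 0 <= k * eps /\ 0 <= W2 * eps /\ 0 <= c7 * eps) by (repeat split; apply Rmult_le_pos; lra).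
  assert (dabs : Rabs d <= c5 * eps) by (apply Rabs_le_between; unfold c5; lra).
  assert (d2 : d ^ 2 <= c5 ^ 2 * eps ^ 2).
  { rewrite <- pow2_abs, <- Rpow_mult_distr. apply pow_incr. split; pos. }
  assert (E0 : (B0 + PI * Ls) ^ 2 / Ls <= 4 * PI * (PI * Ls + d) + c5 ^ 2 * eps ^ 2 / Ls).
  { replace ((B0 + PI * Ls) ^ 2 / Ls) with (4 * PI * (PI * Ls + d) + d ^ 2 / Ls) by (unfold d; field; lra).
    apply Rplus_le_compat_l. apply Rmult_le_compat_r; pos. }
  (* The first term is the energy after optimal dilation. The square measures the distance of [L]
     from its optimum and controls [L - Ls]. *)
  assert (Et : (B + PI * L) ^ 2 / L = 4 * PI * B + (B - PI * L) ^ 2 / L) by (field; lra).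
  assert (sq : 0 <= (B - PI * L) ^ 2 / L) by pos.
  assert (Bup : B - PI * Ls <= - 2 * W2 * eps * cb + c7 * eps ^ 2).
  { assert (4 * PI * B <= 4 * PI * (PI * Ls + d + c5 ^ 2 / (4 * PI * Ls) * eps ^ 2)).
    { replace (4 * PI * (PI * Ls + d + c5 ^ 2 / (4 * PI * Ls) * eps ^ 2)) with (4 * PI * (PI * Ls + d) + c5 ^ 2 * eps ^ 2 / Ls) by (field; lra). lra. }
    apply Rmult_le_reg_l in H; [|lra]. unfold c7. lra. }
  assert (c7e : c7 * eps ^ 2 <= c7 * eps) by (apply Rmult_le_compat_l; lra).
  assert (Blo : - (2 * W2 * et * c) - k * et ^ 2 <= B - PI * Ls).
  { assert (0 <= (B - PI * Ls + 2 * W2 * et * c) + k * et ^ 2); [|lra].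
    apply Rmult_le_reg_l with C1; [lra|]. rewrite Rmult_0_r. apply Rle_trans with N; [exact N0|]. eapply Rle_trans; [exact HN|]. right. unfold k. field. lra. }
  assert (ke2 : k * et ^ 2 <= 2 * k * eps ^ 2) by (rewrite (Rmult_comm 2 k), Rmult_assoc; apply Rmult_le_compat_l; lra).
  assert (Babs : Rabs (B - PI * Ls) <= c12 * eps).
  { apply Rabs_le_between. unfold c12, c9. lra. }
  split; [|split; [|pos]].
  - apply Rle_trans with (D1 * eps); [|apply Rmult_le_compat_r; lra].
    assert (C1 * (B - PI * Ls + 2 * W2 * et * c) <= C1 * ((2 * W2 + c7 + 4 * W2) * eps)) by (apply Rmult_le_compat_l; lra).
    assert (C2 * et ^ 2 <= C2 * (4 * eps)) by (apply Rmult_le_compat_l; lra). unfold D1. lra.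
  - apply Rle_trans with (D2 * eps); [|apply Rmult_le_compat_r; lra].
    assert (S1 : (B - PI * L) ^ 2 <= 2 * Ls * (4 * PI * c12) * eps).
    { assert (S : (B - PI * L) ^ 2 / L <= 4 * PI * (c12 * eps)).
      { apply Rabs_le_between in Babs.
        assert (4 * PI * (PI * Ls - c12 * eps) <= 4 * PI * B) by (apply Rmult_le_compat_l; lra).
        assert (4 * PI * (PI * Ls + d + c5 ^ 2 / (4 * PI * Ls) * eps ^ 2) <= 4 * PI * (PI * Ls + (2 * W2 + c7) * eps)).
        { apply Rmult_le_compat_l; [lra|]. unfold c7 in *. lra. }
        replace (4 * PI * (PI * Ls + d + c5 ^ 2 / (4 * PI * Ls) * eps ^ 2)) with (4 * PI * (PI * Ls + d) + c5 ^ 2 * eps ^ 2 / Ls) in H0 by (field; lra).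
        assert (Bl' : - (c9 * eps) <= B - PI * Ls) by (unfold c9; lra).
        assert (4 * PI * (PI * Ls - c9 * eps) <= 4 * PI * B) by (apply Rmult_le_compat_l; lra).
        unfold c12. lra. }
      replace ((B - PI * L) ^ 2) with ((B - PI * L) ^ 2 / L * L) by (field; lra).
      replace (2 * Ls * (4 * PI * c12) * eps) with (4 * PI * (c12 * eps) * (2 * Ls)) by ring.
      apply Rmult_le_compat; lra. }
    assert (S2 : (B - PI * Ls) ^ 2 <= c12 ^ 2 * eps).
    { rewrite <- pow2_abs. apply Rle_trans with ((c12 * eps) ^ 2); [apply pow_incr; split; [apply Rabs_pos|exact Babs]|].
      rewrite Rpow_mult_distr. apply Rmult_le_compat_l; pos. }
    unfold D2. apply Rmult_le_reg_l with (PI ^ 2); pos.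
    replace (PI ^ 2 * ((2 * (2 * Ls * (4 * PI * c12)) + 2 * c12 ^ 2) / PI ^ 2 * eps)) with
      (2 * (2 * Ls * (4 * PI * c12) * eps) + 2 * (c12 ^ 2 * eps)) by (field; lra).
    pose proof (pow2_ge_0 ((B - PI * L) + (B - PI * Ls))). lra.
  - assert (T1 : eps * cb - (c7 + 4 * k) / (2 * W2) * eps ^ 2 <= et * c).
    { apply Rmult_le_reg_l with (2 * W2); [lra|].
      replace (2 * W2 * (eps * cb - (c7 + 4 * k) / (2 * W2) * eps ^ 2)) with (2 * W2 * eps * cb - (c7 + 4 * k) * eps ^ 2) by (field; lra).
      assert (0 <= k * eps ^ 2) by pos. lra. }
    (* By the conserved closing [rho^2 = L / Ls]. This ratio is the source of the term
       [|L - Ls| / Ls] in the conclusion. *)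
    set (rho := eps / et). assert (rp : 0 < rho) by now apply Rdiv_lt_0_compat.
    assert (r2 : rho ^ 2 - 1 = (L - Ls) / Ls).
    { unfold rho. apply Rmult_eq_reg_l with (Ls * et ^ 2); [|apply Rgt_not_eq, Rmult_lt_0_compat; [lra|now apply pow_lt]].
      replace (Ls * et ^ 2 * ((eps / et) ^ 2 - 1)) with (Ls * eps ^ 2 - Ls * et ^ 2) by (field; lra). rewrite <- Het. field. lra. }
    assert (r1 : Rabs (rho - 1) <= Rabs (L - Ls) / Ls).
    { replace (Rabs (L - Ls) / Ls) with (Rabs (rho ^ 2 - 1)).
      - replace (rho ^ 2 - 1) with ((rho - 1) * (rho + 1)) by ring. rewrite Rabs_mult, (Rabs_pos_eq (rho + 1)) by lra.
        pose proof (Rmult_le_pos _ _ (Rabs_pos (rho - 1)) (Rlt_le _ _ rp)). lra.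
      - rewrite r2. unfold Rdiv. rewrite Rabs_mult, Rabs_inv, (Rabs_pos_eq Ls) by lra. reflexivity. }
    assert (T2 : rho * cb - D3 * eps <= c).
    { apply Rmult_le_reg_l with et; [lra|]. eapply Rle_trans; [|exact T1].
      replace (et * (rho * cb - D3 * eps)) with (eps * cb - D3 * eps * et) by (unfold rho; field; lra).
      assert (D3 * eps * (eps / 2) <= D3 * eps * et) by (apply Rmult_le_compat_l; [pos|lra]).
      replace ((c7 + 4 * k) / (2 * W2) * eps ^ 2) with (D3 * eps * (eps / 2)) by (unfold D3; field; lra). lra. }
    assert (T3 : Rabs ((rho - 1) * cb) <= Rabs (L - Ls) / Ls).
    { rewrite Rabs_mult. rewrite <- (Rmult_1_r (Rabs (L - Ls) / Ls)). apply Rmult_le_compat; pos.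
      apply Rabs_le_between; lra. }
    apply Rabs_le_between in T3. nra.
Qed.

Definition ppart (x : R) : R := Rmax 0 x.

Lemma ppart_sqr_derive (x : R) : is_derive (fun x => ppart x ^ 2) x (2 * ppart x).
Proof.
  destruct (Rtotal_order x 0) as [H|[->|H]].
  - apply (is_derive_ext_loc (fun _ => 0)).
    + exists (mkposreal (- x) ltac:(lra)). intros y Hy. ballR Hy.
      apply Rabs_def2 in Hy. unfold ppart. rewrite Rmax_left by lra. Rring.
    + unfold ppart. rewrite Rmax_left by lra. der.
  - apply (is_derive_of_quadratic _ _ _ 1). intros y _.
    unfold ppart. rewrite (Rmax_left 0 0) by lra. unfold Rmax. destruct Rle_dec; rewrite Rabs_pos_eq; nra.
  - apply (is_derive_ext_loc (fun x => x ^ 2)).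
    + exists (mkposreal x ltac:(lra)). intros y Hy. ballR Hy.
      apply Rabs_def2 in Hy. unfold ppart. rewrite Rmax_right by lra. reflexivity.
    + unfold ppart. rewrite Rmax_right by lra. der.
Qed.

(* [cos b] increases up to [c1]: while [cos b <= c2] the dissipation [D] controls [b'], so the Lyapunov function
   [(c2 - cos b)_+^2 + K E] decreases; [E] is bounded below, so [cos b] reaches [c2] and then stays above [c1] *)
Lemma descent (b b1 E e D : R -> R) (Cb e0 d0 Emin c1 c2 : R) :
  0 <= Cb -> 0 < e0 -> 0 < d0 -> c1 < c2 ->
  (forall t, 0 < t -> is_derive b t (b1 t)) -> (forall t, 0 < t -> b1 t ^ 2 <= Cb * D t) ->
  (forall t, 0 < t -> is_derive E t (- e t * D t)) -> (forall t, 0 < t -> e0 <= e t) -> (forall t, 0 < t -> 0 <= D t) ->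
  (forall t, 0 < t -> Emin <= E t) -> (forall t, 0 < t -> cos (b t) <= c2 -> d0 <= D t) ->
  exists t1, 0 < t1 /\ forall t, t1 <= t -> c1 <= cos (b t).
Proof.
  intros HCb He0 Hd0 Hc Db Hb DE He HD HEm Hdrive.
  set (M := sqrt (Cb / d0)). assert (M0 : 0 <= M) by apply sqrt_pos.
  assert (M2 : M ^ 2 = Cb / d0) by (unfold M; apply pow2_sqrt; apply Rmult_le_pos; [lra|pos]).
  assert (HbM : forall t, 0 < t -> d0 <= D t -> Rabs (b1 t) <= M * D t).
  { intros t Ht Hd. specialize (Hb t Ht). apply Rnot_lt_le. intros L.
    assert ((M * D t) ^ 2 < Rabs (b1 t) ^ 2).
    { assert (0 <= M * D t) by pos. apply Rmult_le_0_lt_compat; lra. }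
    rewrite pow2_abs, Rpow_mult_distr, M2 in H.
    assert (Cb * D t <= Cb / d0 * D t ^ 2); [|lra].
    replace (Cb / d0 * D t ^ 2) with (Cb * D t * (D t / d0)) by lra. rewrite <- (Rmult_1_r (Cb * D t)) at 1.
    apply Rmult_le_compat_l; pos. apply Rmult_le_reg_r with d0; [lra|]. replace (D t / d0 * d0) with (D t) by (field; lra). lra. }
  (* [s] bounds [c2 - cos b]. [K] is chosen so that the decrease of [K E], at least
     [(2 |s| M + 1) D], dominates the possible growth of the squared positive part. *)
  set (s := c2 + 1). set (K := (2 * Rabs s * M + 1) / e0).
  assert (K0 : 0 < K) by (unfold K; apply Rdiv_lt_0_compat; [|lra]; pose proof (Rmult_le_pos (2 * Rabs s) M ltac:(pose proof (Rabs_pos s); lra) M0); lra).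
  set (V := fun t => ppart (c2 - cos (b t)) ^ 2 + K * E t).
  set (V1 := fun t => 2 * ppart (c2 - cos (b t)) * (b1 t * sin (b t)) + K * (- e t * D t)).
  assert (DV : forall t, 0 < t -> is_derive V t (V1 t)).
  { intros t Ht. apply is_derive_Rplus; [|der].
    replace (2 * ppart (c2 - cos (b t)) * (b1 t * sin (b t))) with ((0 - b1 t * - sin (b t)) * (2 * ppart (c2 - cos (b t)))) by ring.
    apply (is_derive_comp (fun y => ppart y ^ 2) (fun t => c2 - cos (b t))); [apply ppart_sqr_derive|].
    der. }
  assert (Vneg : forall t, 0 < t -> V1 t <= 0).
  { intros t Ht. unfold V1. specialize (He t Ht). pose proof (HD t Ht) as D0.
    assert (Ke : K * (- e t * D t) <= - ((2 * Rabs s * M + 1) * D t)).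
    { replace (- ((2 * Rabs s * M + 1) * D t)) with (K * (- e0 * D t)) by (unfold K; field; lra).
      apply Rmult_le_compat_l; [lra|]. apply Rmult_le_compat_r; lra. }
    destruct (Rle_dec (c2 - cos (b t)) 0) as [N|N].
    - unfold ppart. rewrite Rmax_left by lra.
      assert (0 <= (2 * Rabs s * M + 1) * D t); [|lra]. pos.
    - unfold ppart. rewrite Rmax_right by lra.
      specialize (HbM t Ht (Hdrive t Ht ltac:(lra))). pose proof (COS_bound (b t)).
      assert (X : Rabs (2 * (c2 - cos (b t)) * (b1 t * sin (b t))) <= 2 * Rabs s * (M * D t)).
      { rewrite !Rabs_mult, (Rabs_pos_eq 2) by lra. apply Rmult_le_compat.
        - apply Rmult_le_pos; pos.
        - apply Rmult_le_pos; apply Rabs_pos.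
        - apply Rmult_le_compat_l; [lra|]. rewrite Rabs_pos_eq by lra. unfold s. eapply Rle_trans; [|apply Rle_abs]. lra.
        - rewrite <- (Rmult_1_r (M * D t)). apply Rmult_le_compat; [pos|pos|lra|apply Rabs_le_between, SIN_bound]. }
      apply Rabs_le_between in X. lra. }
  assert (mono : forall (f f1 : R -> R), (forall t, 0 < t -> is_derive f t (f1 t)) -> (forall t, 0 < t -> f1 t <= 0) ->
    forall x y, 0 < x -> x <= y -> f y <= f x).
  { intros f f1 Df Nf x y Hx Hxy. apply (nonincreasing_of_derive f f1 x y Hxy).
    - intros z Hz. eapply continuous_of_derive, Df. lra.
    - split; [apply Df; lra|apply Nf; lra]. }
  assert (Em : forall x y, 0 < x -> x <= y -> E y <= E x).
  { apply (mono E (fun t => - e t * D t) DE). intros t Ht. specialize (He t Ht). specialize (HD t Ht). nra. }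
  destruct (completeness (fun y => exists t, 0 < t /\ y = - E t)) as [m [Hm1 Hm2]].
  { exists (- Emin). intros y [t [Ht ->]]. specialize (HEm t Ht). lra. }
  { exists (- E 1), 1. lra. }
  (* Once [E] is within [eta] of its infimum [- m], the term [K E] can fall by at most
     [(c2 - c1)^2], so the squared positive part cannot grow beyond that. *)
  set (eta := (c2 - c1) ^ 2 / K). assert (eta0 : 0 < eta) by (apply Rdiv_lt_0_compat; [pos|exact K0]).
  assert (T1 : exists ts, 0 < ts /\ E ts < - m + eta).
  { destruct (classic (exists ts, 0 < ts /\ E ts < - m + eta)) as [X|X]; [exact X|].
    assert (m <= m - eta); [|lra]. apply Hm2. intros y [t [Ht ->]].
    destruct (Rlt_dec (E t) (- m + eta)) as [Y|Y]; [exfalso; apply X; now exists t|lra]. }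
  destruct T1 as [ts [ts0 Hts]].
  assert (T2 : exists t2, ts <= t2 /\ c2 <= cos (b t2)).
  { destruct (classic (exists t2, ts <= t2 /\ c2 <= cos (b t2))) as [X|X]; [exact X|].
    assert (Y : forall t, ts <= t -> E t + e0 * d0 * t <= E ts + e0 * d0 * ts).
    { intros t Ht. apply (nonincreasing_of_derive (fun t => E t + e0 * d0 * t) (fun t => - e t * D t + e0 * d0) ts t Ht).
      - intros z Hz. apply (continuous_Rplus_c E (fun t => e0 * d0 * t)); [eapply continuous_of_derive, DE; lra|].
        cnt.
      - intros z Hz. split.
        + apply (is_derive_Rplus E (fun t => e0 * d0 * t)); [apply DE; lra|]. der.
        + assert (d0 <= D z). { apply Hdrive; [lra|]. destruct (Rle_dec (cos (b z)) c2) as [Q|Q]; [exact Q|]. exfalso; apply X; exists z; lra. }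
          specialize (He z ltac:(lra)). nra. }
    pose proof (HEm ts ts0) as h1. set (t := ts + (E ts - Emin + 1) / (e0 * d0)).
    assert (ht : ts <= t) by (unfold t; assert (0 <= (E ts - Emin + 1) / (e0 * d0)) by (apply Rmult_le_pos; [lra|pos]); lra).
    specialize (Y t ht). pose proof (HEm t ltac:(lra)).
    replace (e0 * d0 * t) with (e0 * d0 * ts + (E ts - Emin + 1)) in Y by (unfold t; field; lra). lra. }
  destruct T2 as [t2 [Ht2 Hc2]]. exists t2. split; [lra|]. intros t Ht.
  pose proof (mono V V1 DV Vneg t2 t ltac:(lra) Ht) as HV. unfold V in HV.
  assert (Z : ppart (c2 - cos (b t2)) = 0) by (unfold ppart; apply Rmax_left; lra). rewrite Z in HV.
  assert (Et2 : E t2 <= E ts) by auto.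
  assert (Et : - m <= E t) by (specialize (Hm1 (- E t) ltac:(exists t; split; [lra|lra])); lra).
  apply Rnot_lt_le. intros L.
  assert (P : ppart (c2 - cos (b t)) = c2 - cos (b t)) by (unfold ppart; apply Rmax_right; lra). rewrite P in HV.
  assert (Q : (c2 - c1) ^ 2 < (c2 - cos (b t)) ^ 2) by (simpl; rewrite !Rmult_1_r; apply Rmult_le_0_lt_compat; lra).
  assert (KE : K * (E t2 - E t) <= (c2 - c1) ^ 2).
  { apply Rle_trans with (K * eta); [apply Rmult_le_compat_l; lra|]. unfold eta. right. field. lra. }
  lra.
Qed.

(** * The global flow *)

Lemma small_pos (l : list R) : (forall x, In x l -> 0 < x) -> exists e, 0 < e /\ forall x, In x l -> e <= x.
Proof.
  induction l as [|y l IH]; intros H.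
  - exists 1. split; [lra|intros x []].
  - destruct IH as [e [He Hl]]; [intros x Hx; apply H; now right|].
    exists (Rmin y e). split; [apply Rmin_pos; [apply H; now left|exact He]|].
    intros x [<-|Hx]; [apply Rmin_l|]. eapply Rle_trans; [apply Rmin_r|auto].
Qed.

Lemma opn_interval (x y : R) : opn (fun t => x < t < y).
Proof. intros t Ht. apply open_and; [apply open_gt|apply open_lt|exact Ht]. Qed.

Lemma opn_pos : opn (fun t => 0 < t).
Proof. now apply open_gt. Qed.

Section Trapping.
Context {Th Th1 : R -> R} {W2 Ls th0 : R}.
Hypothesis TD : teardrop Th Th1 W2 Ls th0.

Let cTh := Th_cont TD.
Let cTh1 := Th1_cont TD.

Notation gp a t := (gap Th1 (fun x => Aj a 1 x t)).

Lemma coef_even (f : R -> R) (n : Z) : coef f (- n)%Z = coef f n.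
Proof. unfold coef. f_equal. apply RInt_ext. intros x _. rewrite opp_IZR, Ropp_mult_distr_l_reverse, cos_neg. reflexivity. Qed.

(** The difference is a cosine coefficient of [dev], because the constant [b] does not contribute
    for [n <> 0]; the sup bound on [dev] applies. This turns energy control into control of single
    modes. *)
Lemma mode_near {P : R -> Prop} {a : Z -> R -> R} {L : R -> R} {T0 A : R} (t : R) (n : Z) : base_flow P a L T0 A -> n <> 0%Z ->
  Rabs (a n t - coef Th n) <= sqrt (PI * gp a t).
Proof.
  intros BF Hn. pose proof PI_RGT_0 as pi0.
  pose proof (slice_d BF t) as D. pose proof (slice_c BF t) as C.
  pose proof (slice_mean BF t) as M.
  set (g := gp a t) in *. set (b := a 0%Z t) in *.
  pose proof (dev_c TD (fun x => Aj a 0 x t) (fun x => Aj a 1 x t) b D) as Cd.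
  assert (N0 : IZR n <> 0) by now apply not_0_IZR.
  assert (Z : RInt (fun x => cos (IZR n * x)) 0 PI = 0).
  { rewrite (RInt_exact (fun x => / IZR n * sin (IZR n * x)) (fun x => cos (IZR n * x))).
    - rewrite Rmult_0_r, sin_0, (sin_eq_0_1 (IZR n * PI)) by (now exists n). Rring.
    - der. field. exact N0.
    - cnt. }
  assert (E : a n t - coef Th n = / PI * RInt (fun x => dev Th (fun x => Aj a 0 x t) b x * cos (IZR n * x)) 0 PI).
  { pose proof (coef_int BF t n) as I. unfold coef.
    rewrite (RInt_ext (fun x => Aj a 0 x t * cos (IZR n * x)) (fun x => dev Th (fun x => Aj a 0 x t) b x * cos (IZR n * x) + (b * cos (IZR n * x) + Th x * cos (IZR n * x)))) in I
      by (intros x _; unfold dev; Rring).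
    revert I. rlin. rewrite Z. intros I. apply Rmult_eq_reg_l with PI; [|lra]. rewrite Rmult_minus_distr_l, <- I. Rfield. lra.
  }
  rewrite E, Rabs_mult, Rabs_pos_eq by pos.
  apply Rmult_le_reg_l with PI; [lra|]. rewrite <- Rmult_assoc, Rinv_r, Rmult_1_l by lra.
  eapply Rle_trans; [apply (RInt_sup_le (fun x => dev Th (fun x => Aj a 0 x t) b x * cos (IZR n * x)) 0 PI (sqrt (PI * g))); [lra|cnt|]|lra].
  intros x Hx. le_via Rabs_mult_cos. exact (dev_abs TD _ _ b D C M x Hx).
Qed.

(** The last clause is the one-sided trap: [cos] of the mean angle never drops much below its
    initial value, which prevents a passage through [PI]. *)
Definition trapped (eps r1 D b : R) (a : Z -> R -> R) (L : R -> R) (t : R) : Prop :=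
  gp a t <= r1 /\ Ls / 2 <= L t <= 2 * Ls /\ sqrt (L t) * Xf a PI t = sqrt Ls * eps /\ Yf a PI t = 0 /\
  eps / 2 <= Xf a PI t <= 2 * eps /\ (L t - Ls) ^ 2 <= D * eps /\ cos b - Rabs (L t - Ls) / Ls - D * eps <= cos (a 0%Z t).

Lemma trapped_flow (b0 r1 : R) : 0 < r1 -> exists D e2, 0 < D /\ 0 < e2 <= 1 /\ forall eps, 0 < eps <= e2 ->
  exists a L T0 A b, base_flow (fun t => 0 < t) a L T0 A /\ Rabs (b - b0) <= D * eps /\ a 0%Z 0 = b /\
    forall t, 0 <= t -> trapped eps r1 D b a L t.
Proof.
  intros Hr1. pose proof PI_RGT_0 as pi0. pose proof (td_W2 TD) as W0. pose proof (td_Ls TD) as L0.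
  destruct (initial_data TD b0) as [K [C [e1 [K0 [C0 [[e1p e11] Init]]]]]].
  destruct (coef_id TD) as [Ka [Ka0 HKa]].
  destruct (energy_near TD) as [r0 [C1 [C2 [r0p [C1p [C2p EN]]]]]].
  destruct (closeness W2 Ls C C1 C2 W0 L0 C0 C1p C2p) as [D [D0 Close]].
  (* Twice this sum covers the initial coefficients with the margin [KK / 2]. The other factor two
     compensates the loss of at most one half in the exponential on the low modes. *)
  set (KK := 4 * (K + Ka + 1)). assert (KK0 : 0 < KK) by (unfold KK; lra).
  (* [M] exceeds the threshold above which parabolic smoothing alone keeps a mode below the
     level. *)
  set (M := Rabs (8 * kN KK (2 * Ls) / KK) + 1). assert (M1 : 1 <= M) by (unfold M; pose proof (Rabs_pos (8 * kN KK (2 * Ls) / KK)); lra).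
  (* Stops the growth of the analyticity strip early enough that the exponential stays above one
     half for [|n| <= M]. *)
  set (T0 := / (2 * M)). assert (T0p : 0 < T0) by (apply Rinv_0_lt_compat; lra).
  assert (T0M : T0 * M = / 2) by (unfold T0; field; lra).
  set (wM := (/ (1 + M ^ 2)) ^ 2). assert (wMp : 0 < wM) by (apply pow_lt, Rinv_0_lt_compat; pose proof (pow2_ge_0 M); lra).
  (* In turn: validity of [energy_near], the closeness requested by the caller, the range of [L],
     and smallness of the low modes relative to [w^2]. *)
  destruct (small_pos (r0 :: r1 :: (Ls / 2) ^ 2 :: wM ^ 2 / PI :: nil)) as [r [rp Hr]].
  { assert (0 < (Ls / 2) ^ 2) by pos. assert (0 < wM ^ 2 / PI) by pos.
    intros x [<-|[<-|[<-|[<-|[]]]]]; assumption. }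
  assert (rr0 : r <= r0) by (apply Hr; simpl; auto). assert (rr1 : r <= r1) by (apply Hr; simpl; auto).
  assert (rL : r <= (Ls / 2) ^ 2) by (apply Hr; simpl; auto). assert (rw : r <= wM ^ 2 / PI) by (apply Hr; simpl; auto).
  destruct (small_pos (e1 :: r / 2 / C :: r / 4 / D :: nil)) as [e2 [e2p He2]].
  { assert (0 < r / 2 / C) by pos. assert (0 < r / 4 / D) by pos.
    intros x [<-|[<-|[<-|[]]]]; assumption. }
  assert (ee1 : e2 <= e1) by (apply He2; simpl; auto). assert (eC : e2 <= r / 2 / C) by (apply He2; simpl; auto).
  assert (eD : e2 <= r / 4 / D) by (apply He2; simpl; auto).
  exists (C + D), e2. split; [lra|]. split; [lra|]. intros eps [e0 He].
  assert (CR : C * eps <= r / 2) by (apply Rle_trans with (C * (r / 2 / C)); [apply Rmult_le_compat_l; lra|right; field; lra]).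
  assert (DR : D * eps <= r / 4) by (apply Rle_trans with (D * (r / 4 / D)); [apply Rmult_le_compat_l; lra|right; field; lra]).
  destruct (Init eps ltac:(lra)) as [ti [qi [b [Dti [Cqi [Hco [Hmi [Hci [Hsi [Hbi [Hgi Hei]]]]]]]]]]].
  assert (Cti : forall x, continuous ti x) by cnt.
  destruct (truncated_flow KK T0 (Ls / 2) (2 * Ls) Ls (coef ti)) as [a [L [Ca [CL [Ev [a0 [L00 [[A [A0 Dec]] [High Ode]]]]]]]]]; [lra|lra|lra|lra|apply coef_even| |].
  { intros n Hn. eapply Rle_trans; auto. apply Rmult_le_compat_r; [pos|unfold KK; lra]. }
  assert (BFP : forall P, opn P -> (forall t, P t -> 0 < t) -> (forall n t, P t -> is_derive (a n) t (- (n4 n) * a n t + Nc (fun n => a n t) (L t) n)) ->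
    (forall t, P t -> is_derive L t (-2 * L t * Pc (fun n => a n t) (L t) 0)) -> base_flow P a L T0 A) by (intros; constructor; assumption).
  (* With the empty time set, all facts at a fixed time and the continuity in time are available
     before the equations are known to hold. *)
  assert (BF : base_flow (fun _ => False) a L T0 A) by (apply BFP; [intros t []|intros; contradiction..]).
  assert (ini : forall x, 0 < x < PI -> Aj a 0 x 0 = ti x /\ Aj a 1 x 0 = qi x).
  { assert (E : forall x, 0 < x < PI -> Aj a 0 x 0 = ti x).
    { apply cos_coef_unique.
      - intros x. eapply continuous_of_derive, (slice_d BF 0).
      - exact Cti.
      - etransitivity; [apply (coef_int BF 0 n)|]. rewrite a0. unfold coef. Rfield. lra. }
    intros x Hx. split; [auto|].
    apply (is_derive_inj ti x); [|auto]. apply (is_derive_ext_loc (fun x => Aj a 0 x 0)); [|apply (slice_d BF 0)].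
    destruct (opn_interval 0 PI x Hx) as [d Hd]. exists d. auto. }
  assert (mm : Rmin 0 PI = 0 /\ Rmax 0 PI = PI) by (rewrite Rmin_left, Rmax_right; lra). destruct mm as [mm1 mm2].
  assert (X0 : Xf a PI 0 = eps).
  { unfold Xf. rewrite (RInt_ext _ (fun x => cos (ti x))); [lra|]. intros x Hx. rewrite mm1, mm2 in Hx. now rewrite (proj1 (ini x Hx)). }
  assert (Y0 : Yf a PI 0 = 0).
  { unfold Yf. rewrite (RInt_ext _ (fun x => sin (ti x))); [lra|]. intros x Hx. rewrite mm1, mm2 in Hx. now rewrite (proj1 (ini x Hx)). }
  assert (B0 : Bf a 0 = RInt (fun x => qi x ^ 2) 0 PI).
  { apply RInt_ext. intros x Hx. rewrite mm1, mm2 in Hx. now rewrite (proj2 (ini x Hx)). }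
  assert (G0 : gp a 0 = gap Th1 qi).
  { apply RInt_ext. intros x Hx. rewrite mm1, mm2 in Hx. now rewrite (proj2 (ini x Hx)). }
  assert (b0E : a 0%Z 0 = b).
  { rewrite a0. unfold coef. rewrite (RInt_ext _ ti); [rewrite Hmi; field; lra|]. intros x _. rewrite Rmult_0_l, cos_0. Rring. }
  set (f := fun t => gp a t + (L t - Ls) ^ 2).
  assert (gp0 : forall t, 0 <= gp a t) by (intros t; apply (gap_nonneg TD), (slice_c BF t)).
  assert (Lb : forall t, f t <= r -> gp a t <= r /\ Ls / 2 <= L t <= 2 * Ls).
  { intros t Hf. unfold f in Hf. pose proof (gp0 t). pose proof (pow2_ge_0 (L t - Ls)).
    assert (Rabs (L t - Ls) <= Ls / 2); [|apply Rabs_le_between in H1; lra].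
    apply Rnot_lt_le. intros G. assert ((Ls / 2) ^ 2 < Rabs (L t - Ls) ^ 2) by (simpl; rewrite !Rmult_1_r; apply Rmult_le_0_lt_compat; lra).
    rewrite pow2_abs in H1. lra. }
  assert (Unc : forall t, 0 <= t -> f t <= r -> Wb2 KK (Rmin t T0) (fun n => a n t)).
  { intros t Ht Hf n Hn. destruct (Rle_dec (8 * kN KK (2 * Ls) / KK) (Rabs (IZR n))) as [Hi|Lo]; auto.
    assert (nM : Rabs (IZR n) <= M) by (unfold M; pose proof (Rle_abs (8 * kN KK (2 * Ls) / KK)); lra).
    assert (m0 : 0 <= Rmin t T0) by (apply Rmin_glb; lra).
    assert (hf : / 2 <= exp (- (Rmin t T0 * Rabs (IZR n)))).
    { eapply Rle_trans; [|apply exp_ineq1_le]. assert (Rmin t T0 * Rabs (IZR n) <= / 2); [|lra].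
      rewrite <- T0M. apply Rmult_le_compat; [exact m0|pos|apply Rmin_r|exact nM]. }
    assert (wn : wM <= w n ^ 2).
    { apply pow_incr. split; pos.
      apply Rinv_le_contravar; pos. rewrite <- (pow2_abs (IZR n)).
      apply Rplus_le_compat_l, pow_incr. split; pos. }
    pose proof (mode_near t n BF Hn) as Mn.
    assert (sq : sqrt (PI * gp a t) <= wM).
    { rewrite <- (sqrt_pow2 wM) by lra. apply sqrt_le_1_alt. apply Rle_trans with (PI * (wM ^ 2 / PI)); [|right; field; lra].
      apply Rmult_le_compat_l; [lra|]. destruct (Lb t Hf). lra. }
    replace (a n t) with (coef Th n + (a n t - coef Th n)) by ring. le_via Rabs_triang.
    specialize (HKa n Hn).
    apply Rle_trans with (KK * w n ^ 2 * / 2); [|apply Rmult_le_compat_l; [apply Rmult_le_pos; lra|exact hf]].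
    unfold KK. assert (0 <= K * w n ^ 2) by pos. assert (0 <= Ka * w n ^ 2) by pos. lra. }
  assert (f0 : f 0 <= r / 2).
  { unfold f. nra. }
  (* Inactivity of the truncation on the closed interval gives the equations inside it. The two
     resulting bounds [D eps <= r / 4] add up to the [r / 2] needed by the barrier. *)
  assert (Step : forall t, 0 <= t -> (forall s, 0 <= s <= t -> f s <= r) ->
    gp a t <= D * eps /\ (L t - Ls) ^ 2 <= D * eps /\ cos b - Rabs (L t - Ls) / Ls - D * eps <= cos (a 0%Z t) /\
    eps / 2 <= Xf a PI t <= 2 * eps /\ sqrt (L t) * Xf a PI t = sqrt Ls * eps /\ Yf a PI t = 0).
  { intros t Ht Hs.
    assert (OdeP : forall s, 0 < s < t -> (forall n, is_derive (a n) s (- (n4 n) * a n s + Nc (fun n => a n s) (L s) n)) /\ is_derive L s (-2 * L s * Pc (fun n => a n s) (L s) 0)).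
    { intros s Hst. apply Ode; [lra|apply Unc; [lra|apply Hs; lra]|apply Lb, Hs; lra]. }
    assert (HLp : forall s, 0 <= s <= t -> 0 < L s) by (intros s Hst; destruct (Lb s (Hs s Hst)); lra).
    assert (BFt : base_flow (fun s => 0 < s < t) a L T0 A) by (apply BFP; [apply opn_interval|pos|intros n s Hst; now apply OdeP|intros s Hst; now apply OdeP]).
    pose proof (energy_mono BFt t Ht ltac:(auto) HLp) as EM. destruct (closing_conserved BFt t Ht ltac:(auto) HLp) as [XC YC].
    rewrite L00, X0 in XC. rewrite Y0, Rmult_0_r in YC.
    assert (Ltp : 0 < L t) by (apply HLp; lra). pose proof (sqrt_lt_R0 _ Ltp) as sLt.
    assert (Yt : Yf a PI t = 0) by (apply Rmult_integral in YC; destruct YC; [lra|lra]).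
    assert (Xt0 : 0 < Xf a PI t).
    { apply Rmult_lt_reg_l with (sqrt (L t)); [lra|]. rewrite Rmult_0_r, XC. pos. }
    assert (Xt2 : L t * Xf a PI t ^ 2 = Ls * eps ^ 2).
    { assert (E : (sqrt (L t) * Xf a PI t) ^ 2 = (sqrt Ls * eps) ^ 2) by now rewrite XC.
      rewrite !Rpow_mult_distr, !pow2_sqrt in E by lra. exact E. }
    pose proof (slice_d BF t) as Dt. pose proof (slice_c BF t) as Ct. pose proof (slice_mean BF t) as Mt.
    pose proof (EN (fun x => Aj a 0 x t) (fun x => Aj a 1 x t) (a 0%Z t) (Xf a PI t) Dt Ct Mt eq_refl Yt ltac:(destruct (Lb t (Hs t ltac:(lra))); lra)) as ENt.
    pose proof (EN ti qi b eps Dti Cqi Hmi Hci Hsi ltac:(rewrite <- G0; destruct (Lb 0 (Hs 0 ltac:(lra))); lra)) as EN0.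
    pose proof (gap_nonneg TD qi Cqi) as gi0.
    unfold E2 in EM. rewrite L00, B0 in EM.
    destruct (Close eps (RInt (fun x => qi x ^ 2) 0 PI) (Bf a t) (L t) (gp a t) (cos b) (cos (a 0%Z t)) (Xf a PI t)) as [R1 [R2 [R3 [R4 R5]]]];
      [lra|lra|lra|apply COS_bound|apply COS_bound|apply Lb, Hs; lra|exact EM|lra|lra|auto|auto|].
    lra. }
  assert (Barrier : forall t, 0 <= t -> f t <= r).
  { intros t Ht. apply (continuous_barrier f r t rp Ht); [|exact f0| |lra].
    - intros s _. apply continuous_Rplus_c.
      + apply (gap_time BF Th1 s cTh1).
      + cnt.
    - intros s Hs H. destruct (Step s ltac:(lra) H) as [R1 [R2 _]]. unfold f. lra. }
  exists a, L, T0, A, b. split; [|split; [|split]].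
  - assert (OdeP : forall s, 0 < s -> (forall n, is_derive (a n) s (- (n4 n) * a n s + Nc (fun n => a n s) (L s) n)) /\ is_derive L s (-2 * L s * Pc (fun n => a n s) (L s) 0)).
    { intros s Hst. apply Ode; [lra|apply Unc; [lra|apply Barrier; lra]|apply Lb, Barrier; lra]. }
    apply BFP; [exact opn_pos|auto|intros n s Hs; now apply OdeP|intros s Hs; now apply OdeP].
  - eapply Rle_trans; [exact Hbi|]. apply Rmult_le_compat_r; lra.
  - exact b0E.
  - intros t Ht. destruct (Step t Ht ltac:(intros; apply Barrier; lra)) as [R1 [R2 [R3 [R4 [R5 R6]]]]].
    destruct (Lb t (Barrier t Ht)) as [G1 G2]. assert (0 <= C * eps) by pos.
    repeat split; try lra.
Qed.

(** [k] is the tolerance of [sign_of_height]: half of it is spent on the deviation from the rotated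
    teardrop, half on the distance of the mean angle from [PI] at the start and from [0] at the
    end. *)
Lemma global_flow : exists c, 0 < c /\ forall eps, 0 < eps <= c ->
  exists a L T0 A, base_flow (fun t => 0 < t) a L T0 A /\
    (forall t, 0 <= t -> Ls / 2 <= L t <= 2 * Ls /\ sqrt (L t) * Xf a PI t = sqrt Ls * eps /\ Yf a PI t = 0) /\
    (exists s0, 0 < s0 /\ forall t, 0 <= t <= s0 -> forall x, 0 < x < PI -> 0 < Yf a x t) /\
    (exists s1, 0 < s1 /\ forall t, s1 <= t -> forall x, 0 < x < PI -> Yf a x t < 0).
Proof.
  pose proof PI2_1 as pi2. pose proof (td_Ls TD) as L0.
  destruct (sign_of_height TD) as [k [[k0 k1] Sign]].
  assert (sk : 0 < sin (k / 8)) by (apply sin_gt_0; lra).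
  destruct (drive TD (sin (k / 8)) sk) as [rd [cd [rd0 [cd0 Drive]]]].
  set (r1 := Rmin rd ((k / 2) ^ 2 / PI)).
  assert (kk : 0 < (k / 2) ^ 2 / PI) by pos.
  (* Close enough to [PI] for the curve to lie above the axis, yet off it: the initial cosine
     [- cos (k / 4)] exceeds the barrier [- cos (k / 8)] by [g0], which pays for the errors in the
     trap. *)
  destruct (trapped_flow (PI - k / 4) r1) as [D [e2 [D0 [[e20 e21] Trap]]]]; [now apply Rmin_pos|].
  set (g0 := cos (k / 8) - cos (k / 4)).
  assert (g0p : 0 < g0) by (unfold g0; assert (cos (k / 4) < cos (k / 8)) by (apply cos_decreasing_1; lra); lra).
  destruct (small_pos (e2 :: g0 / 4 / D :: (Ls * g0 / 4) ^ 2 / D :: k / 16 / D :: / 2 :: nil)) as [c [c0 Hc]].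
  { assert (0 < g0 / 4 / D) by pos.
    assert (0 < (Ls * g0 / 4) ^ 2 / D) by pos.
    assert (0 < k / 16 / D) by pos.
    intros x [<-|[<-|[<-|[<-|[<-|[]]]]]]; lra. }
  exists c. split; [exact c0|]. intros eps [e0 He].
  assert (E2' : eps <= e2) by (eapply Rle_trans; [exact He|apply Hc; simpl; auto]).
  assert (Eh : eps <= / 2) by (eapply Rle_trans; [exact He|apply Hc; simpl; auto 10]).
  assert (DE : forall y, In (y / D) (e2 :: g0 / 4 / D :: (Ls * g0 / 4) ^ 2 / D :: k / 16 / D :: / 2 :: nil) -> D * eps <= y).
  { intros y Hy. apply Rle_trans with (D * (y / D)); [|right; field; lra]. apply Rmult_le_compat_l; [lra|]. eapply Rle_trans; [exact He|auto]. }
  assert (D1 : D * eps <= g0 / 4) by (apply DE; simpl; auto).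
  assert (D2 : D * eps <= (Ls * g0 / 4) ^ 2) by (apply DE; simpl; auto).
  assert (D3 : D * eps <= k / 16) by (apply DE; simpl; auto).
  destruct (Trap eps ltac:(lra)) as [a [L [T0 [A [b [BF [Hb [b0E HT]]]]]]]].
  destruct BF as [Po Pp T0p A0 Ca CL Ev Dec ODE LODE] eqn:EBF.
  exists a, L, T0, A. split; [exact BF|]. split.
  { intros t Ht. destruct (HT t Ht) as [_ [H1 [H2 [H3 _]]]]. auto. }
  apply Rabs_le_between in Hb.
  assert (cosb : - cos (k / 4) - D * eps <= cos b).
  { assert (Q : Rabs (cos b - cos (PI - k / 4)) <= D * eps).
    { rewrite <- (sin_shift b), <- (sin_shift (PI - k / 4)). le_via sin_lip.
      apply Rabs_le_between. lra. }
    rewrite <- (cos_neg (PI - k / 4)) in Q. replace (- (PI - k / 4)) with (k / 4 - PI) in Q by ring.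
    assert (cos (k / 4 - PI) = - cos (k / 4)) by (rewrite cos_minus, cos_PI, sin_PI; ring). apply Rabs_le_between in Q. lra. }
  assert (cosB : forall t, 0 <= t -> - cos (k / 8) < cos (a 0%Z t)).
  { intros t Ht. destruct (HT t Ht) as [_ [_ [_ [_ [_ [HL Hcs]]]]]].
    assert (Rabs (L t - Ls) <= Ls * g0 / 4).
    { apply Rnot_lt_le. intros G. assert (Lg : 0 <= Ls * g0 / 4) by pos.
      assert ((Ls * g0 / 4) ^ 2 < Rabs (L t - Ls) ^ 2) by (simpl; rewrite !Rmult_1_r; apply Rmult_le_0_lt_compat; lra).
      rewrite pow2_abs in H. lra. }
    assert (Rabs (L t - Ls) / Ls <= g0 / 4).
    { apply Rmult_le_reg_r with Ls; [lra|]. replace (Rabs (L t - Ls) / Ls * Ls) with (Rabs (L t - Ls)) by (field; lra). lra. }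
    unfold g0 in *. lra. }
  assert (cpi : cos (PI - k / 8) = - cos (k / 8)).
  { rewrite cos_minus, cos_PI, sin_PI. ring. }
  (* By continuity the mean angle cannot cross [PI - k / 8] or its opposite. This removes the
     ambiguity modulo [2 PI] when its cosine is close to one. *)
  assert (Bnd : forall t, 0 <= t -> - (PI - k / 8) < a 0%Z t < PI - k / 8).
  { intros t Ht. split; apply Rnot_le_lt; intros G.
    - destruct (IVT_value (fun t => - a 0%Z t) 0 t (PI - k / 8) Ht) as [z [Hz Ez]].
      + cnt.
      + lra.
      + pose proof (cosB z ltac:(lra)) as Q. rewrite <- (cos_neg (a 0%Z z)), Ez, cpi in Q. lra.
    - destruct (IVT_value (a 0%Z) 0 t (PI - k / 8) Ht) as [z [Hz Ez]].
      + cnt.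
      + lra.
      + pose proof (cosB z ltac:(lra)) as Q. rewrite Ez, cpi in Q. lra. }
  assert (Dth := fun t => slice_d BF t). assert (Cq := fun t => slice_c BF t).
  assert (Mth := fun t => slice_mean BF t).
  assert (Cth : forall t x, continuous (fun x => Aj a 0 x t) x) by (intros; eapply continuous_of_derive, Dth).
  assert (Dev : forall t, 0 <= t -> forall x, 0 <= x <= PI -> Rabs (dev Th (fun x => Aj a 0 x t) (a 0%Z t) x) <= k / 2).
  { intros t Ht x Hx. eapply Rle_trans; [exact (dev_abs TD _ _ _ (Dth t) (Cq t) (Mth t) x Hx)|].
    rewrite <- (sqrt_pow2 (k / 2)) by lra. apply sqrt_le_1_alt. destruct (HT t Ht) as [G _].
    apply Rle_trans with (PI * ((k / 2) ^ 2 / PI)); [|right; field; lra]. apply Rmult_le_compat_l; [lra|].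
    eapply Rle_trans; [exact G|apply Rmin_r]. }
  split.
  - pose proof (Ca 0%Z 0) as C0. assert (k16 : 0 < k / 16) by lra.
    destruct (proj1 (filterlim_locally _ _) C0 (mkposreal _ k16)) as [d Hd]. exists (d / 2). pose proof (cond_pos d). split; [lra|].
    intros t Ht x Hx.
    assert (Bt : Rabs (a 0%Z t - b) < k / 16).
    { rewrite b0E in Hd. apply Hd. change (Rabs (t - 0) < d). rewrite Rminus_0_r, Rabs_pos_eq; lra. }
    apply Rabs_def2 in Bt.
    (* Rotation by [PI] reverses the height, so the negative sign for the shifted angle is the
       positive sign wanted. *)
    pose proof (Sign (fun x => Aj a 0 x t - PI)) as S.
    assert (neg : forall y, RInt (fun x => sin (Aj a 0 x t - PI)) 0 y = - Yf a y t).
    { intros y. unfold Yf. rewrite (RInt_ext _ (fun x => (-1) * sin (Aj a 0 x t))) by (intros; rewrite sin_minus, cos_PI, sin_PI; Rring).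
      rlin. Rring. }
    destruct (HT t ltac:(lra)) as [_ [_ [_ [Yt _]]]].
    assert (RInt (fun x => sin (Aj a 0 x t - PI)) 0 x < 0); [|rewrite neg in H0; lra].
    apply S; [| | |exact Hx].
    + cnt.
    + intros y Hy. replace (Aj a 0 y t - PI - Th y) with (dev Th (fun x => Aj a 0 x t) (a 0%Z t) y + (a 0%Z t - PI)) by (unfold dev; ring).
      le_via Rabs_triang. pose proof (Dev t ltac:(lra) y Hy).
      assert (Rabs (a 0%Z t - PI) <= k / 2) by (apply Rabs_le_between; lra). lra.
    + rewrite neg, Yt. Rring.
  (* The speed constant uses [4 PI B <= E2 <= E2 0]. The rate [2 PI] is a lower bound of
     [2 (B + PI L) / L]. The dissipation threshold is [drive] with opening at least [eps / 2],
     squared by Cauchy-Schwarz. *)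
  - destruct (descent (a 0%Z) (fun t => / PI * RInt (fun x => Sf a L x t * Aj a 1 x t) 0 PI) (E2 a L) (fun t => 2 * (Bf a t + PI * L t) / L t) (Df a L)
      (4 / PI * (E2 a L 0 / (4 * PI)) ^ 2) (2 * PI) ((cd * (eps / 2)) ^ 2 / PI) 0 (cos (k / 2)) (cos (k / 4))) as [s1 [s10 Hs1]].
    + apply Rmult_le_pos; pos.
    + lra.
    + apply Rdiv_lt_0_compat; pos.
    + apply cos_decreasing_1; lra.
    + now apply (mean_derive BF).
    + intros t Ht. le_via (mean_speed BF t Ht).
      apply Rmult_le_compat_r; [apply (Df_nonneg BF t Ht)|].
      apply Rmult_le_compat_l; pos. apply pow_incr.
      split; [apply (Bf_nonneg BF)|].
      assert (EM : E2 a L t <= E2 a L 0).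
      { apply (energy_mono BF t); [lra|pos|].
        intros s Hs. destruct (HT s ltac:(lra)) as [_ [G _]]. lra. }
      assert (Lt : 0 < L t) by (destruct (HT t ltac:(lra)) as [_ [G _]]; lra).
      apply Rmult_le_reg_l with (4 * PI); [lra|]. replace (4 * PI * (E2 a L 0 / (4 * PI))) with (E2 a L 0) by (field; lra).
      eapply Rle_trans; [|exact EM]. unfold E2. replace ((Bf a t + PI * L t) ^ 2 / L t) with (4 * PI * Bf a t + (Bf a t - PI * L t) ^ 2 / L t) by (field; lra).
      assert (0 <= (Bf a t - PI * L t) ^ 2 / L t) by pos. lra.
    + intros t Ht. assert (Lt : 0 < L t) by (destruct (HT t ltac:(lra)) as [_ [G _]]; lra).
      exact (energy_derive BF t Ht Lt).
    + intros t Ht. assert (Lt : 0 < L t) by (destruct (HT t ltac:(lra)) as [_ [G _]]; lra).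
      pose proof (Bf_nonneg BF t).
      replace (2 * (Bf a t + PI * L t) / L t) with (2 * PI + 2 * Bf a t / L t) by (field; lra).
      assert (0 <= 2 * Bf a t / L t) by pos. lra.
    + intros t Ht. apply (Df_nonneg BF t Ht).
    + intros t Ht. assert (Lt : 0 < L t) by (destruct (HT t ltac:(lra)) as [_ [G _]]; lra).
      unfold E2. pos.
    + intros t Ht Hct. destruct (HT t ltac:(lra)) as [G1 [G2 [_ [G4 [G5 _]]]]].
      assert (CW : forall x, continuous (fun x => Wf a L x t) x) by (apply (cont_Wf BF t Ht)).
      assert (Dj := fun j x => Aj_dx BF j x t Ht).
      assert (Hdr : cd * Xf a PI t <= RInt (fun x => Rabs (-2 * Aj a 3 x t - Aj a 1 x t ^ 3 + L t * Aj a 1 x t)) 0 PI).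
      { apply (Drive (fun x => Aj a 0 x t) (fun x => Aj a 1 x t) (fun x => Aj a 2 x t) (fun x => Aj a 3 x t) (a 0%Z t) (Xf a PI t) (L t)).
        - apply Dth.
        - apply Dj.
        - apply Dj.
        - intros x. eapply continuous_of_derive, Dj.
        - apply Mth.
        - reflexivity.
        - exact G4.
        - apply slice_left.
        - apply slice_right.
        - lra.
        - eapply Rle_trans; [exact G1|apply Rmin_l].
        (* The cosine lies between [- cos (k / 8)] and [cos (k / 4)], which is below [cos (k / 8)];
           so the sine is at least [sin (k / 8)] in modulus. *)
        - pose proof (cosB t ltac:(lra)) as Q1.
          assert (Q2 : cos (a 0%Z t) <= cos (k / 8)) by (unfold g0 in g0p; lra).
          assert (Q3 : cos (a 0%Z t) ^ 2 <= cos (k / 8) ^ 2) by (rewrite <- pow2_abs; apply pow_incr; split; [pos|apply Rabs_le_between; lra]).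
          pose proof (sin2_cos2 (a 0%Z t)) as S1. pose proof (sin2_cos2 (k / 8)) as S2. unfold Rsqr in *.
          apply Rnot_lt_le. intros G. assert (Rabs (sin (a 0%Z t)) ^ 2 < sin (k / 8) ^ 2) by (simpl; rewrite !Rmult_1_r; apply Rmult_le_0_lt_compat; try lra; apply Rabs_pos).
          rewrite pow2_abs in H. lra. }
      assert (CS : RInt (fun x => Rabs (Wf a L x t)) 0 PI ^ 2 <= PI * Df a L t).
      { eapply Rle_trans; [apply RInt_sqr_CS; [lra|cnt]|]. rewrite Rminus_0_r. right. f_equal. apply RInt_ext. intros; apply pow2_abs. }
      change (fun x => Rabs (-2 * Aj a 3 x t - Aj a 1 x t ^ 3 + L t * Aj a 1 x t)) with (fun x => Rabs (Wf a L x t)) in Hdr.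
      apply Rmult_le_reg_l with PI; [lra|]. replace (PI * ((cd * (eps / 2)) ^ 2 / PI)) with ((cd * (eps / 2)) ^ 2) by (field; lra).
      eapply Rle_trans; [|exact CS]. apply pow_incr. nra.
    + exists s1. split; [lra|]. intros t Ht x Hx. specialize (Hs1 t Ht). specialize (Bnd t ltac:(lra)).
      assert (Bk : Rabs (a 0%Z t) <= k / 2).
      { apply Rnot_lt_le. intros G. assert (cos (Rabs (a 0%Z t)) < cos (k / 2)).
        { apply cos_decreasing_1; try lra. assert (Rabs (a 0%Z t) <= PI - k / 8) by (apply Rabs_le_between; lra). lra. }
        assert (cos (Rabs (a 0%Z t)) = cos (a 0%Z t)) by (unfold Rabs; destruct Rcase_abs; [apply cos_neg|lra]). lra. }
      apply Sign; [auto| |apply (HT t ltac:(lra))|exact Hx].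
      intros y Hy. replace (Aj a 0 y t - Th y) with (dev Th (fun x => Aj a 0 x t) (a 0%Z t) y + a 0%Z t) by (unfold dev; ring).
      le_via Rabs_triang. pose proof (Dev t ltac:(lra) y Hy). lra.
Qed.
End Trapping.

(** * From angle functions to curves *)

(** Vector with tangential part [p] and normal part [q] at angle [th], with the horizontal
    coordinate multiplied by [sg]. Taking [sg] equal to 1 or -1 treats both orders of the endpoints
    at once. *)
Definition frame (sg th p q : R) : vec := (sg * (p * cos th - q * sin th), p * sin th + q * cos th).

Lemma frame_dot (sg th p q p' q' : R) : sg ^ 2 = 1 -> vdot (frame sg th p q) (frame sg th p' q') = p * p' + q * q'.
Proof.
  intros H. unfold vdot, frame; cbn [fst snd]. pose proof (sin2_cos2 th) as E. unfold Rsqr in E.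
  replace (sg * (p * cos th - q * sin th) * (sg * (p' * cos th - q' * sin th)) + (p * sin th + q * cos th) * (p' * sin th + q' * cos th))
    with (sg ^ 2 * ((p * cos th - q * sin th) * (p' * cos th - q' * sin th)) + (p * sin th + q * cos th) * (p' * sin th + q' * cos th)) by ring.
  rewrite H. replace (p * p' + q * q') with ((p * p' + q * q') * (sin th * sin th + cos th * cos th)) by (rewrite E; ring). ring.
Qed.

Section Frame.
Variables (g : field) (t sg : R) (J th k k1 k2 : R -> R).
Hypothesis sg2 : sg ^ 2 = 1.
Hypothesis J_pos : forall v, 0 < J v.
Hypothesis g1_d : forall v, is_derive (fun v => fst (g v t)) v (sg * (J v * cos (th v))).
Hypothesis g2_d : forall v, is_derive (fun v => snd (g v t)) v (J v * sin (th v)).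
Hypothesis th_d : forall v, is_derive th v (J v * k v).
Hypothesis k_d : forall v, is_derive k v (J v * k1 v).
Hypothesis k1_d : forall v, is_derive k1 v (J v * k2 v).

Lemma du_g v : du g v t = frame sg (th v) (J v) 0.
Proof.
  unfold du, frame. f_equal; apply is_derive_unique.
  - replace (sg * (J v * cos (th v) - 0 * sin (th v))) with (sg * (J v * cos (th v))) by ring. apply g1_d.
  - replace (J v * sin (th v) + 0 * cos (th v)) with (J v * sin (th v)) by ring. apply g2_d.
Qed.

Lemma speed v : vnorm (du g v t) = J v.
Proof.
  unfold vnorm. rewrite du_g, frame_dot by lra. replace (J v * J v + 0 * 0) with (J v * J v) by ring. apply sqrt_square. left; apply J_pos.
Qed.

Lemma ds_frame (psi : field) (p q p1 q1 : R -> R) : (forall v, psi v t = frame sg (th v) (p v) (q v)) ->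
  (forall v, is_derive p v (J v * p1 v)) -> (forall v, is_derive q v (J v * q1 v)) ->
  forall v, ds g psi v t = frame sg (th v) (p1 v - k v * q v) (q1 v + k v * p v).
Proof.
  intros E Dp Dq v. pose proof (J_pos v) as Jp.
  unfold ds. rewrite speed. unfold vscal. unfold frame. f_equal.
  - transitivity (/ J v * (sg * ((J v * p1 v * cos (th v) + p v * (J v * k v * - sin (th v))) - (J v * q1 v * sin (th v) + q v * (J v * k v * cos (th v)))))); [f_equal; apply is_derive_unique|field; lra].
    + apply (is_derive_ext (fun v => sg * (p v * cos (th v) - q v * sin (th v)))); [intros z; now rewrite E|].
      der.
  - transitivity (/ J v * ((J v * p1 v * sin (th v) + p v * (J v * k v * cos (th v))) + (J v * q1 v * cos (th v) + q v * (J v * k v * - sin (th v))))); [f_equal; apply is_derive_unique|field; lra].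
    + apply (is_derive_ext (fun v => p v * sin (th v) + q v * cos (th v))); [intros z; now rewrite E|].
      der.
Qed.

Lemma tangent_frame v : ds g g v t = frame sg (th v) 1 0.
Proof.
  pose proof (J_pos v) as Jp. unfold ds. rewrite speed, du_g. unfold vscal, frame. cbn [fst snd]. f_equal; field; lra.
Qed.

Lemma const_d (c : R) v : is_derive (fun _ : R => c) v (J v * 0).
Proof. der. Qed.

Lemma frame_eq (a b p q p' q' : R) : p = p' -> q = q' -> frame a b p q = frame a b p' q'.
Proof. now intros -> ->. Qed.

Lemma curv_frame v : curv g v t = frame sg (th v) 0 (k v).
Proof.
  unfold curv. rewrite (ds_frame (ds g g) (fun _ => 1) (fun _ => 0) (fun _ => 0) (fun _ => 0) tangent_frame (const_d 1) (const_d 0)).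
  apply frame_eq; ring.
Qed.

Lemma nabla_frame (psi : field) (q q1 : R -> R) : (forall v, psi v t = frame sg (th v) 0 (q v)) ->
  (forall v, is_derive q v (J v * q1 v)) -> forall v, nabla_s g psi v t = frame sg (th v) 0 (q1 v).
Proof.
  intros E D v. unfold nabla_s. rewrite (ds_frame psi (fun _ => 0) q (fun _ => 0) q1 E (const_d 0) D), tangent_frame, frame_dot by lra.
  unfold vsub, vscal, frame. cbn [fst snd]. f_equal; ring.
Qed.

Lemma rhs_frame (lam : R) v : elastic_rhs lam g v t = frame sg (th v) 0 (-2 * k2 v - k v ^ 3 + lam * k v).
Proof.
  unfold elastic_rhs. rewrite curv_frame, frame_dot by lra.
  rewrite (nabla_frame (nabla_s g (curv g)) k1 k2 (nabla_frame (curv g) k k1 curv_frame k_d) k1_d).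
  unfold vadd, vscal, frame. cbn [fst snd]. f_equal; ring.
Qed.
End Frame.

(* the flat function [y^-m exp(kap / y)] for [y < 0], extended by [0] *)
Definition flat (kap : R) (m : nat) (y : R) : R := if Rlt_dec y 0 then (/ y) ^ m * exp (kap / y) else 0.

(** The exponential beats any power of [1 / y]. A quadratic bound is what makes the function
    differentiable at [0] with derivative zero. *)
Lemma flat_bound (kap : R) (m : nat) : 0 < kap -> forall h, Rabs (flat kap m h) <= INR (fact (m + 2)) / kap ^ (m + 2) * h ^ 2.
Proof.
  intros Hk h. assert (C : 0 <= INR (fact (m + 2)) / kap ^ (m + 2)) by (apply Rmult_le_pos; [apply pos_INR|pos]).
  unfold flat. destruct (Rlt_dec h 0) as [L|L].
  - assert (P : 0 < / - h) by pos.
    pose proof (pow_exp_decay (m + 2) kap (/ - h) Hk (Rlt_le _ _ P)) as D.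
    replace (- (kap * / - h)) with (kap / h) in D by (field; lra).
    rewrite Rabs_mult, (Rabs_pos_eq (exp _)) by pos. rewrite <- RPow_abs.
    replace (Rabs (/ h)) with (/ - h) by (rewrite Rabs_inv, Rabs_left by lra; reflexivity).
    rewrite pow_add in D. apply Rmult_le_compat_r with (r := h ^ 2) in D; pos.
    replace ((/ - h) ^ m * (/ - h) ^ 2 * exp (kap / h) * h ^ 2) with ((/ - h) ^ m * exp (kap / h)) in D by (field; lra). exact D.
  - rewrite Rabs_R0. pos.
Qed.

Lemma flat_derive (kap : R) (m : nat) (y : R) : 0 < kap -> is_derive (flat kap m) y (- INR m * flat kap (S m) y - kap * flat kap (S (S m)) y).
Proof.
  intros Hk. destruct (Rtotal_order y 0) as [H|[->|H]].
  - apply (is_derive_ext_loc (fun y => (/ y) ^ m * exp (kap / y))).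
    + exists (mkposreal (- y) ltac:(lra)). intros z Hz. ballR Hz.
      apply Rabs_def2 in Hz. unfold flat. destruct (Rlt_dec z 0); lra.
    + unfold flat. destruct (Rlt_dec y 0); [|lra].
      assert (Di : is_derive (fun y => / y) y (- / y ^ 2)) by (auto_derive; [lra|field; lra]).
      assert (Dp : is_derive (fun y => (/ y) ^ m) y (INR m * - / y ^ 2 * (/ y) ^ pred m)) by (apply is_derive_pow; exact Di).
      assert (De : is_derive (fun y => exp (kap / y)) y (kap * - / y ^ 2 * exp (kap / y))).
      { apply (is_derive_comp exp (fun y => kap / y)); [apply is_derive_exp|]. apply (is_derive_scal (fun y => / y)), Di. }
      replace (- INR m * ((/ y) ^ S m * exp (kap / y)) - kap * ((/ y) ^ S (S m) * exp (kap / y))) with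
        (INR m * - / y ^ 2 * (/ y) ^ pred m * exp (kap / y) + (/ y) ^ m * (kap * - / y ^ 2 * exp (kap / y))).
      * now apply (is_derive_Rmult (fun y => (/ y) ^ m) (fun y => exp (kap / y))).
      * destruct m as [|m]; [simpl; field; lra|]. simpl pred. rewrite <- !tech_pow_Rmult. field. lra.
  - assert (Z : forall j, flat kap j 0 = 0) by (intros j; unfold flat; destruct (Rlt_dec 0 0); [lra|lra]).
    rewrite !Z. apply (is_derive_of_quadratic _ _ _ (INR (fact (m + 2)) / kap ^ (m + 2))). intros h _.
    rewrite Z, Rplus_0_l. replace (flat kap m h - 0 - h * (- INR m * 0 - kap * 0)) with (flat kap m h) by ring. now apply flat_bound.
  - apply (is_derive_ext_loc (fun _ => 0)).
    + exists (mkposreal y ltac:(lra)). intros z Hz. ballR Hz.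
      apply Rabs_def2 in Hz. unfold flat. destruct (Rlt_dec z 0); lra.
    + unfold flat. destruct (Rlt_dec y 0); [lra|]. der.
Qed.

Lemma flat_smooth (kap : R) (k : nat) : 0 < kap -> forall m, CK (fun _ => True) k (fun y _ => flat kap m y).
Proof.
  intros Hk. induction k as [|k IH].
  - split; [|exact I]. intros x t _. apply cont2_comp1; [apply cont2_fst|]. eapply continuous_of_derive, flat_derive, Hk.
  - split; [intros x t _; apply (cont2_comp1 (flat kap m) (fun x _ => x)); [apply cont2_fst|eapply continuous_of_derive, flat_derive, Hk]|].
    exists (fun x _ => - INR m * flat kap (S m) x - kap * flat kap (S (S m)) x), (fun _ _ => 0). split; [|split].
    + split; [now apply flat_derive|der].
    + apply CK_minus; (apply CK_mult; [apply CK_const|apply IH]).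
    + apply CK_const.
Qed.

(** The target notion of smoothness ranges over all real times, but the flow is smooth only at
    positive ones. Composing with [H] keeps the clock positive without changing it after [ts]. *)
Lemma smooth_clamp (ts : R) : 0 < ts -> exists H : R -> R, (forall k, CK (fun _ => True) k (fun y _ => H y)) /\
  (forall y, ts <= y -> H y = y /\ is_derive H y 1) /\ (forall y, ts / 2 <= H y).
Proof.
  (* With [z = ts - y] positive the value is [ts - z (1 - exp (- ts / (2 z)))], and
     [1 - exp (- u) <= u] bounds it below by [ts / 2]. *)
  exists (fun y => y - (y - ts) * flat (ts / 2) 0 (y - ts)). split; [|split].
  - intros k. assert (D : CK (fun _ => True) k (fun y _ => y - ts)) by (apply CK_minus; [apply CK_fst|apply CK_const]).
    apply CK_minus; [apply CK_fst|]. apply CK_mult; [exact D|].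
    apply (CK_comp2 (fun _ => True) (fun _ => True) k opn_True opn_True (fun y _ => flat (ts / 2) 0 y) (fun y _ => y - ts) (fun _ t => t)); auto.
    + apply flat_smooth. lra.
    + apply CK_snd.
  - intros y Hy. assert (Z : forall m, flat (ts / 2) m (y - ts) = 0) by (intros m; unfold flat; destruct (Rlt_dec (y - ts) 0); [lra|lra]).
    split; [rewrite Z; ring|].
    assert (D1 : is_derive (fun y => y - ts) y 1) by der.
    replace 1 with (1 - (1 * flat (ts / 2) 0 (y - ts) + (y - ts) * (1 * (- INR 0 * flat (ts / 2) 1 (y - ts) - ts / 2 * flat (ts / 2) 2 (y - ts))))) by (rewrite !Z; ring).
    apply is_derive_Rminus; [der|].
    apply (is_derive_Rmult (fun y => y - ts) (fun y => flat (ts / 2) 0 (y - ts))); [exact D1|].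
    apply (is_derive_comp (flat (ts / 2) 0) (fun y => y - ts)); [apply flat_derive; lra|exact D1].
  - intros y. unfold flat. destruct (Rlt_dec (y - ts) 0) as [L|L]; pos.
    set (z := ts - y). replace (y - ts) with (- z) by (unfold z; ring). assert (0 < z) by (unfold z; lra).
    pose proof (exp_ineq1_le (ts / 2 / - z)) as E.
    assert (z * (1 - exp (ts / 2 / - z)) <= ts / 2).
    { replace (ts / 2) with (z * (- (ts / 2 / - z))) at 2 by (field; lra). apply Rmult_le_compat_l; lra. }
    replace y with (ts - z) by (unfold z; ring). lra.
Qed.

(** The clock is the inverse of a primitive of [m]. The lower bound on [m] makes the primitive
    surjective and the inverse Lipschitz; the primitive is finite everywhere, so the clock passes
    every value. *)
Lemma time_change (m : R -> R) (c ts : R) : 0 < c -> (forall y, c <= m y) -> (forall k, CK (fun _ => True) k (fun y _ => m y)) ->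
  exists tau : R -> R, tau 0 = ts /\ (forall t, is_derive tau t (/ m (tau t))) /\ (forall k, CK (fun _ => True) k (fun _ t => tau t)) /\
    (forall t, 0 <= t -> ts <= tau t) /\ (forall s, exists t1, 0 < t1 /\ forall t, t1 <= t -> s <= tau t).
Proof.
  intros Hc Hm Sm.
  assert (Cm : forall y, continuous m y) by (intros y; apply (cont2_slice1 (fun y _ => m y) y 0), (CK_cont _ 0 _ (Sm 0%nat)); exact I).
  set (F := fun y => RInt m ts y).
  assert (DF : forall y, is_derive F y (m y)) by (intros y; now apply (is_derive_RInt_var m)).
  assert (CF : forall y, continuous F y) by cnt.
  assert (F0 : F ts = 0) by (unfold F; rewrite RInt_point; reflexivity).
  assert (MV : forall x y, exists z, Rmin x y <= z <= Rmax x y /\ F y - F x = m z * (y - x)).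
  { intros x y. destruct (MVT_gen F x y m) as [z [Hz E]]; [auto|intros; apply continuity_pt_filterlim, CF|]. now exists z. }
  assert (Inc : forall x y, x <= y -> c * (y - x) <= F y - F x).
  { intros x y H. destruct (MV x y) as [z [_ E]]. rewrite E. apply Rmult_le_compat_r; [lra|apply Hm]. }
  assert (Ex : forall t, exists y, F y = t).
  { intros t. assert (K : 0 <= Rabs t / c) by pos.
    pose proof (Inc ts (ts + Rabs t / c) ltac:(lra)) as U. pose proof (Inc (ts - Rabs t / c) ts ltac:(lra)) as Lo.
    replace (c * (ts + Rabs t / c - ts)) with (Rabs t) in U by (field; lra). replace (c * (ts - (ts - Rabs t / c))) with (Rabs t) in Lo by (field; lra).
    destruct (IVT_value F (ts - Rabs t / c) (ts + Rabs t / c) t ltac:(lra)) as [y [_ Ey]]; [auto| |now exists y].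
    pose proof (Rle_abs t). pose proof (Rle_abs (- t)). rewrite Rabs_Ropp in *. lra. }
  set (tau := fun t => proj1_sig (constructive_indefinite_description _ (Ex t))).
  assert (Ft : forall t, F (tau t) = t) by (intros t; unfold tau; destruct constructive_indefinite_description; assumption).
  assert (Inj : forall x y, F x = F y -> x = y).
  { intros x y E. destruct (Rle_dec x y) as [H|H].
    - pose proof (Inc x y H). nra.
    - pose proof (Inc y x ltac:(lra)). nra. }
  assert (Lip : forall s t, c * Rabs (tau s - tau t) <= Rabs (s - t)).
  { intros s t. destruct (MV (tau t) (tau s)) as [z [_ E]]. rewrite !Ft in E. rewrite E, Rabs_mult. apply Rmult_le_compat_r; pos.
    eapply Rle_trans; [auto|apply Rle_abs]. }
  assert (Dt : forall t, is_derive tau t (/ m (tau t))).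
  { intros t. apply is_derive_Reals. intros eps He.
    assert (Ci : continuous (fun y => / m y) (tau t)) by (apply (continuous_comp m Rinv); [apply Cm|apply continuous_Rinv; specialize (Hm (tau t)); lra]).
    destruct (proj1 (filterlim_locally _ _) Ci (mkposreal _ He)) as [d Hd].
    assert (cd : 0 < c * d) by (apply Rmult_lt_0_compat; [exact Hc|apply cond_pos]).
    exists (mkposreal _ cd). intros h Hh Hhd.
    destruct (MV (tau t) (tau (t + h))) as [z [Hz E]]. rewrite !Ft in E.
    assert (mz : m z <> 0) by (specialize (Hm z); lra).
    assert (Dq : tau (t + h) - tau t = h / m z) by (apply Rmult_eq_reg_l with (m z); [rewrite <- E; field; exact mz|exact mz]).
    replace ((tau (t + h) - tau t) / h) with (/ m z) by (rewrite Dq; field; auto).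
    apply Hd. pose proof (Lip (t + h) t) as Lp. replace (t + h - t) with h in Lp by ring.
    change (Rabs (z - tau t) < d). apply Rmult_lt_reg_l with c; [exact Hc|].
    eapply Rle_lt_trans; [|exact Hhd]. eapply Rle_trans; [|exact Lp]. apply Rmult_le_compat_l; [lra|].
    unfold Rmin, Rmax in Hz. destruct Rle_dec; unfold Rabs; destruct Rcase_abs; destruct Rcase_abs; lra. }
  exists tau. split; [apply Inj; now rewrite Ft|]. split; [exact Dt|]. split; [|split].
  - induction k as [|k IH].
    + split; [|exact I]. intros x t _. apply cont2_comp1; [apply cont2_snd|cnt].
    + split; [intros x t _; apply (cont2_comp1 tau (fun _ t => t)); [apply cont2_snd|eapply continuous_of_derive, Dt]|].
      exists (fun _ _ => 0), (fun _ t => / m (tau t)). split; [|split].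
      * split; der.
      * apply CK_const.
      * apply (CK_comp2 (fun _ => True) (fun _ => True) k opn_True opn_True (fun y _ => / m y) (fun _ t => tau t) (fun _ t => t)); auto.
        -- apply (CK_inv _ k (fun y _ => m y)); [intros x t _; specialize (Hm x); lra|apply Sm].
        -- apply CK_snd.
  - intros t Ht. apply Rnot_lt_le. intros G. pose proof (Inc (tau t) ts ltac:(lra)) as U. rewrite Ft in U. nra.
  - intros s. exists (Rmax 1 (F (Rmax s ts))). split; [apply Rlt_le_trans with 1; [lra|apply Rmax_l]|].
    intros t Ht. apply Rnot_lt_le. intros G. pose proof (Rmax_l s ts). pose proof (Rmax_r 1 (F (Rmax s ts))).
    pose proof (Inc (tau t) (Rmax s ts) ltac:(lra)) as U. rewrite Ft in U. nra.
Qed.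

Section Bounds.
Variables (P : R -> Prop) (a : Z -> R -> R) (L : R -> R) (T0 A Lm : R).
Hypothesis BF : base_flow P a L T0 A.
Hypothesis L_bd : forall t, 0 <= t -> 0 <= L t <= Lm.

(** The flow theorem needs bounds on the whole real line in [x]. The trigonometric series give them
    for derivatives of the angle uniformly for times bounded away from zero. *)
Lemma drift_bounds (t1 : R) : 0 < t1 -> exists C, 1 <= C /\ forall x t, t1 <= t ->
  Rabs (Sf a L x t) <= C /\ Rabs (Aj a 1 x t * Wf a L x t - P0 a L t) <= C /\
  Rabs (Aj a 2 x t * Wf a L x t + Aj a 1 x t * Wxf a L x t) <= C.
Proof.
  intros Ht1. destruct BF as [Po Pp T0p A0 Ca CL Ev Dec _ _]. pose proof PI_RGT_0 as pi0.
  destruct (Aj_bd BF 1 t1 (le_n 1) Ht1) as [C1 [C10 H1]].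
  destruct (Aj_bd BF 2 t1 ltac:(lia) Ht1) as [C2 [C20 H2]].
  destruct (Aj_bd BF 3 t1 ltac:(lia) Ht1) as [C3 [C30 H3]].
  destruct (Aj_bd BF 4 t1 ltac:(lia) Ht1) as [C4 [C40 H4]].
  assert (mb : forall x y X Y, Rabs x <= X -> Rabs y <= Y -> Rabs (x * y) <= X * Y).
  { intros x y X Y Hx Hy. rewrite Rabs_mult. apply Rmult_le_compat; pos. }
  assert (ab : forall x y X Y, Rabs x <= X -> Rabs y <= Y -> Rabs (x + y) <= X + Y).
  { intros x y X Y Hx Hy. eapply Rle_trans; [apply Rabs_triang|lra]. }
  assert (cb : forall c, Rabs c <= Rabs c) by pos.
  assert (pb : forall n x X, Rabs x <= X -> Rabs (x ^ n) <= X ^ n).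
  { intros n x X Hx. rewrite <- RPow_abs. apply pow_incr. split; pos. }
  assert (Lb : forall t, t1 <= t -> Rabs (L t) <= Lm) by (intros t Ht; destruct (L_bd t ltac:(lra)); rewrite Rabs_pos_eq; lra).
  set (CW := Rabs (-2) * C3 + C1 ^ 3 + Lm * C1). set (CWx := Rabs (-2) * C4 + Rabs 3 * C1 ^ 2 * C2 + Lm * C2).
  set (CP := Rabs 2 * C2 ^ 2 + C1 ^ 4 + Lm * C1 ^ 2).
  assert (HW : forall x t, t1 <= t -> Rabs (Wf a L x t) <= CW).
  { intros x t Ht. apply ab; [apply ab|]; [auto|rewrite Rabs_Ropp; auto|auto]. }
  assert (HWx : forall x t, t1 <= t -> Rabs (Wxf a L x t) <= CWx).
  { intros x t Ht. apply ab; [apply ab|]; [auto|rewrite Rabs_Ropp; apply mb; [apply mb; auto|auto]|auto]. }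
  assert (HP : forall x t, t1 <= t -> Rabs (Pf a L x t) <= CP).
  { intros x t Ht. apply ab; [apply ab|]; [auto|rewrite Rabs_Ropp; auto|auto]. }
  assert (CPf : forall x t, t1 <= t -> continuous (fun x => Pf a L x t) x).
  { intros x t Ht. pose proof (cont_Aj BF 1 t ltac:(lra) x) as c1. pose proof (cont_Aj BF 2 t ltac:(lra) x) as c2.
    unfold Pf. cnt. }
  assert (HP0 : forall t, t1 <= t -> Rabs (P0 a L t) <= CP).
  { intros t Ht. apply Rmult_le_reg_l with PI; [lra|]. rewrite <- (Rabs_pos_eq PI) at 1 by lra. rewrite <- Rabs_mult.
    rewrite <- (P0_int BF t ltac:(lra)).
    eapply Rle_trans; [apply (Rabs_RInt_le (fun y => Pf a L y t) 0 PI CP); [intros; now apply CPf|intros; now apply HP]|]. rewrite Rabs_pos_eq; lra. }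
  assert (HR : forall x t, t1 <= t -> Rabs (Rf a L x t) <= (CP + CP) * PI).
  (* [Rf] is bounded through its derivative from the nearest multiple of [PI] to the left, where it
     vanishes. *)
  { intros x t Ht. destruct (archimed (x / PI)) as [u1 u2]. set (n := (up (x / PI) - 1)%Z).
    assert (n1 : IZR n * PI <= x <= IZR n * PI + PI).
    { unfold n. rewrite minus_IZR. replace x with (x / PI * PI) at 2 3 by (field; lra). split; nra. }
    destruct (MVT_gen (fun y => Rf a L y t) (IZR n * PI) x (fun y => Pf a L y t - P0 a L t)) as [z [_ E]].
    - intros y _. apply (Rf_dx BF t ltac:(lra)).
    - intros y _. apply continuity_pt_filterlim. exact (continuous_of_derive _ _ _ (Rf_dx BF t (Rlt_le_trans _ _ _ Ht1 Ht) y)).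
    - rewrite Rf_zero, Rminus_0_r in E by lra. rewrite E. apply mb; [|rewrite Rabs_pos_eq; lra].
      apply ab; [auto|rewrite Rabs_Ropp; now apply HP0]. }
  set (K := Rabs (-2) * C1 * C2 + (CP + CP) * PI).
  assert (HS : forall x t, t1 <= t -> Rabs (Sf a L x t) <= K).
  { unfold Sf, K. auto. }
  exists (Rabs K + Rabs (C1 * CW + CP) + Rabs (C2 * CW + C1 * CWx) + 1).
  pose proof (Rabs_pos K). pose proof (Rabs_pos (C1 * CW + CP)). pose proof (Rabs_pos (C2 * CW + C1 * CWx)).
  split; [lra|]. intros x t Ht. split; [|split].
  - pose proof (HS x t Ht). pose proof (Rle_abs K). lra.
  - assert (Rabs (Aj a 1 x t * Wf a L x t - P0 a L t) <= C1 * CW + CP) by (apply ab; [auto|rewrite Rabs_Ropp; auto]).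
    pose proof (Rle_abs (C1 * CW + CP)). lra.
  - assert (Rabs (Aj a 2 x t * Wf a L x t + Aj a 1 x t * Wxf a L x t) <= C2 * CW + C1 * CWx) by auto.
    pose proof (Rle_abs (C2 * CW + C1 * CWx)). lra.
Qed.
End Bounds.

(** * Assembly *)

Section Assembly.
Context {a : Z -> R -> R} {L : R -> R} {T0 A : R}.
Variables (Ls eps lam sg d x0 s0 s1 : R).
Hypothesis BF : base_flow (fun t => 0 < t) a L T0 A.
Hypothesis Ls_pos : 0 < Ls.
Hypothesis lam_pos : 0 < lam.
Hypothesis sg2 : sg ^ 2 = 1.
Hypothesis closing : forall t, 0 <= t -> Ls / 2 <= L t <= 2 * Ls /\ sqrt (L t) * Xf a PI t = sqrt Ls * eps /\ Yf a PI t = 0.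
Hypothesis opening : sqrt Ls * eps = sqrt lam * d.
Hypothesis s0_pos : 0 < s0.
Hypothesis s1_pos : 0 < s1.
Hypothesis early : forall t, 0 <= t <= s0 -> forall x, 0 < x < PI -> 0 < Yf a x t.
Hypothesis late : forall t, s1 <= t -> forall x, 0 < x < PI -> Yf a x t < 0.

Let Q : R -> Prop := fun t => 0 < t.
(** Ratio of physical arclength to the parameter [x]. Its logarithmic derivative is [- P0], which
    cancels the dilation term in the motion of the position. *)
Definition ell (t : R) : R := sqrt (L t / lam).

Lemma Ll_pos t : 0 <= t -> 0 < L t / lam.
Proof. intros H. destruct (closing t H) as [B _]. pos. Qed.

Lemma ell_pos t : 0 <= t -> 0 < ell t.
Proof. intros H. apply sqrt_lt_R0. now apply Ll_pos. Qed.

Lemma ell_sq t : 0 <= t -> ell t ^ 2 = L t / lam.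
Proof. intros H. apply pow2_sqrt. left. now apply Ll_pos. Qed.

Lemma CK_L k : CK Q k (fun _ t => L t).
Proof. apply (CK_flow BF k). Qed.

Lemma CK_A k j : CK Q k (Aj a j).
Proof. apply (CK_flow BF k). Qed.

Lemma CK_S k : CK Q k (Sf a L).
Proof.
  destruct (CK_P0_Rf BF k (CK_A k) (CK_L k)) as [_ HR].
  unfold Sf. pose proof (CK_A k 1). pose proof (CK_A k 2). CK_tac.
Qed.

Lemma CK_ell k : CK Q k (fun _ t => ell t).
Proof.
  apply CK_sqrt.
  - intros _ t Ht. apply Ll_pos. unfold Q in Ht. lra.
  - apply CK_mult; [apply CK_L|apply CK_const].
Qed.

Definition U (x t : R) : R := ell t * Xf a x t.
Definition V (x t : R) : R := ell t * Yf a x t.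

Lemma CK_UV k : CK Q k U /\ CK Q k V.
Proof.
  pose proof (CK_sincos Q k (Aj a 0) (CK_A k 0)) as [S C].
  split; apply CK_mult; try apply CK_ell; apply (CK_RInt Q k opn_pos _); assumption.
Qed.

Lemma UV_dx x t : 0 < t -> is_derive (fun y => U y t) x (ell t * cos (Aj a 0 x t)) /\ is_derive (fun y => V y t) x (ell t * sin (Aj a 0 x t)).
Proof.
  split.
  - apply (is_derive_scal (fun y => Xf a y t)), (is_derive_RInt_var (fun y => cos (Aj a 0 y t))). apply (cosA_cont BF).
  - apply (is_derive_scal (fun y => Yf a y t)), (is_derive_RInt_var (fun y => sin (Aj a 0 y t))). apply (sinA_cont BF).
Qed.

Lemma ell_dt t : 0 < t -> is_derive ell t (- P0 a L t * ell t).
Proof.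
  intros Ht. pose proof (bf_Lode _ _ _ _ _ BF t Ht) as D. fold (P0 a L t) in D. pose proof (ell_pos t ltac:(lra)) as lp. pose proof (ell_sq t ltac:(lra)) as l2.
  replace (- P0 a L t * ell t) with ((-2 * L t * P0 a L t * / lam) / (2 * ell t)).
  - apply is_derive_sqrt; [|apply Ll_pos; lra].
    der.
  - replace (-2 * L t * P0 a L t * / lam) with (-2 * P0 a L t * (L t / lam)) by lra. rewrite <- l2. field. lra.
Qed.

Lemma UV_dt x t : 0 < t ->
  is_derive (fun t => U x t) t (ell t * (- Wf a L x t * sin (Aj a 0 x t) + Sf a L x t * cos (Aj a 0 x t))) /\
  is_derive (fun t => V x t) t (ell t * (Wf a L x t * cos (Aj a 0 x t) + Sf a L x t * sin (Aj a 0 x t))).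
Proof.
  intros Ht. pose proof (ell_dt t Ht) as D.
  destruct (XY_derive BF x t Ht) as [DX DY].
  split; [change (fun t => U x t) with (fun t => ell t * Xf a x t)|change (fun t => V x t) with (fun t => ell t * Yf a x t)]; der.
Qed.

Lemma UV_end t : 0 <= t -> U PI t = d /\ V PI t = 0.
Proof.
  intros Ht. destruct (closing t Ht) as [B [X Y]]. unfold U, V. rewrite Y. split; [|ring].
  unfold ell. rewrite sqrt_div by lra. pose proof (sqrt_lt_R0 _ lam_pos).
  replace (sqrt (L t) / sqrt lam * Xf a PI t) with (sqrt (L t) * Xf a PI t / sqrt lam) by lra.
  rewrite X, opening. field. lra.
Qed.

Lemma UV_start t : U 0 t = 0 /\ V 0 t = 0.
Proof. unfold U, V, Xf, Yf. rewrite !RInt_point. split; apply Rmult_0_r. Qed.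

(** Undoes the normalisations: scaling by [ell] restores the fixed end vector, the change of time
    restores the speed of the flow, and the tangential reparametrization makes the velocity purely
    normal. *)
Lemma flow_curve : exists g : field, elastic_flow_nbc lam (x0, 0) (x0 + sg * d, 0) g /\
  exists t0 t1 : R, 0 < t0 /\ t0 < t1 /\
    (forall u t, 0 < u < 1 -> 0 <= t <= t0 -> 0 < snd (g u t)) /\
    (forall u t, 0 < u < 1 -> t1 <= t -> snd (g u t) < 0).
Proof.
  pose proof PI_RGT_0 as pi0. pose proof opn_pos as oQ.
  (* The curve starts at a positive time, where all derivatives exist up to the boundary, but early
     enough to lie above the axis for a while. *)
  set (ts := s0 / 2). assert (ts0 : 0 < ts) by (unfold ts; lra).
  destruct (smooth_clamp ts ts0) as [H [SH [Hid Hlo]]].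
  assert (Hpos : forall y, Q (H y)) by (intros y; unfold Q; specialize (Hlo y); lra).
  (* This is [ell^4] on the clamped clock, the scaling factor of time in a fourth order flow. *)
  set (m := fun y => (L (H y) / lam) ^ 2).
  set (c := (Ls / 2 / lam) ^ 2). assert (c0 : 0 < c) by (apply pow_lt; repeat apply Rdiv_lt_0_compat; lra).
  assert (Hm : forall y, c <= m y).
  { intros y. apply pow_incr. destruct (closing (H y)) as [B _]; [left; apply Hpos|].
    split; pos. apply Rmult_le_compat_r; pos. }
  assert (CKcomp : forall k (F : R -> R -> R) (G h : R -> R -> R), CK Q k F -> CK (fun _ => True) k G -> CK (fun _ => True) k h -> (forall x t, Q (h x t)) ->
     CK (fun _ => True) k (fun x t => F (G x t) (h x t))).
  { intros k F G h HF HG Hh Hq. apply (CK_comp2 Q (fun _ => True) k oQ opn_True); auto. }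
  assert (Sm : forall k, CK (fun _ => True) k (fun y _ => m y)).
  { intros k. assert (S1 : CK (fun _ => True) k (fun y _ => L (H y))) by (apply (CKcomp k (fun _ t => L t) (fun y _ => y) (fun y _ => H y)); [apply CK_L|apply CK_fst|apply SH|auto]).
    apply (CK_ext _ k opn_True (fun y _ => (L (H y) * / lam) * (L (H y) * / lam))); [intros; unfold m; simpl; unfold Rdiv; ring|].
    apply CK_mult; (apply CK_mult; [exact S1|apply CK_const]). }
  destruct (time_change m c ts c0 Hm Sm) as [tau [tau0 [Dtau [Stau [Tge Tinf]]]]].
  set (h := fun t => H (tau t)). assert (hpos : forall t, 0 < h t) by (intros; apply Hpos).
  assert (hlo : forall t, ts / 2 <= h t) by (intros; apply Hlo).
  assert (hid : forall t, 0 <= t -> h t = tau t) by (intros t Ht; apply Hid, Tge, Ht).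
  set (iM := fun t => / m (tau t)).
  assert (iM0 : forall t, 0 < iM t <= / c) by (split; [apply Rinv_0_lt_compat; specialize (Hm (tau t)); lra|apply Rinv_le_contravar; [exact c0|apply Hm]]).
  assert (Dh : forall t, 0 <= t -> is_derive h t (iM t)).
  { intros t Ht. destruct (Hid (tau t) (Tge t Ht)) as [_ D1]. replace (iM t) with (iM t * 1) by ring.
    apply (is_derive_comp H tau); auto. }
  assert (CKtau : forall k (F : R -> R), (forall k, CK (fun _ => True) k (fun y _ => F y)) -> CK (fun _ => True) k (fun _ t => F (tau t))).
  { intros k F HF. apply (CK_comp2 (fun _ => True) (fun _ => True) k opn_True opn_True (fun y _ => F y) (fun _ t => tau t) (fun _ t => t)); auto. apply CK_snd. }
  assert (Sh : forall k, CK (fun _ => True) k (fun _ t => h t)) by (intros k; now apply CKtau).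
  assert (SiM : forall k, CK (fun _ => True) k (fun _ t => iM t)).
  { intros k. apply (CKtau k (fun y => / m y)). intros j. apply (CK_inv _ j (fun y _ => m y)); [intros y _ _; specialize (Hm y); lra|apply Sm]. }
  destruct (drift_bounds (fun t => 0 < t) a L T0 A (2 * Ls) BF ltac:(intros t Ht; destruct (closing t Ht); lra) (ts / 2) ltac:(lra)) as [C [C1 HC]].
  (* Field whose flow cancels the tangential velocity. It vanishes at [0] and [PI], so the endpoints
     keep their parameters. *)
  set (f := fun y t => - Sf a L y (h t) * iM t).
  set (fy := fun y t => - (Aj a 1 y (h t) * Wf a L y (h t) - P0 a L (h t)) * iM t).
  set (fyy := fun y t => - (Aj a 2 y (h t) * Wf a L y (h t) + Aj a 1 y (h t) * Wxf a L y (h t)) * iM t).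
  assert (iMb : forall z t, Rabs z <= C -> Rabs (- z * iM t) <= C * / c).
  { intros z t Hz. rewrite Rabs_mult, Rabs_Ropp, (Rabs_pos_eq (iM t)) by (left; apply iM0). apply Rmult_le_compat; [pos|left; apply iM0|exact Hz|apply iM0]. }
  assert (Cc0 : 0 <= C * / c) by pos.
  assert (f_smooth : forall k, CK (fun _ => True) k f).
  { intros k. apply CK_mult; [|auto]. apply CK_opp.
    apply CKcomp; [apply CK_S|apply CK_fst|apply Sh|auto]. }
  assert (f_dy : forall y t, is_derive (fun y => f y t) y (fy y t)).
  { pose proof (Sf_dx BF). unfold f, fy. der. }
  assert (f_dyy : forall y t, is_derive (fun y => fy y t) y (fyy y t)).
  { pose proof (Aj_dx BF). pose proof (Wf_dx BF). unfold fy, fyy. der. }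
  assert (f_bd : forall y t, Rabs (f y t) <= C * / c) by (intros y t; apply iMb, HC, hlo).
  assert (fy_bd : forall y t, Rabs (fy y t) <= C * / c + 1).
  { intros y t. apply Rle_trans with (C * / c); [|lra]. apply iMb. destruct (HC y (h t) (hlo t)) as [_ [H1 _]]. exact H1. }
  assert (fy_lip : forall y y' t, Rabs (fy y' t - fy y t) <= C * / c * Rabs (y' - y)).
  { intros y y' t. destruct (MVT_gen (fun y => fy y t) y y' (fun y => fyy y t)) as [z [_ E]].
    - auto.
    - intros w _. apply continuity_pt_filterlim. exact (continuous_of_derive (fun y => fy y t) w _ (f_dyy w t)).
    - rewrite E, Rabs_mult. apply Rmult_le_compat_r; pos. apply iMb, HC, hlo. }
  assert (K1 : 1 <= C * / c + 1) by lra.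
  destruct (flow_exists f fy _ _ f_smooth f_dy f_bd fy_bd K1) as [Y [Y0 Yt]].
  pose proof (flow_du f fy _ _ f_smooth f_dy fy_bd fy_lip K1 Cc0 Y Y0 Yt) as Yu.
  pose proof (flow_smooth f fy _ _ f_smooth f_dy fy_bd fy_lip K1 Cc0 Y Y0 Yt) as SY.
  assert (Y_0 : forall t, Y 0 t = 0).
  { apply (flow_fixed f fy _ f_dy fy_bd K1 Y Y0 Yt). intros t. unfold f. pose proof (@Sf_zero a L 0 (h t)) as Z. rewrite Rmult_0_l in Z. rewrite Z. ring. }
  assert (Y_PI : forall t, Y PI t = PI).
  { apply (flow_fixed f fy _ f_dy fy_bd K1 Y Y0 Yt). intros t. unfold f. pose proof (@Sf_zero a L 1 (h t)) as Z. rewrite Rmult_1_l in Z. rewrite Z. ring. }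
  set (X := fun u t => Y (u * PI) t).
  set (g := (fun u t => (x0 + sg * U (X u t) (h t), V (X u t) (h t))) : field).
  set (dX := fun u t => PI * flow_u fy Y (u * PI) t).
  assert (DX : forall u t, is_derive (fun u => X u t) u (dX u t)).
  { intros u t. apply (is_derive_comp (fun y => Y y t) (fun u => u * PI)); [apply Yu|]. der. }
  assert (dXp : forall u t, 0 < dX u t) by (intros; apply Rmult_lt_0_compat; [lra|apply exp_pos]).
  set (J := fun t u => ell (h t) * dX u t).
  assert (lp : forall t, 0 < ell (h t)) by (intros t; apply ell_pos; left; apply hpos).
  assert (Jp : forall t u, 0 < J t u) by (intros; apply Rmult_lt_0_compat; auto).
  set (th := fun t u => Aj a 0 (X u t) (h t)).
  (* The [j]-th arclength derivative of the angle: curvature for [j = 1], its derivatives beyond. *)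
  set (kp := fun j t u => Aj a j (X u t) (h t) / ell (h t) ^ j).
  assert (dAj : forall j t u, is_derive (fun u => Aj a j (X u t) (h t)) u (dX u t * Aj a (S j) (X u t) (h t))).
  { intros j t u. apply (is_derive_comp (fun y => Aj a j y (h t)) (fun u => X u t)); [|apply DX].
    apply (Aj_dx BF j _ (h t) (hpos t)). }
  assert (dth : forall t u, is_derive (th t) u (J t u * kp 1%nat t u)).
  { intros t u. specialize (lp t). replace (J t u * kp 1%nat t u) with (dX u t * Aj a 1 (X u t) (h t)) by (unfold J, kp; field; lra). apply dAj. }
  assert (dkp : forall j t u, is_derive (kp j t) u (J t u * kp (S j) t u)).
  { intros j t u. specialize (lp t). assert (lj : 0 < ell (h t) ^ j) by pos.
    replace (J t u * kp (S j) t u) with (dX u t * Aj a (S j) (X u t) (h t) * / ell (h t) ^ j + Aj a j (X u t) (h t) * 0).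
    - apply (is_derive_Rmult (fun u => Aj a j (X u t) (h t)) (fun _ => / ell (h t) ^ j)); der.
    - unfold J, kp. rewrite <- tech_pow_Rmult. field. split; lra. }
  assert (g1 : forall t u, is_derive (fun u => fst (g u t)) u (sg * (J t u * cos (th t u)))).
  { intros t u. apply is_derive_const_plus. apply is_derive_scal.
    replace (J t u * cos (th t u)) with (dX u t * (ell (h t) * cos (Aj a 0 (X u t) (h t)))) by (unfold J, th; ring).
    apply (is_derive_comp (fun y => U y (h t)) (fun u => X u t)); [apply UV_dx, hpos|apply DX]. }
  assert (g2 : forall t u, is_derive (fun u => snd (g u t)) u (J t u * sin (th t u))).
  { intros t u.
    replace (J t u * sin (th t u)) with (dX u t * (ell (h t) * sin (Aj a 0 (X u t) (h t)))) by (unfold J, th; ring).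
    apply (is_derive_comp (fun y => V y (h t)) (fun u => X u t)); [apply UV_dx, hpos|apply DX]. }
  assert (curvE : forall t u, curv g u t = frame sg (th t u) 0 (kp 1%nat t u)).
  { intros t u. apply (curv_frame g t sg (J t) (th t) (kp 1%nat t) sg2 (Jp t) (g1 t) (g2 t) (dth t)). }
  assert (A1end : forall t, Aj a 1 0 t = 0 /\ Aj a 1 PI t = 0).
  { intros t. pose proof (@A1_zero a 0 t) as Z0. pose proof (@A1_zero a 1 t) as Z1. rewrite Rmult_0_l in Z0. rewrite Rmult_1_l in Z1. auto. }
  assert (Xend : forall t, X 0 t = 0 /\ X 1 t = PI) by (intros t; unfold X; rewrite Rmult_0_l, Rmult_1_l; auto).
  assert (SX : forall k, CK (fun _ => True) k X).
  { intros k. apply (CK_comp2 (fun _ => True) (fun _ => True) k opn_True opn_True Y (fun u _ => u * PI) (fun _ t => t)); auto; [|apply CK_snd].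
    apply CK_mult; [apply CK_fst|apply CK_const]. }
  exists g. split.
  - split; [|split; [|split]].
    + split; apply CK_smooth2; intros k.
      * apply CK_plus; [apply CK_const|]. apply CK_mult; [apply CK_const|].
        apply CKcomp; [apply CK_UV|apply SX|apply Sh|auto].
      * apply CKcomp; [apply CK_UV|apply SX|apply Sh|auto].
    + intros u t _ _. rewrite (speed g t sg (J t) (th t) sg2 (Jp t) (g1 t) (g2 t)). apply Jp.
    + intros u t _ Ht.
      rewrite (rhs_frame g t sg (J t) (th t) (kp 1%nat t) (kp 2%nat t) (kp 3%nat t) sg2 (Jp t) (g1 t) (g2 t) (dth t) (dkp 1%nat t) (dkp 2%nat t)).
      assert (DXt : is_derive (X u) t (f (X u t) t)) by (apply Yt).
      assert (lt := lp t). assert (l2 := ell_sq (h t) (Rlt_le _ _ (hpos t))).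
      assert (E4 : iM t = / (ell (h t) ^ 2) ^ 2) by (unfold iM, m; rewrite l2; reflexivity).
      assert (EL : L (h t) = lam * ell (h t) ^ 2) by (rewrite l2; field; lra).
      assert (CUx : forall x t, Q t -> cont2 (fun x t => ell t * cos (Aj a 0 x t)) x t).
      { apply (CK_cont Q 0). apply CK_mult; [apply CK_ell|]. apply (CK_sincos Q 0 (Aj a 0) (CK_A 0 0)). }
      assert (CVx : forall x t, Q t -> cont2 (fun x t => ell t * sin (Aj a 0 x t)) x t).
      { apply (CK_cont Q 0). apply CK_mult; [apply CK_ell|]. apply (CK_sincos Q 0 (Aj a 0) (CK_A 0 0)). }
      pose proof (is_derive_comp2 Q U (fun x t => ell t * cos (Aj a 0 x t)) (fun x t => ell t * (- Wf a L x t * sin (Aj a 0 x t) + Sf a L x t * cos (Aj a 0 x t)))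
        (X u) h t _ _ oQ (hpos t) (fun x t Ht => proj1 (UV_dx x t Ht)) (fun x t Ht => proj1 (UV_dt x t Ht)) CUx DXt (Dh t Ht)) as D1.
      pose proof (is_derive_comp2 Q V (fun x t => ell t * sin (Aj a 0 x t)) (fun x t => ell t * (Wf a L x t * cos (Aj a 0 x t) + Sf a L x t * sin (Aj a 0 x t)))
        (X u) h t _ _ oQ (hpos t) (fun x t Ht => proj2 (UV_dx x t Ht)) (fun x t Ht => proj2 (UV_dt x t Ht)) CVx DXt (Dh t Ht)) as D2.
      assert (WE : -2 * kp 3%nat t u - kp 1%nat t u ^ 3 + lam * kp 1%nat t u = Wf a L (X u t) (h t) / ell (h t) ^ 3).
      { unfold kp, Wf. rewrite EL. field. lra. }
      rewrite WE. unfold dt, frame. f_equal; apply is_derive_unique.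
      * apply is_derive_const_plus. apply (is_derive_scal (fun s => U (X u s) (h s))) with (k := sg) in D1.
        match goal with |- is_derive _ _ ?r => match type of D1 with is_derive _ _ ?l => replace r with l; [exact D1|] end end.
        unfold f, th. rewrite E4. field. lra.
      * match goal with |- is_derive _ _ ?r => match type of D2 with is_derive _ _ ?l => replace r with l; [exact D2|] end end.
        unfold f, th. rewrite E4. field. lra.
    + intros t Ht. destruct (Xend t) as [X_0 X_1]. destruct (UV_end (h t) (Rlt_le _ _ (hpos t))) as [U1 V1]. destruct (UV_start (h t)) as [U0 V0].
      destruct (A1end (h t)) as [a0 a1].
      split; [|split; [|split]].
      * unfold g. rewrite X_0, U0, V0. f_equal. ring.
      * unfold g. rewrite X_1, U1, V1. reflexivity.
      * rewrite curvE. unfold kp, frame, vzero. rewrite X_0, a0. f_equal; lra.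
      * rewrite curvE. unfold kp, frame, vzero. rewrite X_1, a1. f_equal; lra.
  - assert (Xin : forall u t, 0 < u < 1 -> 0 < X u t < PI).
    { intros u t Hu. destruct (Xend t) as [X_0 X_1].
      destruct (mvt_all (fun u => X u t) (fun u => dX u t) 0 u ltac:(lra) (fun u => DX u t)) as [z [_ E]].
      destruct (mvt_all (fun u => X u t) (fun u => dX u t) u 1 ltac:(lra) (fun u => DX u t)) as [z' [_ E']].
      pose proof (dXp z t). pose proof (dXp z' t).
      assert (0 < dX z t * (u - 0)) by pos. assert (0 < dX z' t * (1 - u)) by pos. lra. }
    assert (Ct : continuous tau 0) by cnt.
    destruct (proj1 (filterlim_locally _ _) Ct (mkposreal ts ts0)) as [dd Hd]. pose proof (cond_pos dd).
    destruct (Tinf s1) as [t1 [t10 Ht1]].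
    (* Up to [dd / 2] the clock stays within [ts] of [ts], hence below [s0]; the maximum with [dd]
       ensures [t0 < t1]. *)
    exists (dd / 2), (Rmax t1 dd). split; [lra|]. split; [apply Rlt_le_trans with dd; [lra|apply Rmax_r]|]. split.
    + intros u t Hu Ht. apply Rmult_lt_0_compat; [apply lp|].
      apply early; auto. rewrite hid by lra. assert (B : Rabs (tau t - tau 0) < ts).
      { apply Hd. change (Rabs (t - 0) < dd). rewrite Rminus_0_r, Rabs_pos_eq; lra. }
      apply Rabs_def2 in B. unfold ts in *. lra.
    + intros u t Hu Ht. unfold g, V; cbn [snd]. pose proof (Rmax_l t1 dd).
      assert (Yf a (X u t) (h t) < 0); [|pose proof (lp t); nra].
      apply late; auto. rewrite hid by lra. apply Ht1. lra.
Qed.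
End Assembly.

Theorem theorem1p1 :
  exists c : R, 0 < c /\
  forall (lambda : R) (p0 p1 : vec),
    0 < lambda ->
    snd p0 = 0 -> snd p1 = 0 ->
    0 < lambda * vdot (vsub p0 p1) (vsub p0 p1) < c ->
    exists g : field,
      elastic_flow_nbc lambda p0 p1 g /\
      exists t0 t1 : R, 0 < t0 /\ t0 < t1 /\
        (forall u t, 0 < u < 1 -> 0 <= t <= t0 -> 0 < snd (g u t)) /\
        (forall u t, 0 < u < 1 -> t1 <= t -> snd (g u t) < 0).
Proof.
  destruct teardrop_exists as [Th [Th1 [W2 [Ls [th0 TD]]]]].
  destruct (global_flow TD) as [c [c0 G]]. pose proof (td_Ls TD) as L0.
  (* The rescaled opening [eps] satisfies [Ls eps^2 = lambda |p0 - p1|^2], so the smallness of [eps]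
     is exactly this bound. *)
  exists (Ls * c ^ 2). split; [pos|].
  intros lambda [x0 y0] [x1 y1] Hl H0 H1 Hc. cbn [fst snd] in H0, H1. subst y0 y1.
  set (d := Rabs (x1 - x0)).
  assert (E : vdot (vsub (x0, 0) (x1, 0)) (vsub (x0, 0) (x1, 0)) = d ^ 2).
  { unfold d. rewrite pow2_abs. unfold vdot, vsub; cbn [fst snd]. ring. }
  rewrite E in Hc.
  assert (d0 : 0 < d).
  { apply Rabs_pos_lt. intros Z. assert (d ^ 2 = 0) by (unfold d; rewrite Z, Rabs_R0; ring). rewrite H in Hc. lra. }
  pose proof (sqrt_lt_R0 _ L0) as sL.
  set (eps := sqrt lambda * d / sqrt Ls).
  assert (e0 : 0 < eps) by (apply Rdiv_lt_0_compat; [pos|exact sL]).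
  assert (e1 : eps <= c).
  { apply Rnot_lt_le. intros N. assert (c ^ 2 <= eps ^ 2) by nra.
    assert (Ls * eps ^ 2 = lambda * d ^ 2).
    { unfold eps. replace ((sqrt lambda * d / sqrt Ls) ^ 2) with (sqrt lambda ^ 2 * d ^ 2 / sqrt Ls ^ 2) by (field; lra).
      rewrite !pow2_sqrt by lra. field. lra. }
    assert (Ls * c ^ 2 <= Ls * eps ^ 2) by nra. lra. }
  destruct (G eps (conj e0 e1)) as [a [L [T0 [A [BF [Cl [[s0 [s00 Early]] [s1 [s10 Late]]]]]]]]].
  (* The construction always runs from left to right; a horizontal reflection covers the other order
     and preserves heights. *)
  set (sg := if Rle_dec x0 x1 then 1 else -1).
  assert (sg2 : sg ^ 2 = 1) by (unfold sg; destruct Rle_dec; ring).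
  assert (x1E : x1 = x0 + sg * d).
  { unfold sg, d. destruct (Rle_dec x0 x1); [rewrite Rabs_pos_eq|rewrite Rabs_left]; lra. }
  rewrite x1E. apply (flow_curve Ls eps lambda sg d x0 s0 s1 BF); try assumption.
  unfold eps. field. lra.
Qed.
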